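(* Let $n,r,N$ be positive integers with $n\le r<N$. Regard $\Lambda(n,r)$ as a subset of $\Lambda(N,r)$ via $(\lambda_1,\dots,\lambda_n)\mapsto(\lambda_1,\dots,\lambda_n,0,\dots,0)$ and put $e=\sum_{\lambda\in\Lambda(n,r)}\mathfrak l_\lambda\in\widehat S(N,r)$. Then the $\mathbb Z$-algebra $e\,\widehat S(N,r)\,e$ is affine quasi-hereditary. In other words, $\widehat S(n,r)\cong e\,\widehat S(N,r)\,e$ is affine quasi-hereditary when $n\le r$.
   Context: **Affine Schur algebra.** Let $n,r\ge 1$. Let $\mathfrak S_r$ be the symmetric group and $\mathfrak S_{\vartriangle}=\mathfrak S_r\ltimes\mathbb Z^r$. This group acts on the right on $I(\mathbb Z,r)=\{\underline i=(i_1,\dots,i_r)\mid i_t\in\mathbb Z\}$, with $\mathfrak S_r$ acting by place permutation and $\varepsilon\in\mathbb Z^r$ acting by $\underline i\mapsto \underline i+n\varepsilon$; it acts diagonally on $I(\mathbb Z,r)\times I(\mathbb Z,r)$. Write $\sim$ for ''in the same orbit''. The affine Schur algebra $\widehat S(n,r)$ is the $\mathbb Z$-algebra that is free as a $\mathbb Z$-module with basis $\xi_{\underline i,\underline j}$ indexed by the orbits on $I(\mathbb Z,r)\times I(\mathbb Z,r)$ (so $\xi_{\underline i,\underline j}=\xi_{\underline k,\underline l}$ iff $(\underline i,\underline j)\sim(\underline k,\underline l)$), with multiplication $$\xi_{\underline i,\underline j}\,\xi_{\underline k,\underline l}=\sum_{(\underline p,\underline q)}\bigl|\{\underline s\in I(\mathbb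 Z,r)\mid(\underline i,\underline j)\sim(\underline p,\underline s),\ (\underline s,\underline q)\sim(\underline k,\underline l)\}\bigr|\ \xi_{\underline p,\underline q},$$ the sum running over representatives of the orbits. (The algebra $\widehat S(N,r)$ is defined in the same way with $N$ in place of $n$.) Let $\Lambda(n,r)=\{(\lambda_1,\dots,\lambda_n)\mid\lambda_i\in\mathbb N,\ \sum_i\lambda_i=r\}$ with $0\in\mathbb N$. For $\lambda\in\Lambda(n,r)$, $\mathfrak l_\lambda=\xi_{\underline i,\underline i}$ where $\underline i=(1,\dots,1,\dots,n,\dots,n)$ contains $t$ exactly $\lambda_t$ times; the $\mathfrak l_\lambda$ are orthogonal idempotents with sum $1$. **Affine quasi-hereditary algebras.** Let $k$ be a Noetherian domain and $A$ a left Noetherian $k$-algebra; modules are left modules unless stated otherwise. A two-sided ideal $J$ of $A$ is an *affine-heredity ideal* if: (1) there is an idempotent $e\in J$ with $J=AeA$; (2) as a left $A$-module, $J\cong P\oplus\cdots\oplus P$ ($m$ copies) for some projective $A$-module $P$ and some $m\in\mathbb N$, and $B:=\operatorname{End}_A(P)$ is an affine algebra, i.e. a finitely generated commutative $k$-algebra; (3) as a right $B$-module, $P$ is finitely generated and flat. The algebra $A$ is *affine quasi-hereditary* if there is a finite chain of ideals $0=J_0\subseteq J_1\subseteq\dots\subseteq J_t=A$ such that $J_i/J_{i-1}$ is an affine-heredity ideal of $A/J_{i-1}$ for each $1\le i\le t$. *)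

(* Defs.v *)
From HB Require Import structures.
From mathcomp Require Import all_boot all_order all_algebra fingroup perm.
From mathcomp Require Import finmap mathcomp_extra boolp classical_sets.
From mathcomp Require Import functions cardinality fsbigop.
From mathcomp Require Import monalg generic_quotient zify.

Set Implicit Arguments.
Unset Strict Implicit.
Unset Printing Implicit Defensive.

Import GRing.Theory.

Local Open Scope classical_set_scope.
Local Open Scope ring_scope.
Local Open Scope quotient_scope.

(** * Rings, ideals and modules *)

(* Rings are [pzRingType]s, i.e. possibly trivial, since A / J_(i-1) may be
   the zero ring.  The algebra structures of the library exclude that case, so
   a k-algebra is a ring with a morphism from k to its centre. *)
Record algebra (k : comPzRingType) := Algebra {
  alg_ring :> pzRingType;
  alg_map : {rmorphism k -> alg_ring};
  alg_mapC : forall c a, alg_map c * a = a * alg_map c }.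

Lemma intr_central (R : pzRingType) (c : int) (a : R) : c%:~R * a = a * c%:~R.
Proof. by rewrite mulrzl mulrzr. Qed.

Definition int_algebra (R : pzRingType) : algebra int :=
  @Algebra int R (@intmul R 1) (@intr_central R).

HB.mixin Record isTwoSided (R : pzRingType) (I : R -> bool) := {
  twosidedMl : forall a, {in I, forall x, a * x \in I};
  twosidedMr : forall a, {in I, forall x, x * a \in I} }.

#[short(type="ideal")]
HB.structure Definition Ideal (R : pzRingType) :=
  {I of GRing.ZmodClosed R I & isTwoSided R I}.

Section QuotientRing.
Variables (R : pzRingType) (I : ideal R).

Definition quot_ring : Type := {ideal_quot I}.

HB.instance Definition _ := GRing.Zmodule.on quot_ring.

Definition quot_pi (x : R) : quot_ring := \pi_({ideal_quot I}) x.

Lemma quot_piE x y : (quot_pi x = quot_pi y) <-> (x - y \in I).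
Proof. by rewrite Quotient.idealrBE; split=> [/eqP|/eqP]. Qed.

Lemma quot_piB x y : quot_pi (x - y) = quot_pi x - quot_pi y.
Proof. exact: (raddfB (\pi_({ideal_quot I}))). Qed.

Lemma quot_piD x y : quot_pi (x + y) = quot_pi x + quot_pi y.
Proof. exact: (raddfD (\pi_({ideal_quot I}))). Qed.

Lemma quot_piP (x : quot_ring) : exists a, x = quot_pi a.
Proof. by exists (repr x); rewrite /quot_pi reprK. Qed.

Definition quot_mul (x y : quot_ring) : quot_ring :=
  quot_pi (repr x * repr y).

Lemma quot_piM x y : quot_pi (x * y) = quot_mul (quot_pi x) (quot_pi y).
Proof.
apply/quot_piE; set x' := repr _; set y' := repr _.
have hx : x - x' \in I by apply/quot_piE; rewrite /quot_pi reprK.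
have hy : y - y' \in I by apply/quot_piE; rewrite /quot_pi reprK.
have -> : x * y - x' * y' = (x - x') * y + x' * (y - y').
  by rewrite mulrBl mulrBr addrA subrK.
by rewrite rpredD //; [exact: twosidedMr|exact: twosidedMl].
Qed.

Lemma quot_mulA : associative quot_mul.
Proof.
move=> x y z; have [[a ->] [b ->] [c ->]] := And3 (quot_piP x) (quot_piP y) (quot_piP z).
by rewrite -!quot_piM mulrA.
Qed.

Lemma quot_mul1 : left_id (quot_pi 1) quot_mul.
Proof. by move=> x; have [a ->] := quot_piP x; rewrite -quot_piM mul1r. Qed.

Lemma quot_mulr1 : right_id (quot_pi 1) quot_mul.
Proof. by move=> x; have [a ->] := quot_piP x; rewrite -quot_piM mulr1. Qed.

Lemma quot_mulDl : left_distributive quot_mul +%R.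
Proof.
move=> x y z; have [[a ->] [b ->] [c ->]] := And3 (quot_piP x) (quot_piP y) (quot_piP z).
by rewrite -!(quot_piM, quot_piD) mulrDl.
Qed.

Lemma quot_mulDr : right_distributive quot_mul +%R.
Proof.
move=> x y z; have [[a ->] [b ->] [c ->]] := And3 (quot_piP x) (quot_piP y) (quot_piP z).
by rewrite -!(quot_piM, quot_piD) mulrDr.
Qed.

HB.instance Definition _ := GRing.Zmodule_isPzRing.Build quot_ring
  quot_mulA quot_mul1 quot_mulr1 quot_mulDl quot_mulDr.

HB.instance Definition _ :=
  GRing.isZmodMorphism.Build R quot_ring quot_pi quot_piB.
HB.instance Definition _ :=
  GRing.isMonoidMorphism.Build R quot_ring quot_pi (conj erefl quot_piM).

End QuotientRing.

Lemma quot_central (k : comPzRingType) (A : algebra k) (I : ideal A) c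
    (a : quot_ring I) :
  quot_pi I (alg_map A c) * a = a * quot_pi I (alg_map A c).
Proof. by have [b ->] := quot_piP a; rewrite -!rmorphM alg_mapC. Qed.

Definition quot_algebra (k : comPzRingType) (A : algebra k) (I : ideal A) :
    algebra k :=
  @Algebra k (quot_ring I) (quot_pi I \o alg_map A) (@quot_central k A I).

(* The ring e R e, with unit e. *)
Section CornerRing.
Variable R : pzRingType.

Record idempotent := Idempotent {
  idem_val :> R;
  idem_mulK : idem_val * idem_val = idem_val }.

Variable ei : idempotent.
Local Notation e := (idem_val ei).

Definition corner_pred : {pred R} := fun x => `[< exists a, x = e * a * e >].

Record corner : Type := Corner {
  corner_val : R;
  _ : corner_val \in corner_pred }.

HB.instance Definition _ := [isSub for corner_val].
HB.instance Definition _ := [Choice of corner by <:].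

Lemma cornerP x : reflect (exists a, x = e * a * e) (x \in corner_pred).
Proof. exact: asboolP. Qed.

Lemma corner_zmod_closed : zmod_closed corner_pred.
Proof.
split=> [|x y /cornerP[a ->] /cornerP[b ->]]; apply/cornerP.
  by exists 0; rewrite mulr0 mul0r.
by exists (a - b); rewrite mulrBr mulrBl.
Qed.

HB.instance Definition _ :=
  GRing.isZmodClosed.Build R corner_pred corner_zmod_closed.
HB.instance Definition _ := [SubChoice_isSubZmodule of corner by <:].

Lemma corner_mulP (x y : corner) : val x * val y \in corner_pred.
Proof.
case: x y => x /= /cornerP[a ->] [y /= /cornerP[b ->]]; apply/cornerP.
by exists (a * e * e * b); rewrite !mulrA.
Qed.

Lemma corner_oneP : e \in corner_pred.
Proof. by apply/cornerP; exists e; rewrite !idem_mulK. Qed.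

Definition corner_mul (x y : corner) : corner := Corner (corner_mulP x y).
Definition corner_one : corner := Corner corner_oneP.

Lemma corner_mulA : associative corner_mul.
Proof. by move=> x y z; apply: val_inj; rewrite /= mulrA. Qed.

Lemma corner_mul1 : left_id corner_one corner_mul.
Proof.
move=> [x xP]; apply: val_inj => /=; have /cornerP[a ->] := xP.
by rewrite !mulrA idem_mulK.
Qed.

Lemma corner_mulr1 : right_id corner_one corner_mul.
Proof.
move=> [x xP]; apply: val_inj => /=; have /cornerP[a ->] := xP.
by rewrite -!mulrA idem_mulK.
Qed.

Lemma corner_mulDl : left_distributive corner_mul +%R.
Proof. by move=> x y z; apply: val_inj; rewrite /= mulrDl. Qed.

Lemma corner_mulDr : right_distributive corner_mul +%R.
Proof. by move=> x y z; apply: val_inj; rewrite /= mulrDr. Qed.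

HB.instance Definition _ := GRing.Zmodule_isPzRing.Build corner
  corner_mulA corner_mul1 corner_mulr1 corner_mulDl corner_mulDr.

End CornerRing.

(* Endomorphisms act on the right: p (f g) = (p f) g, so that a left R-module
   is a right module over its endomorphism ring. *)
Section Endomorphisms.
Variables (R : pzRingType) (P : lmodType R).

Definition endo : Type := {linear P -> P}.

HB.instance Definition _ := gen_eqMixin endo.
HB.instance Definition _ := gen_choiceMixin endo.

Definition endo_fun (f : endo) : {linear P -> P} := f.

Lemma endoP (f g : endo) : endo_fun f =1 endo_fun g -> f = g.
Proof.
case: f => f [[f0] [f1]]; case: g => g [[g0] [g1]] /= /funext fg.
rewrite /endo_fun /= in fg; case: _ / fg in g0 g1 *.
by rewrite (Prop_irrelevance f0 g0) (Prop_irrelevance f1 g1).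
Qed.

Definition endo_zero : endo := @GRing.null_fun P P.
Definition endo_opp (f : endo) : endo := GRing.opp_fun (endo_fun f).
Definition endo_add (f g : endo) : endo := endo_fun f \+ endo_fun g.
Definition endo_one : endo := @idfun P.
Definition endo_mul (f g : endo) : endo := endo_fun g \o endo_fun f.

Lemma endo_addA : associative endo_add.
Proof. by move=> f g h; apply: endoP => p; exact: addrA. Qed.

Lemma endo_addC : commutative endo_add.
Proof. by move=> f g; apply: endoP => p; exact: addrC. Qed.

Lemma endo_add0 : left_id endo_zero endo_add.
Proof. by move=> f; apply: endoP => p; exact: add0r. Qed.

Lemma endo_addN : left_inverse endo_zero endo_opp endo_add.
Proof. by move=> f; apply: endoP => p; exact: addNr. Qed.

Lemma endo_mulA : associative endo_mul.
Proof. by move=> f g h; apply: endoP. Qed.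

Lemma endo_mul1 : left_id endo_one endo_mul.
Proof. by move=> f; apply: endoP. Qed.

Lemma endo_mulr1 : right_id endo_one endo_mul.
Proof. by move=> f; apply: endoP. Qed.

Lemma endo_mulDl : left_distributive endo_mul endo_add.
Proof. by move=> f g h; apply: endoP => p; exact: raddfD. Qed.

Lemma endo_mulDr : right_distributive endo_mul endo_add.
Proof. by move=> f g h; apply: endoP. Qed.

HB.instance Definition _ := GRing.isPzRing.Build endo
  endo_addA endo_addC endo_add0 endo_addN
  endo_mulA endo_mul1 endo_mulr1 endo_mulDl endo_mulDr.

(* P seen as a right module over its endomorphism ring. *)
Definition right_endo_module : Type := P.

HB.instance Definition _ := GRing.Zmodule.on right_endo_module.

Definition endo_act (b : endo^c) (p : right_endo_module) : right_endo_module :=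
  endo_fun b p.

Lemma endo_actA (a b : endo^c) p :
  endo_act a (endo_act b p) = endo_act (a * b) p.
Proof. by []. Qed.

Lemma endo_act1 : left_id 1 endo_act.
Proof. by []. Qed.

Lemma endo_actDr : right_distributive endo_act +%R.
Proof. by move=> b p q; exact: (raddfD (endo_fun b)). Qed.

Lemma endo_actDl p : {morph endo_act^~ p : a b / a + b}.
Proof. by []. Qed.

HB.instance Definition _ :=
  GRing.Zmodule_isLmodule.Build (endo^c) right_endo_module
    endo_actA endo_act1 endo_actDr endo_actDl.

End Endomorphisms.

Section EndomorphismAlgebra.
Variables (k : comPzRingType) (A : algebra k) (P : lmodType A).

(* c in k acts on P as an element of A; this is the k-algebra structure of
   End_A(P). *)
Definition endo_scal_fun (c : k) (p : P) : P := alg_map A c *: p.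

Lemma endo_scal_linear c : linear (endo_scal_fun c).
Proof.
by move=> a p q; rewrite /endo_scal_fun scalerDr !scalerA alg_mapC.
Qed.

HB.instance Definition _ c :=
  GRing.isLinear.Build A P P _ (endo_scal_fun c) (endo_scal_linear c).

Definition endo_scal (c : k) : endo P := endo_scal_fun c.

Lemma endo_scalB : zmod_morphism endo_scal.
Proof.
by move=> c d; apply: endoP => p; rewrite /= /endo_scal_fun rmorphB scalerBl.
Qed.

Lemma endo_scalM : monoid_morphism endo_scal.
Proof.
split=> [|c d]; apply: endoP => p; rewrite /= /endo_scal_fun.
  by rewrite rmorph1 scale1r.
by rewrite mulrC rmorphM -scalerA.
Qed.

HB.instance Definition _ :=
  GRing.isZmodMorphism.Build k (endo P) endo_scal endo_scalB.
HB.instance Definition _ :=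
  GRing.isMonoidMorphism.Build k (endo P) endo_scal endo_scalM.

Lemma endo_central c (f : endo P) : endo_scal c * f = f * endo_scal c.
Proof. by apply: endoP => p; rewrite /= /endo_scal_fun linearZ. Qed.

Definition endo_algebra : algebra k := Algebra endo_central.

End EndomorphismAlgebra.

Definition left_ideal (R : pzRingType) (I : {pred R}) : Prop :=
  0 \in I /\ forall a, {in I &, forall x y, a * x + y \in I}.

Definition left_noetherian (R : pzRingType) : Prop :=
  forall I : {pred R}, left_ideal I ->
  exists m (g : 'I_m -> R), (forall i, g i \in I) /\
    {in I, forall x, exists c : 'I_m -> R, x = \sum_i c i * g i}.

Definition finitely_generated_module (R : pzRingType) (M : lmodType R) : Prop :=
  exists m (g : 'I_m -> M),
    forall x, exists c : 'I_m -> R, x = \sum_i c i *: g i.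

Definition projective (R : pzRingType) (P : lmodType R) : Prop :=
  forall (M N : lmodType R) (g : {linear M -> N}) (f : {linear P -> N}),
    (forall y, exists x, g x = y) ->
  exists h : {linear P -> M}, forall p, g (h p) = f p.

(* A commutative algebra generated by finitely many elements: no proper
   subring contains them together with the image of k. *)
Definition affine_algebra (k : comPzRingType) (B : algebra k) : Prop :=
  (forall x y : B, x * y = y * x) /\
  exists m (g : 'I_m -> B), forall S : {pred B}, subring_closed S ->
    (forall c, alg_map B c \in S) -> (forall i, g i \in S) ->
    forall x, x \in S.

(** * Tensor products and flatness *)

(* Right B-modules are left modules over the converse ring B^c. *)
Section Flatness.
Variable B : pzRingType.

Definition balanced (V : lmodType B^c) (M : lmodType B) (G : zmodType)
    (beta : V -> M -> G) : Prop :=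
  [/\ forall v v' m, beta (v + v') m = beta v m + beta v' m,
      forall v m m', beta v (m + m') = beta v m + beta v m'
    & forall (b : B) v m, beta ((b : B^c) *: v) m = beta v (b *: m)].

Definition is_tensor (V : lmodType B^c) (M : lmodType B) (T : zmodType)
    (tens : V -> M -> T) : Prop :=
  balanced tens /\
  forall (G : zmodType) (beta : V -> M -> G), balanced beta ->
    exists h : {additive T -> G}, (forall v m, h (tens v m) = beta v m) /\
      forall h' : {additive T -> G},
        (forall v m, h' (tens v m) = beta v m) -> h' =1 h.

Definition flat (V : lmodType B^c) : Prop :=
  forall (M N : lmodType B) (f : {linear M -> N}), injective f ->
  forall (VM VN : zmodType) (tM : V -> M -> VM) (tN : V -> N -> VN),
    is_tensor tM -> is_tensor tN ->
  forall h : {additive VM -> VN},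
    (forall v m, h (tM v m) = tN v (f m)) -> injective h.

End Flatness.

(** * Affine quasi-hereditary algebras *)

Section AffineQuasiHereditary.
Variable k : idomainType.

Definition is_AeA (A : pzRingType) (e : A) (J : {pred A}) : Prop :=
  forall x, x \in J <->
    exists s : seq (A * A), x = \sum_(ab <- s) ab.1 * e * ab.2.

Definition affine_heredity_ideal (A : algebra k) (J : {pred A}) : Prop :=
  (exists e : A, [/\ e \in J, e * e = e & is_AeA e J]) /\
  exists P : lmodType A,
    [/\ exists m (f : {linear {ffun 'I_m -> P} -> (A : pzRingType)^o}),
          injective f /\ forall x : A, x \in J <-> exists p, f p = x,
        projective P,
        affine_algebra (endo_algebra P),
        finitely_generated_module (right_endo_module P)
      & flat (right_endo_module P)].

(* (I + J) / I as a subset of A / I. *)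
Definition quot_image (A : pzRingType) (I J : ideal A) : {pred quot_ring I} :=
  fun x => `[< exists2 a, a \in J & x = quot_pi I a >].
Arguments quot_image {A} I J.

Definition affine_quasi_hereditary (A : algebra k) : Prop :=
  [/\ left_noetherian k, left_noetherian A
    & exists t (J : nat -> ideal A),
      [/\ forall x, (x \in J 0%N) = (x == 0),
          forall x, x \in J t
        & forall i, (i < t)%N -> {subset J i <= J i.+1} /\
            affine_heredity_ideal (A := quot_algebra (J i))
              (quot_image (J i) (J i.+1))]].

End AffineQuasiHereditary.

(** * The affine Schur algebra *)

Section Orbits.
Variables n r : nat.

Definition multiindex : Type := {ffun 'I_r -> int}.

HB.instance Definition _ := Choice.on multiindex.

(* The action of the element w eps of S_r |x Z^r; every element of the
   semidirect product has this form. *)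
Definition affine_act (w : 'S_r) (eps : {ffun 'I_r -> int}) (i : multiindex) : multiindex :=
  [ffun t => i (w t) + n%:Z * eps t].

Definition same_orbit : rel (multiindex * multiindex) := fun u v =>
  `[< exists w eps, v = (affine_act w eps u.1, affine_act w eps u.2) >].

Lemma act_id i : affine_act 1%g [ffun=> 0] i = i.
Proof. by apply/ffunP => t; rewrite !ffunE perm1 mulr0 addr0. Qed.

Lemma act_comp (w w' : 'S_r) (eps eps' : {ffun 'I_r -> int}) i :
  affine_act w' eps' (affine_act w eps i) = affine_act (w' * w)%g [ffun t => eps (w' t) + eps' t] i.
Proof. by apply/ffunP => t; rewrite !ffunE permM mulrDr addrA. Qed.

Lemma act_inv (w : 'S_r) (eps : {ffun 'I_r -> int}) i :
  affine_act w^-1%g [ffun t => - eps (w^-1%g t)] (affine_act w eps i) = i.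
Proof.
rewrite act_comp mulVg -[RHS]act_id; congr (affine_act _ _ _).
by apply/ffunP => t; rewrite !ffunE addrN.
Qed.

Lemma same_orbit_equiv : equiv_class_of same_orbit.
Proof.
have sym u v : same_orbit u v -> same_orbit v u.
  move=> /asboolP[w [eps ->]]; apply/asboolP.
  exists w^-1%g, [ffun t => - eps (w^-1%g t)].
  by rewrite !act_inv -surjective_pairing.
split=> [u|u v|u v x].
- apply/asboolP; exists 1%g, [ffun=> 0].
  by rewrite !act_id -surjective_pairing.
- by apply/idP/idP; exact: sym.
- move=> /asboolP[w [eps ->]] /asboolP[w' [eps' ->]]; apply/asboolP.
  by do 2 eexists; rewrite !act_comp.
Qed.

Canonical same_orbit_equivRel := EquivRelPack same_orbit_equiv.

Definition pair_orbit : Type := {eq_quot same_orbit}.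

HB.instance Definition _ := Choice.on pair_orbit.

Definition orb (i j : multiindex) : pair_orbit := \pi_({eq_quot same_orbit}) (i, j).

Lemma orbE i j k l : (orb i j = orb k l) <->
  exists w eps, k = affine_act w eps i /\ l = affine_act w eps j.
Proof.
rewrite /orb; split=> [/eqmodP/asboolP[w [eps [-> ->]]]|[w [eps [-> ->]]]].
  by exists w, eps.
by apply/eqmodP/asboolP; exists w, eps.
Qed.

Lemma orbP (c : pair_orbit) : exists i j, c = orb i j.
Proof.
exists (repr c).1, (repr c).2.
by rewrite /orb -surjective_pairing reprK.
Qed.

Lemma orb_act w eps i j : orb (affine_act w eps i) (affine_act w eps j) = orb i j.
Proof. by apply/esym/orbE; exists w, eps. Qed.

(* |{s | (i,j) ~ (p,s), (s,q) ~ (k,l)}| where a, b, c are the orbits of (i,j),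
   (k,l), (p,q). *)
Definition struct_const (a b c : pair_orbit) : nat :=
  #|` fset_set [set s : multiindex | orb (repr c).1 s = a /\ orb s (repr c).2 = b]|.

Lemma finite_row (a : pair_orbit) p : finite_set [set s | orb p s = a].
Proof.
have [i [j ->]] := orbP a.
apply: (@sub_finite_set _ _
  ((fun w : 'S_r => [ffun t => j (w t) + (p t - i (w t))] : multiindex) @` setT)).
  move=> s /= /esym/orbE[w [eps [-> ->]]]; exists w => //.
  by apply/ffunP => t; rewrite !ffunE (addrC (i (w t))) addrK.
exact/finite_image/finite_finset.
Qed.

Lemma struct_constE a b p q : struct_const a b (orb p q) =
  #|` fset_set [set s | orb p s = a /\ orb s q = b]|.
Proof.
rewrite /struct_const; set c := orb p q.
have /orbE[w [eps [p1 q1]]] : c = orb (repr c).1 (repr c).2.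
  by rewrite /orb -surjective_pairing reprK.
rewrite p1 q1.
set A := [set s | _ ]; set B := [set s | _].
have fB : finite_set B.
  by apply: sub_finite_set (finite_row a p) => s [].
suff -> : A = affine_act w eps @` B.
  rewrite fset_set_image// card_imfset// => s t st.
  by rewrite -[s](act_inv w eps) st act_inv.
apply/seteqP; split=> [s [sa sb]|_ [s [sa sb] <-]]; last first.
  by split; rewrite orb_act.
exists (affine_act w^-1%g [ffun t => - eps (w^-1%g t)] s).
  split; rewrite -?sa -?sb.
    by rewrite -(act_inv w eps p) orb_act act_inv.
  by rewrite -(act_inv w eps q) orb_act act_inv.
rewrite act_comp mulgV -[RHS]act_id; congr (affine_act _ _ _).
by apply/ffunP => t; rewrite !ffunE permK addNr.
Qed.

Lemma struct_const_support a b : finite_set [set c | struct_const a b c <> 0%N].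
Proof.
have [i [j ->]] := orbP a.
apply: (@sub_finite_set _ _ (\bigcup_(s in [set s | orb i s = orb i j])
   (orb i @` [set q | orb s q = b]))).
  move=> c /=; have [p [q ->]] := orbP c; rewrite struct_constE => /eqP.
  rewrite cardfs_eq0 => /negP; apply: contra_notP => noS.
  suff -> : [set s | orb p s = orb i j /\ orb s q = b] = set0.
    by rewrite fset_set0.
  apply/seteqP; split => // s [/orbE[w [eps [ie je]]] sq].
  apply: noS; exists j => //=; exists (affine_act w eps q).
    by rewrite je orb_act.
  by rewrite ie orb_act.
apply: bigcup_finite; first exact: finite_row.
by move=> s _; apply/finite_image/finite_row.
Qed.

End Orbits.

Arguments orb {n r} i j.

Section SchurAlgebra.
Variables n r : nat.

(* The free Z-module on the orbits. *)
Definition affine_schur : Type := {malg int[pair_orbit n r]}.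

HB.instance Definition _ := GRing.Zmodule.on affine_schur.

Definition basis (c : pair_orbit n r) : affine_schur := << c >>.
Definition xi (i j : multiindex r) : affine_schur := basis (orb i j).

Definition xi_mul (a b : pair_orbit n r) : affine_schur :=
  \sum_(c \in [set: pair_orbit n r]) << (struct_const a b c)%:Z *g c >>.

Definition schur_mul (x y : affine_schur) : affine_schur :=
  \sum_(a <- msupp x) \sum_(b <- msupp y) xi_mul a b *~ (x@_a * y@_b).

(* The orbits of the pairs (i,i) are those of the l_lambda; there are finitely
   many of them when n > 0. *)
Definition schur_one : affine_schur :=
  \sum_(c \in [set orb i i | i in [set: multiindex r]]) basis c.

(* Elements as invariant kernels on I(Z,r) x I(Z,r); the product becomes
   convolution. *)
Definition kernel (x : affine_schur) (p q : multiindex r) : int := x@_(orb p q).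

Lemma kernelP x y : (forall p q, kernel x p q = kernel y p q) -> x = y.
Proof.
by move=> xy; apply/malgP => c; have [p [q ->]] := orbP c; exact: xy.
Qed.

Lemma kernelD x y p q : kernel (x + y) p q = kernel x p q + kernel y p q.
Proof. exact: mcoeffD. Qed.

Lemma mcoeff_sum (T : Type) (s : seq T) (F : T -> affine_schur) c :
  (\sum_(i <- s) F i)@_c = \sum_(i <- s) (F i)@_c.
Proof. exact: raddf_sum. Qed.

Lemma mcoeff_fsum (f : pair_orbit n r -> int) (D : set (pair_orbit n r)) c :
  finite_set (D `&` [set c | f c <> 0]) ->
  (\sum_(c \in D) << f c *g c >>)@_c = if c \in D then f c else 0.
Proof.
set S := _ `&` _ => fS.
have -> : \sum_(c \in D) << f c *g c >> =
    \sum_(c <- fset_set S) << f c *g c >> :> affine_schur.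
  rewrite -fsbig_finite//; apply/esym/fsbig_widen => [d []//|d [Dd]].
  move=> nSd; rewrite /=; have [->|/eqP f0] := eqVneq (f d) 0.
    by rewrite monalgU0.
  by case: nSd.
rewrite mcoeff_sum; under eq_bigr do rewrite mcoeffU.
have [cS|cS] := boolP (c \in fset_set S).
  rewrite (big_fsetD1 c)//= eqxx mulr1n big1_seq ?addr0.
    by move: cS; rewrite in_fset_set// inE => -[Dc _]; rewrite mem_set.
  by move=> d /andP[_]; rewrite in_fsetD1 => /andP[/negPf->].
rewrite big1_seq => [|d /andP[_ dS]]; last first.
  by case: eqP => // dc; rewrite -dc dS in cS.
case: ifPn => // /set_mem Dc; apply/esym/eqP; apply: contraNT cS => /eqP f0.
by rewrite in_fset_set// inE.
Qed.

Lemma mcoeff_xi_mul a b c : (xi_mul a b)@_c = (struct_const a b c)%:Z.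
Proof.
rewrite mcoeff_fsum ?in_setT// setTI.
apply: sub_finite_set (struct_const_support a b) => d /=.
by apply: contra_not => ->.
Qed.

Definition covers (x : affine_schur) (p : multiindex r) (T : {fset multiindex r}) :=
  forall s, kernel x p s != 0 -> s \in T.

Lemma coversP x p : exists T, covers x p T.
Proof.
exists (fset_set (\bigcup_(a in [set` msupp x]) [set s | orb p s = a])) => s.
rewrite mcoeff_neq0 => sx; rewrite in_fset_set ?inE.
  by exists (orb p s).
by apply: bigcup_finite => [|a _]; [exact: finite_fset|exact: finite_row].
Qed.

Lemma coversW x p (T T' : {fset multiindex r}) :
  (T `<=` T')%fset -> covers x p T -> covers x p T'.
Proof. by move=> /fsubsetP TT' xT s /xT/TT'. Qed.

Lemma kernelM x y p q (T : {fset multiindex r}) : covers x p T ->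
  kernel (schur_mul x y) p q = \sum_(s <- T) kernel x p s * kernel y s q.
Proof.
move=> xT; rewrite /kernel /schur_mul mcoeff_sum.
have coefE (z : affine_schur) c :
    z@_c = \sum_(a <- msupp z) z@_a *+ (c == a).
  rewrite {1}(monalgE z) mcoeff_sum.
  by apply: eq_bigr => a _; rewrite mcoeffU eq_sym.
transitivity (\sum_(a <- msupp x) \sum_(b <- msupp y) \sum_(s <- T)
   (x@_a *+ (orb p s == a)) * (y@_b *+ (orb s q == b))); last first.
  under eq_bigr do rewrite exchange_big/=.
  rewrite exchange_big/=; apply: eq_bigr => s _.
  rewrite [in RHS]coefE [in X in _ = _ * X]coefE mulr_suml.
  by apply: eq_bigr => a _; rewrite mulr_sumr.
apply: eq_big_seq => a ax; rewrite mcoeff_sum; apply: eq_bigr => b _.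
rewrite raddfMz /= mcoeff_xi_mul struct_constE.
set S := [set s | _].
have ST : fset_set S = [fset s in T | (orb p s == a) && (orb s q == b)]%fset.
  have fS : finite_set S by apply: sub_finite_set (finite_row a p) => s [].
  apply/fsetP => s; rewrite in_fset_set// !inE/=; apply/idP/idP.
    rewrite inE => -[sa sb]; rewrite sa sb !eqxx !andbT.
    by apply: xT; rewrite /kernel sa mcoeff_neq0.
  by case/and3P => _ /eqP sa /eqP sb; rewrite inE.
have -> : #|` fset_set S| = count (fun s => (orb p s == a) && (orb s q == b)) T.
  rewrite ST -size_filter; apply/perm_size/uniq_perm => [||s] //.
    by rewrite filter_uniq.
  by rewrite mem_filter !inE andbC.
transitivity (\sum_(s <- T | (orb p s == a) && (orb s q == b)) x@_a * y@_b).
  by rewrite big_const_seq iter_addr_0 -mulrzl -mulr_natr natz intz.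
rewrite big_mkcond/=; apply: eq_bigr => s _.
by do 2 case: eqP => _; rewrite ?mulr1n ?mulr0n ?mul0r ?mulr0.
Qed.

Lemma schur_mulA : associative schur_mul.
Proof.
move=> x y z; apply: kernelP => p q.
have [T xT] := coversP x p; have [U xyU] := coversP (schur_mul x y) p.
have [V yV] := choice (coversP y).
pose W := (U `|` \bigcup_(s <- T) V s)%fset.
have xyW : covers (schur_mul x y) p W by apply: coversW xyU; exact: fsubsetUl.
rewrite (kernelM _ _ xT) (kernelM _ _ xyW).
transitivity (\sum_(s <- T) \sum_(t <- W)
    kernel x p s * (kernel y s t * kernel z t q)).
  apply: eq_big_seq => s sT; rewrite -mulr_sumr; congr (_ * _).
  apply/kernelM/(coversW _ (yV s))/fsubsetP => t tV.
  by rewrite in_fsetU; apply/orP; right; apply/bigfcupP; exists s; rewrite ?sT.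
rewrite exchange_big; apply: eq_bigr => t _ /=.
rewrite (kernelM _ _ xT) mulr_suml; apply: eq_bigr => s _.
by rewrite mulrA.
Qed.

Lemma schur_mulDl : left_distributive schur_mul +%R.
Proof.
move=> x y z; apply: kernelP => p q.
have [T xT] := coversP x p; have [U yU] := coversP y p.
have [V xyV] := coversP (x + y) p.
pose W := (T `|` U `|` V)%fset.
have xW : covers x p W.
  by apply: coversW xT; rewrite /W -fsetUA fsubsetUl.
have yW : covers y p W.
  by apply: coversW yU; rewrite /W (fsetUC T) -fsetUA fsubsetUl.
have xyW : covers (x + y) p W by apply: coversW xyV; exact: fsubsetUr.
rewrite kernelD (kernelM _ _ xW) (kernelM _ _ yW) (kernelM _ _ xyW).
rewrite -big_split; apply: eq_bigr => s _.
by rewrite kernelD mulrDl.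
Qed.

Lemma schur_mulDr : right_distributive schur_mul +%R.
Proof.
move=> x y z; apply: kernelP => p q; have [T xT] := coversP x p.
rewrite kernelD !(kernelM _ _ xT) -big_split; apply: eq_bigr => s _.
by rewrite kernelD mulrDr.
Qed.

Lemma basis_mul a b : schur_mul (basis a) (basis b) = xi_mul a b.
Proof.
by rewrite /schur_mul !msuppU oner_eq0 !big_seq_fset1 !mcoeffUU mulr1 mulr1z.
Qed.

Lemma orb_diag (p q i : multiindex r) : orb p q = orb i i :> pair_orbit n r -> p = q.
Proof. by move=> /esym/orbE[w [eps [-> ->]]]. Qed.

Lemma kernel_fsum (D : set (pair_orbit n r)) p q : finite_set D ->
  kernel (\sum_(c \in D) basis c) p q = (orb p q \in D)%:R.
Proof.
move=> fD; rewrite /kernel (@mcoeff_fsum (fun=> 1)); first by case: ifP.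
exact: finite_setIl.
Qed.

End SchurAlgebra.

Section SchurRing.
Variables n r : nat.
Local Notation S := (affine_schur n.+1 r).
Local Notation orb := (@orb n.+1 r).

Lemma finite_diag : finite_set [set orb i i | i in [set: multiindex r]].
Proof.
pose low (f : {ffun 'I_r -> 'I_n.+1}) : multiindex r := [ffun t => (f t)%:Z].
apply: (@sub_finite_set _ _ ((fun f => orb (low f) (low f)) @` setT)).
  move=> _ [i _ <-]; exists [ffun t => inord `|(i t %% n.+1)%Z|%N] => //.
  apply/orbE; exists 1%g, [ffun t => (i t %/ n.+1)%Z].
  suff -> : affine_act n.+1 1%g [ffun t => (i t %/ n.+1)%Z]
     (low [ffun t => inord `|(i t %% n.+1)%Z|%N]) = i by [].
  apply/ffunP => t; rewrite !ffunE perm1 inordK; last first.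
    by rewrite -ltz_nat gez0_abs ?modz_ge0 ?ltz_pmod.
  by rewrite gez0_abs ?modz_ge0// [RHS](divz_eq _ n.+1) addrC mulrC.
exact/finite_image/finite_finset.
Qed.

Lemma kernel1 p q : kernel (schur_one n.+1 r) p q = (p == q)%:R.
Proof.
rewrite kernel_fsum; last exact: finite_diag.
congr (nat_of_bool _)%:R; apply/idP/eqP => [/set_mem[i _ /esym/orb_diag]//|->].
by apply/mem_set; exists q.
Qed.

Lemma schur_mul1 : left_id (schur_one n.+1 r) (@schur_mul n.+1 r).
Proof.
move=> x; apply: kernelP => p q.
rewrite (@kernelM _ _ _ _ _ _ [fset p]%fset).
  by rewrite big_seq_fset1 kernel1 eqxx mul1r.
by move=> s; rewrite kernel1 inE (eq_sym s p); case: (p == s).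
Qed.

Lemma schur_mulr1 : right_id (schur_one n.+1 r) (@schur_mul n.+1 r).
Proof.
move=> x; apply: kernelP => p q; have [T xT] := coversP x p.
rewrite (@kernelM _ _ _ _ _ _ (q |` T)%fset); last first.
  by apply: coversW xT; exact: fsubsetU1.
rewrite (big_fsetD1 q) ?fset1U1//= kernel1 eqxx mulr1 big1_seq ?addr0// => s.
by move=> /andP[_]; rewrite in_fsetD1 kernel1 => /andP[/negPf-> _]; rewrite mulr0.
Qed.

HB.instance Definition _ := GRing.Zmodule_isPzRing.Build S
  (@schur_mulA n.+1 r) schur_mul1 schur_mulr1
  (@schur_mulDl n.+1 r) (@schur_mulDr n.+1 r).

Lemma kernel_idem (x : S) (d : pred (multiindex r)) :
  (forall p q, kernel x p q = ((p == q) && d p)%:R) -> x * x = x.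
Proof.
move=> xd; apply: kernelP => p q.
have -> : x * x = schur_mul x x by [].
rewrite (@kernelM _ _ _ _ _ _ [fset p]%fset).
  by rewrite big_seq_fset1 !xd eqxx -natrM mulnb; case: (d p); rewrite ?andbF.
by move=> s; rewrite xd inE (eq_sym s p); case: (p == s).
Qed.

End SchurRing.

(** * The idempotents l_lambda *)

Section Weights.

Definition Lambda (n r : nat) : set {ffun 'I_n -> nat} :=
  [set l | (\sum_t l t)%N = r].
Arguments Lambda n r : clear implicits.

(* (1, ..., 1, ..., n, ..., n) with t occurring l_t times; the parts of l are
   numbered from 0. *)
Definition weight_word n (l : {ffun 'I_n -> nat}) : seq nat :=
  flatten [seq nseq (l t) t.+1 | t <- enum 'I_n].

Definition weight_index n r (l : {ffun 'I_n -> nat}) : multiindex r :=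
  [ffun s : 'I_r => (nth 0%N (weight_word l) s)%:Z].

Definition weight_idem n r (l : {ffun 'I_n -> nat}) : affine_schur n r :=
  xi n (weight_index r l) (weight_index r l).

Definition pad n N (l : {ffun 'I_n -> nat}) : {ffun 'I_N -> nat} :=
  [ffun t : 'I_N => if insub (val t) is Some u then l u else 0%N].

Lemma size_weight_word n r (l : {ffun 'I_n -> nat}) : Lambda n r l ->
  size (weight_word l) = r.
Proof.
move=> <-; rewrite size_flatten /shape -map_comp sumnE big_map big_enum /=.
by apply: eq_bigr => t _; rewrite size_nseq.
Qed.

Lemma count_weight_word n (l : {ffun 'I_n -> nat}) t :
  count_mem t.+1 (weight_word l) = if insub t is Some u then l u else 0%N.
Proof.
rewrite count_flatten -map_comp sumnE big_map big_enum /=.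
under eq_bigr do rewrite count_nseq /= eqSS.
case: insubP => [u _ <-|nt].
  rewrite (bigD1 u)//= eqxx mul1n big1 ?addn0// => v /negPf vu.
  by rewrite (inj_eq val_inj) vu.
by rewrite big1// => v _; case: eqP => // vt; rewrite -vt ltn_ord in nt.
Qed.

Lemma weight_word_bound n (l : {ffun 'I_n -> nat}) x :
  x \in weight_word l -> (0 < x <= n)%N.
Proof.
by move=> /flattenP[_ /mapP[t _ ->]]; rewrite mem_nseq => /andP[_ /eqP->] /=.
Qed.

Lemma weight_orb_inj n r (l m : {ffun 'I_n.+1 -> nat}) :
  Lambda n.+1 r l -> Lambda n.+1 r m ->
  orb (weight_index r l) (weight_index r l) =
    orb (weight_index r m) (weight_index r m) :> pair_orbit n.+1 r -> l = m.
Proof.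
move=> Ll Lm /orbE[w [eps [lm _]]].
have wlm (s : 'I_r) : nth 0%N (weight_word m) s = nth 0%N (weight_word l) (w s).
  move/ffunP/(_ s): lm; rewrite !ffunE => lms.
  have /weight_word_bound/andP[m0 mn] :
    nth 0%N (weight_word m) s \in weight_word m.
    by rewrite mem_nth// (size_weight_word Lm).
  have /weight_word_bound/andP[l0 ln] :
    nth 0%N (weight_word l) (w s) \in weight_word l.
    by rewrite mem_nth// (size_weight_word Ll).
  move: (nth _ _ _) (nth _ _ _) (eps s) lms m0 mn l0 ln => a b e.
  have [->|[e1|e1]] : (e = 0) \/ (1 <= e) \/ (e <= -1) by lia.
  - by lia.
  - by nia.
  - by nia.
have cnt x : count_mem x (weight_word m) = count_mem x (weight_word l).
  have cntE k (Lk : Lambda n.+1 r k) : count_mem x (weight_word k) =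
      (\sum_(s < r) (nth 0%N (weight_word k) s == x))%N.
    rewrite -sum1_count (big_nth 0%N) (size_weight_word Lk) big_mkord.
    by rewrite big_mkcond; apply: eq_bigr => s _ /=; case: eqP.
  rewrite !cntE// [RHS](reindex_inj (@perm_inj _ w)).
  by apply: eq_bigr => s _; rewrite wlm.
apply/ffunP => t; have := cnt t.+1; rewrite !count_weight_word.
by case: insubP => [u _ /val_inj ->//|]; rewrite ltn_ord.
Qed.

Lemma finite_Lambda n r : finite_set (Lambda n r).
Proof.
apply: (@sub_finite_set _ _
  ((fun f : {ffun 'I_n -> 'I_r.+1} => [ffun t => val (f t)]) @` setT)).
  move=> l Ll; exists [ffun t => inord (l t)] => //.
  apply/ffunP => t; rewrite !ffunE /= inordK// ltnS -Ll.
  by rewrite (bigD1 t)//= leq_addr.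
exact/finite_image/finite_finset.
Qed.

Variables n N r : nat.

(* Positive integers are written n.+1 and N.+1.  For n <= N the intersection
   below is just the image of Lambda(n.+1,r). *)
Definition Lambda_sub : set {ffun 'I_N.+1 -> nat} :=
  Lambda N.+1 r `&` (@pad n.+1 N.+1 @` Lambda n.+1 r).

Definition corner_elt : affine_schur N.+1 r :=
  \sum_(l \in Lambda_sub) weight_idem r l.

Lemma corner_eltK : corner_elt * corner_elt = corner_elt.
Proof.
pose h (l : {ffun 'I_N.+1 -> nat}) : pair_orbit N.+1 r :=
  orb (weight_index r l) (weight_index r l).
have fL : finite_set Lambda_sub by apply: finite_setIl; exact: finite_Lambda.
have eE : corner_elt = \sum_(c \in h @` Lambda_sub) basis c.
  rewrite fsbig_image// => l m /set_mem[Ll _] /set_mem[Lm _].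
  exact: weight_orb_inj.
apply: (@kernel_idem _ _ _ (fun p => orb p p \in h @` Lambda_sub)) => p q.
rewrite eE kernel_fsum; last exact: finite_image.
case: eqP => [->//|pq]; congr (nat_of_bool _)%:R.
by apply/negP => /set_mem[l _ /esym/orb_diag].
Qed.

Definition schur_idempotent : idempotent (affine_schur N.+1 r) :=
  Idempotent corner_eltK.

End Weights.

Arguments corner_elt n N r : clear implicits.
Arguments schur_idempotent n N r : clear implicits.

(* Main.v *)
(* With the words p in the letters 1, ..., n as representatives of the orbits on
   I(Z,r), an element of S^(n,r) becomes an S_r-equivariant matrix indexed by
   pairs of words with entries in Z[x_1^+-1, ..., x_r^+-1]; so does an element of
   e S^(N,r) e, whence the isomorphism.  In this matrix ring A, the chain consists
   of the ideals generated by the l_mu with mu at least lambda in the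
   lexicographic order, for all compositions lambda.  Let rho be the word of
   lambda and Gamma the space of the columns rho of the elements of A l_lambda,
   i.e. of the Stab(rho)-equivariant vectors.  The higher ideal contributes
   relations: a coefficient at a word q which vanishes whenever the values of the
   variables at certain cells of row i + 1 occur among those at certain cells of
   row i can be straightened away.  If lambda is not a partition, this kills
   Gamma.  If it is, it leaves, at every word, finitely many products of Schur
   functions over the ring of invariants of Stab(rho), which are indexed by the
   column strict fillings of lambda.  Antisymmetrizing over the columns at the
   points that are constant on the columns annihilates the higher ideal and shows
   that the remaining vectors are independent, also when paired with their
   transposes; the scalars vanishing at those points act by zero.  Thus the layer
   is a matrix-like ideal free over a commutative ring, which is finitely
   generated since the invariants are a finite module over the symmetric Laurent
   polynomials. *)
Require Import Defs.
From HB Require Import structures.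
From mathcomp Require Import all_boot all_order all_algebra fingroup perm.
From mathcomp Require Import finmap boolp classical_sets.
From mathcomp Require Import functions cardinality fsbigop monalg.
From mathcomp Require Import ring lra zify.

Set Implicit Arguments.
Unset Strict Implicit.
Unset Printing Implicit Defensive.

Import Order.TTheory GRing.Theory Num.Theory.

Local Open Scope ring_scope.

(** Two mechanisms oppose each other. Relations come from routing a coefficient through a word of
    higher content: cells of row [i1] are moved up to row [i0], and the correction terms inherit the
    vanishing at covered points, so they can be corrected in turn. Conversely, a word whose content
    is above a partition repeats a letter in some column, so the signed sum over column permutations
    kills it wherever these permutations fix the variables. Hence exactly the column constant points
    detect what survives, and the scalars of a layer are the restrictions of invariants to these
    points. This ring is never presented by generators and relations: its elements are compared by
    their values. Laurent polynomials are treated as functions for the same reason: substitutions,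
    coincidences of variables and vanishing conditions become statements about points. Integrality
    is kept by spanning with Schur functions over Z; denominators occur only in values at single
    points, for cancelling Vandermonde determinants and inverting the matrix of values. *)

Section ZSpan.
Variable V : zmodType.
Implicit Types (G : V -> Prop) (f g : V).

(** The subgroup generated by [G], encoded as an intersection, so that induction on generators is
    the application of a hypothesis to the subgroup at hand. *)
Definition zspan G f : Prop := forall S : V -> Prop,
  S 0 -> (forall x y, S x -> S y -> S (x - y)) -> (forall g, G g -> S g) -> S f.

Lemma zspan0 G : zspan G 0. Proof. by []. Qed.

Lemma zspan_gen G g : G g -> zspan G g.
Proof. by move=> Gg S _ _; exact. Qed.

Lemma zspanB G f g : zspan G f -> zspan G g -> zspan G (f - g).
Proof.
move=> Gf Gg S S0 SB SG.
by apply: (SB) => //; [exact: (Gf S S0 SB SG)|exact: (Gg S S0 SB SG)].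
Qed.

Lemma zspanN G f : zspan G f -> zspan G (- f).
Proof. by move=> Gf; rewrite -[- f]add0r; exact: zspanB. Qed.

Lemma zspanD G f g : zspan G f -> zspan G g -> zspan G (f + g).
Proof. by move=> Gf Gg; rewrite -[g]opprK; apply: zspanB => //; exact: zspanN. Qed.

Lemma zspan_sum G (I : Type) (s : seq I) (P : pred I) F :
  (forall i, P i -> zspan G (F i)) -> zspan G (\sum_(i <- s | P i) F i).
Proof. by move=> GF; apply: big_ind => //; exact: zspanD. Qed.

Lemma zspan_sum_seq G (I : eqType) (s : seq I) F :
  (forall i, i \in s -> zspan G (F i)) -> zspan G (\sum_(i <- s) F i).
Proof. by move=> GF; rewrite big_seq; apply: zspan_sum. Qed.

Lemma zspanMn G f n : zspan G f -> zspan G (f *+ n).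
Proof. by move=> Gf; elim: n => [|n IH]; rewrite ?mulr0n // mulrS; exact: zspanD. Qed.

Lemma zspanMz G f (c : int) : zspan G f -> zspan G (f *~ c).
Proof.
move=> Gf; case: c => n; first by rewrite -pmulrn; exact: zspanMn.
by rewrite NegzE mulrNz -pmulrn; apply: zspanN; exact: zspanMn.
Qed.

Lemma zspan_trans G G' f :
  zspan G f -> (forall g, G g -> zspan G' g) -> zspan G' f.
Proof. by move=> Gf GG'; apply: Gf => //; exact: zspanB. Qed.

End ZSpan.

Lemma zspan_map (V W : zmodType) (h : V -> W) (G : V -> Prop) (G' : W -> Prop) f :
  h 0 = 0 -> {morph h : x y / x - y} ->
  zspan G f -> (forall g, G g -> zspan G' (h g)) -> zspan G' (h f).
Proof.
move=> h0 hB Gf GG'; apply: (Gf (fun x => zspan G' (h x))) => // [|x y Gx Gy].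
  by rewrite h0.
by rewrite hB; exact: zspanB.
Qed.

(** * Laurent polynomials as functions *)

Section Laurent.
Variable r : nat.

(* Laurent polynomials are functions of the point x_s = o s + 1; the shift
   keeps negative powers meaningful, and rat carries the determinants. *)
Definition point := 'I_r -> nat.
Definition lfun := point -> rat.
HB.instance Definition _ := GRing.ComPzRing.on lfun.

Definition expo := {ffun 'I_r -> int}.
HB.instance Definition _ := GRing.Zmodule.on expo.
Implicit Types (a b : expo) (f g : lfun) (o : point) (w : 'S_r).

Lemma lfunD f g o : (f + g) o = f o + g o. Proof. by []. Qed.
Lemma lfunN f o : (- f) o = - f o. Proof. by []. Qed.
Lemma lfunB f g o : (f - g) o = f o - g o. Proof. by []. Qed.
Lemma lfunM f g o : (f * g) o = f o * g o. Proof. by []. Qed.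
Lemma lfun_sum I (s : seq I) (P : pred I) (F : I -> lfun) o :
  (\sum_(i <- s | P i) F i) o = \sum_(i <- s | P i) F i o.
Proof. exact: (big_morph (fun f : lfun => f o)). Qed.
Lemma lfun_prod I (s : seq I) (P : pred I) (F : I -> lfun) o :
  (\prod_(i <- s | P i) F i) o = \prod_(i <- s | P i) F i o.
Proof. exact: (big_morph (fun f : lfun => f o)). Qed.
Lemma lfunMz f c o : (f *~ c) o = f o *~ c.
Proof.
have nat n : (f *+ n) o = f o *+ n.
  by elim: n => [|n IH]; rewrite ?mulr0n // !mulrS lfunD IH.
by case: c => n; rewrite ?NegzE ?mulrNz ?lfunN -!pmulrn nat.
Qed.

Definition mono a : lfun := fun o => \prod_s (o s).+1%:R ^ a s.

Lemma coordU (o : point) s : (o s).+1%:R \is a @GRing.unit rat.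
Proof. by rewrite unitfE pnatr_eq0. Qed.

Lemma monoD a b : mono (a + b) = mono a * mono b.
Proof.
apply/funext => o; rewrite lfunM /mono -big_split; apply: eq_bigr => s _.
by rewrite ffunE expfzDr // -unitfE coordU.
Qed.

Lemma mono0 : mono 0 = 1.
Proof. by apply/funext => o; apply: big1 => s _; rewrite ffunE expr0z. Qed.

Definition Laur : lfun -> Prop := zspan (fun f => exists a, f = mono a).

Lemma Laur_mono a : Laur (mono a).
Proof. by apply: zspan_gen; exists a. Qed.

Lemma Laur1 : Laur 1. Proof. by rewrite -mono0; exact: Laur_mono. Qed.

Lemma LaurM f g : Laur f -> Laur g -> Laur (f * g).
Proof.
move=> Lf Lg; apply: (zspan_map (h := fun f => f * g) _ _ Lf).
- by rewrite mul0r.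
- by move=> x y; rewrite mulrBl.
move=> _ [a ->]; apply: (zspan_map (h := fun g => mono a * g) _ _ Lg).
- by rewrite mulr0.
- by move=> x y; rewrite mulrBr.
by move=> _ [b ->]; rewrite -monoD; exact: Laur_mono.
Qed.

Lemma Laur_sum I (s : seq I) (P : pred I) F :
  (forall i, P i -> Laur (F i)) -> Laur (\sum_(i <- s | P i) F i).
Proof. exact: zspan_sum. Qed.

Lemma Laur_prod I (s : seq I) (P : pred I) F :
  (forall i, P i -> Laur (F i)) -> Laur (\prod_(i <- s | P i) F i).
Proof. by move=> LF; apply: big_ind => //; [exact: Laur1|exact: LaurM]. Qed.

Lemma LaurB f g : Laur f -> Laur g -> Laur (f - g). Proof. exact: zspanB. Qed.
Lemma LaurN f : Laur f -> Laur (- f). Proof. exact: zspanN. Qed.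
Lemma Laur0 : Laur 0. Proof. exact: zspan0. Qed.

(** Uniqueness of signed expansions in base [M]: the lowest digit is a multiple of [M] and smaller
    than [M] in absolute value, hence zero, and the rest can be divided by [M]. *)
Lemma digits (M : nat) q (d : nat -> int) :
  (forall s, (s < q)%N -> `|d s| < M%:Z) ->
  \sum_(s < q) d s * M%:Z ^+ s = 0 -> forall s, (s < q)%N -> d s = 0.
Proof.
elim: q d => [//|q IH] d dM; rewrite big_ord_recl /= expr0 mulr1.
under eq_bigr do rewrite /bump /= add1n exprS mulrCA.
rewrite -mulr_sumr => dE.
have d0 : d 0%N = 0.
  have := dM 0%N isT; move: dE; set S := \sum_(i < q) _.
  move/eqP; rewrite addr_eq0 => /eqP->; rewrite normrN normrM.
  have [->|S0] := eqVneq S 0; first by rewrite mulr0 oppr0.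
  have : 1 <= `|S| by rewrite -gtz0_ge1 normr_gt0.
  by nia.
have M0 : M%:Z != 0.
  by have := dM 0%N isT; apply: contraTneq => ->; rewrite -leNgt.
move: dE; rewrite d0 add0r => /eqP; rewrite mulf_eq0 (negPf M0) => /eqP dE.
case=> [_ //|s]; rewrite ltnS => sq.
by apply: (IH (fun s => d s.+1)) => // t tq; exact: dM.
Qed.

(** Kronecker substitution: with x_s = X^(M^s) the monomials become distinct powers of X, and the
    resulting polynomial vanishes at all integers X > 1. These points are injective, so injective
    points alone separate Laurent polynomials. *)
Lemma mono_indep (A : seq expo) (c : expo -> rat) : uniq A ->
  (forall o, injective o -> \sum_(a <- A) c a * mono a o = 0) ->
  {in A, forall a, c a = 0}.
Proof.
move=> uA c0.
pose K := (\sum_(a <- A) \sum_s `|a s|%N)%N.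
have K_ge a s : a \in A -> (`|a s| <= K)%N.
  by move=> aA; rewrite /K (big_rem a) //= (bigD1 s) //= -!addnA leq_addr.
(* The digits to compare are differences of exponents, hence at most [2 * K] in absolute value.
   Moreover [M] must exceed 1 for the point below to be injective. *)
pose M := (2 * K + 2)%N.
pose e a : int := \sum_(s < r) a s * M%:Z ^+ s.
have e_inj : {in A &, injective e}.
  move=> a b aA bA /eqP; rewrite -subr_eq0 /e -sumrB => /eqP eab.
  pose d (s : nat) : int := if insub s is Some t then a t - b t else 0.
  have dE (s : 'I_r) : d s = a s - b s by rewrite /d valK.
  apply/ffunP => s; apply/eqP; rewrite -subr_eq0 -dE; apply/eqP.
  apply: (@digits M r) => // [t tr|].
    by have := K_ge _ (Ordinal tr) aA; have := K_ge _ (Ordinal tr) bA;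
       rewrite (dE (Ordinal tr)) /M; lia.
  by rewrite -[RHS]eab; apply: eq_bigr => t _; rewrite dE mulrBl.
(* A shift that makes all the exponents of X nonnegative. *)
pose E := (\sum_(a <- A) `|e a|%N)%N.
have E_ge a : a \in A -> 0 <= e a + E%:Z.
  by move=> aA; rewrite /E (big_rem a) //=; lia.
pose ex a := absz (e a + E%:Z).
pose p : {poly rat} := \sum_(a <- A) c a *: 'X^(ex a).
have pE (X : nat) : (1 < X)%N -> p.[X%:R] = 0.
  move=> X1; pose o : point := fun s => (X ^ (M ^ s)).-1.
  have X0 : (0 < X)%N by lia.
  have oE s : (o s).+1 = (X ^ (M ^ s))%N by rewrite /o prednK // expn_gt0 X0.
  have oi : injective o.
    move=> s t /(congr1 succn); rewrite !oE => /eqP; rewrite eqn_exp2l //.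
    by rewrite eqn_exp2l ?/M ?addn2 // => /eqP/val_inj.
  have XU : X%:R != 0 :> rat by rewrite pnatr_eq0; lia.
  have monoE a : mono a o = X%:R ^ e a.
    rewrite /e; transitivity (\prod_(s < r) X%:R ^ (a s * M%:Z ^+ s) : rat).
      apply: eq_bigr => s _; rewrite oE natrX exprnP exprz_exp mulrC.
      by congr (_ ^ (_ * _)); rewrite -!natz natrX.
    by elim/big_rec2: _ => [|s x y _ ->]; rewrite ?expr0z // expfzDr.
  transitivity ((\sum_(a <- A) c a * mono a o) * X%:R ^ E%:Z); last first.
    by rewrite c0 // mul0r.
  rewrite /p horner_sum mulr_suml big_seq [RHS]big_seq; apply: eq_bigr => a aA.
  rewrite hornerZ hornerXn monoE -mulrA -expfzDr //; congr (_ * _).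
  by rewrite exprnP /ex gez0_abs // E_ge.
have p0 : p = 0.
  apply/eqP; apply/negPn/negP => pn0.
  pose rs : seq rat := [seq (i.+2)%:R | i <- iota 0 (size p)].
  have rs_root : all (root p) rs.
    by apply/allP => _ /mapP[i _ ->]; apply/eqP; exact: pE.
  have rs_uniq : uniq rs.
    by rewrite map_inj_uniq ?iota_uniq // => i j /eqP; rewrite eqr_nat => /eqP[].
  by have := max_poly_roots pn0 rs_root rs_uniq; rewrite size_map size_iota ltnn.
move=> a aA; have := congr1 (fun q : {poly rat} => q`_(ex a)) p0.
rewrite /p coef_sum coef0 (bigD1_seq a) //= coefZ coefXn eqxx mulr1.
rewrite big1_seq ?addr0 // => b /andP[ba bA]; rewrite coefZ coefXn.
case: eqP => [exab|]; last by rewrite mulr0.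
case/eqP: ba; apply: e_inj => //; apply: (addIr E%:Z).
by rewrite -[LHS]gez0_abs ?E_ge // -[RHS]gez0_abs ?E_ge // -/(ex _) -/(ex a) exab.
Qed.

End Laurent.

(** * Invariants of Young subgroups *)

(** Orbits of words and of points are recognized throughout by counting values. *)
Lemma perm_of_counts (r : nat) (L : eqType) (u v : 'I_r -> L) :
  (forall l, (\sum_s (u s == l) = \sum_s (v s == l))%N) ->
  exists w : 'S_r, forall s, u s = v (w s).
Proof.
move=> uv; pose t (x : 'I_r -> L) := [tuple x s | s < r].
have cnt x l : count_mem l (t x) = (\sum_s (x s == l))%N.
  rewrite /= count_map -sum1_count big_mkcond /= big_enum /=.
  by apply: eq_bigr => s _ /=; case: eqP.
have /tuple_permP[w tuE] : perm_eq (t u) (t v).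
  by apply/allP => l _ /=; rewrite !cnt; apply/eqP; exact: uv.
exists w => s; have /val_inj tE := tuE.
by have := congr1 (fun x => tnth x s) tE; rewrite !tnth_mktuple.
Qed.

Section Invariants.
Variable r : nat.
Local Notation point := (point r).
Local Notation lfun := (lfun r).
Local Notation expo := (expo r).
Implicit Types (a b : expo) (f g : lfun) (o : point) (w : 'S_r).

Definition actE w a : expo := [ffun s => a ((w^-1)%g s)].

Lemma mono_act w a o : mono a (fun s => o (w s)) = mono (actE w a) o.
Proof.
rewrite /mono [RHS](reindex_inj (@perm_inj _ w)).
by apply: eq_bigr => s _; rewrite ffunE permK.
Qed.

Lemma actE1 a : actE 1%g a = a.
Proof. by apply/ffunP => s; rewrite ffunE invg1 perm1. Qed.

Lemma actEM w w' a : actE w (actE w' a) = actE (w' * w)%g a.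
Proof. by apply/ffunP => s; rewrite !ffunE invMg permM. Qed.

Lemma actEK w : cancel (actE w) (actE (w^-1)%g).
Proof. by move=> a; rewrite actEM mulgV actE1. Qed.

Lemma actE_inj w : injective (actE w). Proof. exact: can_inj (actEK w). Qed.

Definition fixes (K : eqType) (k : 'I_r -> K) : pred 'S_r :=
  fun w => [forall s, k (w s) == k s].

Lemma fixesP (K : eqType) (k : 'I_r -> K) w :
  reflect (forall s, k (w s) = k s) (fixes k w).
Proof. by apply: (iffP forallP) => kw s; apply/eqP; rewrite kw. Qed.

Lemma fixes1 (K : eqType) (k : 'I_r -> K) : fixes k 1%g.
Proof. by apply/fixesP => s; rewrite perm1. Qed.

Lemma fixesM (K : eqType) (k : 'I_r -> K) w w' :
  fixes k w -> fixes k w' -> fixes k (w * w')%g.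
Proof. by move=> /fixesP kw /fixesP kw'; apply/fixesP => s; rewrite permM kw'. Qed.

Lemma fixesV (K : eqType) (k : 'I_r -> K) w : fixes k w -> fixes k w^-1%g.
Proof. by move=> /fixesP kw; apply/fixesP => s; rewrite -[in RHS](permKV w s) kw. Qed.

Lemma fixes_fun (K K' : eqType) (k : 'I_r -> K) (h : K -> K') w :
  fixes k w -> fixes (fun s => h (k s)) w.
Proof. by move=> /fixesP kw; apply/fixesP => s; rewrite kw. Qed.

(* Laurent polynomials invariant under the Young subgroup of the blocks of k *)
Definition inv (K : eqType) (k : 'I_r -> K) f :=
  Laur f /\ forall w, fixes k w -> forall o, f (fun s => o (w s)) = f o.

Section InvClosed.
Variables (K : eqType) (k : 'I_r -> K).

Lemma inv0 : inv k 0. Proof. by split=> //; exact: Laur0. Qed.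
Lemma inv1 : inv k 1. Proof. by split=> //; exact: Laur1. Qed.
Lemma invB f g : inv k f -> inv k g -> inv k (f - g).
Proof.
move=> [Lf kf] [Lg kg]; split; first exact: LaurB.
by move=> w kw o; rewrite !lfunB kf // kg.
Qed.
Lemma invM f g : inv k f -> inv k g -> inv k (f * g).
Proof.
move=> [Lf kf] [Lg kg]; split; first exact: LaurM.
by move=> w kw o; rewrite !lfunM kf // kg.
Qed.
Lemma invN f : inv k f -> inv k (- f).
Proof. by move=> kf; rewrite -sub0r; apply: invB => //; exact: inv0. Qed.
Lemma invD f g : inv k f -> inv k g -> inv k (f + g).
Proof. by move=> kf kg; rewrite -[g]opprK; apply: invB => //; exact: invN. Qed.
Lemma inv_sum I (s : seq I) (P : pred I) F :
  (forall i, P i -> inv k (F i)) -> inv k (\sum_(i <- s | P i) F i).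
Proof. by move=> kF; apply: big_ind => //; [exact: inv0|exact: invD]. Qed.
Lemma inv_prod I (s : seq I) (P : pred I) F :
  (forall i, P i -> inv k (F i)) -> inv k (\prod_(i <- s | P i) F i).
Proof. by move=> kF; apply: big_ind => //; [exact: inv1|exact: invM]. Qed.
Lemma inv_zspan (G : lfun -> Prop) f :
  (forall g, G g -> inv k g) -> zspan G f -> inv k f.
Proof. by move=> kG; apply; [exact: inv0|exact: invB|]. Qed.
End InvClosed.

Lemma inv_sub (K K' : eqType) (k : 'I_r -> K) (k' : 'I_r -> K') f :
  (forall w, fixes k w -> fixes k' w) -> inv k' f -> inv k f.
Proof. by move=> kk' [Lf kf]; split=> // w /kk'; exact: kf. Qed.

Definition LaurS (P : expo -> Prop) : lfun -> Prop :=
  zspan (fun f => exists a, P a /\ f = mono a).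

Lemma LaurST f : Laur f <-> LaurS (fun=> True) f.
Proof.
split=> Lf; first by apply: (zspan_trans Lf) => _ [a ->]; apply: zspan_gen; exists a.
by apply: (zspan_trans Lf) => _ [a [_ ->]]; exact: Laur_mono.
Qed.

Lemma big_ext_seq (M : zmodType) (T : eqType) (A B : seq T) (F : T -> M) :
  uniq A -> uniq B -> {subset A <= B} -> (forall x : T, x \notin A -> F x = 0) ->
  \sum_(x <- A) F x = \sum_(x <- B) F x.
Proof.
move=> uA uB AB F0; rewrite [RHS](bigID (mem A)) /=.
rewrite [X in _ + X]big1 ?addr0; last by move=> x; exact: F0.
rewrite -[RHS]big_filter; apply: perm_big; apply: uniq_perm => //.
  by rewrite filter_uniq.
move=> x; rewrite mem_filter; apply/idP/andP => [aA|[]//].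
by rewrite aA AB.
Qed.

Lemma LaurS_rep P f : LaurS P f -> exists (A : seq expo) (c : expo -> int),
  [/\ uniq A, forall a, a \notin A -> c a = 0, forall a, a \in A -> P a &
      forall o, f o = \sum_(a <- A) (c a)%:~R * mono a o].
Proof.
move=> Pf; apply: (Pf (fun f => exists A c, [/\ uniq A, _, _ & _])).
- by exists [::], (fun=> 0); split=> // o; rewrite big_nil.
- move=> f1 f2 [A1 [c1 [u1 z1 P1 E1]]] [A2 [c2 [u2 z2 P2 E2]]].
  exists (undup (A1 ++ A2)), (fun a => c1 a - c2 a); split.
  + exact: undup_uniq.
  + by move=> a; rewrite mem_undup mem_cat negb_or => /andP[/z1-> /z2->].
  + by move=> a; rewrite mem_undup mem_cat => /orP[/P1|/P2].
  move=> o; rewrite lfunB E1 E2; under [RHS]eq_bigr do rewrite rmorphB mulrBl.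
  rewrite sumrB; congr (_ - _); apply: big_ext_seq; rewrite ?undup_uniq //.
  - by move=> a aA; rewrite mem_undup mem_cat aA.
  - by move=> a /z1->; rewrite mul0r.
  - by move=> a aA; rewrite mem_undup mem_cat aA orbT.
  - by move=> a /z2->; rewrite mul0r.
move=> _ [a [Pa ->]]; exists [:: a], (fun b => (b == a)%:Z); split=> //.
- by move=> b; rewrite inE => /negPf->.
- by move=> b; rewrite inE => /eqP->.
- by move=> o; rewrite big_seq1 eqxx mul1r.
Qed.

Lemma rep_LaurS P (A : seq expo) (c : expo -> int) f :
  (forall a, a \in A -> P a) ->
  (forall o, f o = \sum_(a <- A) (c a)%:~R * mono a o) -> LaurS P f.
Proof.
move=> PA fE; have -> : f = \sum_(a <- A) mono a *~ c a.
  apply/funext => o; rewrite fE lfun_sum; apply: eq_bigr => a _.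
  by rewrite lfunMz mulrzl.
by apply: zspan_sum_seq => a aA; apply: zspanMz; apply: zspan_gen; exists a; split=> //; exact: PA.
Qed.

(** Testing at injective points only is what permits Vandermonde determinants to be cancelled
    later. *)
Lemma Laur_eq0 f : Laur f -> (forall o, injective o -> f o = 0) -> f = 0.
Proof.
move=> /LaurST/LaurS_rep[A [c [uA z _ E]]] f0.
apply/funext => o; rewrite E big1_seq // => a /andP[_ aA].
suff -> : (c a)%:~R = 0 :> rat by rewrite mul0r.
apply: (mono_indep uA (c := fun a => (c a)%:~R)) => // o' io'.
by rewrite -E f0.
Qed.

(** By independence of the monomials, the coefficients inherit the symmetry of the function. They
    are rational because in [decompose] they are themselves values at a point. *)
Lemma rep_act w (A : seq expo) (C : expo -> rat) : uniq A ->
  (forall a, a \notin A -> C a = 0) ->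
  (forall o, \sum_(a <- A) C a * mono a (fun s => o (w s)) = \sum_(a <- A) C a * mono a o) ->
  forall a, C (actE w a) = C a.
Proof.
move=> uA z E; pose B := undup (A ++ [seq actE w b | b <- A]).
have Bz b : b \notin B -> C b = 0 /\ C (actE w^-1%g b) = 0.
  rewrite mem_undup mem_cat negb_or => /andP[/z-> nb]; split=> //.
  apply: z; apply: contraNN nb => ?; apply/mapP; exists (actE w^-1%g b) => //.
  by rewrite -{1}(invgK w) actEK.
have CB b : b \in B -> C (actE w^-1%g b) = C b.
  move=> bB; apply/eqP; rewrite -subr_eq0; apply/eqP.
  apply: (@mono_indep _ B (fun b => C (actE w^-1%g b) - C b)) => //.
    exact: undup_uniq.
  move=> o io; under eq_bigr do rewrite mulrBl.
  rewrite sumrB; apply/eqP; rewrite subr_eq0; apply/eqP.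
  transitivity (\sum_(a <- A) C a * mono a o); last first.
    apply: big_ext_seq => //; rewrite ?undup_uniq //.
      by move=> b' b'A; rewrite mem_undup mem_cat b'A.
    by move=> b' /z->; rewrite mul0r.
  rewrite -E; under [RHS]eq_bigr do rewrite mono_act.
  transitivity (\sum_(b <- [seq actE w b | b <- A]) C (actE w^-1%g b) * mono b o).
    apply/esym/big_ext_seq; rewrite ?undup_uniq ?(map_inj_uniq (@actE_inj w)) //.
      by move=> b' b'A; rewrite mem_undup mem_cat b'A orbT.
    move=> b' nb; rewrite z ?mul0r //; apply: contraNN nb => ?.
    by apply/mapP; exists (actE w^-1%g b') => //; rewrite -{1}(invgK w) actEK.
  by rewrite big_map; apply: eq_bigr => b' _; rewrite actEK.
move=> a; have [aB|/Bz[-> a0]] := boolP (actE w a \in B).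
  by have := CB _ aB; rewrite actEK.
by rewrite actEK in a0.
Qed.

Section Orbits.
Variables (K : eqType) (k : 'I_r -> K).

Definition eorb a : seq expo := undup [seq actE w a | w <- enum (fixes k)].

Lemma eorbP a b : reflect (exists2 w, fixes k w & b = actE w a) (b \in eorb a).
Proof.
rewrite mem_undup; apply: (iffP mapP) => -[w kw ->]; exists w => //.
  by rewrite mem_enum in kw.
by rewrite mem_enum.
Qed.

Lemma eorb_refl a : a \in eorb a.
Proof. by apply/eorbP; exists 1%g; rewrite ?fixes1 ?actE1. Qed.

Lemma eorb_act w a b : fixes k w -> (actE w b \in eorb a) = (b \in eorb a).
Proof.
move=> kw; apply/eorbP/eorbP => -[w' kw' E].
  exists (w' * w^-1)%g; first by rewrite fixesM // fixesV.
  by rewrite -actEM -E actEK.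
by exists (w' * w)%g; [rewrite fixesM|rewrite E actEM].
Qed.

Definition orbm a : lfun := \sum_(b <- eorb a) mono b.

Lemma orbmE a o : orbm a o = \sum_(b <- eorb a) mono b o.
Proof. exact: lfun_sum. Qed.

Lemma inv_orbm a : inv k (orbm a).
Proof.
split; first by apply: Laur_sum => b _; exact: Laur_mono.
move=> w kw o; rewrite !orbmE; under eq_bigr do rewrite mono_act.
rewrite -(big_map (actE w) xpredT (fun b => mono b o)); apply: perm_big.
apply: uniq_perm; rewrite ?undup_uniq ?(map_inj_uniq (@actE_inj w)) ?undup_uniq //.
move=> b; apply/mapP/idP => [[b' b'a ->]|ba]; first by rewrite eorb_act.
by exists (actE w^-1%g b); rewrite ?eorb_act ?fixesV // -{1}(invgK w) actEK.
Qed.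

(** The parameter [x] lets the coefficients be functions of further variables, as in [decompose];
    the representatives do not depend on it. *)
Lemma orb_reps (T : Type) (A : seq expo) (C : expo -> T -> rat) : uniq A ->
  (forall a, a \notin A -> forall x, C a x = 0) ->
  (forall w a, fixes k w -> C (actE w a) =1 C a) ->
  exists B : seq expo, [/\ uniq B, {subset B <= A},
    {in B &, forall b b', b' \in eorb b -> b' = b} &
    forall x o, \sum_(a <- A) C a x * mono a o = \sum_(b <- B) C b x * orbm b o].
Proof.
have [N] := ubnP (size A); elim: N A C => // N IH [|a0 A0] C szA uA CA Cw.
  by exists [::]; split=> // x o; rewrite !big_nil.
set A := a0 :: A0 in szA uA CA *.
pose A' := [seq a <- A | a \notin eorb a0].
pose C' a x := if a \in eorb a0 then 0 else C a x.
have szA' : (size A' < N)%N.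
  rewrite size_filter /A /= eorb_refl /= add0n.
  by apply: leq_ltn_trans (count_size _ _) _; exact: szA.
have [||B [uB BA' Borb BE]] := IH A' C' szA' (filter_uniq _ uA).
- move=> a; rewrite mem_filter negb_and negbK /C' => /orP[->//|/CA aA x].
  by case: ifP.
- by move=> w a kw x; rewrite /C' eorb_act // Cw.
have Bn b : b \in B -> b \notin eorb a0.
  by move=> /BA'; rewrite mem_filter => /andP[].
exists (a0 :: B); split.
- by rewrite /= uB andbT; apply/negP => /Bn; rewrite eorb_refl.
- move=> b; rewrite inE => /orP[/eqP->|/BA']; first by rewrite inE eqxx.
  by rewrite mem_filter => /andP[].
- move=> b b'; rewrite !inE => /orP[/eqP->|bB] /orP[/eqP->|b'B] //.
  + by rewrite (negPf (Bn _ b'B)).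
  + move=> /eorbP[w kw E]; have := Bn _ bB.
    by rewrite -(eorb_act _ _ kw) -E eorb_refl.
  + exact: Borb.
move=> x o; rewrite (bigID (mem (eorb a0))) /= [RHS]big_cons; congr (_ + _).
  rewrite orbmE mulr_sumr; have [Ca0|Ca0] := eqVneq (C a0 x) 0.
    rewrite [RHS]big1 ?[LHS]big1 // => a; last by rewrite Ca0 mul0r.
    by move=> /eorbP[w kw ->]; rewrite Cw // Ca0 mul0r.
  rewrite -big_filter; transitivity (\sum_(a <- eorb a0) C a x * mono a o).
    apply: perm_big; apply: uniq_perm; rewrite ?filter_uniq ?undup_uniq //.
    move=> a; rewrite mem_filter /=; case aO : (a \in eorb a0) => //=.
    apply/negPn/negP => /CA/(_ x); move/eorbP: aO => [w kw ->].
    by rewrite Cw // => /eqP; rewrite (negPf Ca0).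
  rewrite big_seq [RHS]big_seq; apply: eq_bigr => a /eorbP[w kw ->].
  by rewrite Cw.
rewrite -big_filter -/A' [RHS](eq_big_seq (fun b => C' b x * orbm b o)); last first.
  by move=> b /Bn bO; rewrite /C' (negPf bO).
rewrite -BE; apply: eq_big_seq => a; rewrite mem_filter => /andP[aO _].
by rewrite /C' (negPf aO).
Qed.

Lemma orbm_indep (B : seq expo) (x : expo -> rat) : uniq B ->
  {in B &, forall b b', b' \in eorb b -> b' = b} ->
  (forall o, injective o -> \sum_(b <- B) x b * orbm b o = 0) ->
  {in B, forall b, x b = 0}.
Proof.
move=> uB Borb x0 b bB.
pose D := undup (flatten [seq eorb b | b <- B]).
pose e d := \sum_(b <- B) x b * (d \in eorb b)%:R.
have De : e b = 0.
  apply: (@mono_indep _ D e (undup_uniq _)); last first.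
    by rewrite mem_undup; apply/flattenP; exists (eorb b); [exact: map_f|exact: eorb_refl].
  move=> o io; rewrite -[RHS](x0 o io).
  transitivity (\sum_(d <- D) \sum_(b0 <- B) x b0 * (d \in eorb b0)%:R * mono d o).
    by apply: eq_bigr => d _; rewrite mulr_suml.
  rewrite exchange_big /=; apply: eq_big_seq => b' b'B.
  under eq_bigr do rewrite -mulrA.
  rewrite -mulr_sumr; congr (_ * _); rewrite orbmE.
  rewrite [LHS](bigID (mem (eorb b'))) /= [X in _ + X]big1 ?addr0; last first.
    by move=> d /negPf->; rewrite mul0r.
  rewrite -big_filter (perm_big (eorb b')); last first.
    apply: uniq_perm; rewrite ?filter_uniq ?undup_uniq // => d.
    rewrite mem_filter /=; case dO : (d \in eorb b') => //=.
    by rewrite mem_undup; apply/flattenP; exists (eorb b') => //; exact: map_f.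
  by apply: eq_big_seq => d ->; rewrite mul1r.
rewrite -De /e (bigD1_seq b) //= eorb_refl mulr1 big1_seq ?addr0 // => b'.
move=> /andP[b'b b'B]; case bO : (b \in eorb b'); last by rewrite mulr0.
by case/eqP: b'b; rewrite (Borb b' b).
Qed.

Lemma inv_orb_span P f : LaurS P f -> inv k f ->
  zspan (fun g => exists a, P a /\ g = orbm a) f.
Proof.
move=> Lf [_ kf]; have [A [c [uA z PA E]]] := LaurS_rep Lf.
have cw w a : fixes k w -> c (actE w a) = c a.
  move=> kw; apply/eqP; rewrite -(eqr_int rat); apply/eqP.
  apply: (rep_act (A := A) (C := fun a => (c a)%:~R)) => // [b /z->//|o].
  by rewrite -!E kf.
have [||B [uB BA _ BE]] := @orb_reps unit A (fun a _ => (c a)%:~R) uA.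
- by move=> a /z->.
- by move=> w a kw _; rewrite cw.
have -> : f = \sum_(b <- B) orbm b *~ c b.
  apply/funext => o; rewrite E (BE tt) lfun_sum; apply: eq_bigr => b _.
  by rewrite lfunMz mulrzl.
apply: zspan_sum_seq => b bB; apply: zspanMz; apply: zspan_gen; exists b.
by split=> //; exact/PA/BA.
Qed.

End Orbits.
End Invariants.

Lemma sum_perm (r : nat) (w : 'S_r) (F : 'I_r -> nat) :
  (\sum_s F ((w^-1)%g s) = \sum_s F s)%N.
Proof. by rewrite [RHS](reindex_inj (@perm_inj _ (w^-1)%g)). Qed.

(** * Separation of blocks of variables *)

Section Split.
Variable r : nat.
Local Notation point := (point r).
Local Notation lfun := (lfun r).
Local Notation expo := (expo r).
Implicit Types (a b : expo) (f g : lfun) (o : point) (w : 'S_r).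

Definition depends (P : pred 'I_r) f :=
  forall o o', (forall s, P s -> o s = o' s) -> f o = f o'.

Section Merge.
Variables (K : eqType) (k : 'I_r -> K) (k1 k2 : K).
Hypothesis k12 : k1 != k2.

Definition merge s := if k s == k2 then k1 else k s.

Definition splits f := zspan (fun g => exists q p : lfun,
  [/\ inv merge q, inv (fun s => k s == k2) p, depends (fun s => k s == k2) p
    & g = q * p]) f.

Lemma fixes_merge w : fixes k w -> fixes merge w.
Proof. by move=> /fixesP kw; apply/fixesP => s; rewrite /merge kw. Qed.

(* Peel the exponents on the block k2 off an orbit sum: the other terms of the
   product have fewer nonzero exponents on the block k1. *)
Lemma inv_split f : inv k f -> splits f.
Proof.
pose nz a : nat := (\sum_s ((k s == k1) && (a s != 0)))%N.
suff main N g : LaurS (fun a => (nz a < N)%N) g -> inv k g -> splits g.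
  move=> kf; have /LaurST/LaurS_rep[A [c [_ _ _ E]]] := kf.1.
  apply: (main (\max_(a <- A) nz a).+1 f _ kf); apply: rep_LaurS E => a aA.
  by rewrite ltnS (leq_bigmax_seq _ aA).
elim: N g => [|N IH] g Lg kg.
  apply: (zspan_trans (inv_orb_span Lg kg)) => _ [a [//]].
apply: (zspan_trans (inv_orb_span Lg kg)) => _ [a [aN ->]].
pose a1 : expo := [ffun s => if k s == k2 then 0 else a s].
pose a2 : expo := [ffun s => if k s == k2 then a s else 0].
pose kb s := k s == k2.
pose O1 := eorb merge a1; pose O2 := eorb kb a2.
pose onX b := [forall s, (k s == k2) ==> (b s == 0)].
(* The correction terms: here [b1] has moved a nonzero exponent into the block [k2], so fewer are
   left in the block [k1]. *)
pose R : lfun := \sum_(b1 <- O1 | ~~ onX b1) \sum_(b2 <- O2) mono (b1 + b2).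
have O2z b2 s : b2 \in O2 -> k s != k2 -> b2 s = 0.
  move=> /eorbP[w /fixesP kw ->] ks; rewrite !ffunE.
  have := kw (w^-1%g s); rewrite /kb permKV => <-.
  by rewrite (negPf ks).
(* The products with [b1] zero on [k2] are the members of the orbit of [a], each occurring once. *)
have E : orbm merge a1 * orbm kb a2 = orbm k a + R.
  transitivity (\sum_(b1 <- O1) \sum_(b2 <- O2) mono (b1 + b2) : lfun).
    rewrite /orbm mulr_suml; apply: eq_bigr => b1 _; rewrite mulr_sumr.
    by apply: eq_bigr => b2 _; rewrite monoD.
  rewrite (bigID onX) /=; congr (_ + _); rewrite -big_filter.
  rewrite -(@big_allpairs_dep _ _ _ expo (fun=> expo) expo +%R _ (fun=> O2) (@mono r)).
  apply: perm_big; apply: uniq_perm; rewrite ?undup_uniq //.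
    rewrite allpairs_uniq ?filter_uniq ?undup_uniq // => -[b1 b2] [b3 b4].
    move=> /allpairsP[[? ?] [/= m1 m2 [-> ->]]] /allpairsP[[? ?] [/= m3 m4 [-> ->]]].
    move: m1 m3; rewrite !mem_filter => /andP[/forallP o1 _] /andP[/forallP o3 _] /= E.
    congr (_, _); apply/ffunP => s; have := congr1 (fun b : expo => b s) E; rewrite !ffunE;
      have := o1 s; have := o3 s; have [ks|ks] /= := boolP (k s == k2).
    + by move=> /eqP-> /eqP->.
    + by move=> _ _; rewrite (O2z _ _ m2) // (O2z _ _ m4) // !addr0.
    + by move=> /eqP-> /eqP->; rewrite !add0r.
    + by rewrite (O2z _ _ m2) // (O2z _ _ m4).
  move=> b; apply/allpairsP/eorbP => [[[b1 b2] /= [b1O b2O ->]]|[w kw ->]]; last first.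
    exists (actE w a1, actE w a2) => /=; split.
    - rewrite mem_filter; apply/andP; split.
        apply/forallP => s; apply/implyP => ks; rewrite !ffunE.
        by have /fixesP-> := fixesV kw; rewrite ks.
      by apply/eorbP; exists w => //; exact: fixes_merge.
    - by apply/eorbP; exists w => //; exact: (fixes_fun (fun x => x == k2)).
    - by apply/ffunP => s; rewrite !ffunE; case: ifP; rewrite ?add0r ?addr0.
  move: b1O; rewrite mem_filter => /andP[/forallP b1X /eorbP[w1 /fixesV/fixesP w1P b1E]].
  have b1z s : k s = k2 -> b1 s = 0 by move=> ks; have := b1X s; rewrite ks eqxx => /eqP.
  have /eorbP[w2 /fixesV/fixesP w2P b2E] := b2O.
  have [[c x]|w wP] := @perm_of_counts r _ (fun s => (k s, (b1 + b2) s)) (fun s => (k s, a s)); last first.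
    exists w^-1%g; last by apply/ffunP => s; rewrite [RHS]ffunE invgK; case: (wP s).
    by apply: fixesV; apply/fixesP => s; case: (wP s).
  under eq_bigr do rewrite xpair_eqE; under [RHS]eq_bigr do rewrite xpair_eqE.
  have [->|ck2] := eqVneq c k2.
    transitivity (\sum_s ((k s == k2) && (a2 s == x)))%N; last first.
      by apply: eq_bigr => s _; rewrite ffunE; case: ifP.
    rewrite -[RHS](sum_perm w2); apply: eq_bigr => s _.
    have -> : (k (w2^-1%g s) == k2) = (k s == k2) by exact: w2P.
    case: eqP => //= ks; rewrite ffunE b1z // add0r b2E ffunE //.
  have E1 m : (\sum_s ((merge s == m) && (b1 s == x)) =
     \sum_s ((merge s == m) && (a1 s == x)))%N.
    by rewrite -[RHS](sum_perm w1); apply: eq_bigr => s _; rewrite w1P b1E ffunE.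
  have L : (\sum_s ((k s == c) && ((b1 + b2)%R s == x)) = \sum_s ((k s == c) && (b1 s == x)))%N.
    by apply: eq_bigr => s _; rewrite ffunE; case: eqP => //= ks; rewrite (O2z b2) ?ks ?addr0.
  have R' : (\sum_s ((k s == c) && (a s == x)) = \sum_s ((k s == c) && (a1 s == x)))%N.
    by apply: eq_bigr => s _; rewrite ffunE; case: eqP => //= ->; rewrite (negPf ck2).
  rewrite L R'; have := E1 c; have [ck1|ck1] := eqVneq c k1; last first.
    rewrite (eq_bigr (fun s => ((k s == c) && (b1 s == x)) : nat)); last first.
      by move=> s _; rewrite /merge; case: (eqVneq (k s) k2) => [->|//]; rewrite ![k1 == _]eq_sym ![k2 == _]eq_sym (negPf ck1) (negPf ck2).
    move->; apply: eq_bigr => s _.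
    by rewrite /merge; case: (eqVneq (k s) k2) => [->|//]; rewrite ![k1 == _]eq_sym ![k2 == _]eq_sym (negPf ck1) (negPf ck2).
  have sp (d : expo) : (forall s, k s = k2 -> d s = 0) ->
      (\sum_s ((merge s == c) && (d s == x)) = \sum_s ((k s == c) && (d s == x)) +
        \sum_s ((k s == k2) && (0%R == x)))%N.
    move=> dz; rewrite -big_split; apply: eq_bigr => s _ /=; rewrite /merge.
    case: (eqVneq (k s) k2) => [ks|]; last by rewrite addn0.
    by rewrite ck1 eqxx ks [k2 == k1]eq_sym (negPf k12) /= add0n dz.
  by rewrite !sp // => [/addIn//|s ks]; rewrite ffunE ks eqxx.
have Rinv : inv k R.
  have -> : R = orbm merge a1 * orbm kb a2 - orbm k a by rewrite E [X in X - _]addrC addrK.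
  apply: invB; last exact: inv_orbm.
  apply: invM; [apply: inv_sub (inv_orbm _ _) => w|apply: inv_sub (inv_orbm _ _) => w].
    exact: fixes_merge.
  exact: (fixes_fun (fun x => x == k2)).
have RL : LaurS (fun b => (nz b < N)%N) R.
  rewrite /R big_seq_cond; apply: zspan_sum => b1 /andP[b1O b1X]; apply: zspan_sum_seq => b2 b2O.
  apply: zspan_gen; exists (b1 + b2); split=> //.
  have [s0 /andP[ks0 b10]] : exists s, (k s == k2) && (b1 s != 0).
    by move: b1X => /forallPn[s]; rewrite negb_imply => ?; exists s.
  move: b1O => /eorbP[w1 /fixesV/fixesP w1P b1E]; rewrite ltnS in aN.
  apply: leq_trans aN; rewrite /nz.
  have -> : (\sum_s ((k s == k1) && (a s != 0)) = \sum_s ((merge s == k1) && (b1 s != 0)))%N.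
    transitivity (\sum_s ((merge s == k1) && (a1 s != 0)))%N.
      apply: eq_bigr => s _; rewrite /merge ffunE.
      case: (eqVneq (k s) k2) => [->|//]; rewrite eqxx andbF.
      by rewrite eq_sym (negPf k12).
    rewrite -[LHS](sum_perm w1); apply: eq_bigr => s _; by rewrite w1P b1E [actE _ _ s]ffunE.
  rewrite (bigD1 s0) //= [X in (_ < X)%N](bigD1 s0) //= /merge ks0 eqxx b10 (eqP ks0).
  rewrite eq_sym (negPf k12) /= add0n add1n ltnS; apply: leq_sum => s _.
  rewrite ffunE; case: eqP => //= ks; rewrite (O2z b2) ?ks // addr0.
  by rewrite (negPf k12) eqxx.
have -> : orbm k a = orbm merge a1 * orbm kb a2 - R by rewrite E addrK.
apply: zspanB; last exact: IH.
apply: zspan_gen; exists (orbm merge a1), (orbm kb a2); split=> //.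
- exact: inv_orbm.
- exact: inv_orbm.
move=> o o' oo'; rewrite !orbmE; apply: eq_big_seq => b2 b2O.
apply: eq_bigr => s _; have [ks|ks] := boolP (k s == k2); first by rewrite oo'.
by rewrite (O2z b2) // !expr0z.
Qed.

End Merge.

Definition splice (P : pred 'I_r) o o' : point := fun s => if P s then o' s else o s.

(** Expand [g] in orbit sums of the variables in [P]. These are linearly independent, so the
    coefficients inherit symmetry, vanishing and independence of variables from [g]; the last two
    clauses record this. *)
Lemma decompose (K1 K2 : eqType) (k1 : 'I_r -> K1) (k2 : 'I_r -> K2)
    (P : pred 'I_r) g : Laur g ->
  (forall w o o', fixes k1 w -> g (splice P (fun s => o (w s)) o') = g (splice P o o')) ->
  (forall w o o', fixes k2 w -> g (splice P o (fun s => o' (w s))) = g (splice P o o')) ->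
  exists (B : seq expo) (q p : expo -> lfun),
    [/\ {in B, forall b, inv k1 (q b)}, forall b, inv k2 (p b),
        forall o o', g (splice P o o') = \sum_(b <- B) q b o * p b o',
        forall o, (forall o', g (splice P o o') = 0) -> {in B, forall b, q b o = 0} &
        forall o o1, (forall o', g (splice P o o') = g (splice P o1 o')) ->
          {in B, forall b, q b o = q b o1}].
Proof.
move=> /LaurST/LaurS_rep[A [c [uA _ _ E]]] g1 g2.
pose a1 a : expo := [ffun s => if P s then 0 else a s].
pose a2 a : expo := [ffun s => if P s then a s else 0].
have monoE a o o' : mono a (splice P o o') = mono (a1 a) o * mono (a2 a) o'.
  rewrite /mono -big_split; apply: eq_bigr => s _; rewrite /splice !ffunE.
  by case: (P s); rewrite expr0z /= ?mul1r ?mulr1.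
pose B0 := undup [seq a2 a | a <- A].
pose C b : lfun := \sum_(a <- A | a2 a == b) mono (a1 a) *~ c a.
have CE b o : C b o = \sum_(a <- A | a2 a == b) (c a)%:~R * mono (a1 a) o.
  by rewrite /C lfun_sum; apply: eq_bigr => a _; rewrite lfunMz mulrzl.
have C0 b : b \notin B0 -> forall o, C b o = 0.
  move=> bB o; rewrite CE big1_seq // => a /andP[/eqP ab aA].
  by case/negP: bB; rewrite mem_undup -ab map_f.
have gE o o' : g (splice P o o') = \sum_(b <- B0) C b o * mono b o'.
  rewrite E; under eq_bigr do rewrite monoE mulrA.
  transitivity (\sum_(b <- B0) \sum_(a <- A | a2 a == b)
    (c a)%:~R * mono (a1 a) o * mono (a2 a) o'); last first.
    by apply: eq_bigr => b _; rewrite CE mulr_suml; apply: eq_bigr => a /eqP->.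
  rewrite (exchange_big_dep xpredT) //=; apply: eq_big_seq => a aA.
  rewrite -big_filter (_ : [seq _ <- _ | _] = [:: a2 a]) ?big_seq1 //.
  rewrite (eq_filter (a2 := pred1 (a2 a))) => [|b]; last exact: eq_sym.
  by rewrite filter_pred1_uniq ?undup_uniq // mem_undup map_f.
have [|B [uB _ Borb BE]] := @orb_reps _ _ k2 _ B0 C (undup_uniq _) C0.
  move=> w b kw o; apply: (rep_act (A := B0) (C := fun b => C b o)) => //.
  - exact: undup_uniq.
  - by move=> b' /C0; exact.
  by move=> o'; rewrite -!gE g2.
have qP o o1 : (forall o', g (splice P o o') = g (splice P o1 o')) ->
    {in B, forall b, C b o = C b o1}.
  move=> oo1 b bB; apply/eqP; rewrite -subr_eq0; apply/eqP.
  apply: (orbm_indep (x := fun b => C b o - C b o1) uB Borb) => // o' _.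
  under eq_bigr do rewrite mulrBl.
  by rewrite sumrB -!BE -!gE oo1 subrr.
exists B, C, (orbm k2); split=> //.
- move=> b bB; split; first by apply: Laur_sum => a _; apply: zspanMz; exact: Laur_mono.
  by move=> w kw o; apply: qP => // o'; rewrite g1.
- by move=> b; exact: inv_orbm.
- by move=> o o'; rewrite gE BE.
move=> o o0; apply: (orbm_indep (x := fun b => C b o) uB Borb) => o' _.
by rewrite -BE -gE o0.
Qed.

End Split.

(** * Equivariant vectors and matrices *)

Section Words.
Variable r : nat.
Local Notation point := (point r).
Local Notation lfun := (lfun r).
Implicit Types (o : point) (w : 'S_r).

Definition word (C : finType) := {ffun 'I_r -> C}.
Definition pact (C : finType) w (p : word C) : word C := [ffun t => p (w t)].
Definition oact w o : point := fun t => o (w t).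

Lemma pact1 (C : finType) (p : word C) : pact 1%g p = p.
Proof. by apply/ffunP => t; rewrite ffunE perm1. Qed.
Lemma pactM (C : finType) w w' (p : word C) : pact w (pact w' p) = pact (w * w')%g p.
Proof. by apply/ffunP => t; rewrite !ffunE permM. Qed.
Lemma pactK (C : finType) w : cancel (@pact C w) (pact w^-1%g).
Proof. by move=> p; rewrite pactM mulVg pact1. Qed.
Lemma pactKV (C : finType) w : cancel (@pact C w^-1%g) (pact w).
Proof. by move=> p; rewrite pactM mulgV pact1. Qed.
Lemma oact1 o : oact 1%g o = o.
Proof. by apply/funext => t; rewrite /oact perm1. Qed.
Lemma oactM w w' o : oact w (oact w' o) = oact (w * w')%g o.
Proof. by apply/funext => t; rewrite /oact permM. Qed.
Lemma oactK w : cancel (oact w) (oact w^-1%g).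
Proof. by move=> o; rewrite oactM mulVg oact1. Qed.
Lemma oactKV w : cancel (oact w^-1%g) (oact w).
Proof. by move=> o; rewrite oactM mulgV oact1. Qed.

Lemma fixes_pact (C : finType) w (p : word C) : fixes p w = (pact w p == p).
Proof.
apply/fixesP/eqP => [pw|E s]; first by apply/ffunP => s; rewrite ffunE.
by rewrite -[in RHS]E ffunE.
Qed.

Definition vec (C : finType) := word C -> lfun.
Definition mat (C D : finType) := word C -> word D -> lfun.
HB.instance Definition _ (C : finType) := GRing.Zmodule.on (vec C).

Lemma vecB (C : finType) (u v : vec C) p : (u - v) p = u p - v p. Proof. by []. Qed.
Lemma vecD (C : finType) (u v : vec C) p : (u + v) p = u p + v p. Proof. by []. Qed.
Lemma vec_sum (C : finType) I (s : seq I) (P : pred I) (F : I -> vec C) p :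
  (\sum_(i <- s | P i) F i) p = \sum_(i <- s | P i) F i p.
Proof. exact: (big_morph (fun f : vec C => f p)). Qed.

(** Columns of equivariant matrices: fixing the second index [k] leaves equivariance under its
    stabilizer. *)
Definition eqvec (C : finType) (K : eqType) (k : 'I_r -> K) (u : vec C) :=
  (forall p, Laur (u p)) /\
  forall w, fixes k w -> forall p o, u (pact w p) (oact w o) = u p o.

Definition eqmat (C D : finType) (M : mat C D) :=
  (forall p q, Laur (M p q)) /\
  forall w p q o, M (pact w p) (pact w q) (oact w o) = M p q o.

Definition mulv (C D : finType) (M : mat C D) (v : vec D) : vec C :=
  fun p => \sum_s M p s * v s.

Definition mulm (C D E : finType) (M : mat C D) (M' : mat D E) : mat C E :=
  fun p q => \sum_s M p s * M' s q.

Lemma mulvE (C D : finType) (M : mat C D) v p o :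
  mulv M v p o = \sum_s M p s o * v s o.
Proof. exact: lfun_sum. Qed.

Lemma eqmat_mul (C D E : finType) (M : mat C D) (M' : mat D E) :
  eqmat M -> eqmat M' -> eqmat (mulm M M').
Proof.
move=> [LM eM] [LM' eM']; split=> [p q|w p q o].
  by apply: Laur_sum => s _; exact: LaurM.
rewrite /mulm !lfun_sum (reindex_inj (can_inj (@pactK _ w))) /=.
by apply: eq_bigr => s _; rewrite !lfunM eM eM'.
Qed.

Lemma mulvA (C D E : finType) (M : mat C D) (M' : mat D E) v :
  mulv M (mulv M' v) = mulv (mulm M M') v.
Proof.
apply/funext => p; rewrite /mulv /mulm.
under eq_bigr do rewrite mulr_sumr.
rewrite exchange_big; apply: eq_bigr => s _ /=; rewrite mulr_suml.
by apply: eq_bigr => t _; rewrite mulrA.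
Qed.

Lemma eqvec_mul (C D : finType) (K : eqType) (k : 'I_r -> K) (M : mat C D) v :
  eqmat M -> eqvec k v -> eqvec k (mulv M v).
Proof.
move=> [LM eM] [Lv ev]; split=> [p|w kw p o].
  by apply: Laur_sum => s _; exact: LaurM.
rewrite !mulvE (reindex_inj (can_inj (@pactK _ w))) /=.
by apply: eq_bigr => s _; rewrite eM ev.
Qed.

Section EqvecClosed.
Variables (C : finType) (K : eqType) (k : 'I_r -> K).
Lemma eqvec0 : eqvec k (0 : vec C).
Proof. by split=> // p; exact: Laur0. Qed.
Lemma eqvecB (u v : vec C) : eqvec k u -> eqvec k v -> eqvec k (u - v).
Proof.
move=> [Lu eu] [Lv ev]; split=> [p|w kw p o]; first exact: LaurB.
by rewrite !vecB !lfunB eu // ev.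
Qed.
Lemma eqvec_scale (u : vec C) a : eqvec k u -> inv k a -> eqvec k (fun p => u p * a).
Proof.
move=> [Lu eu] [La ea]; split=> [p|w kw p o]; first exact: LaurM.
by rewrite !lfunM eu // ea.
Qed.
Lemma eqvec_inv (u : vec C) (p : word C) : eqvec k u -> inv (fun t => (k t, p t)) (u p).
Proof.
move=> [Lu eu]; split=> // w /fixesP kw o; rewrite -[RHS](eu w) //; last first.
  by apply/fixesP => t; case: (kw t).
by congr (u _ _); apply/ffunP => t; rewrite ffunE; case: (kw t).
Qed.
End EqvecClosed.

Section OrbitMatrix.
Variables (C D : finType) (p0 : word C) (q0 : word D) (f : lfun).
Hypothesis finv : inv (fun t => (p0 t, q0 t)) f.

(** The equivariant matrix supported on the orbit of [(p0, q0)] with entry [f] there. The choice of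
    [w] does not matter, since [f] is invariant under the stabilizer of the pair. *)
Definition orbmat : mat C D := fun p q o =>
  if [pick w : 'S_r | (pact w p0 == p) && (pact w q0 == q)] is Some w
  then f (oact w^-1%g o) else 0.

Lemma orbmatE w o : orbmat (pact w p0) (pact w q0) (oact w o) = f o.
Proof.
rewrite /orbmat; case: pickP => [w' /andP[/eqP pw /eqP qw]|/(_ w)]; last by rewrite !eqxx.
rewrite oactM -[RHS](finv.2 (w'^-1 * w)%g) //; apply/fixesP => t.
have := congr1 (pact w'^-1%g) pw; have := congr1 (pact w'^-1%g) qw.
by rewrite !pactK !pactM => {2}-> {2}->; rewrite !ffunE.
Qed.

Lemma orbmatP p q o : orbmat p q o = 0 \/
  exists w, [/\ p = pact w p0, q = pact w q0 & orbmat p q o = f (oact w^-1%g o)].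
Proof.
rewrite /orbmat; case: pickP => [w /andP[/eqP pw /eqP qw]|_]; last by left.
by right; exists w.
Qed.

Lemma orbmat_eq w p q o : p = pact w p0 -> q = pact w q0 ->
  orbmat p q o = f (oact w^-1%g o).
Proof. by move=> -> ->; rewrite -{1}(oactKV w o) orbmatE. Qed.

Lemma eqmat_orbmat : eqmat orbmat.
Proof.
split=> [p q|w p q o].
  case: (pickP (fun w : 'S_r => (pact w p0 == p) && (pact w q0 == q))).
    move=> w /andP[/eqP pw /eqP qw].
    have -> : orbmat p q = fun o => f (oact w^-1%g o).
      by apply/funext => o; rewrite (@orbmat_eq w).
    have /LaurST/LaurS_rep[A [c [_ _ _ E]]] := finv.1.
    apply/LaurST; apply: (@rep_LaurS _ _ [seq actE w^-1%g a | a <- A] (fun a => c (actE w a))) => // o.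
    rewrite E big_map; apply: eq_bigr => a _.
    by rewrite /oact mono_act -{2}(invgK w) actEK.
  move=> no; suff -> : orbmat p q = 0 by exact: Laur0.
  by apply/funext => o; rewrite /orbmat; case: pickP => // w; rewrite no.
case: (orbmatP p q o) => [E|[w' [-> -> ->]]]; last first.
  by rewrite !pactM (@orbmat_eq (w * w')%g) // oactM invMg -mulgA mulVg mulg1.
rewrite E; case: (orbmatP (pact w p) (pact w q) (oact w o)) => // -[w' [pw qw _]].
rewrite (orbmat_eq _ pw qw) oactM.
have pE : p = pact (w^-1 * w')%g p0 by rewrite -pactM -pw pactK.
have qE : q = pact (w^-1 * w')%g q0 by rewrite -pactM -qw pactK.
by rewrite (orbmat_eq _ pE qE) invMg invgK in E.
Qed.

Lemma orbmat_lc : orbmat p0 q0 = f.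
Proof. by apply/funext => o; rewrite (@orbmat_eq 1%g) ?pact1 // invg1 oact1. Qed.
End OrbitMatrix.

Lemma eqvec_col (C D : finType) (M : mat C D) (q : word D) :
  eqmat M -> eqvec q (fun p => M p q).
Proof.
move=> [LM eM]; split=> // w; rewrite fixes_pact => /eqP qw p o.
by rewrite -{1}qw eM.
Qed.

End Words.

(** * Relations contributed by higher contents *)

Section Relations.
Variables n r : nat.
Local Notation point := (point r).
Local Notation lfun := (lfun r).
Local Notation W := (word r 'I_n).
Implicit Types (o : point) (w : 'S_r) (s : W).

Definition cnt (K : eqType) (k : 'I_r -> K) (x : K) : nat := \sum_t (k t == x).

Lemma cnt_act (K : eqType) (k : 'I_r -> K) w x : cnt (fun t => k (w t)) x = cnt k x.
Proof. by rewrite [RHS](reindex_inj (@perm_inj _ w)). Qed.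

Lemma cnt_pact (C : finType) (p : word r C) w x : cnt (pact w p) x = cnt p x.
Proof. by rewrite -(cnt_act p w); apply: eq_bigr => t _; rewrite ffunE. Qed.

(** Only the contents of the words are compared; they are the weights lambda that index the
    chain. *)
Definition lexgt (s s' : W) : bool :=
  [exists j : 'I_n, [forall i : 'I_n, (i < j)%N ==> (cnt s i == cnt s' i)] &&
    (cnt s' j < cnt s j)%N].

Variable rho : W.

(** For words in the same letters these are the columns at [rho] of the ideal generated by the
    higher contents, see [relvec_rho_col] and [rho_col_in]. *)
Definition relvec (C : finType) : vec r C -> Prop := zspan (fun u =>
  exists (M : mat r C 'I_n) (v : vec r 'I_n),
    [/\ eqmat M, eqvec rho v, forall s, ~~ lexgt s rho -> v s = 0 & u = mulv M v]).

Lemma mulvB (C D : finType) (M : mat r C D) : {morph mulv M : u v / u - v}.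
Proof.
move=> u v; apply/funext => p; rewrite vecB /mulv -sumrB.
by apply: eq_bigr => s _; rewrite vecB mulrBr.
Qed.

Lemma mulv0 (C D : finType) (M : mat r C D) : mulv M 0 = 0.
Proof. by apply/funext => p; apply: big1 => s _; rewrite mulr0. Qed.

Lemma relvec_mul (C D : finType) (M : mat r C D) u :
  eqmat M -> relvec u -> relvec (mulv M u).
Proof.
move=> eM Ru; apply: (zspan_map _ _ Ru); [exact: mulv0|exact: mulvB|].
move=> _ [M' [v [eM' ev v0 ->]]]; apply: zspan_gen; exists (mulm M M'), v.
by split=> //; [exact: eqmat_mul|rewrite mulvA].
Qed.

Lemma relvec_scale (C : finType) (u : vec r C) a :
  inv rho a -> relvec u -> relvec (fun p => u p * a : lfun).
Proof.
move=> ia Ru; apply: (zspan_map (h := fun (u : vec r C) p => u p * a) _ _ Ru).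
- by apply/funext => p; rewrite mul0r.
- by move=> u1 u2; apply/funext => p; rewrite !vecB mulrBl.
move=> _ [M [v [eM ev v0 ->]]]; apply: zspan_gen.
exists M, (fun s => v s * a); split=> //.
- exact: eqvec_scale.
- by move=> s /v0->; rewrite mul0r.
by apply/funext => p; rewrite /mulv mulr_suml; apply: eq_bigr => s _; rewrite mulrA.
Qed.

Lemma relvec_eqvec (C : finType) (u : vec r C) : relvec u -> eqvec rho u.
Proof.
apply; [exact: eqvec0|exact: eqvecB|].
by move=> _ [M [v [eM ev _ ->]]]; exact: eqvec_mul.
Qed.

(** Passing through a single word [s0] of higher content; the relations used for straightening are
    built from these. *)
Lemma relvec_orb (C : finType) (p0 : word r C) (s0 : W) q f :
  inv (fun t => (p0 t, s0 t)) q -> inv (fun t => (s0 t, rho t)) f ->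
  lexgt s0 rho ->
  relvec (mulv (orbmat p0 s0 q) (fun s => orbmat s0 rho f s rho)).
Proof.
move=> iq jf gt; apply: zspan_gen.
exists (orbmat p0 s0 q), (fun s => orbmat s0 rho f s rho); split=> //.
- exact: eqmat_orbmat.
- exact/eqvec_col/eqmat_orbmat.
move=> s sgt; apply/funext => o.
case: (orbmatP s0 rho f s rho o) => // -[w [sE _ _]]; case/negP: sgt.
move: gt; rewrite sE /lexgt => /existsP[j H]; apply/existsP; exists j.
rewrite cnt_pact; case/andP: H => /forallP H ->; rewrite andbT.
by apply/forallP => i; rewrite cnt_pact.
Qed.

End Relations.

(** * Exchange relations between two rows *)

(** Lets the variables on [A] and off [A] be permuted separately, as the hypotheses of [decompose]
    require. *)
Lemma restr_perm_ex (r : nat) (A : pred 'I_r) (w : 'S_r) :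
  (forall t, A (w t) = A t) -> exists w' : 'S_r, forall t, w' t = if A t then w t else t.
Proof.
move=> Aw; have inj : injective (fun t => if A t then w t else t).
  move=> t t'; case At: (A t); case At': (A t') => E //.
  - exact: perm_inj E.
  - by rewrite -E Aw At in At'.
  - by rewrite E Aw At' in At.
by exists (perm inj) => t; rewrite permE.
Qed.

Section Exchange.
Variables n r : nat.
Local Notation point := (point r).
Local Notation lfun := (lfun r).
Variables (rho : word r 'I_n) (i0 i1 : 'I_n).
Hypothesis i01 : (i0 < i1)%N.

(* [inl true] and [inl false] mark the two kinds of letters which are
   exchanged between the rows i0 and i1; [inr j] marks the spectators of row j. *)
Definition kind : finType := (bool + 'I_n)%type.
Variable p0 : word r kind.

Local Notation up := (inl true : kind).
Local Notation dn := (inl false : kind).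

Definition rowok t (c : kind) : bool :=
  match c with inl _ => (rho t == i0) || (rho t == i1) | inr j => rho t == j end.
(** Routing through a word with cells moved up may also let a spectator of row [i0] sink into row
    [i1]. Such words are tolerated because they turn out to be earlier for [prec], see
    [linked_bad]. *)
Definition rowsemi t (c : kind) : bool :=
  match c with inl _ => (rho t == i0) || (rho t == i1)
  | inr j => (rho t == j) || ((j == i0) && (rho t == i1)) end.

Definition same (p : word r kind) := [forall c, cnt p c == cnt p0 c].
Definition good p := same p && [forall t, rowok t (p t)].
Definition bad p := [&& same p, [forall t, rowsemi t (p t)] & ~~ [forall t, rowok t (p t)]].

Definition low (p : word r kind) : pred 'I_r := fun t => (rho t == i1) && (p t == dn).
Definition ylen p : nat := \sum_t low p t.
Definition high (p : word r kind) : pred 'I_r := fun t => (rho t == i0) && (p t == up).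
(** An inclusion of multisets: the values at the low cells occur among those at the high cells with
    multiplicity, hence the injectivity of [h]. *)
Definition covered p (o : point) := exists h : 'I_r -> 'I_r,
  {in low p &, injective h} /\ forall t, low p t -> high p (h t) /\ o (h t) = o t.

Lemma i0_neq : i0 == i1 = false.
Proof. by apply/negbTE; rewrite -val_eqE /= neq_ltn i01. Qed.

Definition jcnt (p : word r kind) c j : nat := \sum_t ((p t == c) && (rho t == j)).

Lemma good_inr p c j : good p -> jcnt p (inr c) j = ((j == c) * cnt p (inr c))%N.
Proof.
move=> /andP[_ /forallP gp]; rewrite /jcnt /cnt big_distrr; apply: eq_bigr => t _ /=.
have := gp t; case: (p t) => [b|c'] /=; first by rewrite muln0.
move=> /eqP->; rewrite (_ : (inr c' == inr c :> kind) = (c' == c)) //.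
by case: (eqVneq c' c) => [->|_]; rewrite ?muln0 //= muln1 eq_sym.
Qed.

Lemma good_inl p b j : good p -> j != i0 -> j != i1 -> jcnt p (inl b) j = 0%N.
Proof.
move=> /andP[_ /forallP gp] j0 j1; apply: big1 => t _.
have := gp t; case: (p t) => [b'|c'] //=.
by case/orP => /eqP->; rewrite [_ == j]eq_sym ?(negPf j0) ?(negPf j1) andbF.
Qed.

Lemma good_inl_sum p b : good p -> (jcnt p (inl b) i0 + jcnt p (inl b) i1 = cnt p (inl b))%N.
Proof.
move=> /andP[_ /forallP gp]; rewrite -big_split; apply: eq_bigr => t _ /=.
have := gp t; case: (p t) => [b'|c'] //=; have [_|] := eqVneq (inl b' : kind) (inl b) => //=.
by case/orP => /eqP->; rewrite eqxx ?i0_neq // eq_sym i0_neq.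
Qed.

Lemma good_row p : good p -> (jcnt p up i1 + jcnt p dn i1 + jcnt p (inr i1) i1 = cnt rho i1)%N.
Proof.
move=> /andP[_ /forallP gp]; rewrite -!big_split; apply: eq_bigr => t _ /=.
have := gp t; case: (p t) => [[]|c'] /=; rewrite ?addn0 //.
by move=> /eqP->; rewrite add0n (_ : (inr c' == inr i1 :> kind) = (c' == i1)) // andbb.
Qed.

Lemma ylenE p : ylen p = jcnt p dn i1.
Proof. by apply: eq_bigr => t _; rewrite /low andbC. Qed.

(** For good words the table of kinds against rows is determined by the single number [ylen]: the
    spectators are fixed, and row lengths and totals give the rest. *)
Lemma good_orbit p p' : good p -> good p' -> ylen p = ylen p' ->
  exists w, fixes rho w /\ p' = pact w p.
Proof.
move=> gp gp' yy.
have cE c : cnt p c = cnt p' c.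
  case/andP: gp => /forallP/(_ c)/eqP-> _.
  by case/andP: gp' => /forallP/(_ c)/eqP-> _.
have J1 : jcnt p dn i1 = jcnt p' dn i1 by rewrite -!ylenE.
have J2 : jcnt p up i1 = jcnt p' up i1.
  have := good_row gp; rewrite -(good_row gp') !good_inr // cE J1.
  by move=> /addIn/addIn.
have JE c j : jcnt p c j = jcnt p' c j.
  case: c => [b|c]; last by rewrite !good_inr // cE.
  have [->|j1] := eqVneq j i1; first by case: b.
  have [->|j0] := eqVneq j i0; last by rewrite !good_inl.
  have := good_inl_sum b gp; rewrite cE -(good_inl_sum b gp').
  have -> : jcnt p (inl b) i1 = jcnt p' (inl b) i1 by case: b.
  by move=> /addIn.
have [[c j]|w wP] := @perm_of_counts r _ (fun t => (p' t, rho t)) (fun t => (p t, rho t)).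
  under eq_bigr do rewrite xpair_eqE; under [RHS]eq_bigr do rewrite xpair_eqE.
  exact/esym/JE.
exists w; split; first by apply/fixesP => t; case: (wP t).
by apply/ffunP => t; rewrite ffunE; case: (wP t).
Qed.

Lemma same_act w p : same (pact w p) = same p.
Proof. by apply: eq_forallb => c; rewrite cnt_pact. Qed.

Lemma rowok_act w p : fixes rho w ->
  [forall t, rowok t (pact w p t)] = [forall t, rowok t (p t)].
Proof.
move=> /fixesP rw; apply/forallP/forallP => gp t.
  by have := gp (w^-1%g t); rewrite ffunE permKV /rowok -(rw (w^-1%g t)) permKV.
by have := gp (w t); rewrite ffunE /rowok rw.
Qed.

Lemma good_act w p : fixes rho w -> good (pact w p) = good p.
Proof. by move=> rw; rewrite /good same_act rowok_act. Qed.

Lemma ylen_act w p : fixes rho w -> ylen (pact w p) = ylen p.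
Proof.
move=> /fixesP rw; rewrite /ylen [RHS](reindex_inj (@perm_inj _ w)).
by apply: eq_bigr => t _; rewrite /low ffunE rw.
Qed.

(* Letters of kind [dn] of row i1 are moved up to row i0, together with
   their variables; when the variables of the up letters of row i0 contain
   those of the dn letters of row i1, the correction terms vanish too. *)
Lemma exchange N (u : vec r kind) : eqvec rho u ->
  (forall p, u p <> 0 -> good p /\ (ylen p < N)%N) ->
  (forall (p : word r kind) o o',
    (forall t, (p t == up) || low p t -> o t = o' t) -> u p o = u p o') ->
  (forall p o, covered p o -> u p o = 0) ->
  exists k, relvec rho k /\ forall p, ~~ bad p -> u p = k p.
Proof.
elim: N u => [|N IH] u eu su du vu.
  exists 0; split; first exact: zspan0.
  by move=> p _; apply: contrapT => /su[].
case: (pselect (exists p, u p <> 0 /\ ylen p = N)); last first.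
  move=> no; apply: IH => // p up0; have [gp yp] := su p up0; split=> //.
  by rewrite ltnS leq_eqVlt in yp; case/orP: yp => // /eqP yp; case: no; exists p.
case=> pl [upl ypl]; have [gpl _] := su pl upl.
pose P := low pl.
(* The intermediate word: the low cells of [pl] are moved to row [i0], which raises the content
   above that of [rho]. *)
pose sl : word r 'I_n := [ffun t => if P t then i0 else rho t].
(* Without low cells every point is covered, and the coefficient would vanish. *)
have N0 : (0 < N)%N.
  rewrite -ypl lt0n; apply/eqP => y0; apply: upl; apply/funext => o; apply: vu.
  have noP t : ~~ low pl t.
    by move: y0 => /eqP; rewrite sum_nat_eq0 => /forallP/(_ t); rewrite eqb0.
  by exists id; split=> // t; rewrite (negPf (noP t)).
have PE t : P t -> rho t = i1 /\ pl t = dn by case/andP => /eqP-> /eqP->.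
have slN t : ~~ P t -> sl t = rho t by rewrite ffunE => /negPf->.
have slP t : P t -> sl t = i0 by rewrite ffunE => ->.
have slup t : pl t = up -> sl t = rho t.
  by move=> pt; apply: slN; apply/negP => /PE[_]; rewrite pt.
have gt : lexgt sl rho.
  apply/existsP; exists i0; apply/andP; split.
    apply/forallP => j; apply/implyP => j0; apply/eqP; apply: eq_bigr => t _.
    have [/[dup]/PE[-> _]/slP->|/slN->//] := boolP (P t).
    have ji1 := ltn_trans j0 i01.
    by rewrite -!val_eqE /= ![(_ == j :> nat)]eq_sym (ltn_eqF j0) (ltn_eqF ji1).
  have -> : cnt sl i0 = (cnt rho i0 + ylen pl)%N.
    rewrite /cnt /ylen -big_split; apply: eq_bigr => t _ /=; rewrite -/P.
    have [/[dup]/PE[-> _]/slP->|/slN->] := boolP (P t); last by rewrite addn0.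
    by rewrite eqxx eq_sym i0_neq.
  by rewrite ypl -[X in (X < _)%N]addn0 ltn_add2l.
(* Separate the variables of the low cells from the others, so that the two factors can be placed on
   the two sides of [sl]. *)
have [] := @decompose r _ _ (fun t => (pl t, sl t)) (fun t => (sl t, rho t)) P (u pl).
- exact: eu.1.
- move=> w o o' /fixesP fw.
  have pw t : pl (w t) = pl t by case: (fw t).
  have sw t : sl (w t) = sl t by case: (fw t).
  have [|w' w'E] := @restr_perm_ex r (fun t => pl t == up) w; first by move=> t; rewrite pw.
  have rw' : fixes rho w'.
    apply/fixesP => t; rewrite w'E; case: eqP => // pt.
    by rewrite -!slup ?pw // sw.
  have pw' : pact w' pl = pl by apply/ffunP => t; rewrite ffunE w'E; case: eqP => // _; rewrite pw.
  rewrite -[RHS](eu.2 w') // pw'; apply: du => t; rewrite /splice /oact w'E => /orP[/eqP pt|Pt].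
    rewrite pt eqxx /= ifN; last by apply/negP => /PE[_]; rewrite pt.
    by rewrite ifN //; apply/negP => /PE[_]; rewrite pw pt.
  by rewrite (_ : P t) // (PE t Pt).2 /= (_ : P t).
- move=> w o o' /fixesP fw.
  have rw t : rho (w t) = rho t by case: (fw t).
  have sw t : sl (w t) = sl t by case: (fw t).
  have PW t : P t = (sl t == i0) && (rho t == i1).
    have [/[dup]/PE[-> _]/slP->|/slN->] := boolP (P t); first by rewrite !eqxx.
    by apply/esym/negP => /andP[/eqP-> ]; rewrite i0_neq.
  have Pw t : P (w t) = P t by rewrite !PW rw sw.
  have [|w' w'E] := @restr_perm_ex r P w; first exact: Pw.
  have rw' : fixes rho w' by apply/fixesP => t; rewrite w'E; case: ifP => // _; rewrite rw.
  have pw' : pact w' pl = pl.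
    by apply/ffunP => t; rewrite ffunE w'E; case: ifP => // Pt; rewrite (PE t Pt).2 (PE _ _).2 // Pw.
  rewrite -[RHS](eu.2 w') // pw'; congr (u pl _); apply/funext => t; rewrite /splice /oact w'E.
  by case Pt: (P t); rewrite ?Pw Pt.
move=> B [q [f [iq jf uE _ _]]].
pose k0 : vec r kind := \sum_(b <- B) mulv (orbmat pl sl (q b)) (fun s => orbmat sl rho (f b) s rho).
pose kt p s o := \sum_(b <- B) orbmat pl sl (q b) p s o * orbmat sl rho (f b) s rho o.
have k0E p o : k0 p o = \sum_s kt p s o.
  rewrite /k0 vec_sum lfun_sum exchange_big /=; apply: eq_bigr => b _.
  by rewrite mulvE.
have Rk0 : relvec rho k0.
  by apply: zspan_sum_seq => b bB; apply: relvec_orb => //; exact: iq.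
have ktE p s o w1 w2 : [/\ p = pact w1 pl, s = pact w1 sl, s = pact w2 sl
      & rho = pact w2 rho] -> kt p s o = u pl (splice P (oact w1^-1%g o) (oact w2^-1%g o)).
  move=> [p1 s1 s2 r2]; rewrite uE; apply: eq_big_seq => b bB.
  by rewrite (orbmat_eq (iq b bB) _ p1 s1) (orbmat_eq (jf b) _ s2 r2).
(* The term of [k0] at [p] through [s] can be nonzero only if both orbit matrices are. Then [w1]
   transports the variables off the low cells and [w2] those of the low cells. *)
pose linked p s w1 w2 := [/\ p = pact w1 pl, s = pact w1 sl, s = pact w2 sl
  & rho = pact w2 rho].
have kt0 p s : (exists w1 w2, linked p s w1 w2) \/ forall o, kt p s o = 0.
  case: (pselect (exists w1 w2, linked p s w1 w2)) => [|no]; [by left|right=> o].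
  apply: big1_seq => b _; case: (orbmatP pl sl (q b) p s o) => [->|[w1 [p1 s1 _]]].
    by rewrite mul0r.
  case: (orbmatP sl rho (f b) s rho o) => [->|[w2 [s2 r2 _]]]; first by rewrite mulr0.
  by case: no; exists w1, w2; split.
have ktsemi p s w1 w2 : linked p s w1 w2 -> same p /\ forall t, rowsemi t (p t).
  move=> [p1 s1 s2 r2]; have [sml /forallP okl] := andP gpl.
  split=> [|t]; first by rewrite p1 same_act.
  have st : s t = sl (w1 t) by rewrite s1 ffunE.
  have st' : s t = rho t \/ s t = i0 /\ rho t = i1.
    have rt : rho t = rho (w2 t) by rewrite [in LHS]r2 ffunE.
    rewrite s2 ffunE rt; have [/[dup]/PE[-> _]/slP->|/slN->] := boolP (P (w2 t)); by [right|left].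
  have pt : p t = pl (w1 t) by rewrite p1 ffunE.
  have := okl (w1 t); rewrite -pt; have [Pt|nPt] := boolP (P (w1 t)).
    rewrite pt (PE _ Pt).2 /= => _; rewrite (slP _ Pt) in st.
    by case: st' => [<-|[_ ->]]; rewrite ?st ?eqxx ?orbT.
  rewrite (slN _ nPt) in st.
  case: (p t) => [b|j] /=; rewrite -st.
    by case: st' => [->//|[-> ->]]; rewrite !eqxx orbT.
  by case: st' => [->->//|[-> ->]]; rewrite eqxx andbT [j == i0]eq_sym => ->; rewrite orbT.
have lkrow p s w1 w2 t : linked p s w1 w2 -> rho (w2 t) = rho t.
  by move=> [_ _ _ r2]; rewrite [in RHS]r2 ffunE.
have lks2 p s w1 w2 t : linked p s w1 w2 -> s t = sl (w2 t) by move=> [_ _ -> _]; rewrite ffunE.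
have lks1 p s w1 w2 t : linked p s w1 w2 -> s t = sl (w1 t) by move=> [_ -> _ _]; rewrite ffunE.
have lkp p s w1 w2 t : linked p s w1 w2 -> p t = pl (w1 t) by move=> [-> _ _ _]; rewrite ffunE.
have [sml /forallP okl] := andP gpl.
have PW t : P t = (rho t == i1) && (sl t == i0).
  have [/[dup]/PE[-> _]/slP->|/slN->] := boolP (P t); first by rewrite !eqxx.
  by apply/esym/negP => /andP[/eqP->]; rewrite eq_sym i0_neq.
have lkP p s w1 w2 t : linked p s w1 w2 -> P (w2 t) = (rho t == i1) && (s t == i0).
  by move=> lk; rewrite PW (lkrow _ _ _ _ _ lk) -(lks2 _ _ _ _ _ lk).
have lklow p s w1 w2 t : good p -> linked p s w1 w2 -> low p t -> P (w2 t).
  move=> gp lk /andP[/eqP rt /eqP pt]; rewrite (lkP _ _ _ _ _ lk) rt eqxx /=.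
  rewrite (lks1 _ _ _ _ _ lk); rewrite (lkp _ _ _ _ _ lk) in pt.
  have [Pw|Pw] := boolP (P (w1 t)); first by rewrite slP.
  have := okl (w1 t); rewrite pt /= slN // => /orP[//|r1].
  by case/negP: Pw; rewrite /P /low r1 pt eqxx.
have lkcls p s w1 w2 t : good p -> linked p s w1 w2 -> P (w2 t) -> p t = up \/ low p t.
  move=> /andP[_ /forallP gp] lk; rewrite (lkP _ _ _ _ _ lk) => /andP[rt st].
  have := gp t; case E: (p t) => [[]|j] /=; [by left|by right; rewrite /low rt E eqxx|].
  move=> /eqP rj; move: st; rewrite (lks1 _ _ _ _ _ lk).
  have pt := E; rewrite (lkp _ _ _ _ _ lk) in pt.
  have := okl (w1 t); rewrite pt /= => /eqP r1; rewrite slN; last first.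
    by apply/negP => /PE[_]; rewrite pt.
  by rewrite r1 -rj (eqP rt) eq_sym i0_neq.
(* Every low cell of [p] comes from a moved cell. So [ylen] is at most [N], and for the value [N]
   the word [s] is determined. *)
have lksum p s w1 w2 : good p -> linked p s w1 w2 ->
    (N = ylen p + \sum_t (P (w2 t) && ~~ low p t))%N.
  move=> gp lk; rewrite -ypl {1}/ylen (reindex_inj (@perm_inj _ w2)) /= -big_split.
  apply: eq_bigr => t _ /=; rewrite -/(P _).
  have := lklow _ _ _ _ t gp lk; case: (low p t) => [->//|_]; by rewrite andbT.
have lkuniq p s w1 w2 : good p -> ylen p = N -> linked p s w1 w2 ->
    s = [ffun t => if low p t then i0 else rho t].
  move=> gp yp lk; apply/ffunP => t; rewrite ffunE (lks2 _ _ _ _ _ lk).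
  have := lksum _ _ _ _ gp lk; rewrite yp -[LHS]addn0 => /addnI/esym/eqP.
  rewrite sum_nat_eq0 => /forallP/(_ t); rewrite eqb0 negb_and negbK.
  have := lklow _ _ _ _ t gp lk; case: (low p t) => [/(_ isT) Pt _|_]; first exact: slP.
  by rewrite orbF => Pt; rewrite slN // (lkrow _ _ _ _ _ lk).
have k0main p : good p -> ylen p = N -> u p = k0 p.
  move=> gp yp; apply/funext => o.
  have [w0 [rw0 pE]] := good_orbit gpl gp (etrans ypl (esym yp)).
  have lk : linked p (pact w0 sl) w0 w0.
    by split=> //; apply/esym/eqP; rewrite -fixes_pact.
  rewrite k0E (bigD1 (pact w0 sl)) //= big1 ?addr0 => [|s sw].
    rewrite (ktE _ _ _ _ _ lk) -[in LHS](oactKV w0 o) {1}pE eu.2 //.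
    by congr (u pl _); apply/funext => t; rewrite /splice; case: ifP.
  case: (kt0 p s) => // -[w1 [w2 lk']]; case/eqP: sw.
  by rewrite (lkuniq _ _ _ _ gp yp lk') (lkuniq _ _ _ _ gp yp lk).
have k0out p : ~~ bad p -> ~ (good p /\ (ylen p <= N)%N) -> k0 p = 0.
  move=> nb ng; apply/funext => o; rewrite k0E; apply: big1 => s _.
  case: (kt0 p s) => // -[w1 [w2 lk]]; case: ng.
  have [sm /forallP semi] := ktsemi _ _ _ _ lk.
  have gp : good p by move: nb; rewrite /bad /good sm semi /= negbK.
  by split=> //; rewrite (lksum _ _ _ _ gp lk) leq_addr.
have k0dep (p : word r kind) o o' : good p ->
    (forall t, (p t == up) || low p t -> o t = o' t) -> k0 p o = k0 p o'.
  move=> gp oo; rewrite !k0E; apply: eq_bigr => s _.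
  case: (kt0 p s) => [[w1 [w2 lk]]|E]; last by rewrite !E.
  rewrite !(ktE _ _ _ _ _ lk); apply: du => t; rewrite /splice => /orP[/eqP pt|Pt].
    rewrite ifN; last by apply/negP => /PE[_]; rewrite pt.
    rewrite ifN; last by apply/negP => /PE[_]; rewrite pt.
    by apply: oo; rewrite (lkp _ _ _ _ _ lk) permKV pt eqxx.
  rewrite (_ : P t) //; apply: oo.
  have := lkcls p s w1 w2 (w2^-1%g t) gp lk; rewrite permKV.
  by move=> /(_ Pt)[->|->]; rewrite ?eqxx ?orbT.
have k0cov p o : good p -> covered p o -> k0 p o = 0.
  move=> gp [h [hinj hP]]; rewrite k0E; apply: big1 => s _.
  case: (kt0 p s) => [[w1 [w2 lk]]|//]; rewrite (ktE _ _ _ _ _ lk); apply: vu.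
  (* A covering of [p] yields one of [pl] at the spliced point: a moved cell that is still low is
     matched through [h], one that now has kind [up] with itself. *)
  pose eta x := if low p x then h x else x.
  have rx x : P (w2 x) -> rho x = i1 by rewrite (lkP _ _ _ _ _ lk) => /andP[/eqP].
  exists (fun t => w1 (eta (w2^-1%g t))); split=> [t t' Pt Pt' /perm_inj|t Pt].
    have := rx (w2^-1%g t); have := rx (w2^-1%g t').
    rewrite !permKV => /(_ Pt') r' /(_ Pt) r0; rewrite /eta.
    case: ifP => lt; case: ifP => lt'.
    + by move=> /(hinj _ _ lt lt')/perm_inj.
    + by move=> E; have [/andP[/eqP rh _] _] := hP _ lt; rewrite E r' in rh; have := i0_neq; rewrite -rh eqxx.
    + by move=> E; have [/andP[/eqP rh _] _] := hP _ lt'; rewrite -E r0 in rh; have := i0_neq; rewrite -rh eqxx.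
    + by move=> /perm_inj.
  set x := w2^-1%g t; have Px : P (w2 x) by rewrite permKV.
  have hi z : p z = up -> s z = i0 -> high pl (w1 z) /\
      splice P (oact w1^-1%g o) (oact w2^-1%g o) (w1 z) = o z.
    move=> pz sz; have plz : pl (w1 z) = up by rewrite -(lkp _ _ _ _ _ lk).
    split; first by rewrite /high plz eqxx -slup // -(lks1 _ _ _ _ _ lk) sz eqxx.
    rewrite /splice ifN; last by apply/negP => /PE[_]; rewrite plz.
    by rewrite /oact permK.
  have -> : splice P (oact w1^-1%g o) (oact w2^-1%g o) t = o x by rewrite /splice (_ : P t).
  have sx : s x = i0 by rewrite (lks2 _ _ _ _ _ lk) slP.
  rewrite /eta; case: ifP => lx.
    have [/andP[/eqP rh /eqP ph] <-] := hP _ lx; apply: hi => //.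
    rewrite (lks2 _ _ _ _ _ lk) slN ?(lkrow _ _ _ _ _ lk) //.
    by apply/negP => /PE[]; rewrite (lkrow _ _ _ _ _ lk) rh => E; have := i0_neq; rewrite E eqxx.
  by apply: hi => //; case: (lkcls _ _ _ _ x gp lk Px) => //; rewrite lx.
(* What remains to be corrected: the words with [ylen] equal to [N] are already matched by [k0]. *)
pose u2 : vec r kind := fun p => if good p && (ylen p < N)%N then u p - k0 p else 0.
have ek0 : eqvec rho k0 by exact: relvec_eqvec Rk0.
have [||||k2 [Rk2 k2E]] := IH u2.
- split=> [p|w rw p o]; rewrite /u2; last first.
    rewrite good_act // ylen_act //; case: ifP => // _.
    by rewrite !lfunB eu.2 // ek0.2.
  by case: ifP => _; [apply: LaurB; [exact: eu.1|exact: ek0.1]|exact: Laur0].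
- by move=> p; rewrite /u2; case: ifP => // /andP[].
- move=> p o o' oo; rewrite /u2; case: ifP => // /andP[gp _].
  by rewrite !lfunB (du p o o') // (k0dep p o o').
- move=> p o co; rewrite /u2; case: ifP => // /andP[gp _].
  by rewrite lfunB vu // k0cov // subrr.
exists (k0 + k2); split=> [|p nb]; first exact: zspanD.
rewrite vecD -k2E // /u2; case: ifP => [|/negP ng]; first by rewrite addrC subrK.
rewrite addr0; case: (pselect (u p = 0)) => [up0|/su[gp]].
  have [gpN|gpN] := pselect (good p /\ (ylen p <= N)%N); last by rewrite k0out.
  case: gpN => gp; rewrite leq_eqVlt => /orP[/eqP yp|yp]; first exact: k0main.
  by case: ng; rewrite gp.
rewrite ltnS leq_eqVlt => /orP[/eqP yp|yp]; first exact: k0main.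
by case: ng; rewrite gp.
Qed.

End Exchange.

(** * Leading coefficients *)

Section Straighten.
Variables n r : nat.
Local Notation point := (point r).
Local Notation lfun := (lfun r).
Local Notation W := (word r 'I_n).
Variable rho : W.
Implicit Types (q : W) (o : point) (w : 'S_r).

Definition rcnt q (j a : 'I_n) : nat := \sum_t ((rho t == j) && (q t == a)).
Definition req q q' := forall j a, rcnt q j a = rcnt q' j a.

(** Letters are compared from the largest down and, for one letter, rows from the top down; the word
    with fewer occurrences at the first discrepancy is earlier. Straightening moves large letters to
    lower rows. *)
Definition prec q q' := exists a i : 'I_n,
  [/\ forall (b j : 'I_n), (a < b)%N -> rcnt q j b = rcnt q' j b,
      forall j : 'I_n, (j < i)%N -> rcnt q j a = rcnt q' j a
    & (rcnt q i a < rcnt q' i a)%N].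

Lemma prec_irr q : ~ prec q q.
Proof. by case=> a [i [_ _]]; rewrite ltnn. Qed.

Lemma prec_trans q q' q'' : prec q q' -> prec q' q'' -> prec q q''.
Proof.
case=> a [i [A1 A2 A3]] [b [j [B1 B2 B3]]].
have [ab|ba|/val_inj ab] := ltngtP a b.
- exists b, j; split=> [c k bc|k kj|].
  + by rewrite A1 ?B1 // (ltn_trans ab).
  + by rewrite A1 ?B2.
  + by rewrite A1.
- exists a, i; split=> [c k ac|k ki|].
  + by rewrite A1 // B1 // (ltn_trans ba).
  + by rewrite A2 // B1.
  + by rewrite -B1.
rewrite -{b}ab in B1 B2 B3; have [ij|ji|/val_inj ij] := ltngtP i j.
- exists a, i; split=> [c k ac|k ki|].
  + by rewrite A1 // B1.
  + by rewrite A2 // B2 // (ltn_trans ki).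
  + by rewrite -B2.
- exists a, j; split=> [c k ac|k kj|].
  + by rewrite A1 // B1.
  + by rewrite A2 ?B2 // (ltn_trans kj).
  + by rewrite A2.
rewrite -{j}ij in B2 B3; exists a, i; split=> [c k ac|k ki|].
- by rewrite A1 // B1.
- by rewrite A2 // B2.
- exact: ltn_trans B3.
Qed.

Lemma prec_ind (P : W -> Prop) :
  (forall q, (forall q', prec q' q -> P q') -> P q) -> forall q, P q.
Proof.
move=> IH q; have [N] := ubnP #|[pred x : W | `[< prec x q >]]|.
elim: N q => // N IHN q; rewrite ltnS => qN; apply: IH => q' q'q; apply: IHN.
apply: leq_trans qN; apply: proper_card; apply/properP; split. apply/fintype.subsetP => x; rewrite !inE => xq'; exact: prec_trans xq' q'q.
exists q'; rewrite !inE //.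
by apply/negP; rewrite inE => /prec_irr.
Qed.

Lemma req_orbit q q' : req q q' -> exists w, fixes rho w /\ q' = pact w q.
Proof.
move=> qq'; have [[j a]|w wP] := @perm_of_counts r _
  (fun t => (rho t, q' t)) (fun t => (rho t, q t)).
  under eq_bigr do rewrite xpair_eqE; under [RHS]eq_bigr do rewrite xpair_eqE.
  exact/esym/qq'.
exists w; split; first by apply/fixesP => t; case: (wP t).
by apply/ffunP => t; rewrite ffunE; case: (wP t).
Qed.

Lemma rcnt_act w q j a : fixes rho w -> rcnt (pact w q) j a = rcnt q j a.
Proof.
move=> /fixesP rw; rewrite /rcnt [RHS](reindex_inj (@perm_inj _ w)).
by apply: eq_bigr => t _; rewrite ffunE rw.
Qed.

Definition orbvec (C : finType) (p : word r C) (f : lfun) : vec r C :=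
  fun s => orbmat p rho f s rho.

Lemma orbvec_eqvec (C : finType) (p : word r C) f :
  inv (fun t => (p t, rho t)) f -> eqvec rho (orbvec p f).
Proof. by move=> jf; exact/eqvec_col/eqmat_orbmat. Qed.

Lemma orbvec_supp (C : finType) (p s : word r C) f o : orbvec p f s o = 0 \/
  exists w, [/\ fixes rho w, s = pact w p & orbvec p f s o = f (oact w^-1%g o)].
Proof.
rewrite /orbvec; case: (orbmatP p rho f s rho o) => [|[w [sE rE E]]]; [by left|right].
by exists w; split=> //; rewrite fixes_pact -rE.
Qed.

Lemma inv_swap (K K' : eqType) (k : 'I_r -> K) (k' : 'I_r -> K') f :
  inv (fun t => (k t, k' t)) f -> inv (fun t => (k' t, k t)) f.
Proof.
apply: inv_sub => w /fixesP kw; apply/fixesP => t.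
by case: (kw t) => -> ->.
Qed.

Lemma orbvec_lc (C : finType) (p : word r C) f :
  inv (fun t => (p t, rho t)) f -> orbvec p f p = f.
Proof. by move=> jf; rewrite /orbvec orbmat_lc. Qed.

Section Leading.
Variable S : vec r 'I_n -> Prop.
Hypotheses (S0 : S 0) (SB : forall u v, S u -> S v -> S (u - v)).

Lemma leadD u v : S u -> S v -> S (u + v).
Proof. by move=> Su Sv; rewrite -[v]opprK -[- v]sub0r; do 2 apply: SB => //. Qed.

(** Subtracting the orbit vector at one word of the support removes that word and adds none. *)
Lemma span_orbvec (D : W -> Prop) :
  (forall q f, D q -> inv (fun t => (rho t, q t)) f -> S (orbvec q f)) ->
  forall u, eqvec rho u -> (forall q, u q <> 0 -> D q) -> S u.
Proof.
move=> SD u; have [N] := ubnP #|[pred q : W | `[< u q <> 0 >]]|.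
elim: N u => // N IH u uN eu uD.
case: (pselect (exists q, u q <> 0)) => [[q uq]|no]; last first.
  suff -> : u = 0 by [].
  by apply/funext => q; apply: contrapT => uq; apply: no; exists q.
have iq := eqvec_inv q eu; have iq' := inv_swap iq.
have eo := orbvec_eqvec iq'.
have out q' : u q' = 0 -> orbvec q (u q) q' = 0.
  move=> u0; apply/funext => o; case: (orbvec_supp q q' (u q) o) => // -[w [rw q'E ->]].
  by rewrite -(eu.2 w) // oactKV -q'E u0.
rewrite -[u](subrK (orbvec q (u q))).
apply: leadD; last by apply: SD => //; exact: uD.
apply: IH; [|exact: eqvecB eu eo|]; last first.
  by move=> q' uq'; apply: uD => u0; apply: uq'; rewrite vecB u0 out // subrr.
rewrite ltnS in uN; apply: leq_trans uN; apply: proper_card; apply/properP; split.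
  apply/fintype.subsetP => q'; rewrite !inE => uq' u0.
  by apply: uq'; rewrite vecB u0 out // subrr.
exists q; rewrite !inE //.
by apply/negP; rewrite inE; apply; rewrite vecB orbvec_lc // subrr.
Qed.

(** On the words of the first kind the coefficient of [u] is determined by equivariance from the one
    at [q]; the others are lower terms. *)
Definition leads q (f : lfun) := exists u, [/\ S u, eqvec rho u, u q = f &
  forall q', u q' <> 0 -> req q' q \/ prec q' q].

Lemma leads0 q : leads q 0.
Proof. by exists 0; split=> //; exact: eqvec0. Qed.

Lemma leadsB q f g : leads q f -> leads q g -> leads q (f - g).
Proof.
move=> [u [Su eu <- du]] [v [Sv ev <- dv]]; exists (u - v); split=> //.
- exact: SB.
- exact: eqvecB.
move=> q' uv; case: (pselect (u q' = 0)) => [u0|/du//].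
by apply: dv => v0; apply: uv; rewrite vecB u0 v0 subrr.
Qed.

Lemma leads_zspan q (G : lfun -> Prop) f :
  (forall g, G g -> leads q g) -> zspan G f -> leads q f.
Proof. by move=> SG; apply; [exact: leads0|exact: leadsB|]. Qed.

(** Elimination along [prec]: subtracting a member of [S] with the same coefficient at [q] leaves a
    vector supported on earlier words. *)
Lemma leads_all :
  (forall q f, inv (fun t => (rho t, q t)) f -> leads q f) ->
  forall u, eqvec rho u -> S u.
Proof.
move=> lead; suff H q f : inv (fun t => (rho t, q t)) f -> S (orbvec q f).
  by move=> u eu; apply: (@span_orbvec (fun=> True)) => // q f _; exact: H.
elim/prec_ind: q f => q IH f jf; have [u [Su eu uq du]] := lead q f jf.
have jf' := inv_swap jf; rewrite -[orbvec q f](subrK u); apply: leadD => //.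
apply: (@span_orbvec (fun q' => prec q' q)) => [q' g pq' ig||].
  exact: IH.
  by apply: eqvecB => //; exact: orbvec_eqvec.
move=> q'; rewrite vecB => nz.
case: (pselect (u q' = 0)) => [u0|/du[e|//]].
  case: nz; rewrite u0 subr0; apply/funext => o.
  case: (orbvec_supp q q' f o) => // -[w [rw q'E E]].
  rewrite E; move: u0; rewrite q'E => /(congr1 (fun g : lfun => g (oact w (oact w^-1%g o)))).
  by rewrite eu.2 // uq.
case: nz; have [w [rw ->]] : exists w, fixes rho w /\ q' = pact w q.
  by apply: req_orbit => j a; rewrite e.
apply/funext => o; rewrite -[o](oactKV w) lfunB eu.2 // (orbvec_eqvec jf').2 //.
by rewrite uq orbvec_lc // subrr.
Qed.

End Leading.
End Straighten.

(** * Leading coefficients that vanish at the covered points *)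

Section CoveredIdeal.
Variables n r : nat.
Local Notation point := (point r).
Local Notation lfun := (lfun r).
Local Notation W := (word r 'I_n).
Variables (rho q : W) (i0 i1 a0 : 'I_n).
Hypothesis i01 : (i0 < i1)%N.
Implicit Types (o : point) (w : 'S_r).

Local Notation up := (inl true : kind n).
Local Notation dn := (inl false : kind n).

(** The letters [a0] of row [i0] are marked [dn] and not as spectators: after an exchange they share
    their places with the letters of row [i1], so the number of [a0] in row [i0] can only drop. *)
Definition kind_word : word r (kind n) := [ffun t =>
  if (rho t == i0) && (q t < a0)%N then up
  else if (rho t == i0) && (q t == a0) || (rho t == i1) && (q t <= a0)%N then dn
  else inr (rho t)].
Local Notation p0 := kind_word.

Lemma p0E t : p0 t = if (rho t == i0) && (q t < a0)%N then up
  else if (rho t == i0) && (q t == a0) || (rho t == i1) && (q t <= a0)%N then dn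
  else inr (rho t).
Proof. by rewrite ffunE. Qed.

Let i10 : (i1 == i0) = false.
Proof. by apply/negbTE; rewrite -val_eqE /= neq_ltn i01 orbT. Qed.
Let i01' : (i0 == i1) = false.
Proof. by rewrite eq_sym i10. Qed.

Let inrE (j j' : 'I_n) : (inr j == inr j' :> kind n) = (j == j').
Proof. by []. Qed.

Variant p0_spec t : kind n -> Prop :=
| P0up : rho t = i0 -> (q t < a0)%N -> p0_spec t up
| P0dn0 : rho t = i0 -> q t = a0 -> p0_spec t dn
| P0dn1 : rho t = i1 -> (q t <= a0)%N -> p0_spec t dn
| P0sp0 : rho t = i0 -> (a0 < q t)%N -> p0_spec t (inr i0)
| P0sp1 : rho t = i1 -> (a0 < q t)%N -> p0_spec t (inr i1)
| P0sp j : rho t = j -> j != i0 -> j != i1 -> p0_spec t (inr j).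

Lemma p0P t : p0_spec t (p0 t).
Proof.
rewrite p0E; have [r0|r0] := eqVneq (rho t) i0 => /=.
  have [qa|qa|/val_inj qa] := ltngtP (q t) a0.
  - exact: P0up.
  - rewrite -val_eqE /= gtn_eqF //= r0 i01' /=; exact: P0sp0.
  - by rewrite qa eqxx /=; apply: P0dn0.
have [r1|r1] := eqVneq (rho t) i1 => /=; last exact: P0sp.
case: leqP => qa; first exact: P0dn1.
by rewrite r1; exact: P0sp1.
Qed.

Lemma good_p0 : good rho i0 i1 p0 p0.
Proof.
rewrite /good; apply/andP; split; first by apply/forallP.
by apply/forallP => t; case: p0P => [r0|r0|r0|r0|r0|j r0] *; rewrite /rowok /= r0 ?eqxx ?orbT.
Qed.

Section Linked.
Variables (q' : W) (p : word r (kind n)) (w : 'S_r).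
Hypotheses (q'E : q' = pact w q) (pE : p = pact w p0).
Hypothesis semi : forall t, rowsemi rho i0 i1 t (p t).

Let pair (c : kind n) (a : 'I_n) : nat := \sum_t ((p0 t == c) && (q t == a)).
Let pairE c a : pair c a = (\sum_t ((p t == c) && (q' t == a)))%N.
Proof.
by rewrite /pair (reindex_inj (@perm_inj _ w)); apply: eq_bigr => t _ /=;
  rewrite q'E pE !ffunE.
Qed.

Variant link_spec t : kind n -> 'I_n -> Prop :=
| Lup0 (a : 'I_n) : rho t = i0 -> (a < a0)%N -> link_spec t up a
| Lup1 (a : 'I_n) : rho t = i1 -> (a < a0)%N -> link_spec t up a
| Ldn0 (a : 'I_n) : rho t = i0 -> (a <= a0)%N -> link_spec t dn a
| Ldn1 (a : 'I_n) : rho t = i1 -> (a <= a0)%N -> link_spec t dn a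
| Lsp0 (a : 'I_n) : rho t = i0 -> (a0 < a)%N -> link_spec t (inr i0) a
| Lbad (a : 'I_n) : rho t = i1 -> (a0 < a)%N -> link_spec t (inr i0) a
| Lsp1 (a : 'I_n) : rho t = i1 -> (a0 < a)%N -> link_spec t (inr i1) a
| Lsp j (a : 'I_n) : rho t = j -> j != i0 -> j != i1 -> link_spec t (inr j) a.

Lemma linkP t : link_spec t (p t) (q' t).
Proof.
have := semi t; rewrite pE q'E !ffunE -p0E.
have := p0P (w t); move: (p0 (w t)) => c.
case=> [r0 qa|r0 qa|r0 qa|r0 qa|r0 qa|j rj j0 j1] /=.
- by case/orP => /eqP r1; [apply: Lup0|apply: Lup1].
- by rewrite qa; case/orP => /eqP r1; [apply: Ldn0|apply: Ldn1].
- by case/orP => /eqP r1; [apply: Ldn0|apply: Ldn1].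
- by rewrite eqxx /=; case/orP => /eqP r1; [apply: Lsp0|apply: Lbad].
- by rewrite i10 orbF => /eqP r1; apply: Lsp1.
- by rewrite (negPf j0) orbF => /eqP r1; apply: Lsp.
Qed.

Let ebad a : nat := \sum_t [&& rho t == i1, p t == inr i0 & q' t == a].

Lemma link_other j a : j != i0 -> j != i1 -> rcnt rho q' j a = rcnt rho q j a.
Proof.
move=> j0 j1; have [j0' j1'] : (i0 == j) = false /\ (i1 == j) = false.
  by rewrite !(eq_sym _ j) (negPf j0) (negPf j1).
transitivity (pair (inr j) a).
  rewrite pairE; apply: eq_bigr => t _.
  by case: linkP => [b|b|b|b|b|b|b|j' b] -> *; rewrite ?inrE ?j0' ?j1'.
by apply: eq_bigr => t _; case: p0P => [||||| j'] -> *; rewrite ?inrE ?j0' ?j1'.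
Qed.

Lemma link_big0 (a : 'I_n) : (a0 < a)%N -> (rcnt rho q' i0 a + ebad a = rcnt rho q i0 a)%N.
Proof.
move=> aa; have ne (b : 'I_n) : (b < a)%N -> (b == a) = false by move=> ba; rewrite -val_eqE /= ltn_eqF.
transitivity (pair (inr i0) a).
  rewrite pairE -big_split; apply: eq_bigr => t _ /=.
  case: linkP => [b|b|b|b|b|b|b|j' b] ->; rewrite ?inrE ?eqxx ?i10 ?i01' ?addn0 //=.
  - by move=> ba; rewrite ne // (ltn_trans ba).
  - by move=> ba; rewrite ne // (leq_ltn_trans ba).
  by move=> /negPf-> /negPf->.
apply: eq_bigr => t _; case: p0P => [|||||j'] ->; rewrite ?inrE ?eqxx ?i10 ?i01' //=.
- by move=> ba; rewrite ne // (ltn_trans ba).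
- by move=> ->; rewrite ne.
Qed.

Lemma link_big1 (a : 'I_n) : (a0 < a)%N -> (rcnt rho q' i1 a = rcnt rho q i1 a + ebad a)%N.
Proof.
move=> aa; have ne (b : 'I_n) : (b < a)%N -> (b == a) = false by move=> ba; rewrite -val_eqE /= ltn_eqF.
transitivity (pair (inr i1) a + ebad a)%N.
  rewrite pairE -big_split; apply: eq_bigr => t _ /=.
  case: linkP => [b|b|b|b|b|b|b|j' b] ->; rewrite ?inrE ?eqxx ?i10 ?i01' ?addn0 //=.
  - by move=> ba; rewrite ne // (ltn_trans ba).
  - by move=> ba; rewrite ne // (leq_ltn_trans ba).
  by move=> _ /negPf->.
congr (_ + _)%N; apply: eq_bigr => t _.
case: p0P => [|||||j'] ->; rewrite ?inrE ?eqxx ?i10 ?i01' //=.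
- by move=> ba; rewrite ne // (leq_ltn_trans ba).
Qed.

(** The spectators of row [i0] that sank into row [i1] carry letters above [a0]; the largest of
    these letters gives the first discrepancy. *)
Lemma linked_bad : ~~ good rho i0 i1 p0 p -> prec rho q' q.
Proof.
move=> ng; have [t] : exists t, ~~ rowok rho i0 i1 t (p t).
  have : same p0 p by rewrite pE same_act; apply/forallP.
  by move=> sm; move: ng; rewrite /good sm negb_forall => /existsP.
move=> nok; have [rt pt qt] : [/\ rho t = i1, p t = inr i0 & (a0 < q' t)%N].
  move: nok; rewrite /rowok; case: linkP => [b|b|b|b|b|b|b|j' b] -> //;
  by rewrite ?eqxx ?orbT.
have eq' : ebad (q' t) != 0%N by rewrite /ebad (bigD1 t) //= rt pt !eqxx.
pose a := [arg max_(a > q' t | ebad a != 0%N) (a : nat)].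
have [ea amax] : ebad a != 0%N /\ forall b, ebad b != 0%N -> (b <= a)%N.
  by rewrite /a; case: arg_maxnP.
have a0a : (a0 < a)%N by apply: leq_trans (amax _ eq').
exists a, i0; split=> [b j ab|j ji|]; last first.
- by rewrite -link_big0 // -[X in (X < _)%N]addn0 ltn_add2l lt0n.
- by apply: link_other; rewrite -val_eqE /= ltn_eqF // (ltn_trans ji).
have eb : ebad b = 0%N.
  by apply/eqP/negPn/negP => /amax; rewrite leqNgt ab.
have a0b := ltn_trans a0a ab.
have [->|j0] := eqVneq j i0; first by rewrite -link_big0 // eb addn0.
have [->|j1] := eqVneq j i1; first by rewrite link_big1 // eb addn0.
exact: link_other.
Qed.

(* Letters above a0 stay in place; those at most a0 in the two rows are
   distributed among the up and dn cells. *)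
Lemma linked_good : good rho i0 i1 p0 p -> ylen rho i1 p = ylen rho i1 p0 ->
  prec rho q' q \/ req rho q' q /\ (q' = q -> p = p0).
Proof.
move=> gp yp; have [/forallP sm /forallP gok] := andP gp.
have eb a : ebad a = 0%N.
  apply: big1 => t _; have := gok t; rewrite /rowok.
  case: (p t) => [b|j]; first by rewrite andbF.
  by rewrite inrE => /eqP->; case: eqP => //= ->; rewrite i10.
have up1 : jcnt rho p up i1 = 0%N.
  have := good_row gp; rewrite -(good_row good_p0) -!ylenE yp !(good_inr _ _ gp) !(good_inr _ _ good_p0).
  rewrite (eqP (sm _)) => /addIn/addIn->; apply: big1 => t _.
  by case: p0P => [||||| j] -> *; rewrite ?i01' ?andbF.
have up0 t : p t = up -> rho t = i0.
  move=> pt; move: up1 => /eqP; rewrite sum_nat_eq0 => /forallP/(_ t).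
  by case: linkP pt => [b|b|b|b|b|b|b|j' b] // -> _ _; rewrite !eqxx.
pose dnlt := (\sum_t [&& rho t == i0, p t == dn & (q' t < a0)%N])%N.
have x0 : (rcnt rho q' i0 a0 + dnlt = rcnt rho q i0 a0)%N.
  have -> : (rcnt rho q' i0 a0 + dnlt = jcnt rho p dn i0)%N.
    rewrite -big_split; apply: eq_bigr => t _ /=.
    case: linkP => [b|b|b|b|b|b|b|j' b] -> //; rewrite ?eqxx ?i10 ?inrE //=.
    - by move=> ba; rewrite -val_eqE /= ltn_eqF.
    - by rewrite leq_eqVlt val_eqE; case: eqP => [->|_ /= ->//]; rewrite ltnn.
    - by move=> ba; rewrite -val_eqE /= gtn_eqF.
    by move=> /negPf->.
  have -> : jcnt rho p dn i0 = jcnt rho p0 dn i0.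
    have := good_inl_sum i01 false gp; rewrite (eqP (sm _)) -(good_inl_sum i01 false good_p0).
    by rewrite -!ylenE yp => /addIn.
  apply: eq_bigr => t _; case: p0P => [||||| j] ->; rewrite ?eqxx ?i10 ?inrE //=.
  - by move=> ba; rewrite -val_eqE /= ltn_eqF.
  - by move=> ->; rewrite eqxx.
  - by move=> ba; rewrite -val_eqE /= gtn_eqF.
  by move=> /negPf->.
have big_row j (a : 'I_n) : (a0 < a)%N -> rcnt rho q' j a = rcnt rho q j a.
  move=> ab; have [->|j0] := eqVneq j i0; first by rewrite -link_big0 // eb addn0.
  have [->|j1] := eqVneq j i1; first by rewrite link_big1 // eb addn0.
  exact: link_other.
have [d0|dn0] := eqVneq dnlt 0%N; [right|left].
  have dt t : ~~ [&& rho t == i0, p t == dn & (q' t < a0)%N].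
    by move: d0 => /eqP; rewrite sum_nat_eq0 => /forallP/(_ t); rewrite eqb0.
  have row0 a : rcnt rho q' i0 a = rcnt rho q i0 a.
    have [aa|aa|/val_inj->] := ltngtP a a0; [|exact: big_row|by rewrite -x0 d0 addn0].
    transitivity (pair up a); [rewrite pairE|]; apply: eq_bigr => t _.
      have := up0 t; have := dt t.
      case: linkP => [b|b|b|b|b|b|b|j' b] ->; rewrite ?eqxx ?i10 //=.
      - by move=> _ _ /(_ erefl)/eqP; rewrite i10.
      - by move=> _; rewrite -leqNgt => ab _; rewrite -val_eqE /= gtn_eqF // (leq_trans aa).
      - by move=> ba _ _; rewrite -val_eqE /= gtn_eqF // (ltn_trans aa).
      by move=> /negPf->.
    case: p0P => [||||| j] ->; rewrite ?eqxx ?i10 //=.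
    - by move=> ->; rewrite -val_eqE /= gtn_eqF.
    - by move=> ba; rewrite -val_eqE /= gtn_eqF // (ltn_trans aa).
    by move=> /negPf->.
  split=> [j a|q'q].
    have [->//|j0] := eqVneq j i0; have [->|j1] := eqVneq j i1; last exact: link_other.
    have tot (x : W) : cnt x a = (rcnt rho x i0 a + (rcnt rho x i1 a +
        \sum_(j | (j != i0) && (j != i1)) rcnt rho x j a))%N.
      transitivity (\sum_j rcnt rho x j a)%N; last first.
        by rewrite (bigD1 i0) //= (bigD1 i1) /= ?i10.
      rewrite exchange_big; apply: eq_bigr => t _ /=.
      by rewrite (bigD1 (rho t)) //= eqxx big1 ?addn0 // => k; rewrite eq_sym => /negPf->.
    have := tot q'; rewrite [in LHS]q'E cnt_pact tot row0 => /addnI.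
    have -> : (\sum_(j | (j != i0) && (j != i1)) rcnt rho q' j a =
        \sum_(j | (j != i0) && (j != i1)) rcnt rho q j a)%N.
      by apply: eq_bigr => k /andP[k0 k1]; apply: link_other.
    by move=> /addIn.
  apply/ffunP => t; rewrite p0E -q'q.
  have := gok t; rewrite /rowok; have := @up0 t.
  move: d0 => /eqP; rewrite sum_nat_eq0 => /forallP/(_ t).
  case: linkP => [b|b|b|b|b|b|b|j' b] ->; rewrite ?eqxx ?inrE ?i10 ?i01' //=.
  - by move=> -> //.
  - by move=> ba _ /(_ erefl)/eqP; rewrite i10.
  - move=> ba; rewrite eqb0 -leqNgt => ab _ _; rewrite ltnNge ab /=.
    by rewrite -val_eqE /= eqn_leq ba ab.
  - by move=> ->.
  - by move=> ba _ _ _; rewrite ltnNge ltnW //= -val_eqE /= gtn_eqF.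
  - by move=> ba _ _ _; rewrite leqNgt ba.
  by move=> /negPf-> /negPf->.
exists a0, i0; split=> [b j ab|j ji|]; last first.
- by rewrite -x0 -[X in (X < _)%N]addn0 ltn_add2l lt0n.
- by apply: link_other; rewrite -val_eqE /= ltn_eqF // (ltn_trans ji).
exact: big_row.
Qed.

End Linked.

Lemma pactE (C : finType) w (p : word r C) t : pact w p t = p (w t).
Proof. by rewrite ffunE. Qed.

Lemma orbvec_pact (p : word r (kind n)) f w o : inv (fun t => (p t, rho t)) f -> fixes rho w ->
  orbvec rho p f (pact w p) o = f (oact w^-1%g o).
Proof.
move=> jf rw; rewrite -[o in LHS](oactKV w) (orbvec_eqvec jf).2 //.
by rewrite orbvec_lc.
Qed.

(** The matrix [orbmat q p0 psi] translates kinds into letters in the relation found by [exchange].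
    On the bad words, which [exchange] leaves uncontrolled, it only produces words before [q]. *)
Lemma leads_covered_prod c psi a :
  inv (fun t => (p0 t, rho t)) c ->
  depends (fun t => (p0 t == up) || low rho i1 p0 t) c ->
  (forall o, covered rho i0 i1 p0 o -> c o = 0) ->
  inv (fun t => (q t, p0 t)) psi -> inv rho a ->
  leads rho (relvec rho (C := 'I_n)) q (c * (psi * a)).
Proof.
move=> ic dc vc ipsi ia; pose u := orbvec rho p0 c.
have su p : u p <> 0 -> exists2 w, fixes rho w & p = pact w p0.
  move=> up0; apply: contrapT => no; apply: up0; apply/funext => o.
  case: (orbvec_supp rho p0 p c o) => // -[w [rw pE _]].
  by case: no; exists w.
have gu p : u p <> 0 -> good rho i0 i1 p0 p /\ ylen rho i1 p = ylen rho i1 p0.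
  by case/su => w rw ->; rewrite good_act // ylen_act // good_p0.
have ulow p w : fixes rho w -> p = pact w p0 -> forall t, low rho i1 p0 t -> low rho i1 p (w^-1%g t).
  move=> /fixesV/fixesP rw -> t; rewrite /low pactE permKV.
  by rewrite rw.
have [||||k [Rk kE]] := @exchange n r rho i0 i1 i01 p0 (ylen rho i1 p0).+1 u.
- exact: orbvec_eqvec.
- by move=> p /gu[gp ->].
- move=> p o o' oo; case: (pselect (u p = 0)) => [->//|/su[w rw pE]].
  rewrite /u pE !orbvec_pact //; apply: dc => t pt; apply: oo.
  case/orP: pt => [pt|/(ulow _ _ rw pE)->]; last by rewrite orbT.
  by rewrite pE pactE permKV pt.
- move=> p o [h [hI hP]]; case: (pselect (u p = 0)) => [->//|/su[w rw pE]].
  rewrite /u pE orbvec_pact //; apply: vc; have lw := ulow _ _ rw pE.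
  have /fixesP rw' := rw.
  exists (fun t => w (h (w^-1%g t))); split.
    by move=> t t' lt lt' /perm_inj/hI hh; apply: (@perm_inj _ w^-1%g); apply: hh; apply: lw.
  move=> t lt; have [/andP[h1 h2] h3] := hP _ (lw _ lt); rewrite /oact permK h3; split=> //.
  by move: h1 h2; rewrite /high {1}pE pactE -rw' => -> ->.
have link q' p w : q' = pact w q -> p = pact w p0 -> k p <> 0 ->
    prec rho q' q \/ req rho q' q /\ (q' = q -> p = p0).
  move=> q'E pE kp; have [gp|ngp] := boolP (good rho i0 i1 p0 p).
    have nb : ~~ bad rho i0 i1 p0 p by move: gp; rewrite /bad /good => /andP[-> ->]; rewrite andbF.
    rewrite -kE // in kp; have [_ yp] := gu p kp.
    by apply: (linked_good q'E pE _ gp yp) => t; have /andP[_ /forallP/(_ t)] := gp; case: (p t) => //= j ->.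
  have [/and3P[_ /forallP semi _]|nb] := boolP (bad rho i0 i1 p0 p).
    by left; apply: linked_bad q'E pE semi ngp.
  by rewrite -kE // in kp; have [gp] := gu p kp; rewrite gp in ngp.
have nz q' p o : orbmat q p0 psi q' p o * k p o <> 0 ->
    prec rho q' q \/ req rho q' q /\ (q' = q -> p = p0).
  case: (orbmatP q p0 psi q' p o) => [->|[w [q'E pE _]]]; first by rewrite mul0r.
  move=> nz; apply: link q'E pE _ => kp; apply: nz.
  by rewrite kp mulr0.
pose s : vec r 'I_n := fun p => mulv (orbmat q p0 psi) k p * a.
have Rs : relvec rho s.
  by apply: relvec_scale => //; apply: relvec_mul => //; exact: eqmat_orbmat.
exists s; split=> //; first exact: relvec_eqvec Rs.
- apply/funext => o; rewrite /s !lfunM mulvE (bigD1 p0) //= big1 ?addr0 => [|p pp0].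
    rewrite orbmat_lc // -kE; last by rewrite /bad; case/andP: good_p0 => -> ->; rewrite andbF.
    by rewrite /u orbvec_lc // mulrA [psi o * _]mulrC.
  apply: contrapT => /nz[/prec_irr//|[_ /(_ erefl) E]].
  by rewrite E eqxx in pp0.
move=> q' sq; apply: contrapT => no; apply: sq; apply/funext => o.
rewrite /s lfunM mulvE big1 ?mul0r // => p _.
apply: contrapT => /nz[pq|[rq _]]; apply: no; [by right|by left].
Qed.

(** What is missing for [leads_covered_prod] is that [f] be a combination of products [psi * a]; two
    splittings of blocks achieve this. *)
Lemma leads_covered_mul c f :
  inv (fun t => (p0 t, rho t)) c ->
  depends (fun t => (p0 t == up) || low rho i1 p0 t) c ->
  (forall o, covered rho i0 i1 p0 o -> c o = 0) ->
  inv (fun t => (rho t, q t)) f ->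
  leads rho (relvec rho (C := 'I_n)) q (c * f).
Proof.
move=> ic dc vc jf.
pose G g := exists psi a, [/\ inv (fun t => (q t, p0 t)) psi, inv rho a & g = psi * a].
suff : zspan G f.
  move=> Gf; apply: (leads_zspan (@zspan0 _ _) (@zspanB _ _) (G := fun h => exists psi a,
     [/\ inv (fun t => (q t, p0 t)) psi, inv rho a & h = c * (psi * a)])).
    by move=> _ [psi [a [h1 h2 ->]]]; apply: leads_covered_prod.
  apply: (zspan_map _ _ Gf) => [|g h|_ [psi [a [h1 h2 ->]]]].
  - by rewrite mulr0.
  - by rewrite mulrBr.
  by apply: zspan_gen; exists psi, a.
(* The letters [a0] of both rows have kind [dn], so [psi] must be symmetric in their union; hence
   these two blocks are merged. *)
have k12 : (i0, a0) != (i1, a0) by rewrite xpair_eqE i01'.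
apply: (zspan_trans (inv_split k12 jf)) => _ [Q [p [iQ ip _ ->]]].
(* The remaining symmetric function of the letters [a0] of row [i1] is expressed by functions of the
   whole row, which go into [a], and of its other letters, which go into [psi]. *)
pose k2 t := (rho t == i1, (rho t == i1) && (q t == a0)).
have k12' : (true, true) != (true, false) by [].
have ip2 : inv k2 p.
  by apply: inv_sub ip => w /fixesP fw; apply/fixesP => t; case: (fw t); rewrite !xpair_eqE.
have iQ' : inv (fun t => (q t, p0 t)) Q.
  pose h (x : 'I_n * kind n) : 'I_n * 'I_n := match x.2 with
    | inl true => (i0, x.1) | inl false => (if x.1 == a0 then i0 else i1, x.1) | inr j => (j, x.1) end.
  have hE t : merge (fun t => (rho t, q t)) (i0, a0) (i1, a0) t = h (q t, p0 t).
    rewrite /merge xpair_eqE /h /=; case: p0P => [||||| j] ->; rewrite ?i01' ?eqxx //=.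
    - by move=> ->; rewrite eqxx.
    - by move=> _; case: eqP => // ->.
    - by move=> aq; rewrite -val_eqE /= gtn_eqF.
    by move=> _ /negPf->.
  apply: inv_sub iQ => w /fixesP fw; apply/fixesP => t; rewrite !hE.
  by rewrite fw.
apply: (zspan_map (h := fun g : lfun => Q * g) _ _ (inv_split k12' ip2)).
- by rewrite mulr0.
- by move=> g h; rewrite mulrBr.
move=> _ [a [b [ja jb _ ->]]]; apply: zspan_gen; exists (Q * b), a; split.
- apply: invM => //; apply: inv_sub jb => w /fixesP fw; apply/fixesP => t.
  pose h (x : 'I_n * kind n) := match x.2 with inl false => x.1 != a0 | inr j => j == i1 | _ => false end.
  have hE s : (k2 s == (true, false)) = h (q s, p0 s).
    rewrite /k2 /h xpair_eqE /=; case: p0P => [||||| j] ->; rewrite ?i01' ?eqxx //=.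
    - by move=> ->; rewrite eqxx.
    - by move=> aq; rewrite -val_eqE /= gtn_eqF.
    by move=> _ /negPf->.
  by rewrite !hE fw.
- apply: inv_sub ja => w /fixesP fw; apply/fixesP => t.
  by rewrite /merge /k2 !xpair_eqE fw; case: (rho t == i1) => //=; do 2 case: (q _ == a0).
by rewrite mulrAC -!mulrA.
Qed.

Definition active t := (p0 t == up) || low rho i1 p0 t.

(* The coefficients of f, as a polynomial in the variables of the inactive
   cells, vanish on the covered points as well. *)
Lemma leads_covered f g :
  inv (fun t => (rho t, if active t then None else Some (q t))) f ->
  (forall o, covered rho i0 i1 p0 o -> f o = 0) ->
  inv (fun t => (rho t, q t)) g ->
  leads rho (relvec rho (C := 'I_n)) q (f * g).
Proof.
move=> jf vf jg; pose P t := ~~ active t.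
have [||B [c [p [jc jp fE vc dc]]]] := @decompose r _ _ (fun t => (p0 t, rho t)) (fun t => (rho t, q t)) P f jf.1.
- move=> w o o' /fixesP fw.
  have aw t : active (w t) = active t by rewrite /active /low; case: (fw t) => -> ->.
  have [|w' w'E] := @restr_perm_ex r active w; first exact: aw.
  rewrite -[RHS](jf.2 w'); last first.
    apply/fixesP => t; rewrite w'E; case: ifP => at_; last by rewrite at_.
    by rewrite aw at_; case: (fw t) => _ ->.
  congr (f _); apply/funext => t; rewrite /splice /P w'E.
  by case at_: (active t); rewrite /= ?aw at_.
- move=> w o o' /fixesP fw.
  have aw t : active (w t) = active t.
    by rewrite /active /low !p0E; case: (fw t) => -> ->.
  have [|w' w'E] := @restr_perm_ex r P w; first by move=> t; rewrite /P aw.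
  rewrite -[RHS](jf.2 w'); last first.
    apply/fixesP => t; rewrite w'E; case: ifP => // at_.
    by rewrite aw; case: (fw t) => -> ->.
  congr (f _); apply/funext => t; rewrite /splice w'E; case: ifP => at_; last by rewrite at_.
  by rewrite /P aw (_ : ~~ _).
have -> : f * g = \sum_(b <- B) c b * (p b * g).
  apply/funext => o; rewrite lfunM lfun_sum (_ : f o = f (splice P o o)); last first.
    by congr (f _); apply/funext => t; rewrite /splice; case: ifP.
  by rewrite fE mulr_suml; apply: eq_bigr => b _; rewrite -mulrA.
rewrite big_seq; apply: (big_ind (leads rho (relvec rho (C := 'I_n)) q)).
- exact: (leads0 rho (@zspan0 _ _)).
- move=> x y lx ly; rewrite -[y]opprK -[- y]sub0r.
  by do 2![apply: (leadsB (@zspanB _ _)) => //]; exact: (leads0 rho (@zspan0 _ _)).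
move=> b bB; apply: leads_covered_mul.
- exact: jc.
- move=> o o' oo; apply: dc bB => o1; congr (f _); apply/funext => t.
  by rewrite /splice /P /=; case: ifP => // /negbFE/oo.
- move=> o co; apply: vc bB => o'; apply: vf.
  have mE t : active t -> splice P o o' t = o t by rewrite /splice /P => ->.
  have [h [hI hP]] := co; exists h; split=> // t lt; have [hh ho] := hP t lt.
  rewrite !mE //; first by rewrite /active lt orbT.
  by rewrite /active; case/andP: hh => _ ->.
exact: invM.
Qed.

End CoveredIdeal.

(** * Alternants *)

(** The elements of [Z] outside [D] are matched in order with those outside the image. *)
Lemma ext_perm (T : finType) (D Z : {set T}) (f : T -> T) :
  {in D &, injective f} -> D \subset Z -> f @: D \subset Z ->
  exists w : {perm T}, (forall t, t \in D -> w t = f t) /\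
    forall t, t \notin Z -> w t = t.
Proof.
move=> fI DZ fDZ; pose A := enum (Z :\: D); pose B := enum (Z :\: f @: D).
have sAB : size A = size B.
  by rewrite -!cardE !cardsD (finset.setIidPr DZ) (finset.setIidPr fDZ) card_in_imset.
pose g t := if t \in D then f t else if t \in Z then nth t B (index t A) else t.
have gB t : t \notin D -> t \in Z -> g t \in B /\ index (g t) B = index t A.
  move=> tD tZ; rewrite /g (negPf tD) tZ.
  have tA : (index t A < size B)%N by rewrite -sAB index_mem mem_enum inE tD tZ.
  by rewrite mem_nth // index_uniq // enum_uniq.
have gD t : t \in D -> g t \in f @: D by move=> tD; rewrite /g tD imset_f.
have BZ t : t \in B -> (t \in Z) && (t \notin f @: D) by rewrite mem_enum inE andbC.
have gE t : t \notin Z -> g t = t.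
  move=> tZ; rewrite /g (negPf tZ) ifN //.
  by apply: contra tZ; exact: (fintype.subsetP DZ).
have gI : injective g.
  move=> t t' tt'; have [tD|tD] := boolP (t \in D); have [tD'|tD'] := boolP (t' \in D).
  - by apply: fI => //; move: tt'; rewrite /g tD tD'.
  - have [tZ|tZ] := boolP (t' \in Z).
      have [/BZ/andP[_]] := gB t' tD' tZ; by rewrite -tt' gD.
    have := fintype.subsetP fDZ _ (gD t tD); rewrite tt' gE // => tZ'.
    by rewrite tZ' in tZ.
  - have [tZ|tZ] := boolP (t \in Z).
      have [/BZ/andP[_]] := gB t tD tZ; by rewrite tt' gD.
    have := fintype.subsetP fDZ _ (gD t' tD'); rewrite -tt' gE // => tZ'.
    by rewrite tZ' in tZ.
  have [tZ|tZ] := boolP (t \in Z); have [tZ'|tZ'] := boolP (t' \in Z).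
  - have [_ i1] := gB t tD tZ; have [_ i2] := gB t' tD' tZ'.
    move: i1; rewrite tt' i2 => /(congr1 (nth t A)).
    by rewrite !nth_index // mem_enum inE ?tD ?tD'.
  - have [/BZ/andP[]] := gB t tD tZ; by rewrite tt' gE // (negPf tZ').
  - have [/BZ/andP[]] := gB t' tD' tZ'; by rewrite -tt' gE // (negPf tZ).
  by move: tt'; rewrite !gE.
exists (perm gI); split=> t tD; rewrite permE; last exact: gE.
by rewrite /g tD.
Qed.

Section Alternants.
Variable r : nat.
Local Notation point := (point r).
Local Notation lfun := (lfun r).
Local Notation expo := (expo r).
Implicit Types (o : point) (w : 'S_r).

Definition xpow (s : 'I_r) (a : int) : lfun := fun o => (o s).+1%:R ^ a.

Lemma xpowE s a : xpow s a = mono [ffun t => if t == s then a else 0].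
Proof.
apply/funext => o; rewrite /mono (bigD1 s) //= ffunE eqxx big1 ?mulr1 // => t ts.
by rewrite ffunE (negPf ts) expr0z.
Qed.

Lemma Laur_xpow s a : Laur (xpow s a).
Proof. by rewrite xpowE; exact: Laur_mono. Qed.

Lemma xpowD s a b : xpow s (a + b) = xpow s a * xpow s b.
Proof. by apply/funext => o; rewrite lfunM /xpow expfzDr // -unitfE coordU. Qed.

Section Reduction.
Variable U : {set 'I_r}.
Local Notation m := #|U|.
Local Notation colU := (fun t => t \in U).

Definition charp o : {poly rat} := \prod_(u in U) ('X - ((o u).+1%:R)%:P).
(** Up to sign the elementary symmetric functions of the variables in [U]; [ch0V] inverts the
    constant coefficient and so gives access to negative powers. *)
Definition ch (l : nat) : lfun := fun o => (charp o)`_l.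
Definition ch0V : lfun := \prod_(u in U) (- xpow u (-1)).

Lemma inv_ch l : inv colU (ch l).
Proof.
split=> [|w /fixesP fw o]; last first.
  suff E : charp (fun s => o (w s)) = charp o by rewrite /ch E.
  by rewrite /charp [RHS](reindex_inj (@perm_inj _ w)); apply: eq_bigl => u; rewrite fw.
have -> : ch l = fun o => (\prod_(u <- enum U) ('X - ((o u).+1%:R : rat)%:P))`_l.
  by apply/funext => o; rewrite /ch /charp big_enum.
elim: (enum U) l => [|u s IH] l.
  have -> : (fun o : point => (\prod_(u <- [::]) ('X - ((o u).+1%:R : rat)%:P))`_l) =
    if l == 0%N then 1 else 0.
    by apply/funext => o; rewrite big_nil coef1; case: (l == 0%N).
  by case: ifP => _; [exact: Laur1|exact: Laur0].
have -> : (fun o : point => (\prod_(u <- u :: s) ('X - ((o u).+1%:R : rat)%:P))`_l) =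
  (if l == 0%N then 0 else fun o => (\prod_(u <- s) ('X - ((o u).+1%:R : rat)%:P))`_l.-1)
  - xpow u 1 * (fun o => (\prod_(u <- s) ('X - ((o u).+1%:R : rat)%:P))`_l).
  apply/funext => o; rewrite lfunB lfunM big_cons mulrBl coefB coefXM coefCM /xpow expr1z.
  by case: (l == 0%N).
apply: LaurB; first by case: ifP => _; [exact: Laur0|exact: IH].
by apply: LaurM => //; exact: Laur_xpow.
Qed.

Let size_charp o : size (charp o) = m.+1.
Proof. by rewrite /charp -big_enum size_prod_XsubC -cardE. Qed.

Let ch_top o : ch m o = 1.
Proof.
have /monicP : charp o \is monic by apply: monic_prod => u _; exact: monicXsubC.
by rewrite lead_coefE size_charp.
Qed.

Let ch_root u o : u \in U -> \sum_(l < m.+1) xpow u l o * ch l o = 0.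
Proof.
move=> uU; have : (charp o).[(o u).+1%:R] = 0.
  by rewrite /charp horner_prod (bigD1 u) //= hornerXsubC subrr mul0r.
rewrite (@horner_coef_wide _ m.+1) => [E|]; last by rewrite size_charp.
by rewrite -[RHS]E; apply: eq_bigr => l _; rewrite mulrC.
Qed.

Lemma inv_ch0V : inv colU ch0V.
Proof.
split=> [|w /fixesP fw o].
  by apply: Laur_prod => u _; apply: LaurN; exact: Laur_xpow.
rewrite /ch0V !lfun_prod [RHS](reindex_inj (@perm_inj _ w)).
by apply: eq_big => u; rewrite ?fw.
Qed.
Let ch0VE o : ch 0 o * ch0V o = 1.
Proof.
rewrite /ch /ch0V -horner_coef0 /charp horner_prod lfun_prod -big_split big1 //= => u _.
by rewrite hornerXsubC sub0r lfunN mulrNN /xpow exprN1 divrr // coordU.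
Qed.

Variable K : lfun -> Prop.
Hypotheses (K1 : K 1) (KB : forall f g, K f -> K g -> K (f - g)).
Hypotheses (KM : forall f g, K f -> K g -> K (f * g)).
Hypotheses (Kch : forall l, K (ch l)) (Kch0V : K ch0V).

Let K0 : K 0. Proof. by rewrite -(subrr 1); exact: KB. Qed.
Let KN f : K f -> K (- f). Proof. by rewrite -sub0r; exact: KB. Qed.
Let KD f g : K f -> K g -> K (f + g). Proof. by move=> Kf Kg; rewrite -[g]opprK; apply: KB => //; exact: KN. Qed.

(** One formula for all the variables of [U] at once. The ring [K] of coefficients is abstract: it
    is a ring of invariants in [reduces_xpow_inv], and consists of the multipliers preserving
    generated submodules in [Laur_gen]. *)
Definition reduces (g : 'I_r -> lfun) := exists R : 'I_m -> lfun,
  (forall l, K (R l)) /\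
  forall u o, u \in U -> g u o = \sum_(l < m) xpow u l o * R l o.

Lemma reduces_sum I (s : seq I) (P : pred I) (c : I -> lfun) (g : I -> 'I_r -> lfun) :
  (forall i, P i -> K (c i)) -> (forall i, P i -> reduces (g i)) ->
  reduces (fun u => \sum_(i <- s | P i) g i u * c i).
Proof.
move=> ic rg; elim: s => [|i s [R [iR RE]]].
  exists (fun=> 0); split=> [l|u o _]; first exact: K0.
  by rewrite big_nil big1 // => l _; rewrite mulr0.
have [Pi|Pi] := boolP (P i); last first.
  by exists R; split=> // u o uU; rewrite big_cons (negPf Pi) RE.
have [R' [iR' RE']] := rg i Pi; exists (fun l => R' l * c i + R l); split=> [l|u o uU].
  by apply: KD => //; apply: KM => //; exact: ic.
rewrite big_cons Pi lfunD lfunM RE // RE' // mulr_suml -big_split; apply: eq_bigr => l _.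
by rewrite lfunD lfunM mulrDr mulrA.
Qed.

Lemma reduces_low (l : 'I_m) : reduces (fun u => xpow u l).
Proof.
exists (fun l' => if l' == l then 1 else 0); split=> [l'|u o uU].
  by case: ifP => _; [exact: K1|exact: K0].
by rewrite (bigD1 l) //= eqxx mulr1 big1 ?addr0 // => l' /negPf->; rewrite mulr0.
Qed.

(** Every variable of [U] is a root of [charp], which is monic with invertible constant coefficient,
    so powers can be reduced from above and from below. *)
Lemma reduces_xpow a : reduces (fun u => xpow u a).
Proof.
have [U0|[u0 u0U]] := set_0Vmem U.
  by exists (fun=> 0); split=> [l|u o]; [exact: K0|rewrite U0 inE].
have m0 : (0 < m)%N by apply/card_gt0P; exists u0.
have topE u o : u \in U -> xpow u m o = \sum_(l < m) xpow u l o * - ch l o.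
  move=> /(ch_root o); rewrite big_ord_recr /= ch_top mulr1 => /eqP.
  rewrite addrC addr_eq0 => /eqP->; rewrite -sumrN; apply: eq_bigr => l _.
  by rewrite mulrN.
have top : reduces (fun u => xpow u m).
  exists (fun l => - ch l); split=> [l|u o uU]; first by apply: KN.
  by rewrite topE.
have low (l : nat) : (l <= m)%N -> reduces (fun u => xpow u l).
  by rewrite leq_eqVlt => /orP[/eqP->//|lm]; exact: (reduces_low (Ordinal lm)).
have bot : reduces (fun u => xpow u (-1)).
  have [l _|l _|R [iR RE]] := @reduces_sum _ (index_enum 'I_m) xpredT
      (fun l => - (ch0V * ch l.+1)) (fun (l : 'I_m) u => xpow u l).
  - by apply: KN; apply: KM.
  - exact: reduces_low.
  exists R; split=> // u o uU; rewrite -RE // lfun_sum.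
  have := ch_root o uU; rewrite big_ord_recl /= => /eqP.
  rewrite addr_eq0 => /eqP E.
  have -> : xpow u (-1) o = xpow u (-1) o * (xpow u 0 o * ch 0 o) * ch0V o.
    by rewrite -!mulrA ch0VE mulr1 /xpow expr0z mulr1.
  rewrite E mulrN mulNr mulr_sumr mulr_suml -sumrN; apply: eq_bigr => l _.
  rewrite lfunM lfunN lfunM (_ : xpow u (bump 0 l) = xpow u 1 * xpow u l); last first.
    by rewrite -xpowD.
  rewrite lfunM !mulrA -[xpow u (-1) o * _]lfunM -xpowD addNr /xpow expr0z mul1r.
  by rewrite mulrN -!mulrA [ch _ o * _]mulrC.
have step b c : (forall l : 'I_m, reduces (fun u => xpow u (l%:Z + c))) ->
    reduces (fun u => xpow u b) -> reduces (fun u => xpow u (b + c)).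
  move=> lc [R [iR RE]].
  have [//|//|R' [iR' RE']] := @reduces_sum _ (index_enum 'I_m) xpredT R
      (fun (l : 'I_m) u => xpow u (l%:Z + c)).
  exists R'; split=> // u o uU.
  rewrite -RE' // xpowD lfunM RE // lfun_sum mulr_suml; apply: eq_bigr => l _.
  by rewrite lfunM xpowD lfunM mulrAC.
elim/int_rect: a => [|n IH|n IH].
- exact: (low 0%N).
- rewrite -addn1 PoszD; apply: step => // l.
  by rewrite -PoszD addn1; exact: low.
rewrite -addn1 PoszD opprD; apply: step => // l.
case: l => -[|l] lm /=; first by rewrite add0r.
by rewrite -addn1 PoszD addrK; apply: low; exact/ltnW/ltnW.
Qed.

End Reduction.

Lemma reduces_xpow_inv (U : {set 'I_r}) a :
  reduces U (inv (fun t => t \in U)) (fun u => xpow u a).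
Proof.
apply: reduces_xpow; [exact: inv1|exact: invB|exact: invM|exact: inv_ch|exact: inv_ch0V].
Qed.

Lemma lfunX (f : lfun) k o : (f ^+ k) o = f o ^+ k.
Proof. by elim: k => // k IH; rewrite !exprS lfunM IH. Qed.

Definition fdet k (M : 'I_k -> 'I_k -> lfun) : lfun :=
  \sum_(s : 'S_k) (-1) ^+ s * \prod_i M i (s i).

Lemma fdetE k (M : 'I_k -> 'I_k -> lfun) o : fdet M o = \det (\matrix_(i, j) M i j o).
Proof.
rewrite /fdet /determinant lfun_sum; apply: eq_bigr => s _.
rewrite lfunM lfunX lfun_prod; congr (_ * _).
by apply: eq_bigr => i _; rewrite mxE.
Qed.

Lemma inv_fdet (K : eqType) (c : 'I_r -> K) k (M : 'I_k -> 'I_k -> lfun) :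
  (forall i j, inv c (M i j)) -> inv c (fdet M).
Proof.
move=> iM; apply: inv_sum => s _; apply: invM; last by apply: inv_prod.
by rewrite -signr_odd; case: (odd _); [apply: invN|]; exact: inv1.
Qed.

Section Symmetric.
Variables (X : {set 'I_r}).
Local Notation k := #|X|.
Local Notation pos := (@enum_val _ (mem X)).
Local Notation colX := (fun t => t \in X).

Definition alt (e : 'I_k -> int) o : rat := \det (\matrix_(i, j) xpow (pos i) (e j) o).

Lemma alt_Vandermonde o : injective o -> alt (fun j => j) o != 0.
Proof.
move=> oI; pose a : 'rV[rat]_k := \row_j (o (pos j)).+1%:R.
have -> : alt (fun j => j) o = \det (Vandermonde k a).
  rewrite -det_tr; congr (\det _); apply/matrixP => i j; rewrite !mxE /xpow.
  by rewrite -exprnP.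
rewrite det_Vandermonde; apply/prodf_neq0 => i _; apply/prodf_neq0 => j ij.
rewrite !mxE subr_eq0 eqr_nat eqSS; apply: contraTneq ij => /oI/enum_val_inj->.
by rewrite ltnn.
Qed.

(** Instead of dividing polynomials, reduce all powers modulo [charp]: the matrix of powers is the
    Vandermonde matrix times a matrix of symmetric functions. The quotient is a Schur function when
    the exponents increase strictly and are nonnegative. *)
Lemma alt_divisible (e : 'I_k -> int) : exists s : lfun, inv colX s /\
  forall o, alt e o = alt (fun j => j) o * s o.
Proof.
have [R RP] := choice (reduces_xpow_inv X).
exists (fdet (fun l j => R (e j) l)); split.
  by apply: inv_fdet => l j; case: (RP (e j)) => [iR _].
move=> o; rewrite fdetE -det_mulmx; congr (\det _); apply/matrixP => i j.
rewrite !mxE (RP (e j)).2 ?enum_valP //; apply: eq_bigr => l _.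
by rewrite !mxE.
Qed.

Lemma symmetric_rep p : inv colX p -> depends (mem X) p ->
  exists (A : seq expo) (c : expo -> int), forall o,
    p o = \sum_(b <- A) (c b)%:~R * \prod_i xpow (pos i) (b (pos i)) o.
Proof.
move=> [/LaurST/LaurS_rep[A [c [_ _ _ E]]] _] dp; exists A, c => o.
have -> : p o = p (fun t => if t \in X then o t else 0%N).
  apply: dp => s sX; have sX' : s \in X by []. by rewrite sX'.
rewrite E; apply: eq_bigr => b _; congr (_ * _).
rewrite /mono (bigID (mem X)) /= mulrC big1 ?mul1r; last first.
  by move=> t /negPf->; rewrite exp1rz.
by rewrite big_enum_val; apply: eq_bigr => i _; rewrite /xpow enum_valP.
Qed.

(** In each term of the Vandermonde determinant, [p] may be written with its exponents permuted
    accordingly; the terms then reassemble into alternants. *)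
Lemma symmetric_alt p (A : seq expo) (c : expo -> int) : inv colX p ->
  (forall o, p o = \sum_(b <- A) (c b)%:~R * \prod_i xpow (pos i) (b (pos i)) o) ->
  forall o, p o * alt (fun j => j) o =
    \sum_(b <- A) (c b)%:~R * alt (fun j => b (pos j) + j) o.
Proof.
move=> ip pE o; have sym (s : 'S_k) : p o =
    \sum_(b <- A) (c b)%:~R * \prod_i xpow (pos i) (b (pos (s i))) o.
  pose f t := if [pick i | pos i == t] is Some i then pos (s^-1%g i) else t.
  have fE i : f (pos i) = pos (s^-1%g i).
    rewrite /f; case: pickP => [j /eqP/enum_val_inj->//|/(_ i)].
    by rewrite eqxx.
  have Xpos t : t \in X -> exists i, t = pos i.
    by move=> tX; exists (enum_rank_in tX t); rewrite enum_rankK_in.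
  have [|||w [wX wN]] := @ext_perm _ X X f.
  - move=> _ _ /Xpos[i ->] /Xpos[j ->]; rewrite !fE => /enum_val_inj/perm_inj->//.
  - by [].
  - by apply/fintype.subsetP => _ /imsetP[_ /Xpos[i ->] ->]; rewrite fE enum_valP.
  rewrite -(ip.2 w) => [|].
    rewrite pE; apply: eq_bigr => b _; congr (_ * _).
    rewrite (reindex_inj (@perm_inj _ s)); apply: eq_bigr => i _.
    by rewrite /xpow wX ?enum_valP // fE permK.
  apply/fixesP => t; have [tX|tX] := boolP (t \in X); last by rewrite wN // (negPf tX).
  by rewrite wX //; case: (Xpos t tX) => i ->; rewrite fE !enum_valP.
rewrite {1}/alt /determinant mulr_sumr.
under eq_bigr => s _ do rewrite mulrCA (sym s) mulr_suml.
under eq_bigr do rewrite mulr_sumr.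
rewrite exchange_big; apply: eq_bigr => b _ /=; rewrite /alt /determinant mulr_sumr.
apply: eq_bigr => s _; rewrite [RHS]mulrCA -!mulrA; congr (_ * (_ * _)).
rewrite -big_split; apply: eq_bigr => i _ /=; rewrite !mxE.
by rewrite [in RHS]xpowD lfunM.
Qed.

Definition expset m (S : {set 'I_m}) (j : 'I_k) : int :=
  nth 0%N [seq val i | i <- enum S] j.

Lemma alt_expset m (J : {ffun 'I_k -> 'I_m}) : exists eps : int,
  (eps != 0 -> #|J @: predT| == k) /\
  forall o, alt (fun j => (J j : nat)) o = eps%:~R * alt (expset (J @: predT)) o.
Proof.
have [/injectiveP JI|] := boolP (injectiveb J); last first.
  move=> /injectivePn[i [j ij Jij]]; exists 0; split=> [|o]; first by rewrite eqxx.
  rewrite mul0r /alt -det_tr; apply: (determinant_alternate ij) => l.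
  by rewrite !mxE Jij.
have cJ : #|J @: predT| = k by rewrite card_imset // card_ord.
set E := enum (J @: predT); have sE : size E = k by rewrite -cardE.
have JE j : J j \in E by rewrite mem_enum imset_f.
have idx j : (index (J j) E < k)%N by rewrite -[X in (_ < X)%N]sE index_mem.
have sI : injective (fun j => Ordinal (idx j)).
  move=> i j /(congr1 val) /= ij; apply: JI.
  by rewrite -(nth_index (J i) (JE i)) ij nth_index.
exists ((-1) ^+ perm sI); split=> [_|o]; first by rewrite cJ.
have -> : ((-1) ^+ perm sI)%:~R = (-1) ^+ (perm sI) :> rat by rewrite rmorphXn rmorphN1.
rewrite -det_perm mulrC /alt -[\det (perm_mx _)]det_tr -det_mulmx.
congr (\det _); apply/matrixP => i j; rewrite !mxE (bigD1 (perm sI j)) //= big1 ?addr0.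
  rewrite !mxE eqxx mulr1 /expset permE /= (nth_map (J j)) ?sE //.
  by rewrite nth_index.
by move=> l li; rewrite !mxE eq_sym (negPf li) mulr0.
Qed.

(** Multiply by the Vandermonde determinant. In the alternants that arise the powers are reduced
    below [m] over the invariants of [V], and multilinearity leaves, up to sign, alternants of
    exponent sets. The determinant is cancelled at injective points. *)
Lemma symmetric_span (V : {set 'I_r}) m (s : {set 'I_m} -> lfun) : #|V| = m ->
  X \subset V -> (forall S, Laur (s S)) ->
  (forall S o, alt (expset S) o = alt (fun j => j) o * s S o) ->
  forall p, inv colX p -> depends (mem X) p ->
  exists c : {set 'I_m} -> lfun, (forall S, inv (fun t => t \in V) (c S)) /\
    forall o, p o = \sum_(S : {set 'I_m} | #|S| == k) s S o * c S o.
Proof.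
move=> Vm; case: m / Vm s => s XV Ls sE p ip dp.
have [A [c pE]] := symmetric_rep ip dp.
have [R RP] := choice (reduces_xpow_inv V).
have [eps epsP] := choice (@alt_expset #|V|).
have altE e o : alt e o = \sum_(J : {ffun 'I_k -> 'I_#|V|})
    (\prod_j R (e j) (J j) o) * alt (fun j => (J j : nat)) o.
  rewrite {1}/alt -det_tr {1}/determinant.
  transitivity (\sum_(s : 'S_k) \sum_(J : {ffun 'I_k -> 'I_#|V|}) (-1) ^+ s *
      \prod_j (xpow (pos (s j)) (J j : nat) o * R (e j) (J j) o)).
    apply: eq_bigr => t _; rewrite -mulr_sumr; congr (_ * _).
    rewrite -(bigA_distr_bigA (fun j (l : 'I_#|V|) => xpow (pos (t j)) (l : nat) o * R (e j) l o)).
    apply: eq_bigr => j _; rewrite !mxE (RP (e j)).2 //.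
    by apply: (fintype.subsetP XV); rewrite enum_valP.
  rewrite exchange_big; apply: eq_bigr => J _; rewrite /alt -[in RHS]det_tr /determinant mulr_sumr.
  apply: eq_bigr => t _; rewrite big_split /= [RHS]mulrCA; congr (_ * _).
  rewrite [RHS]mulrC; congr (_ * _).
  by apply: eq_bigr => j _; rewrite !mxE.
pose C S : lfun := \sum_(b <- A) \sum_(J : {ffun 'I_k -> 'I_#|V|} | J @: predT == S)
  (\prod_j R (b (pos j) + j) (J j)) *~ (c b * eps J).
exists C; have iC S : inv (fun t => t \in V) (C S).
  apply: inv_sum => b _; apply: inv_sum => J _.
  apply: (inv_zspan (G := inv (fun t => t \in V))) => //; apply: zspanMz; apply: zspan_gen.
  by apply: inv_prod => j _; case: (RP (b (pos j) + j)).
split=> // o; apply/eqP; rewrite -subr_eq0; apply/eqP.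
pose f : lfun := p - \sum_(S : {set 'I_#|V|} | #|S| == k) s S * C S.
have fE o' : f o' = p o' - \sum_(S : {set 'I_#|V|} | #|S| == k) s S o' * C S o'.
  by rewrite /f lfunB lfun_sum.
rewrite -fE; suff -> : f = 0 by [].
apply: Laur_eq0 => [|o' oI].
  apply: LaurB; first exact: ip.1.
  by apply: Laur_sum => S _; apply: LaurM => //; case: (iC S).
have a0 := alt_Vandermonde oI; apply: (mulIf a0); rewrite mul0r fE mulrBl.
apply/eqP; rewrite subr_eq0; apply/eqP; rewrite (symmetric_alt ip pE) mulr_suml.
transitivity (\sum_(S : {set 'I_#|V|}) \sum_(b <- A) \sum_(J : {ffun 'I_k -> 'I_#|V|} | J @: predT == S)
    (c b * eps J)%:~R * (\prod_j R (b (pos j) + j) (J j) o') * alt (expset S) o').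
  rewrite exchange_big; apply: eq_bigr => b _ /=; rewrite altE mulr_sumr.
  rewrite (partition_big (fun J : {ffun 'I_k -> 'I_#|V|} => J @: predT) xpredT) //=.
  apply: eq_bigr => S _; apply: eq_bigr => J /eqP <-.
  rewrite (epsP J).2 intrM; ring.
rewrite (bigID (fun S : {set 'I_#|V|} => #|S| == k)) /= [X in _ + X]big1 ?addr0.
  apply: eq_bigr => S _; rewrite /C lfun_sum [s S o' * _]mulr_sumr mulr_suml; apply: eq_bigr => b _.
  rewrite lfun_sum [s S o' * _]mulr_sumr mulr_suml; apply: eq_bigr => J _.
  rewrite lfunMz lfun_prod sE -mulrzl; ring.
move=> S Sk; apply: big1 => b _; apply: big1 => J /eqP JS.
have [->|/(epsP J).1] := eqVneq (eps J) 0; first by rewrite mulr0 !mul0r.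
by rewrite JS (negPf Sk).
Qed.

End Symmetric.

Lemma Laur_act w (f : lfun) : Laur f -> Laur (fun o => f (fun t => o (w t))).
Proof.
move=> Lf; apply: (zspan_map (h := fun f : lfun => (fun o => f (fun t => o (w t))) : lfun) _ _ Lf).
- by [].
- by [].
move=> _ [a ->]; apply: zspan_gen; exists (actE w a).
by apply/funext => o; exact: mono_act.
Qed.

Lemma perm_out w (Z : {set 'I_r}) : (forall t, t \notin Z -> w t = t) ->
  forall t, (w t \in Z) = (t \in Z).
Proof.
move=> wN t; have [tZ|tZ] := boolP (t \in Z); last by rewrite wN // (negPf tZ).
by apply/negPn/negP => wZ; move: (wZ); rewrite (perm_inj (wN _ wZ)) tZ.
Qed.

(* If the values of the variables of Y occur among those of Z, the functions
   of X reduce to #|X| + #|Z| - #|Y| variables: those of X and the others of Z. *)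
Lemma reduce_block (X Z Y : {set 'I_r}) m : [disjoint X & Z] -> [disjoint X & Y] ->
  [disjoint Z & Y] -> (#|Y| <= #|Z|)%N -> m = (#|X| + #|Z| - #|Y|)%N ->
  exists s : {set 'I_m} -> lfun, (forall S, inv (fun t => t \in X) (s S)) /\
  forall p, inv (fun t => t \in X) p -> depends (mem X) p ->
  exists c : {set 'I_m} -> lfun,
    (forall S, inv (fun t => (t \in X :|: Z, t \in Y)) (c S)) /\
    forall o, (exists h : 'I_r -> 'I_r, {in Y &, injective h} /\
        forall t, t \in Y -> h t \in Z /\ o (h t) = o t) ->
      p o = \sum_(S : {set 'I_m} | #|S| == #|X|) s S o * c S o.
Proof.
move=> dXZ dXY dZY YZ mE.
have [s sP] := choice (fun S : {set 'I_m} => alt_divisible (@expset X m S)).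
exists s; split=> [S|p ip dp]; first by case: (sP S).
pose h0 t := nth t (enum Z) (index t (enum Y)).
have idxY t : t \in Y -> (index t (enum Y) < size (enum Z))%N.
  by move=> tY; apply: leq_trans (_ : #|Y| <= _)%N; rewrite ?cardE ?index_mem ?mem_enum // -!cardE.
have h0Z t : t \in Y -> h0 t \in Z by move=> tY; rewrite -mem_enum mem_nth // idxY.
have h0I : {in Y &, injective h0}.
  move=> t t' tY tY'; rewrite /h0 (set_nth_default t) ?idxY // => /eqP.
  rewrite nth_uniq ?idxY ?enum_uniq // => /eqP/(congr1 (nth t (enum Y))).
  by rewrite !nth_index ?mem_enum.
have h0YZ : h0 @: Y \subset Z by apply/fintype.subsetP => _ /imsetP[t tY ->]; exact: h0Z.
(* At a covered point the variables of [h0 @: Y] repeat those of [Y]; these are the variables that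
   are left. *)
pose V := (X :|: Z) :\: h0 @: Y.
have XV : X \subset V.
  apply/fintype.subsetP => t tX; rewrite inE inE tX andbT.
  by apply: contraTN tX => /(fintype.subsetP h0YZ) tZ; rewrite (disjointFl dXZ).
have cV : #|V| = m.
  have /finset.setIidPr e : h0 @: Y \subset X :|: Z by exact: fintype.subset_trans h0YZ (finset.subsetUr _ _).
  rewrite cardsD e.
  by rewrite cardsU (disjoint_setI0 dXZ) cards0 subn0 card_in_imset // mE.
have [c [ic pE]] := symmetric_span cV XV (fun S => (sP S).1.1) (fun S => (sP S).2) ip dp.
pose kap t := if t \in V then 0%N else if t \in h0 @: Y then 1%N else 2%N.
have [tau [tauY tauN]] : exists tau : 'S_r, (forall t, t \in Y -> tau (h0 t) = t) /\
    forall t, (tau t \in Y) = (t \in h0 @: Y).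
  pose g t := if t \in Y then h0 t else if [pick y in Y | h0 y == t] is Some y then y else t.
  have gY y : y \in Y -> g y = h0 y by rewrite /g => ->.
  have YN y : y \in Y -> h0 y \notin Y by move=> yY; rewrite (disjointFr dZY) // h0Z.
  have gE y : y \in Y -> g (h0 y) = y.
    move=> yY; rewrite /g (negPf (YN y yY)); case: pickP => [y' /andP[y'Y /eqP/h0I->//]|/(_ y)].
    by rewrite yY eqxx.
  pose D := Y :|: h0 @: Y.
  have DP t : t \in D -> exists2 y, y \in Y & t = y \/ t = h0 y.
    rewrite inE => /orP[tY|/imsetP[y yY ->]]; first by exists t => //; left.
    by exists y => //; right.
  have [|//||w [wD wN]] := @ext_perm _ D D g.
  - move=> _ _ /DP[y yY [->|->]] /DP[y' yY' [->|->]].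
    + by rewrite !gY // => /h0I->.
    + by rewrite (gY y) // (gE y') // => E; move: (YN y yY); rewrite E yY'.
    + by rewrite (gE y) // (gY y') // => E; move: (YN y' yY'); rewrite -E yY.
    by rewrite !gE // => ->.
  - apply/fintype.subsetP => _ /imsetP[_ /DP[y yY [->|->]] ->].
    + by rewrite gY // inE imset_f ?orbT.
    by rewrite gE // inE yY.
  have YD y : y \in Y -> y \in D by rewrite inE => ->.
  have h0D y : y \in Y -> h0 y \in D by move=> yY; rewrite inE imset_f ?orbT.
  exists w; split=> [t tY|t]; first by rewrite wD ?gE ?h0D.
  have [/DP[y yY [->|->]]|tD] := boolP (t \in D).
  - rewrite wD ?YD // gY // (negPf (YN y yY)); apply/esym/negbTE/negP => /(fintype.subsetP h0YZ).
    by rewrite (disjointFl dZY).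
  - by rewrite wD ?h0D // gE // yY imset_f.
  by move: (tD); rewrite wN // inE negb_or => /andP[/negPf-> /negPf->].
(* The coefficients are only symmetric in [V]. Splitting off the block [h0 @: Y] writes them through
   functions symmetric in [X :|: Z] and functions of [h0 @: Y]; [tau] rewrites the latter in the
   variables of [Y]. *)
have lift S : exists c' : lfun, inv (fun t => (t \in X :|: Z, t \in Y)) c' /\
  forall o o' : point, (forall t, t \in Y -> o' (h0 t) = o t) ->
    (exists2 w : 'S_r, (forall t, t \notin Z -> w t = t) & o' = fun t => o (w t)) ->
    c S o' = c' o.
  have iS : inv kap (c S).
    apply: inv_sub (ic S) => w /fixesP fw; apply/fixesP => t; have := fw t.
    by rewrite /kap; do 2 case: (_ \in V) => //; case: ifP => //; case: ifP.
  pose Q (g : lfun) := exists c' : lfun, inv (fun t => (t \in X :|: Z, t \in Y)) c' /\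
    forall o o' : point, (forall t, t \in Y -> o' (h0 t) = o t) ->
      (exists2 w : 'S_r, (forall t, t \notin Z -> w t = t) & o' = fun t => o (w t)) ->
      g o' = c' o.
  have H : splits kap 0%N 1%N (c S) by exact: inv_split iS.
  apply: (H Q).
  - by exists 0; split=> //; exact: inv0.
  - move=> f g [f' [jf fE]] [g' [jg gE]]; exists (f' - g'); split; first exact: invB.
    by move=> o o' h w; rewrite !lfunB (fE o o') // (gE o o').
  move=> _ [q [f [iq jf df ->]]].
  have mgE t : merge kap 0%N 1%N t = if t \in X :|: Z then 0%N else 2%N.
    rewrite /merge /kap /V [_ \in _ :\: _]inE; have [/(fintype.subsetP h0YZ) tZ|tY] /= := boolP (t \in h0 @: Y).
      by rewrite inE tZ orbT.
    by case: (t \in X :|: Z).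
  have kE t : (kap t == 1%N) = (t \in h0 @: Y).
    rewrite /kap; have [|/=] := boolP (t \in V); last by case: ifP.
    by rewrite inE => /andP[/negPf-> _].
  exists (q * (fun o => f (fun t => o (tau t)))); split.
    apply: invM.
      by apply: inv_sub iq => w /fixesP fw; apply/fixesP => t; rewrite !mgE; case: (fw t) => ->.
    split=> [|w /fixesP fw o]; first by apply: Laur_act; exact: jf.1.
    rewrite -[RHS](jf.2 (tau * w * tau^-1)%g).
      by congr (f _); apply/funext => t; rewrite !permM permKV.
    apply/fixesP => t; rewrite !kE -!tauN !permM permKV.
    by case: (fw (tau t)).
  move=> o o' oY [w wZ o'E]; rewrite !lfunM; congr (_ * _).
    rewrite o'E iq.2 //; apply/fixesP => t; rewrite !mgE !inE (perm_out wZ).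
    by have [//|tZ] := boolP (t \in Z); [rewrite !orbT|rewrite wZ].
  apply: df => t; rewrite /kap; case: ifP => // _; case: ifP => // /imsetP[y yY ->] _.
  by rewrite oY // tauY.
have [c' cP] := choice lift.
exists c'; split=> [S|o [h [hI hP]]]; first by case: (cP S).
have hY t : t \in h0 @: Y -> exists2 y, y \in Y & t = h0 y by move=> /imsetP[y]; exists y.
pose f t := if [pick y in Y | h0 y == t] is Some y then h y else t.
have fE y : y \in Y -> f (h0 y) = h y.
  move=> yY; rewrite /f; case: pickP => [y' /andP[y'Y /eqP/h0I->//]|/(_ y)].
  by rewrite yY eqxx.
(* The given covering [h] differs from the fixed [h0] by a permutation of [Z]. *)
have [|//||w [wY wN]] := @ext_perm _ (h0 @: Y) Z f.
- by move=> _ _ /hY[y yY ->] /hY[y' yY' ->]; rewrite !fE // => /hI->.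
- by apply/fintype.subsetP => _ /imsetP[_ /hY[y yY ->] ->]; rewrite fE //; case: (hP y yY).
have wX t : t \in X -> w t = t by move=> tX; rewrite wN // (disjointFr dXZ).
have -> : p o = p (fun t => o (w t)) by apply: dp => t tX; rewrite wX.
rewrite pE; apply: eq_bigr => S _; congr (_ * _).
  rewrite (sP S).1.2 //; apply/fixesP => t; have [tZ|tZ] := boolP (t \in Z); last by rewrite wN.
  by rewrite !(disjointFl dXZ) // perm_out.
apply: (cP S).2; last by exists w.
by move=> t tY; rewrite wY ?imset_f // fE //; case: (hP t tY).
Qed.

End Alternants.

(** * Reduction to Schur functions, block by block *)

Section Refine.
Variables n r : nat.
Local Notation point := (point r).
Local Notation lfun := (lfun r).
Local Notation W := (word r 'I_n).
Variables rho q : W.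
Implicit Types (o : point) (w : 'S_r) (i a : 'I_n).

Definition blockX i a : {set 'I_r} := [set t | (rho t == i) && (q t == a)].
Definition blockZ i a : {set 'I_r} := [set t | (rho t == i) && (q t < a)%N].
Definition blockY i a : {set 'I_r} := [set t | (rho t == i.+1 :> nat) && (q t <= a)%N].
(** The number of variables left after cancelling those of [Y]. In a column strict filling it counts
    the columns that [pattern] refers to, see [heights_size]. *)
Definition blockm i a : nat := (#|blockX i a| + #|blockZ i a| - #|blockY i a|)%N.

Definition natset m (P : pred nat) : {set 'I_m} := [set j : 'I_m | P j].

Variable S0 : vec r 'I_n -> Prop.
Hypotheses (S00 : S0 0) (S0B : forall u v, S0 u -> S0 v -> S0 (u - v)).
Hypothesis S0rel : forall u, relvec rho u -> S0 u.

Lemma leads_add f g : leads rho S0 q f -> leads rho S0 q g -> leads rho S0 q (f + g).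
Proof.
move=> lf lg; rewrite -[g]opprK -[- g]sub0r.
by do 2![apply: leadsB => //]; exact: leads0.
Qed.

Lemma leads_relvec f : leads rho (relvec rho (C := 'I_n)) q f -> leads rho S0 q f.
Proof. by move=> [u [Ru eu uq du]]; exists u; split=> //; exact: S0rel. Qed.

(** An instance of [leads_covered] for two consecutive rows. Below the last row there is nothing to
    cover, so there [f] itself vanishes. *)
Lemma leads_blocks i a f g :
  inv (fun t => (rho t, if t \in blockZ i a :|: blockY i a then None else Some (q t))) f ->
  (forall o, (exists h : 'I_r -> 'I_r, {in blockY i a &, injective h} /\
        forall t, t \in blockY i a -> h t \in blockZ i a /\ o (h t) = o t) -> f o = 0) ->
  inv (fun t => (rho t, q t)) g -> leads rho S0 q (f * g).
Proof.
move=> jf vf jg; have [ni|ni] := ltnP i.+1 n; last first.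
  have -> : f * g = 0; last exact: leads0.
  apply/funext => o; rewrite lfunM vf ?mul0r //; exists id; split=> // t.
  rewrite inE => /andP[/eqP ti _]; move: ni; rewrite leqNgt => /negP[].
  by rewrite -ti.
pose i1 := Ordinal ni; have i01 : (i < i1)%N by [].
have i10 : (i1 == i) = false by rewrite -val_eqE /= gtn_eqF.
have upE t : (kind_word rho q i i1 a t == inl true) = ((rho t == i) && (q t < a)%N).
  rewrite p0E; case: ifP => //; by case: ifP.
have lowE t : low rho i1 (kind_word rho q i i1 a) t = (t \in blockY i a).
  rewrite /low p0E inE -[rho t == i.+1 :> nat]/(rho t == i1).
  by have [->|//] := eqVneq (rho t) i1; rewrite i10 /=; case: ifP.
apply: leads_relvec; apply: (leads_covered (a0 := a) i01) => //.
  apply: inv_sub jf => w /fixesP fw; apply/fixesP => t.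
  have E s : (s \in blockZ i a :|: blockY i a) = active rho q i i1 a s.
    by rewrite /active lowE upE inE inE.
  by rewrite !E; exact: fw.
move=> o [h [hI hP]]; apply: vf; exists h; split=> [t t' tY tY'|t tY].
  by apply: hI; rewrite -topredE /= lowE.
have [|hh ho] := hP t; first by rewrite lowE.
by split=> //; move: hh; rewrite /high upE inE => /andP[_].
Qed.

(* If the variables of Y outnumber those of Z, no point is covered. *)
Lemma leads_uncoverable i a f : (#|blockZ i a| < #|blockY i a|)%N ->
  inv (fun t => (rho t, q t)) f -> leads rho S0 q f.
Proof.
move=> ZY jf; rewrite -[f]mul1r; apply: (@leads_blocks i a) => //; first exact: inv1.
move=> o [h [hI hP]]; exfalso; move: ZY; rewrite ltnNge => /negP; apply.
rewrite -(card_in_imset hI); apply: subset_leq_card; apply/fintype.subsetP => _ /imsetP[t tY ->].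
by case: (hP t tY).
Qed.

Hypothesis coverable : forall i a, (#|blockY i a| <= #|blockZ i a|)%N.

Definition block_basis (s : forall i a, {set 'I_(blockm i a)} -> lfun) :=
  (forall i a S, inv (fun t => t \in blockX i a) (s i a S)) /\
  forall i a p, inv (fun t => t \in blockX i a) p -> depends (mem (blockX i a)) p ->
  exists c : {set 'I_(blockm i a)} -> lfun,
    (forall S, inv (fun t => (t \in blockX i a :|: blockZ i a, t \in blockY i a)) (c S)) /\
    forall o, (exists h : 'I_r -> 'I_r, {in blockY i a &, injective h} /\
        forall t, t \in blockY i a -> h t \in blockZ i a /\ o (h t) = o t) ->
      p o = \sum_(S : {set 'I_(blockm i a)} | #|S| == #|blockX i a|) s i a S o * c S o.

Lemma block_basis_ex : exists s, block_basis s.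
Proof.
have dXZ i a : [disjoint blockX i a & blockZ i a].
  rewrite -setI_eq0; apply/eqP/setP => t; rewrite !inE.
  by case: eqP => //= _; case: eqP => //= ->; rewrite ltnn.
have dY i a (A : {set 'I_r}) : (forall t, t \in A -> rho t = i) -> [disjoint A & blockY i a].
  move=> Ai; rewrite -setI_eq0; apply/eqP/setP => t; rewrite !inE.
  have [/Ai->|//] := boolP (t \in A); by rewrite /= ltn_eqF.
have dXY i a : [disjoint blockX i a & blockY i a].
  by apply: dY => t; rewrite inE => /andP[/eqP].
have dZY i a : [disjoint blockZ i a & blockY i a].
  by apply: dY => t; rewrite inE => /andP[/eqP].
pose H i a := cid (reduce_block (dXZ i a) (dXY i a) (dZY i a) (coverable i a) (erefl (blockm i a))).
exists (fun i a => projT1 (H i a)); split=> [i a S|i a].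
  by case: (projT2 (H i a)).
by case: (projT2 (H i a)).
Qed.

Variables (s : forall i a, {set 'I_(blockm i a)} -> lfun).
Hypothesis sP : block_basis s.

(** Blocks are processed by increasing letter and, for one letter, from the top row down. When
    [(i, a)] is reached, the letters below [a] are merged in rows [i] and [i + 1], and the
    coefficients of [block_basis] are invariant for the next stage. *)
Definition key i a : nat := (a * n + i)%N.

Lemma ltn_key i a j b : (key j b < key i a)%N = (b < a)%N || (b == a) && (j < i)%N.
Proof.
rewrite /key -val_eqE /=; have := ltn_ord i; have := ltn_ord j.
move: (nat_of_ord i) (nat_of_ord j) (nat_of_ord a) (nat_of_ord b) => {}i {}j {}a {}b jn in_.
by apply/idP/idP; nia.
Qed.

Lemma key_surj N : (N < n * n)%N -> exists i a, key i a = N.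
Proof.
move=> Nn; have n0 : (0 < n)%N by case: (posnP n) Nn => // ->.
have hm : (N %% n < n)%N by rewrite ltn_mod.
have hd : (N %/ n < n)%N by rewrite ltn_divLR.
by exists (Ordinal hm), (Ordinal hd); rewrite /key /= -divn_eq.
Qed.

Lemma key_bound i a : (key i a < n * n)%N.
Proof. by rewrite /key; have := ltn_ord i; have := ltn_ord a; nia. Qed.

Lemma key_inj i a j b : key i a = key j b -> i = j /\ a = b.
Proof.
move=> e; have := ltn_key i a j b; have := ltn_key j b i a; rewrite e ltnn.
have [ab|ba|/val_inj->] := ltngtP (a : nat) (b : nat) => //.
by rewrite eqxx /= => /esym/negbT + /esym/negbT; have [|//|/val_inj->] := ltngtP (i : nat) j.
Qed.

Definition block_prod (P : 'I_n -> 'I_n -> pred nat) N : lfun :=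
  \prod_(ia : 'I_n * 'I_n | (key ia.1 ia.2 < N)%N) s (natset (blockm ia.1 ia.2) (P ia.1 ia.2)).

(* Merge the letters of the rows one at a time. *)
Definition stage N t := (rho t, if (key (rho t) (q t) < N)%N then None else Some (q t)).

Lemma leads_stage :
  (forall P, (forall i a, #|natset (blockm i a) (P i a)| = #|blockX i a|) ->
    forall g, inv rho g -> leads rho S0 q (g * block_prod P (n * n))) ->
  forall d N P f, (N + d = n * n)%N ->
    (forall i a, (key i a < N)%N -> #|natset (blockm i a) (P i a)| = #|blockX i a|) ->
    inv (stage N) f -> leads rho S0 q (f * block_prod P N).
Proof.
move=> top; elim=> [|d IH] N P f Nd PN jf.
  rewrite addn0 in Nd; rewrite Nd; apply: top => [i a|].
    by apply: PN; rewrite Nd key_bound.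
  apply: inv_sub jf => w /fixesP fw; apply/fixesP => t.
  by rewrite /stage Nd !key_bound fw.
have Nn : (N < n * n)%N by rewrite -Nd addnS ltnS leq_addr.
have [i [a ia]] := key_surj Nn.
have k12 : (i, None) != (i, Some a) by rewrite xpair_eqE andbF.
have keyX t : ((rho t == i) && (q t == a)) = (key (rho t) (q t) == N).
  apply/andP/eqP => [[/eqP-> /eqP->]//|]; rewrite -ia => /key_inj[-> ->].
  by rewrite !eqxx.
have stageX t : (stage N t == (i, Some a)) = (t \in blockX i a).
  rewrite /stage inE xpair_eqE keyX; case: ifP => [kN|kN].
    by rewrite andbF (ltn_eqF kN).
  by rewrite -keyX (_ : (Some (q t) == Some a) = (q t == a)).
have mergeE t : merge (stage N) (i, None) (i, Some a) t = stage N.+1 t.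
  rewrite /merge stageX inE keyX /stage [in RHS]ltnS [in RHS]leq_eqVlt.
  have [kN|//] := eqVneq (key (rho t) (q t)) N.
  by move/eqP: kN; rewrite -keyX => /andP[/eqP-> _].
have prodS P' : block_prod P' N.+1 = s (natset (blockm i a) (P' i a)) * block_prod P' N.
  rewrite /block_prod (bigD1 (i, a)) /= ?ia //; congr (_ * _); apply: eq_bigl => -[j b] /=.
  rewrite ltnS leq_eqVlt; case: eqP => [kN|kN] /=.
    rewrite kN ltnn; apply/negbTE; rewrite negbK xpair_eqE.
    have [-> ->] : j = i /\ b = a by apply: key_inj; rewrite kN ia.
    by rewrite !eqxx.
  case: (key j b < N)%N => //=; rewrite xpair_eqE; apply/negP => /andP[/eqP ji /eqP ba].
  by apply: kN; rewrite ji ba.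
have iprod P' N' : inv (fun t => (rho t, q t)) (block_prod P' N').
  apply: inv_prod => -[j b] _; apply: inv_sub (sP.1 j b _) => w /fixesP fw; apply/fixesP => t /=.
  by rewrite !inE; case: (fw t) => -> ->.
have stage_q k f' : inv (stage k) f' -> inv (fun t => (rho t, q t)) f'.
  by apply: inv_sub => w /fixesP fw; apply/fixesP => t; rewrite /stage; case: (fw t) => -> ->.
apply: (leads_zspan S00 S0B (G := fun g => exists Q p, [/\ inv (stage N.+1) Q,
   inv (fun t => t \in blockX i a) p, depends (mem (blockX i a)) p & g = Q * p * block_prod P N])); last first.
  apply: (zspan_map (h := fun f : lfun => f * block_prod P N) _ _ (inv_split k12 jf)).
  - by rewrite mul0r.
  - by move=> g h; rewrite mulrBl.
  move=> _ [Q [p [jQ jp dp ->]]]; apply: zspan_gen; exists Q, p; split=> //.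
  - by apply: inv_sub jQ => w /fixesP fw; apply/fixesP => t; rewrite !mergeE.
  - by apply: inv_sub jp => w /fixesP fw; apply/fixesP => t; rewrite !stageX.
  by move=> o o' oo; apply: dp => t; rewrite stageX; exact: oo.
move=> _ [Q [p [jQ jp dp ->]]]; have [c [ic cE]] := sP.2 i a p jp dp.
pose F S := s (S : {set 'I_(blockm i a)}) * c S.
pose T : lfun := \sum_(S : {set 'I_(blockm i a)} | #|S| == #|blockX i a|) F S.
have jc S : inv (stage N.+1) (c S).
  pose h (x : 'I_n * option 'I_n) := ((x.1 == i) && (x.2 == None),
    (x.1 == i.+1 :> nat) && ((x.2 == None) || (x.2 == Some a))).
  have hE t : (t \in blockX i a :|: blockZ i a, t \in blockY i a) = h (stage N.+1 t).
    have kE : (key (rho t) (q t) < N.+1)%N =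
        (rho t == i) && (q t == a) || ((q t < a)%N || (q t == a) && (rho t < i)%N).
      by rewrite ltnS leq_eqVlt -keyX -ia ltn_key.
    rewrite /h /stage kE !inE -andb_orr /=; congr (_, _).
      have [->|//] := eqVneq (rho t) i; rewrite ltnn andbF orbF /=.
      by case: (q t == a) => //=; case: (q t < a)%N.
    case: (eqVneq (rho t : nat) i.+1) => //= ti.
    have -> : (rho t == i) = false by rewrite -val_eqE /= ti gtn_eqF.
    have -> : (rho t < i)%N = false by rewrite ti ltnNge leqnSn.
    rewrite andbF orbF /= leq_eqVlt val_eqE orbC.
    by case: (q t < a)%N.
  by apply: inv_sub (ic S) => w /fixesP fw; apply/fixesP => t; rewrite !hE fw.
(* Since [p - T] vanishes at the covered points, its part is straightened away; in each term of [T]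
   a Schur function is split off from a coefficient of the next stage. *)
have -> : Q * p * block_prod P N = (p - T) * (Q * block_prod P N) + T * (Q * block_prod P N).
  by rewrite -mulrDl subrK mulrA (mulrC p).
apply: leads_add.
  apply: (@leads_blocks i a); last by apply: invM => //; exact: stage_q jQ.
    pose k t := (rho t, if t \in blockZ i a :|: blockY i a then None else Some (q t)).
    have rowY t : t \in blockY i a -> rho t == i = false.
      by rewrite inE => /andP[/eqP ti _]; rewrite -val_eqE /= ti gtn_eqF.
    have kX t : (t \in blockX i a) = ((k t).1 == i) && ((k t).2 == Some a).
      rewrite /k inE finset.in_setU; have [/rowY->//|_] := boolP (t \in blockY i a).
      rewrite orbF inE; case: (rho t == i) => //=; case: ifP => // qa.
      by rewrite -val_eqE /= ltn_eqF.
    have jX f' : inv (fun t => t \in blockX i a) f' -> inv k f'.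
      by apply: inv_sub => w /fixesP fw; apply/fixesP => t; rewrite !kX fw.
    apply: invB; first exact: jX.
    apply: inv_sum => S _; apply: invM; first by apply: jX; exact: sP.1.
    pose h (x : 'I_n * option 'I_n) := ((x.1 == i) && ((x.2 == None) || (x.2 == Some a)),
      (x.1 == i.+1 :> nat) && (x.2 == None)).
    have hE t : (t \in blockX i a :|: blockZ i a, t \in blockY i a) = h (k t).
      rewrite /h finset.in_setU kX /k /= !inE; congr (_, _).
        have [ti|//] := eqVneq (rho t) i; rewrite ti ltn_eqF //= orbF.
        by case: (q t < a)%N; rewrite ?orbT ?orbF.
      case: (eqVneq (rho t : nat) i.+1) => //= ti.
      have -> : (rho t == i) = false by rewrite -val_eqE /= ti gtn_eqF.
      by rewrite /=; case: (q t <= a)%N.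
    by apply: inv_sub (ic S) => w /fixesP fw; apply/fixesP => t; rewrite !hE; congr h; exact: fw.
  move=> o co; rewrite lfunB (cE o co) /T lfun_sum.
  by apply/eqP; rewrite subr_eq0; apply/eqP/eq_bigr.
rewrite /T mulr_suml; apply: (big_ind (leads rho S0 q)).
- exact: leads0.
- by move=> x y; exact: leads_add.
(* Record [S] as the pattern of the block [(i, a)]; the blocks treated before keep theirs. *)
move=> S /eqP cS; pose P' i' a' : pred nat := if (i', a') == (i, a) then (fun j => [exists j' in S, val j' == j]) else P i' a'.
have P'N : block_prod P' N = block_prod P N.
  apply: eq_bigr => -[j b] /= jb; rewrite /P' ifN // xpair_eqE.
  by apply: contraTN jb => /andP[/eqP-> /eqP->]; rewrite ia ltnn.
have P'S : natset (blockm i a) (P' i a) = S.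
  apply/setP => j; rewrite inE /P' eqxx /=; apply/existsP/idP => [[j' /andP[jS /eqP/val_inj<-]]//|jS].
  by exists j; rewrite jS eqxx.
have := IH N.+1 P' (Q * c S); rewrite prodS P'N P'S addSnnS Nd => /(_ erefl).
have -> : Q * c S * (s S * block_prod P N) = F S * (Q * block_prod P N).
  by rewrite /F; ring.
apply; last exact: invM.
move=> j b; rewrite ltnS leq_eqVlt => /orP[/eqP jb|jb].
  have [-> ->] : j = i /\ b = a by apply: key_inj; rewrite jb ia.
  by rewrite P'S.
rewrite /P' ifN ?PN // xpair_eqE.
by apply: contraTN jb => /andP[/eqP-> /eqP->]; rewrite ia ltnn.
Qed.

Theorem leads_refine :
  (forall P, (forall i a, #|natset (blockm i a) (P i a)| = #|blockX i a|) ->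
    forall g, inv rho g -> leads rho S0 q (g * block_prod P (n * n))) ->
  forall f, inv (fun t => (rho t, q t)) f -> leads rho S0 q f.
Proof.
move=> top f jf; have := @leads_stage top (n * n)%N 0%N (fun _ _ => xpred0) f.
rewrite /block_prod big1 ?mulr1 => [|//]; exact.
Qed.

End Refine.

(** * Column strict fillings *)

Lemma sum_index (T : eqType) (s : seq T) (F : nat -> nat) : uniq s ->
  (\sum_(c <- s) F (index c s) = \sum_(j < size s) F j)%N.
Proof.
case: s => [|x s] us; first by rewrite big_nil big_ord0.
by rewrite (big_nth x) big_mkord; apply: eq_bigr => j _; rewrite index_uniq.
Qed.

Section Columns.
Variables n r : nat.
Local Notation W := (word r 'I_n).
Variable rho : W.
Implicit Types (i : 'I_n) (c : 'I_r).

Let rowseq i := [seq t <- enum 'I_r | rho t == i].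

Let size_rowseq i : size (rowseq i) = cnt rho i.
Proof.
rewrite size_filter -sumn_count sumnE big_map big_enum /=; apply: eq_bigr => t _.
by [].
Qed.

Lemma cnt_le i : (cnt rho i <= r)%N.
Proof. by rewrite -size_rowseq -[X in (_ <= X)%N](size_enum_ord r) size_filter count_size. Qed.

Let mem_rowseq t : t \in rowseq (rho t).
Proof. by rewrite mem_filter eqxx mem_enum. Qed.

Let col_subproof t : (index t (rowseq (rho t)) < r)%N.
Proof. by apply: leq_trans (cnt_le (rho t)); rewrite -size_rowseq index_mem. Qed.

(** Listing each row by increasing position identifies the positions with the cells of a diagram
    whose row lengths are the content of [rho]. *)
Definition col t : 'I_r := Ordinal (col_subproof t).

Lemma col_lt t : (col t < cnt rho (rho t))%N.
Proof. by rewrite -size_rowseq index_mem. Qed.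

Lemma col_inj t t' : rho t = rho t' -> col t = col t' -> t = t'.
Proof.
move=> rt /(congr1 val) /=; rewrite -rt => /(congr1 (nth t (rowseq (rho t)))).
by rewrite !nth_index // rt.
Qed.

Lemma cell i c : (c < cnt rho i)%N -> exists2 t, rho t = i & col t = c.
Proof.
rewrite -size_rowseq => ci; pose t := nth c (rowseq i) c.
have : t \in rowseq i by rewrite mem_nth.
rewrite mem_filter => /andP[/eqP rt _]; exists t => //.
by apply: val_inj; rewrite /= rt index_uniq // filter_uniq // enum_uniq.
Qed.

Lemma cell_sum i c : (\sum_t ((rho t == i) && (col t == c)) = (c < cnt rho i))%N.
Proof.
have [/cell[t rt ct]|ci] := ltnP c (cnt rho i).
  rewrite (bigD1 t) //= rt ct !eqxx big1 // => t' tt'.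
  apply/eqP; rewrite eqb0; apply: contra tt' => /andP[/eqP rt' /eqP ct'].
  by apply/eqP; apply: col_inj; rewrite ?rt' ?ct'.
rewrite big1 // => t _; apply/eqP; rewrite eqb0; apply: contraTN ci => /andP[/eqP<- /eqP<-].
by rewrite -ltnNge col_lt.
Qed.

Lemma row_sum i (F : 'I_r -> nat) :
  (\sum_t (rho t == i) * F (col t) = \sum_(c : 'I_r) (c < cnt rho i) * F c)%N.
Proof.
transitivity (\sum_t \sum_(c : 'I_r) ((rho t == i) && (col t == c)) * F c)%N.
  apply: eq_bigr => t _; rewrite (bigD1 (col t)) //= eqxx andbT big1 ?addn0 // => c.
  by rewrite eq_sym => /negPf->; rewrite andbF.
by rewrite exchange_big; apply: eq_bigr => c _; rewrite -big_distrl /= cell_sum.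
Qed.

Lemma col_sum c (F : 'I_n -> nat) :
  (\sum_t (col t == c) * F (rho t) = \sum_(i : 'I_n) (c < cnt rho i) * F i)%N.
Proof.
transitivity (\sum_t \sum_(i : 'I_n) ((rho t == i) && (col t == c)) * F i)%N.
  apply: eq_bigr => t _; rewrite (bigD1 (rho t)) //= eqxx big1 ?addn0 // => i.
  by rewrite eq_sym => /negPf->.
by rewrite exchange_big; apply: eq_bigr => i _; rewrite -big_distrl /= cell_sum.
Qed.

Definition partition_word := forall i i' : 'I_n, i' = i.+1 :> nat -> (cnt rho i' <= cnt rho i)%N.

Definition colstrict (p : W) : bool :=
  [forall t, forall t', (col t == col t') && (rho t < rho t')%N ==> (p t < p t')%N].

Lemma colstrictP (p : W) :
  reflect (forall t t', col t = col t' -> (rho t < rho t')%N -> (p t < p t')%N) (colstrict p).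
Proof.
apply: (iffP forallP) => [H t t' ct rt|H t].
  by move: (H t) => /forallP/(_ t')/implyP; apply; rewrite ct eqxx.
by apply/forallP => t'; apply/implyP => /andP[/eqP ct]; exact: H.
Qed.

Hypothesis part : partition_word.

Lemma cnt_anti i i' : (i <= i')%N -> (cnt rho i' <= cnt rho i)%N.
Proof.
case: i' => i' ii' /=; elim: i' ii' => [|i' IH] ii'.
  by rewrite leqn0 => /eqP i0; rewrite (_ : Ordinal ii' = i) //; apply: val_inj.
rewrite leq_eqVlt => /orP[/eqP i0|]; first by rewrite (_ : Ordinal ii' = i) //; apply: val_inj.
rewrite ltnS => /(IH (ltnW ii')); apply: leq_trans; exact: part.
Qed.

Definition hgt c : nat := \sum_(i : 'I_n) (c < cnt rho i)%N.

Lemma hgt_le c : (hgt c <= n)%N.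
Proof. by rewrite -[X in (_ <= X)%N]card_ord -sum1_card; apply: leq_sum => i _; apply: leq_b1. Qed.

Lemma sum_ltn_gen m (k : nat) : (k <= m)%N -> (\sum_(i < m) (i < k) = k)%N.
Proof.
move=> kn; transitivity (\sum_(i < m | (i < k)%N) 1)%N; last first.
  by rewrite -(big_ord_widen _ (fun=> 1%N) kn) sum1_card card_ord.
by rewrite [RHS]big_mkcond; apply: eq_bigr => i _; case: (i < k)%N.
Qed.

Lemma sum_ltn (k : nat) : (k <= n)%N -> (\sum_(i < n) (i < k) = k)%N.
Proof. exact: sum_ltn_gen. Qed.

(** Conjugate partitions: the condition describes the same cell by its row length or by its column
    height. *)
Lemma hgtE i c : (c < cnt rho i)%N = (i < hgt c)%N.
Proof.
apply/idP/idP => [ci|].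
  rewrite -[X in (X <= _)%N](sum_ltn (ltn_ord i)); apply: leq_sum => i' _.
  by rewrite ltnS; case: (leqP i' i) => // ii'; rewrite (leq_trans ci (cnt_anti ii')).
apply: contraTT; rewrite -!leqNgt => ci.
rewrite -[X in (_ <= X)%N](sum_ltn (ltnW (ltn_ord i))); apply: leq_sum => i' _.
case: (ltnP i' i) => [_|/cnt_anti ii']; first exact: leq_b1.
by rewrite leqn0 eqb0 -leqNgt (leq_trans ii').
Qed.

Definition fill (p : W) (a : nat) c : nat := \sum_t ((col t == c) && (p t < a)%N).

(* The columns whose last letter at most a lies in row i; the pattern of p
   records which of them, from left to right, contain a in row i. *)
Definition pattern (p : W) (i a : 'I_n) : pred nat := fun j =>
  nth i.+1 [seq fill p a c | c <- enum 'I_r & fill p a.+1 c == i.+1] j == i.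

Section Fill.
Variable P : 'I_n -> 'I_n -> pred nat.

Let PN (i a : nat) : pred nat :=
  match insub i, insub a with Some i', Some a' => P i' a' | _, _ => xpred0 end.

Let PNE (i a : 'I_n) : PN i a = P i a.
Proof. by rewrite /PN !valK. Qed.

(** Here [H c] is the number of letters at most [a] in column [c]. By strictness only the last of
    them can be [a], and the pattern decides whether it is. Columns ending in the same row are
    numbered from left to right, as in [pattern]. *)
Let desc a (H : 'I_r -> nat) c : nat := if H c is i.+1 then
  i + ~~ PN i a (index c [seq c' <- enum 'I_r | H c' == i.+1]) else 0%N.

Fixpoint height_from (d : nat) : 'I_r -> nat := if d is d'.+1 then desc (n - d'.+1) (height_from d') else hgt.

Definition height (a : nat) : 'I_r -> nat := height_from (n - a).

Lemma height_top c : height n c = hgt c.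
Proof. by rewrite /height subnn. Qed.

Lemma height_rec a c : (a < n)%N -> height a c = desc a (height a.+1) c.
Proof.
by move=> an; rewrite /height -[(n - a)%N]subnSK //= subnSK // subKn // ltnW.
Qed.

Lemma height_step a c : (a < n)%N -> (height a c <= height a.+1 c)%N.
Proof.
move=> an; rewrite height_rec // /desc; case: (height _ c) => // i.
by rewrite -[X in (_ <= X)%N]addn1 leq_add2l leq_b1.
Qed.

Lemma height_step1 a c : (a < n)%N -> (height a.+1 c <= (height a c).+1)%N.
Proof.
move=> an; rewrite [height a c]height_rec // /desc; case: (height _ c) => // i.
by rewrite ltnS leq_addr.
Qed.

Lemma height_mono a b c : (a <= b <= n)%N -> (height a c <= height b c)%N.
Proof.
move=> /andP[]; elim: b => [|b IH]; first by rewrite leqn0 => /eqP->.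
rewrite leq_eqVlt => /orP[/eqP->//|ab] bn.
exact: leq_trans (IH ab (ltnW bn)) (height_step c bn).
Qed.

Lemma height_hgt a c : (a <= n)%N -> (height a c <= hgt c)%N.
Proof. by move=> an; rewrite -height_top; apply: height_mono; rewrite an leqnn. Qed.

(** The smallest [a] with [rho t < height a.+1 (col t)], written as a count because the heights
    increase with [a]. *)
Let word_of t : nat := \sum_(a < n) (height a.+1 (col t) <= rho t)%N.

Let word_of_lt0 t b : (b <= n)%N -> (height b (col t) <= rho t)%N -> (b <= word_of t)%N.
Proof.
move=> bn Hb; rewrite -[X in (X <= _)%N](sum_ltn bn); apply: leq_sum => a _.
case: ltnP => // ab; rewrite lt0b; apply: leq_trans Hb; apply: height_mono.
by rewrite ab.
Qed.

Let word_of_lt1 t b : (b.+1 <= n)%N -> (rho t < height b.+1 (col t))%N -> (word_of t <= b)%N.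
Proof.
move=> bn Hb; rewrite -[X in (_ <= X)%N](sum_ltn (ltnW bn)); apply: leq_sum => a _.
case: (ltnP a b) => ab; first exact: leq_b1.
rewrite leqn0 eqb0 -ltnNge; apply: leq_trans Hb _; apply: height_mono.
by rewrite ltnS ab ltn_ord.
Qed.

Let word_of_bound t : (word_of t < n)%N.
Proof.
have n0 : (0 < n)%N by apply: leq_ltn_trans (ltn_ord (rho t)).
rewrite -(prednK n0) ltnS; apply: word_of_lt1; rewrite prednK //.
by rewrite height_top -hgtE col_lt.
Qed.

Definition fill_word : W := [ffun t => Ordinal (word_of_bound t)].

Variable q : W.
Hypotheses (cov : forall i a, (#|blockY rho q i a| <= #|blockZ rho q i a|)%N)
  (PC : forall i a, #|natset (blockm rho q i a) (P i a)| = #|blockX rho q i a|).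

Let R (i a : nat) : nat := \sum_t ((rho t == i :> nat) && (q t < a)%N).

Let cardE (A : pred 'I_r) : #|[set t | A t]| = (\sum_t A t)%N.
Proof. by rewrite cardsE -sum1_card big_mkcond; apply: eq_bigr => t _; rewrite unfold_in; case: (A t). Qed.

Let RX (i a : 'I_n) : R i a.+1 = (R i a + #|blockX rho q i a|)%N.
Proof.
rewrite cardE -big_split; apply: eq_bigr => t _ /=; rewrite val_eqE.
case: (rho t == i) => //=; rewrite ltnS leq_eqVlt val_eqE.
by case: eqP => [->|_]; rewrite ?ltnn //= addn0.
Qed.

Let RZ (i a : 'I_n) : R i a = #|blockZ rho q i a|.
Proof. by rewrite cardE; apply: eq_bigr => t _; rewrite val_eqE. Qed.

Let RY (i a : 'I_n) : R i.+1 a.+1 = #|blockY rho q i a|.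
Proof. by rewrite cardE. Qed.

Let heights_size_aux (i a : 'I_n) : (forall i' : nat, \sum_c (i' < height a.+1 c) = R i' a.+1)%N ->
  size [seq c <- enum 'I_r | height a.+1 c == i.+1] = blockm rho q i a.
Proof.
move=> IH; set s := filter _ _.
have e : (\sum_c (i < height a.+1 c) = size s + \sum_c (i.+1 < height a.+1 c))%N.
  rewrite size_filter -sumn_count sumnE big_map big_enum /= -big_split.
  by apply: eq_bigr => c _ /=; case: (ltngtP i.+1); rewrite ?addn0 ?addn1.
move: e; rewrite !IH RX RZ RY /blockm.
by move: (cov i a); lia.
Qed.

(** Descending induction on the letter: of the [blockm] columns that end in row [i], the pattern
    shortens as many as [q] has letters [a] in that row. Hence the filling has the same letters as
    [q] in every row. *)
Let count_heights a (i : nat) : (a <= n)%N -> (\sum_c (i < height a c) = R i a)%N.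
Proof.
move=> an; rewrite -(subKn an); move: (leq_subr a n); set d := (n - a)%N.
elim: d i => [|d IH] i dn.
  rewrite subn0; have [ni|ni] := ltnP i n; last first.
    rewrite big1 => [|c _]; last by rewrite height_top ltnNge (leq_trans (hgt_le c)).
    apply/esym/big1 => t _; rewrite (_ : (rho t == i :> nat) = false) //.
    by apply/negbTE; rewrite neq_ltn (leq_trans (ltn_ord _) ni).
  transitivity (\sum_(c < r) (c < cnt rho (Ordinal ni)))%N.
    by apply: eq_bigr => c _; rewrite height_top hgtE.
  rewrite sum_ltn_gen; last exact: cnt_le.
  by apply: eq_bigr => t _; rewrite ltn_ord andbT.
set b := (n - d.+1)%N; have bn : (b < n)%N by rewrite /b; lia.
have bE : b.+1 = (n - d)%N by rewrite /b; lia.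
have IH' (i' : nat) : (\sum_c (i' < height b.+1 c) = R i' b.+1)%N by rewrite bE; apply: IH; lia.
have [ni|ni] := ltnP i n; last first.
  rewrite big1 => [|c _]; last by rewrite ltnNge (leq_trans (height_hgt c (ltnW bn))) // (leq_trans (hgt_le c)).
  apply/esym/big1 => t _; rewrite (_ : (rho t == i :> nat) = false) //.
  by apply/negbTE; rewrite neq_ltn (leq_trans (ltn_ord _) ni).
pose oi := Ordinal ni; pose ob := Ordinal bn.
pose s := [seq c <- enum 'I_r | height b.+1 c == i.+1].
have sizes : size s = blockm rho q oi ob by exact: (@heights_size_aux oi ob IH').
apply: (@addIn (\sum_(j < size s) P oi ob j)%N).
transitivity (\sum_c (i < height b.+1 c))%N; last first.
  rewrite IH' (RX oi ob) -(PC oi ob) sizes; congr (_ + _)%N.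
  rewrite /natset cardsE -sum1_card big_mkcond; apply: eq_bigr => j _.
  by rewrite unfold_in; case: (P _ _ j).
transitivity (\sum_c (i < height b c) + \sum_(c <- s) P oi ob (index c s))%N.
  congr (_ + _)%N; rewrite (sum_index (fun j => nat_of_bool (P oi ob j))) //.
  by rewrite filter_uniq // enum_uniq.
rewrite big_filter big_enum_cond [X in (_ + X)%N]big_mkcond -big_split; apply: eq_bigr => c _ /=.
rewrite [height b c]height_rec // /desc -/s; case E: (height b.+1 c) => [|k] /=; first by [].
have [ki|ki] := eqVneq k.+1 i.+1; last first.
  rewrite addn0; congr nat_of_bool; case: (PN _ _ _); rewrite ?addn0 ?addn1 //= ltnS.
  by move: ki; rewrite eqSS; case: ltngtP.
case: ki => ->; rewrite (PNE oi ob).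
by case: (P oi ob _); rewrite ?addn0 ?addn1 ?ltnn ?ltnSn.
Qed.

Lemma heights_size (i a : 'I_n) :
  size [seq c <- enum 'I_r | height a.+1 c == i.+1] = blockm rho q i a.
Proof. by apply: heights_size_aux => i'; exact: count_heights. Qed.

Let height0 c : height 0 c = 0%N.
Proof.
have : R 0 0 = 0%N by apply: big1 => t _; rewrite andbF.
rewrite -count_heights // => /eqP; rewrite sum_nat_eq0 => /forallP/(_ c).
by rewrite eqb0 -leqNgt leqn0 => /eqP.
Qed.

Lemma fill_word_lt t (b : nat) : (b <= n)%N -> (fill_word t < b)%N = (rho t < height b (col t))%N.
Proof.
move=> bn; rewrite ffunE /=; apply/idP/idP => [|h].
  by apply: contraTT; rewrite -!leqNgt; exact: word_of_lt0.
by case: b bn h => [|b] bn h; [rewrite height0 in h|rewrite ltnS word_of_lt1].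
Qed.

Lemma fill_word_colstrict : colstrict fill_word.
Proof.
apply/colstrictP => t t' ct rt; rewrite fill_word_lt ?(ltnW (ltn_ord _)) // ct.
have bn := ltn_ord (fill_word t').
have : (rho t' < height (fill_word t').+1 (col t'))%N by rewrite -fill_word_lt.
by move/leq_trans/(_ (height_step1 _ bn)); rewrite ltnS; exact: leq_trans.
Qed.

Lemma fill_word_req : req rho fill_word q.
Proof.
have RR (x : W) (i a : 'I_n) : (rcnt rho x i a + \sum_t ((rho t == i) && (x t < a)%N) =
    \sum_t ((rho t == i) && (x t < a.+1)%N))%N.
  rewrite -big_split; apply: eq_bigr => t _ /=; case: (rho t == i) => //=.
  have -> : (x t < a.+1)%N = (x t == a) || (x t < a)%N by rewrite ltnS leq_eqVlt.
  by case: eqP => [->|_]; rewrite ?ltnn.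
have RE (i : 'I_n) b : (b <= n)%N -> (\sum_t ((rho t == i) && (fill_word t < b)%N) =
    \sum_t ((rho t == i) && (q t < b)%N))%N.
  move=> bn; transitivity (R i b); last by apply: eq_bigr => t _; rewrite val_eqE.
  rewrite -count_heights //.
  transitivity (\sum_t (rho t == i) * (i < height b (col t)))%N.
    by apply: eq_bigr => t _; rewrite fill_word_lt //; case: eqP => //= ->; rewrite mul1n.
  rewrite (row_sum i (fun c => nat_of_bool (i < height b c)%N)); apply: eq_bigr => c _.
  rewrite hgtE; case: (ltnP i (height b c)) => [h|_]; last by rewrite muln0.
  by rewrite (leq_trans h (height_hgt _ bn)).
move=> i a; have := RR fill_word i a; rewrite !RE ?(ltn_ord a) // ?(ltnW (ltn_ord a)) //.
by rewrite -RR => /addIn.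
Qed.

Lemma fillE b c : (b <= n)%N -> fill fill_word b c = height b c.
Proof.
move=> bn; transitivity (\sum_t (col t == c) * (rho t < height b c))%N.
  by apply: eq_bigr => t _; rewrite fill_word_lt //; case: eqP => //= ->; rewrite mul1n.
rewrite (col_sum c (fun i => nat_of_bool (i < height b c)%N)) -[RHS](@sum_ltn_gen n).
  apply: eq_bigr => i _; rewrite hgtE; case: (ltnP i (height b c)) => [h|_]; last by rewrite muln0.
  by rewrite (leq_trans h (height_hgt _ bn)).
exact: leq_trans (height_hgt _ bn) (hgt_le c).
Qed.

Lemma fill_word_pattern i a :
  natset (blockm rho q i a) (pattern fill_word i a) = natset (blockm rho q i a) (P i a).
Proof.
apply/setP => j; rewrite !inE /pattern.
have -> : [seq fill fill_word a c | c <- enum 'I_r & fill fill_word a.+1 c == i.+1] =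
  [seq height a c | c <- enum 'I_r & height a.+1 c == i.+1].
  rewrite (eq_filter (a2 := fun c => height a.+1 c == i.+1)) => [|c]; last by rewrite fillE.
  by apply: eq_map => c; rewrite fillE // ltnW.
have js : (j < size [seq c <- enum 'I_r | height a.+1 c == i.+1])%N.
  by rewrite heights_size.
have c0 : 'I_r by case: (enum 'I_r) js => // c.
rewrite (nth_map c0) // height_rec // /desc.
set c := nth c0 _ j; have : c \in [seq c <- enum 'I_r | height a.+1 c == i.+1] by rewrite mem_nth.
rewrite mem_filter => /andP[/eqP -> _]; rewrite PNE index_uniq ?filter_uniq ?enum_uniq //.
  by case: (P i a j); rewrite ?addn0 ?addn1 ?eqxx // gtn_eqF.
by rewrite -enumT enum_uniq.
Qed.

End Fill.

Local Notation lfun := (lfun r).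
Local Notation point := (point r).

Definition coverable (q : W) : bool :=
  [forall i, forall a, #|blockY rho q i a| <= #|blockZ rho q i a|]%N.

Lemma coverableP q : reflect (forall i a, (#|blockY rho q i a| <= #|blockZ rho q i a|)%N) (coverable q).
Proof.
by apply: (iffP forallP) => [H i a|H i]; [have /forallP := H i|apply/forallP]; exact.
Qed.

Let bases q : exists s, coverable q -> @block_basis n r rho q s.
Proof.
have [/coverableP/block_basis_ex[s sP]|_] := boolP (coverable q); first by exists s.
by exists (fun _ _ _ => 0).
Qed.

Let sbase q := projT1 (cid (bases q)).
Arguments sbase : clear implicits.
Let sbaseP q : coverable q -> @block_basis n r rho q (sbase q).
Proof. exact: (projT2 (cid (bases q))). Qed.

(** A canonical word in the orbit, so that the Schur functions chosen for [q] depend on the orbit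
    only. *)
Let rep (q : W) : W :=
  choose (fun q' : W => [forall i, forall a, rcnt rho q' i a == rcnt rho q i a]) q.

Let repP q : req rho (rep q) q.
Proof.
have := @chooseP _ (fun q' : W => [forall i, forall a, rcnt rho q' i a == rcnt rho q i a]) q.
have -> : [forall i, forall a, rcnt rho q i a == rcnt rho q i a].
  by apply/forallP => i; apply/forallP.
by move=> /(_ isT) /forallP H i a; have /forallP/(_ a)/eqP := H i.
Qed.

Let rep_eq q q' : req rho q q' -> rep q = rep q'.
Proof.
move=> qq'; rewrite /rep (@eq_choose _ _ (fun x : W => [forall i, forall a, rcnt rho x i a == rcnt rho q' i a])).
  apply: choose_id; apply/forallP => i; apply/forallP => a; by rewrite ?qq'.
by move=> x; apply: eq_forallb => i; apply: eq_forallb => a; rewrite qq'.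
Qed.

(** The filling [p] enters twice: its orbit gives the word at which the vector lives, its pattern
    the Schur function in each block. *)
Definition basisvec (p : W) : vec r 'I_n :=
  if coverable (rep p) then orbvec rho (rep p) (@block_prod n r rho (rep p) (sbase (rep p)) (pattern p) (n * n))
  else 0.

Let block_prod_inv q P N : coverable q -> inv (fun t => (q t, rho t)) (@block_prod n r rho q (sbase q) P N).
Proof.
move=> cq; apply: inv_prod => -[j b] _; apply: inv_sub ((sbaseP cq).1 j b _) => w /fixesP fw.
by apply/fixesP => t /=; rewrite !inE; case: (fw t) => -> ->.
Qed.

Lemma basisvec_eqvec p : eqvec rho (basisvec p).
Proof.
rewrite /basisvec; case: ifP => cq; last exact: eqvec0.
by apply: orbvec_eqvec; exact: block_prod_inv.
Qed.

Definition spanned (u : vec r 'I_n) := exists c : W -> lfun, (forall p, inv rho (c p)) /\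
  relvec rho (u - (fun q => \sum_(p | colstrict p) basisvec p q * c p)).

Lemma leads_act S w q f : fixes rho w -> leads rho S q (fun o => f (oact w o)) ->
  leads rho S (pact w q) f.
Proof.
move=> rw [u [Su eu uq du]]; exists u; split=> //.
  by apply/funext => o; rewrite -[o in LHS](oactKV w) eu.2 // uq oactKV.
have e q' i a : rcnt rho q' i a = rcnt rho q i a -> rcnt rho q' i a = rcnt rho (pact w q) i a.
  by rewrite rcnt_act.
move=> q' /du[h|[a [i [h1 h2 h3]]]]; [left=> i a|right; exists a, i]; rewrite ?rcnt_act //.
by split=> [b j ab|j ji|]; rewrite ?rcnt_act //; auto.
Qed.

(** The spanned vectors form a subgroup that contains the relations, so leading coefficients
    suffice. Those at words that are not coverable are leading coefficients of relations; the others
    reduce to products of Schur functions. *)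
Theorem spanning u : eqvec rho u -> spanned u.
Proof.
move: u; have S0 : spanned 0.
  exists (fun=> 0); split=> [p|]; first exact: inv0.
  suff -> : (0 : vec r 'I_n) - (fun q => \sum_(p | colstrict p) basisvec p q * 0) = 0 by exact: zspan0.
  by apply/funext => q; rewrite vecB big1 ?subrr // => p _; rewrite mulr0.
have SB u v : spanned u -> spanned v -> spanned (u - v).
  move=> [c [ic Rc]] [d [jd Rd]]; exists (fun p => c p - d p); split=> [p|].
    exact: invB.
  suff -> : u - v - (fun q => \sum_(p | colstrict p) basisvec p q * (c p - d p)) =
    (u - (fun q => \sum_(p | colstrict p) basisvec p q * c p)) -
    (v - (fun q => \sum_(p | colstrict p) basisvec p q * d p)) by exact: zspanB.
  apply/funext => q; rewrite !vecB.
  under eq_bigr do rewrite mulrBr.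
  by rewrite sumrB; ring.
have SR u : relvec rho u -> spanned u.
  move=> Ru; exists (fun=> 0); split=> [p|]; first exact: inv0.
  suff -> : u - (fun q => \sum_(p | colstrict p) basisvec p q * 0) = u by [].
  by apply/funext => q; rewrite vecB big1 ?subr0 // => p _; rewrite mulr0.
apply: leads_all => // q f jf.
have [cq|] := boolP (coverable q); last first.
  rewrite negb_forall => /existsP[i]; rewrite negb_forall => /existsP[a]; rewrite -ltnNge => YZ.
  by apply: leads_uncoverable YZ jf.
have [w [rw qE]] := req_orbit (repP q); rewrite qE in jf *.
set q0 := rep q in qE jf *.
apply: leads_act => //.
have cq0 : coverable q0.
  apply/coverableP => i a; move/coverableP/(_ i a): cq; rewrite qE.
  suff E (A : W -> pred 'I_r) : (forall t, A (pact w q0) t = A q0 (w t)) ->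
      #|[set t | A (pact w q0) t]| = #|[set t | A q0 t]|.
    rewrite /blockY /blockZ (E (fun x t => (rho t == i.+1 :> nat) && (x t <= a)%N)) => [|t].
      by rewrite (E (fun x t => (rho t == i) && (x t < a)%N)) // => t; rewrite pactE; move/fixesP: rw => ->.
    by rewrite pactE; move/fixesP: rw => ->.
  move=> AE; rewrite -[RHS](card_imset _ (@perm_inj _ w^-1%g)); congr #|pred_of_set _|.
  apply/setP => t; rewrite inE AE; apply/idP/imsetP => [At|[t' + ->]].
    by exists (w t); rewrite ?inE // permK.
  by rewrite inE permKV.
have bq := sbaseP cq0.
apply: (leads_refine S0 SB SR bq) => [P PC g ig|].
  (* The pattern left by the refinement is that of a column strict filling in the orbit of [q0], so
     the product is the leading coefficient of its basis vector. *)
  pose p := fill_word P; have pq : req rho p q0 by exact: fill_word_req (elimT (coverableP q0) cq0) PC.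
  have rp : rep p = q0 by rewrite (rep_eq pq) (rep_eq (repP q)).
  have fE : @block_prod n r rho q0 (sbase q0) (pattern p) (n * n) = @block_prod n r rho q0 (sbase q0) P (n * n).
    apply: eq_bigr => -[i a] _ /=; congr (sbase _ _ _ _).
      exact: (fill_word_pattern (elimT (coverableP q0) cq0) PC).
  have vE : basisvec p = orbvec rho q0 (@block_prod n r rho q0 (sbase q0) P (n * n)).
    by rewrite /basisvec rp cq0 fE.
  have ib := block_prod_inv P (n * n) cq0.
  exists (fun q' => basisvec p q' * g); split.
  - exists (fun p' => if p' == p then g else 0); split=> [p'|].
      by case: ifP => _ //; exact: inv0.
    suff -> : (fun q' => basisvec p q' * g) - (fun q' => \sum_(p' | colstrict p') basisvec p' q' * (if p' == p then g else 0)) = (0 : vec r 'I_n) by exact: zspan0.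
    apply/funext => q'; rewrite vecB (bigD1 p) ?eqxx /= ?big1 ?addr0 ?subrr //.
      by move=> p' /andP[_ /negPf->]; rewrite mulr0.
    exact: fill_word_colstrict (elimT (coverableP q0) cq0) PC.
  - by apply: eqvec_scale => //; exact: basisvec_eqvec.
  - by rewrite vE orbvec_lc // mulrC.
  move=> q' nz; left; apply: contrapT => nr; apply: nz; rewrite vE.
  apply/funext => o; rewrite lfunM; case: (orbvec_supp rho q0 q' (@block_prod n r rho q0 (sbase q0) P (n * n)) o) => [->|[w' [rw' q'E _]]].
    by rewrite mul0r.
  by case: nr => i a; rewrite q'E rcnt_act.
split=> [|w' /fixesP fw o]; first by have := Laur_act w jf.1.
rewrite -[RHS](jf.2 (w * w' * w^-1)%g).
  congr (f _); apply/funext => t; rewrite /oact !permM; congr (o _).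
  by rewrite permKV.
apply/fixesP => t; move/fixesP: rw => rw; rewrite !ffunE !permM permKV.
case: (fw (w t)) => _ ->; congr (_, _).
by rewrite -rw permKV; case: (fw (w t)) => -> _; rewrite rw.
Qed.

End Columns.

(** * Antisymmetrization over the columns *)

Section Independence.
Variables n r : nat.
Local Notation W := (word r 'I_n).
Local Notation lfun := (lfun r).
Local Notation point := (point r).
Variable rho : W.
Implicit Types (i : 'I_n) (c : 'I_r) (o : point).

(** For the largest letter, [blockY] is the whole longer row [i'], which cannot be covered by the
    shorter row [i]. *)
Lemma nonpartition_relvec i i' u : i' = i.+1 :> nat -> (cnt rho i < cnt rho i')%N ->
  eqvec rho u -> relvec rho (u : vec r 'I_n).
Proof.
move=> ii' lt; have zB := @zspanB (vec r 'I_n); apply: leads_all => //; first exact: zB.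
move=> q f jf; have n0 : (0 < n)%N by apply: leq_ltn_trans (ltn_ord i).
pose a := Ordinal (eq_ind_r (fun x => (x <= n)%N) (leqnn n) (prednK n0)).
have alla (b : 'I_n) : (b <= a)%N by rewrite -ltnS /= prednK.
apply: (@leads_uncoverable n r rho q _ _ _ i a f) => //.
have cE (A : pred 'I_r) : #|[set t | A t]| = (\sum_t A t)%N.
  by rewrite cardsE -sum1_card big_mkcond; apply: eq_bigr => t _; rewrite unfold_in; case: (A t).
rewrite /blockY /blockZ !cE; apply: leq_trans (_ : cnt rho i' <= _)%N.
  apply: leq_ltn_trans lt; apply: leq_sum => t _.
  by case: (rho t == i) => //=; exact: leq_b1.
by apply: leq_sum => t _; rewrite alla andbT -ii' val_eqE.
Qed.

Lemma lfunMn (f : lfun) k o : (f *+ k) o = f o *+ k.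
Proof. by elim: k => [|k IH]; rewrite ?mulr0n // !mulrS lfunD IH. Qed.

Local Notation col := (col rho).
Definition colperm : pred 'S_r := fixes col.
Definition colconst o := forall t t', col t = col t' -> o t = o t'.

Lemma colconst_act o w : colconst o -> colperm w -> oact w o = o.
Proof. by move=> co /fixesP cw; apply/funext => t; apply: co; rewrite cw. Qed.

(** The column antisymmetrizer, acting on words but not on variables; it is meant for column
    constant points, where this makes no difference. *)
Definition antisym o (u : vec r 'I_n) (q : W) : rat :=
  \sum_(w : 'S_r | colperm w) (-1) ^+ w * u (pact w q) o.

Lemma antisym0 o q : antisym o 0 q = 0.
Proof. by apply: big1 => w _; rewrite mulr0. Qed.

Lemma antisymB o u v q : antisym o (u - v) q = antisym o u q - antisym o v q.
Proof. by rewrite /antisym -sumrB; apply: eq_bigr => w _; rewrite mulrBr. Qed.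

Lemma antisym_act o u q w : colperm w -> antisym o u (pact w q) = (-1) ^+ w * antisym o u q.
Proof.
move=> cw; rewrite /antisym mulr_sumr.
rewrite [RHS](reindex_inj (mulIg w)) /=; apply: eq_big => [v|v cv].
  apply/idP/idP => cv; first exact: fixesM.
  by rewrite -[v](mulgK w); apply: fixesM => //; exact: fixesV.
rewrite pactM odd_permM; case: (odd_perm v); case: (odd_perm w); rewrite /= ?expr0 ?expr1; ring.
Qed.

Lemma antisym_eq0 o u (q : W) t t' : t != t' -> col t = col t' -> q t = q t' -> antisym o u q = 0.
Proof.
move=> tt' ct qt; have := @antisym_act o u q (tperm t t') _.
have -> : pact (tperm t t') q = q.
  by apply/ffunP => x; rewrite ffunE; case: tpermP => [->|->|].
rewrite odd_tperm tt' expr1 mulN1r => H.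
have {}H : antisym o u q = - antisym o u q.
  by apply: H; apply/fixesP => x; case: tpermP => [->|->|].
by move: H; set y := antisym _ _ _; lra.
Qed.

Hypothesis part : partition_word rho.

(** With distinct letters, a column holds at most as many letters up to [j] as in [rho], namely the
    minimum of its height and [j + 1]. Summed over the columns, this contradicts the first
    discrepancy of the contents. *)
Lemma lexgt_repeat (s : W) : lexgt s rho -> exists t t', [/\ t != t', col t = col t' & s t = s t'].
Proof.
move=> gt; apply: contrapT => no.
have inj t t' : col t = col t' -> s t = s t' -> t = t'.
  by move=> ct st; apply/eqP/negPn/negP => tt'; apply: no; exists t, t'.
move: gt => /existsP[j /andP[/forallP eqj]]; apply/negP; rewrite -leqNgt.
have tot (x : W) : (\sum_t (x t <= j)%N = \sum_(a : 'I_n | (a < j)%N) cnt x a + cnt x j)%N.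
  rewrite /cnt exchange_big -big_split; apply: eq_bigr => t _ /=.
  rewrite leq_eqVlt val_eqE addnC; have [->|xj] := eqVneq (x t) j.
    by rewrite big1 // => a aj; rewrite -val_eqE /= gtn_eqF.
  rewrite add0n; have [xl|xl] := boolP (x t < j)%N; last first.
    rewrite big1 // => a aj; rewrite -val_eqE /=; case: eqP => // xa.
    by rewrite xa aj in xl.
  by rewrite (bigD1 (x t)) //= eqxx big1 // => a /andP[_]; rewrite eq_sym => /negPf->.
rewrite -(leq_add2l (\sum_(a : 'I_n | (a < j)%N) cnt s a)) -tot.
have -> : (\sum_(a : 'I_n | (a < j)%N) cnt s a = \sum_(a : 'I_n | (a < j)%N) cnt rho a)%N.
  by apply: eq_bigr => a aj; have := eqj a; rewrite aj => /eqP.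
rewrite -tot.
have byc (x : W) : (\sum_t (x t <= j)%N = \sum_c \sum_t ((col t == c) && (x t <= j)%N))%N.
  rewrite exchange_big; apply: eq_bigr => t _ /=.
  by rewrite (bigD1 (col t)) //= eqxx big1 ?addn0 // => c; rewrite eq_sym => /negPf->.
rewrite !byc; apply: leq_sum => c _.
have cE (A : pred 'I_r) : (\sum_t A t)%N = #|[set t | A t]|.
  by rewrite cardsE -sum1_card [RHS]big_mkcond; apply: eq_bigr => t _; rewrite unfold_in; case: (A t).
have -> : (\sum_t ((col t == c) && (rho t <= j)%N) = minn (hgt rho c) j.+1)%N.
  transitivity (\sum_t (col t == c) * (rho t < j.+1))%N.
    by apply: eq_bigr => t _; rewrite mulnb.
  rewrite (col_sum rho c (fun i => nat_of_bool (i < j.+1)%N)) -[RHS](@sum_ltn_gen n).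
    by apply: eq_bigr => i _; rewrite hgtE // ltn_min; case: (i < hgt rho c)%N; rewrite ?mul1n.
  by rewrite geq_min (hgt_le rho c).
rewrite leq_min; apply/andP; split.
  apply: leq_trans (_ : \sum_t (col t == c) * 1 <= _)%N.
    by apply: leq_sum => t _; rewrite muln1; case: (col t == c) => //; exact: leq_b1.
  by rewrite (col_sum rho c (fun=> 1%N)); apply: leq_sum => i _; rewrite muln1.
rewrite cE -(card_in_imset (f := s)) => [|t t']; last first.
  by rewrite !inE => /andP[/eqP ct _] /andP[/eqP ct' _]; apply: inj; rewrite ct ct'.
rewrite -[X in (_ <= X)%N](@sum_ltn_gen n j.+1) // .
have -> : (\sum_(i < n) (i < j.+1) = #|[set i : 'I_n | (i < j.+1)%N]|)%N.
  by rewrite -sum1dep_card [RHS]big_mkcond; apply: eq_bigr => t _; case: (t < j.+1)%N.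
apply: subset_leq_card; apply/fintype.subsetP => _ /imsetP[t + ->].
by rewrite !inE => /andP[_].
Qed.

(** At a column constant point antisymmetrization commutes with equivariant matrices, and it kills
    vectors supported on words with a repetition in a column. *)
Lemma antisym_relvec o u q : colconst o -> relvec rho u -> antisym o u q = 0.
Proof.
move=> co Ru; apply: (Ru (fun u => antisym o u q = 0)); [exact: antisym0|by move=> x y x0 y0; rewrite antisymB x0 y0 subrr|].
move=> _ [M [v [eM ev v0 ->]]].
transitivity (\sum_(s : W) M q s o * antisym o v s).
  rewrite /antisym; under [RHS]eq_bigr do rewrite mulr_sumr.
  rewrite exchange_big; apply: eq_bigr => w cw /=.
  rewrite mulvE mulr_sumr (reindex_inj (can_inj (@pactK r 'I_n w))); apply: eq_bigr => s _ /=.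
  by rewrite -{1}(colconst_act co cw) eM.2 mulrCA.
apply: big1 => s _; have [gt|ngt] := boolP (lexgt s rho).
  have [t [t' [tt' ct st]]] := lexgt_repeat gt.
  by rewrite (antisym_eq0 o v tt' ct st) mulr0.
rewrite (_ : antisym o v s = 0) ?mulr0 //; apply: big1 => w _.
rewrite v0 ?mulr0 //; apply: contra ngt => /existsP[j /andP[/forallP h1 h2]].
apply/existsP; exists j; apply/andP; split; last by rewrite cnt_pact in h2.
by apply/forallP => i; have := h1 i; rewrite cnt_pact.
Qed.

Definition spread (x : point) : point := fun t => x (col t).

Lemma colconst_spread x : colconst (spread x).
Proof. by move=> t t' ct; rewrite /spread ct. Qed.

Section Dual.
Variables (x : point) (xI : injective x) (p : W).

(** A product as in Lagrange interpolation: at a row permutation of [spread x] it vanishes unless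
    the permutation fixes [p], because otherwise some variable takes the value belonging to a cell
    of its row with another letter. *)
Definition separator : lfun := fun o => \prod_t \prod_(t' | (rho t' == rho t) && (p t' != p t))
  ((o t).+1%:R - (spread x t').+1%:R).

Lemma inv_separator : inv (fun t => (p t, rho t)) separator.
Proof.
split=> [|w /fixesP fw o].
  have -> : separator = \prod_t \prod_(t' | (rho t' == rho t) && (p t' != p t))
      (xpow t 1 - 1 *+ (spread x t').+1).
    apply/funext => o; rewrite lfun_prod; apply: eq_bigr => t _; rewrite lfun_prod.
    apply: eq_bigr => t' _; rewrite lfunB /xpow expr1z; congr (_ - _).
    by rewrite lfunMn.
  apply: Laur_prod => t _; apply: Laur_prod => t' _; apply: LaurB; first exact: Laur_xpow.
  by apply: zspanMn; exact: Laur1.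
rewrite /separator [RHS](reindex_inj (@perm_inj _ w)); apply: eq_bigr => t _.
by apply: eq_bigl => t'; case: (fw t) => -> ->.
Qed.

Lemma separator_neq0 : separator (spread x) != 0.
Proof.
apply/prodf_neq0 => t _; apply/prodf_neq0 => t' /andP[/eqP rt pt].
rewrite subr_eq0 eqr_nat eqSS; apply: contraNneq pt => /xI ct.
by rewrite (col_inj rt (esym ct)).
Qed.

Lemma separator_act w : fixes rho w -> pact w p != p -> separator (oact w^-1%g (spread x)) = 0.
Proof.
move=> /fixesP rw; rewrite -fixes_pact => /forallPn[t pt].
rewrite /separator (bigD1 (w t)) //= (bigD1 t) /=.
  by rewrite /oact permK subrr !mul0r.
by rewrite rw eqxx eq_sym.
Qed.

Lemma orbvec_separator s : orbvec rho p separator s (spread x) = if s == p then separator (spread x) else 0.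
Proof.
case: eqP => [->|sp]; first by rewrite orbvec_lc //; exact: inv_separator.
case: (orbvec_supp rho p s separator (spread x)) => // -[w [rw sE ->]].
by apply: separator_act => //; apply/eqP; rewrite -sE.
Qed.

(** No column permutation except the identity takes a column strict filling to a column strict
    filling, so at most one term of the signed sum survives. *)
Lemma antisym_dual q : colstrict rho p -> colstrict rho q ->
  antisym (spread x) (orbvec rho p separator) q = if q == p then separator (spread x) else 0.
Proof.
move=> cp cq.
have cstrict (w : 'S_r) (s s' : W) : colperm w -> colstrict rho s -> colstrict rho s' ->
    pact w s = s' -> w = 1%g.
  move=> /fixesP cw /colstrictP cs /colstrictP cs' sE; apply/eqP/negPn/negP => w1.
  have [t0 wt0] : exists t, w t != t.
    apply: contrapT => no; case/negP: w1; apply/eqP/permP => t; rewrite perm1.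
    by apply/eqP/negPn/negP => wt; apply: no; exists t.
  (* Take a moved cell in the highest row. Its image and its preimage both lie below it in its
     column, and strictness of [s] and of [s'] gives opposite inequalities. *)
  have [t wt tmin] := @arg_minnP _ t0 (fun t => w t != t) (fun t => rho t : nat) wt0.
  have lower v : w v != v -> v != t -> col v = col t -> (rho t < rho v)%N.
    move=> /tmin; rewrite leq_eqVlt => /orP[/eqP/val_inj rv|//] vt cv.
    by rewrite (col_inj (esym rv) cv) eqxx in vt.
  have h1 : (rho t < rho (w t))%N by apply: lower; rewrite ?(inj_eq perm_inj) // cw.
  have h2 : (rho t < rho (w^-1%g t))%N.
    have wt' : w^-1%g t != t by rewrite -(inj_eq (@perm_inj _ w)) permKV eq_sym.
    by apply: lower => //; [rewrite permKV eq_sym|rewrite -[in RHS](permKV w t) cw].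
  have := cs' t (w^-1%g t); rewrite -sE !pactE permKV => /(_ _ h2).
  rewrite -{1}(permKV w t) cw => /(_ erefl); apply/negP; rewrite -leqNgt ltnW //.
  by apply: cs => //; rewrite cw.
case: eqP => [->|qp].
  rewrite /antisym (bigD1 1%g) /=; last exact: fixes1.
  rewrite pact1 odd_perm1 expr0 mul1r orbvec_separator eqxx big1 ?addr0 //.
  move=> w /andP[cw w1]; rewrite orbvec_separator; case: eqP => [E|]; last by rewrite mulr0.
  by rewrite (cstrict w p p) // eqxx in w1.
apply: big1 => w cw; rewrite orbvec_separator; case: eqP => [E|]; last by rewrite mulr0.
by case: qp; rewrite -E (cstrict w q p) // pact1.
Qed.

End Dual.

Lemma antisym_sum o q (e : W -> lfun) :
  antisym o (fun q => \sum_(p | colstrict rho p) basisvec rho p q * e p) q =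
  \sum_(p | colstrict rho p) antisym o (basisvec rho p) q * e p o.
Proof.
rewrite /antisym; under [RHS]eq_bigr do rewrite mulr_suml.
rewrite exchange_big; apply: eq_bigr => w _ /=; rewrite lfun_sum mulr_sumr.
by apply: eq_bigr => p _; rewrite lfunM mulrA.
Qed.

(* The dual vectors are combinations of the spanning family, which has as many
   members: the square matrix of values has a one-sided inverse. *)
Lemma antisym_basis_inj x (v : W -> rat) : injective x ->
  (forall q, colstrict rho q ->
     \sum_(p | colstrict rho p) antisym (spread x) (basisvec rho p) q * v p = 0) ->
  forall p, colstrict rho p -> v p = 0.
Proof.
move=> xI v0 p0 cp0; pose D := [pred p | colstrict rho p].
pose cst := @enum_val _ D; have cstP (k : 'I_#|D|) : colstrict rho (cst k) by exact: (enum_valP k).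
have [d dP] : exists d : W -> W -> lfun, forall p, relvec rho (orbvec rho p (separator x p) -
    (fun q => \sum_(p' | colstrict rho p') basisvec rho p' q * d p p')).
  have H p : spanned rho (orbvec rho p (separator x p)).
    by apply: spanning => //; apply: orbvec_eqvec; exact: inv_separator.
  by have [d dP] := choice H; exists d => p; case: (dP p).
have cx := colconst_spread x.
pose B : 'M[rat]_#|D| := \matrix_(i, j) antisym (spread x) (basisvec rho (cst i)) (cst j).
pose E : 'M[rat]_#|D| := \matrix_(i, j) (d (cst i) (cst j) (spread x) / separator x (cst i) (spread x)).
(* Antisymmetrize the expansion of each dual vector in the spanning family; the relations drop
   out. *)
have EB : E *m B = 1%:M.
  apply/matrixP => i j; rewrite !mxE.
  have := antisym_relvec (cst j) cx (dP (cst i)); rewrite antisymB antisym_sum antisym_dual // (big_enum_val (A := D)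
    (fun p => antisym (spread x) (basisvec rho p) (cst j) * d (cst i) p (spread x))).
  move=> /eqP; rewrite subr_eq0 => /eqP E1.
  have s0 := separator_neq0 xI (cst i).
  apply: (mulfI s0); rewrite mulr_sumr.
  transitivity (if cst j == cst i then separator x (cst i) (spread x) else 0).
    by rewrite E1; apply: eq_bigr => l _; rewrite !mxE; field.
  rewrite (inj_eq enum_val_inj) eq_sym; by case: eqP; rewrite ?mulr1 ?mulr0.
pose vr : 'rV[rat]_#|D| := \row_i v (cst i).
have vB : vr *m B = 0.
  apply/matrixP => i j; rewrite !mxE -[RHS](v0 (cst j)) // (big_enum_val (A := D)
    (fun p => antisym (spread x) (basisvec rho p) (cst j) * v p)).
  by apply: eq_bigr => l _; rewrite !mxE mulrC.
have : vr = 0 by rewrite -[vr]mulmx1 -(mulmx1C EB) mulmxA vB mul0mx.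
by move/matrixP/(_ 0 (enum_rank_in cp0 p0)); rewrite !mxE /cst enum_rankK_in.
Qed.

Lemma basisvec_indep (c : W -> lfun) :
  relvec rho (fun q => \sum_(p | colstrict rho p) basisvec rho p q * c p) ->
  forall x, injective x -> forall p, colstrict rho p -> c p (spread x) = 0.
Proof.
move=> Rc x xI; apply: (antisym_basis_inj (v := fun p => c p (spread x)) xI) => q _; rewrite -antisym_sum.
by apply: antisym_relvec Rc; exact: colconst_spread.
Qed.

End Independence.

(** * Scalars vanishing on the column constant points *)

Lemma Laur_comp r (g : 'I_r -> 'I_r) (f : lfun r) : Laur f ->
  Laur (fun o => f (fun t => o (g t)) : rat).
Proof.
move=> Lf; apply: (zspan_map (h := fun f : lfun r => (fun o => f (fun t => o (g t))) : lfun r) _ _ Lf) => //.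
move=> _ [a ->]; apply: zspan_gen; exists [ffun s => \sum_(t | g t == s) a t].
apply/funext => o; rewrite /mono (partition_big g xpredT) //=; apply: eq_bigr => s _.
rewrite ffunE; transitivity (\prod_(t | g t == s) ((o s).+1%:R : rat) ^ a t).
  by apply: eq_bigr => t /eqP->.
apply/esym/(big_morph (fun b : int => ((o s).+1%:R : rat) ^ b)) => // b b'.
by rewrite expfzDr // -unitfE coordU.
Qed.

Lemma inv_counts r (K : eqType) (k : 'I_r -> K) (f : lfun r) (o o' : point r) : inv k f ->
  (forall x v, (\sum_t ((k t == x) && (o t == v)) = \sum_t ((k t == x) && (o' t == v)))%N) ->
  f o = f o'.
Proof.
move=> [_ kf] cnt; have [[x v]|w wP] := @perm_of_counts r _ (fun t => (k t, o t)) (fun t => (k t, o' t)).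
  by under eq_bigr do rewrite xpair_eqE; under [RHS]eq_bigr do rewrite xpair_eqE.
rewrite -[RHS](kf w); last by apply/fixesP => t; case: (wP t).
by congr (f _); apply/funext => t; case: (wP t).
Qed.

Section Faithful.
Variables n r : nat.
Local Notation W := (word r 'I_n).
Local Notation lfun := (lfun r).
Local Notation point := (point r).
Variable rho : W.
Implicit Types (i j : 'I_n) (o : point).
Local Notation col := (col rho).
Hypothesis part : partition_word rho.

(* Generators of the ideal of the relations among the scalars. *)
Definition covrel (f : lfun) := exists i i' : 'I_n, [/\ i' = i.+1 :> nat, inv rho f &
  forall o (h : 'I_r -> 'I_r), {in [pred t | rho t == i'] &, injective h} ->
    (forall t, rho t = i' -> rho (h t) = i /\ o (h t) = o t) -> f o = 0].

Lemma covrel_mul f g : inv rho g -> zspan covrel f -> zspan covrel (g * f).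
Proof.
move=> jg Zf; apply: (zspan_map (h := fun f : lfun => g * f) _ _ Zf); first exact: mulr0.
  by move=> x y; exact: mulrBr.
move=> h [i [i' [ii' jh vh]]]; apply: zspan_gen; exists i, i'; split=> // [|o h' hI hP].
  exact: invM.
by rewrite lfunM (vh o h') ?mulr0.
Qed.

Definition cell_in j t := odflt t [pick t' | (rho t' == j) && (col t' == col t)].

Lemma cell_inP j t : (col t < cnt rho j)%N -> rho (cell_in j t) = j /\ col (cell_in j t) = col t.
Proof.
move=> /cell[t' rt ct]; rewrite /cell_in; case: pickP => [t'' /andP[/eqP-> /eqP->]//|/(_ t')].
by rewrite rt ct !eqxx.
Qed.

Lemma cell_in_out j t : (cnt rho j <= col t)%N -> cell_in j t = t.
Proof.
move=> jt; rewrite /cell_in; case: pickP => // t' /andP[/eqP rt /eqP ct].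
by move: (col_lt rho t'); rewrite ct rt ltnNge jt.
Qed.

Section Row.
Variables i i' : 'I_n.
Hypothesis ii' : i' = i.+1 :> nat.

Let i_ne : (i == i') = false. Proof. by rewrite -val_eqE /= ii' ltn_eqF. Qed.
Let i_ne' : (i' == i) = false. Proof. by rewrite eq_sym i_ne. Qed.

Definition free t := (rho t == i) && (cnt rho i' <= col t)%N.
Definition down t := if rho t == i then cell_in i' t else t.

Lemma down_free t : free t -> down t = t.
Proof. by rewrite /down => /andP[-> /cell_in_out->]. Qed.

Lemma down_below t : rho t = i -> ~~ free t -> rho (down t) = i' /\ col (down t) = col t.
Proof. by rewrite /free /down => -> /=; rewrite eqxx /= -ltnNge; exact: cell_inP. Qed.

Lemma down_id t : rho t != i -> down t = t.
Proof. by rewrite /down => /negPf->. Qed.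

Let swap t := if rho t == i then cell_in i' t else if rho t == i' then cell_in i t else t.

Lemma swap_ex : exists tau : 'S_r, [/\ forall t, tau (tau t) = t,
  forall t, rho t = i -> tau t = down t, forall t, rho t = i' -> rho (tau t) = i
  & forall t, rho t != i -> rho t != i' -> tau t = t].
Proof.
have swapK : cancel swap swap.
  move=> t; rewrite {2}/swap; have [rt|rt] := eqVneq (rho t) i.
    have [ct|ct] := ltnP (col t) (cnt rho i').
      have [r1 c1] := cell_inP ct; rewrite /swap r1 i_ne' eqxx.
      have [|r2 c2] := @cell_inP i (cell_in i' t); first by rewrite c1 -rt col_lt.
      by apply: (@col_inj _ _ rho); rewrite ?r2 ?c2.
    by rewrite cell_in_out // /swap rt eqxx cell_in_out.
  have [rt'|rt'] := eqVneq (rho t) i'; last by rewrite /swap (negPf rt) (negPf rt').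
  have [|r1 c1] := @cell_inP i t; first by rewrite (leq_trans (col_lt rho t)) // rt' part.
  rewrite /swap r1 eqxx; have [|r2 c2] := @cell_inP i' (cell_in i t).
    by rewrite c1 -rt' col_lt.
  by apply: (@col_inj _ _ rho); rewrite ?r2 ?c2.
exists (perm (can_inj swapK)); split=> [t|t rt|t rt|t r1 r2]; rewrite !permE ?swapK //.
- by rewrite /swap /down rt eqxx.
- by rewrite /swap rt i_ne' eqxx (@cell_inP i t _).1 // (leq_trans (col_lt rho t)) // rt part.
by rewrite /swap (negPf r1) (negPf r2).
Qed.

(** At points invariant under [down], row [i] carries the values of the free cells and of row [i']
    together. By [inv_split], a function of the free cells is written through functions of that
    union, which [tau] moves to row [i], and functions of row [i']. *)
Lemma free_lift p : inv free p -> exists f, inv rho f /\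
  forall o, (forall t, o (down t) = o t) -> f o = p o.
Proof.
move=> jp; have [tau [tauK tauD tau_below tauN]] := swap_ex.
pose kap t := if free t then 0%N else if rho t == i' then 1%N else 2%N.
have jk : inv kap p.
  apply: inv_sub jp => w /fixesP fw; apply/fixesP => t; have := fw t.
  by rewrite /kap; do 2 case: (free _) => //; case: ifP => //; case: ifP.
pose Q (g : lfun) := exists f, inv rho f /\ forall o, (forall t, o (down t) = o t) -> f o = g o.
have H : splits kap 0%N 1%N p by exact: inv_split jk.
apply: (H Q).
- by exists 0; split=> //; exact: inv0.
- move=> f g [f' [jf fE]] [g' [jg gE]]; exists (f' - g'); split; first exact: invB.
  by move=> o oo; rewrite !lfunB fE ?gE.
move=> _ [q [f [jq jf _ ->]]]; exists ((fun o => q (fun t => o (tau t))) * f).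
have mgE t : merge kap 0%N 1%N t = if free t || (rho t == i') then 0%N else 2%N.
  by rewrite /merge /kap; case: (free t) => //=; case: (rho t == i').
have tau_row t : free (tau t) || (rho (tau t) == i') = (rho t == i).
  have [rt|rt] := eqVneq (rho t) i.
    rewrite tauD //; have [ft|ft] := boolP (free t); first by rewrite down_free // ft.
    by rewrite (down_below rt ft).1 eqxx orbT.
  have [rt'|rt'] := eqVneq (rho t) i'; last first.
    by rewrite tauN // /free (negPf rt) (negPf rt').
  have rtt := tau_below t rt'; rewrite rtt i_ne orbF; apply/negP => ft.
  have := tauK t; rewrite tauD // down_free // => E.
  by rewrite -E rtt eqxx in rt.
split; first apply: invM.
- split; first exact: Laur_comp jq.1.
  move=> w /fixesP fw o; rewrite -[RHS](jq.2 (tau * w * tau)%g).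
    by congr (q _); apply/funext => t; rewrite !permM tauK.
  apply/fixesP => t; rewrite !mgE !permM tau_row fw -tau_row tauK //.
- have kE t : (kap t == 1%N) = (rho t == i').
    rewrite /kap /free; have [->|_] := eqVneq (rho t) i; last by case: (rho t == i').
    by rewrite i_ne; case: (_ <= _)%N.
  by apply: inv_sub jf => w /fixesP fw; apply/fixesP => t; rewrite !kE fw.
move=> o oo; rewrite !lfunM; congr (q _ * _); apply/funext => t.
have [rt|rt] := eqVneq (rho t) i; first by rewrite tauD // oo.
have [rt'|rt'] := eqVneq (rho t) i'; last by rewrite tauN.
by rewrite -(oo (tau t)) -tauD ?tauK // tau_below.
Qed.

(* The rows below i, and the free cells of row i, determine the value at down. *)
Lemma down_counts c o o' : inv rho c -> depends (fun t => (i <= rho t)%N) c ->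
  (forall v, (\sum_t (free t && (o t == v)) = \sum_t (free t && (o' t == v)))%N) ->
  (forall j v, (i < j)%N -> (\sum_t ((rho t == j) && (o t == v)) = \sum_t ((rho t == j) && (o' t == v)))%N) ->
  c (fun t => o (down t)) = c (fun t => o' (down t)).
Proof.
move=> jc dc freeE rowE; pose z (o : point) t := if (i <= rho t)%N then o (down t) else 0%N.
have zE (x : point) : c (fun t => x (down t)) = c (z x) by apply: dc => t it; rewrite /z it.
rewrite !zE; apply: (inv_counts jc) => j v.
have [ji|ij|/val_inj ij] := ltngtP j i.
- apply: eq_bigr => t _; have [rt|//] := eqVneq (rho t) j.
  by rewrite /z rt leqNgt ji.
- have zj (x : point) : (\sum_t ((rho t == j) && (z x t == v)) = \sum_t ((rho t == j) && (x t == v)))%N.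
    apply: eq_bigr => t _; have [rt|//] := eqVneq (rho t) j.
    by rewrite /z rt ltnW // down_id // rt -val_eqE /= gtn_eqF.
  by rewrite !zj rowE.
have zi (x : point) : (\sum_t ((rho t == i) && (z x t == v)) =
    \sum_t (free t && (x t == v)) + \sum_t ((rho t == i') && (x t == v)))%N.
  have [tau [tauK tauD tau_below tauN]] := swap_ex.
  transitivity (\sum_t (free t && (x t == v)) + \sum_t [&& rho t == i, ~~ free t & x (down t) == v])%N.
    rewrite -big_split; apply: eq_bigr => t _ /=; rewrite /z.
    have [rt|rt] := eqVneq (rho t) i; last by rewrite /free (negPf rt).
    rewrite rt leqnn; have [ft|ft] := boolP (free t); first by rewrite down_free // addn0.
    by [].
  congr (_ + _)%N; rewrite [RHS](reindex_inj (@perm_inj _ tau)); apply: eq_bigr => t _.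
  have [rt|rt] := eqVneq (rho t) i.
    rewrite tauD // /=; have [ft|ft] := boolP (free t); first by rewrite down_free // rt i_ne.
    by rewrite (down_below rt ft).1 eqxx.
  have [rt'|rt'] := eqVneq (rho t) i'; last by rewrite tauN // (negPf rt').
  by rewrite tau_below // i_ne.
by rewrite ij !zi freeE rowE // ii'.
Qed.

End Row.

(** Pull [c] back along [down] and expand it in the free cells of row [k]. The coefficients live on
    the lower rows and vanish at column constant points there, so induction applies to them. Lifting
    the free parts gives a [T] that agrees with [c] wherever row [k + 1] is covered by row [k]. *)
Lemma covrel_of_colconst d k c : (k + d = n)%N -> inv rho c ->
  depends (fun t => (k <= rho t)%N) c ->
  (forall o, (forall t t', (k <= rho t)%N -> (k <= rho t')%N -> col t = col t' -> o t = o t') ->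
    c o = 0) -> zspan covrel c.
Proof.
elim: d k c => [|d IH] k c kd jc dc vc.
  suff -> : c = 0 by exact: zspan0.
  apply/funext => o; apply: vc => t t' kt; move: kt (ltn_ord (rho t)).
  by rewrite addn0 in kd; rewrite kd ltnNge => ->.
have [kn|kn] := ltnP k.+1 n; last first.
  suff -> : c = 0 by exact: zspan0.
  apply/funext => o; apply: vc => t t' kt kt' ct; congr (o _); apply: col_inj ct.
  apply: ord_inj; move: kt kt' (ltn_ord (rho t)) (ltn_ord (rho t')) kn kd.
  by move: (rho t : nat) (rho t' : nat) => a b; clear; lia.
pose i := Ordinal (ltnW kn); pose i' := Ordinal kn; have ii' : i' = i.+1 :> nat by [].
pose c1 : lfun := fun o => c (fun t => o (down i i' t)).
have lt_row t (j : 'I_n) : rho t = j -> (i < j)%N -> (k < rho t)%N by move=> ->.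
have nfree t : (k < rho t)%N -> free i i' t = false.
  by move=> kt; rewrite /free -val_eqE /= gtn_eqF.
have [||B [q [p [jq jp cE vq dq]]]] := @decompose r _ _ rho (free i i') (free i i') c1 (Laur_comp (down i i') jc.1).
- move=> w o o' /fixesP fw; apply: (@down_counts i i' ii' c _ _ jc dc) => // [v|j v ij].
    by apply: eq_bigr => t _; rewrite /splice; case: (free i i' t).
  rewrite [RHS](reindex_inj (@perm_inj _ w)); apply: eq_bigr => t _; rewrite fw.
  by have [rt|//] := eqVneq (rho t) j; rewrite /splice !nfree ?fw // (lt_row _ _ rt).
- move=> w o o' /fixesP fw; apply: (@down_counts i i' ii' c _ _ jc dc) => // [v|j v ij].
    rewrite [RHS](reindex_inj (@perm_inj _ w)); apply: eq_bigr => t _; rewrite fw /splice fw.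
    by case: (free i i' t).
  by apply: eq_bigr => t _; have [rt|//] := eqVneq (rho t) j; rewrite /splice !nfree // (lt_row _ _ rt).
have [phi phiP] := choice (fun b => free_lift ii' (jp b)).
have mrg_id o : splice (free i i') o o = o by apply/funext => t; rewrite /splice; case: ifP.
have Zq b : b \in B -> zspan covrel (q b).
  move=> bB; apply: (IH k.+1); [by rewrite addSnnS|exact: jq| |].
  - move=> o o1 oo; apply: dq bB => o'; apply: dc => t kt.
    have [ti|ti] := eqVneq (rho t) i; last first.
      rewrite down_id // /splice; case: ifP => // _; apply: oo.
      by rewrite ltn_neqAle kt andbT eq_sym -[k]/(val i) val_eqE.
    rewrite /splice; have [ft|ft] := boolP (free i i' t); first by rewrite down_free // ft.
    have [r1 _] := down_below ti ft; have h : (k < rho (down i i' t))%N by rewrite r1.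
    by rewrite nfree // oo.
  move=> o oo; apply: vq bB => o'; apply: vc => t t' kt kt' ct.
  have main x y : (k <= rho x)%N -> (k <= rho y)%N -> col x = col y -> rho x = i -> rho y <> i ->
      splice (free i i') o o' (down i i' x) = splice (free i i') o o' (down i i' y).
    move=> kx ky cxy xi yi; have ky' : (k < rho y)%N.
      by rewrite ltn_neqAle ky andbT eq_sym -[k]/(val i) val_eqE; apply/eqP.
    have fx : ~~ free i i' x.
      rewrite /free xi eqxx andTb -ltnNge cxy (leq_trans (col_lt rho y)) //.
      by apply: (cnt_anti part); rewrite /= -[k]/(val i).
    have [r1 c1'] := down_below xi fx.
    rewrite [down i i' y]down_id; last exact/eqP.
    rewrite /splice !nfree ?r1 //; apply: oo; rewrite ?r1 //.
    by rewrite c1'.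
  have [ti|/eqP ti] := eqVneq (rho t) i; have [ti'|/eqP ti'] := eqVneq (rho t') i.
  - by rewrite (col_inj (etrans ti (esym ti')) ct).
  - exact: main.
  - by apply/esym; apply: main.
  have kk x : (k <= rho x)%N -> rho x <> i -> (k < rho x)%N.
    by move=> kx xi; rewrite ltn_neqAle kx andbT eq_sym -[k]/(val i) val_eqE; apply/eqP.
  rewrite !down_id; try exact/eqP.
  by rewrite /splice !nfree; [apply: oo => //| |]; exact: kk.
pose T : lfun := \sum_(b <- B) phi b * q b.
rewrite -[c](subrK T); apply: zspanD; last first.
  by apply: zspan_sum_seq => b bB; apply: covrel_mul; [case: (phiP b)|exact: Zq].
have jT : inv rho T.
  rewrite /T big_seq; apply: inv_sum => b bB; apply: invM; last exact: jq.
  by case: (phiP b).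
apply: zspan_gen; exists i, i'; split=> // [|o h hI hP]; first exact: invB.
pose D : {set 'I_r} := [set t | (rho t == i) && ~~ free i i' t].
pose Z : {set 'I_r} := [set t | rho t == i].
have DP t : t \in D -> rho t = i /\ ~~ free i i' t by rewrite inE => /andP[/eqP].
(* Permute row [i] so that the covering matches each cell with the one above it; the permuted point
   is invariant under [down]. *)
have [||| w [wD wN]] := @ext_perm _ D Z (fun t => h (down i i' t)).
- move=> t t' /DP[rt ft] /DP[rt' ft'] hh.
  have [r1 c1'] := down_below rt ft; have [r2 c2] := down_below rt' ft'.
  apply: (@col_inj _ _ rho); first by rewrite rt rt'.
  rewrite -c1' -c2; congr col; apply: hI hh; rewrite inE ?r1 ?r2 eqxx //.
- by apply/fintype.subsetP => t /DP[rt _]; rewrite inE rt.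
- apply/fintype.subsetP => _ /imsetP[t /DP[rt ft] ->]; rewrite inE.
  by have [r1 _] := down_below rt ft; rewrite (hP _ r1).1.
have fw : fixes rho w.
  apply/fixesP => t; have [tZ|tZ] := boolP (t \in Z); last by rewrite wN.
  have := perm_out wN t; rewrite tZ inE => /eqP->.
  by move: tZ; rewrite inE => /eqP->.
pose o' t := o (w t).
have oD t : o' (down i i' t) = o' t.
  have [ti|ti] := eqVneq (rho t) i; last by rewrite down_id.
  have [ft|ft] := boolP (free i i' t); first by rewrite down_free.
  have [r1 _] := down_below ti ft; rewrite /o' wN ?inE ?r1 -?val_eqE /= ?gtn_eqF //.
  by rewrite wD ?inE ?ti ?eqxx // (hP _ r1).2.
rewrite -((invB jc jT).2 w fw) lfunB; apply/eqP; rewrite subr_eq0; apply/eqP.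
have -> : c (fun t => o (w t)) = c1 o' by congr (c _); apply/funext => t; rewrite oD.
rewrite -[in LHS](mrg_id o') cE /T lfun_sum; apply: eq_bigr => b _.
by rewrite lfunM mulrC (phiP b).2.
Qed.
Theorem colconst_covrel c : inv rho c -> (forall x : point, injective x -> c (spread rho x) = 0) ->
  zspan covrel c.
Proof.
move=> jc vc; apply: (@covrel_of_colconst n 0) => // [o o' oo|o oc].
  by congr (c _); apply/funext => t; exact: oo.
have := Laur_eq0 (Laur_comp col jc.1) vc.
(* A column constant point is [spread rho x] for some [x], not necessarily injective; columns
   without cells get the value 0. Vanishing extends from injective to all [x] by [Laur_eq0]. *)
pose x : point := fun s => odflt 0%N (omap o [pick t | col t == s]).
move=> /(congr1 (fun f : lfun => f x)) => E; apply: etrans E.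
congr (c _); apply/funext => t; rewrite /x; case: pickP => [t' /eqP ct /=|/(_ t)].
  by apply: oc.
by rewrite eqxx.
Qed.

Definition samecnt (q : W) := [forall a, cnt q a == cnt rho a].

Lemma samecntP (q : W) : reflect (forall a, cnt q a = cnt rho a) (samecnt q).
Proof. by apply: (iffP forallP) => H a; apply/eqP; exact: H. Qed.

Lemma samecnt_act w (q : W) : samecnt (pact w q) = samecnt q.
Proof. by apply: eq_forallb => a; rewrite cnt_pact. Qed.

Definition project (u : vec r 'I_n) : vec r 'I_n := fun q => if samecnt q then u q else 0.

Lemma relvec_project u : relvec rho u -> relvec rho (project u).
Proof.
pose pr : mat r 'I_n 'I_n := fun p q => if (p == q) && samecnt p then 1 else 0.
have epr : eqmat pr.
  split=> [p q|w p q o]; first by rewrite /pr; case: ifP => _; [exact: Laur1|exact: Laur0].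
  by rewrite /pr samecnt_act (inj_eq (can_inj (@pactK r 'I_n w))); case: ifP.
have -> : project u = mulv pr u; last exact: relvec_mul.
apply/funext => p; rewrite /mulv (bigD1 p) //= big1 ?addr0 => [|s /negPf sp].
  by rewrite /pr eqxx /project; case: ifP; rewrite ?mul1r ?mul0r.
by rewrite /pr eq_sym sp mul0r.
Qed.

Lemma eqvec_project u : eqvec rho u -> eqvec rho (project u).
Proof.
move=> [Lu eu]; split=> [p|w rw p o]; rewrite /project; first by case: ifP => _ //; exact: Laur0.
by rewrite samecnt_act; case: ifP => // _; exact: eu.
Qed.

Lemma leads_project q f : samecnt q -> leads rho (relvec rho (C := 'I_n)) q f ->
  leads rho (fun u => relvec rho u /\ forall q', u q' <> 0 -> samecnt q') q f.
Proof.
move=> sq [u [Ru eu uq du]]; exists (project u); split.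
- split=> [|q']; first exact: relvec_project.
  by rewrite /project; case: ifP.
- exact: eqvec_project.
- by rewrite /project sq.
by move=> q'; rewrite /project; case: ifP => // _; exact: du.
Qed.

(** A letter in row [k + 1] forces a strictly smaller letter in row [k]; induct on the row. *)
Lemma coverable_above q : coverable rho q -> forall t, (rho t <= q t)%N.
Proof.
move=> /coverableP cov t; move: {2}(rho t : nat) (erefl (rho t : nat)) => k.
elim: k t => [|k IH] t rk; rewrite rk //.
have kn : (k < n)%N by rewrite (leq_trans _ (ltn_ord (rho t))) // rk.
have [t' t'Z] : exists t', t' \in blockZ rho q (Ordinal kn) (q t).
  apply/card_gt0P/(leq_trans _ (cov (Ordinal kn) (q t)))/card_gt0P; exists t.
  by rewrite inE rk eqxx leqnn.
move: t'Z; rewrite inE => /andP[/eqP rt' qt']; apply: leq_ltn_trans qt'.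
by rewrite -[k]/(nat_of_ord (Ordinal kn)) -rt'; apply: IH; rewrite rt'.
Qed.

(** The sums of all letters agree, so the inequality of [coverable_above] is an equality in every
    cell. *)
Lemma coverable_samecnt q : coverable rho q -> samecnt q -> q = rho.
Proof.
move=> /coverable_above qr /samecntP sq.
have tot (x : W) : (\sum_t x t = \sum_(a : 'I_n) a * cnt x a)%N.
  transitivity (\sum_t \sum_(a : 'I_n) a * (x t == a))%N.
    apply: eq_bigr => t _; rewrite (bigD1 (x t)) //= eqxx muln1 big1 ?addn0 // => a.
    by rewrite eq_sym => /negPf->; rewrite muln0.
  by rewrite exchange_big; apply: eq_bigr => a _; rewrite -big_distrr.
have : (\sum_t (q t - rho t) == 0)%N.
  rewrite sumnB // !tot; apply/eqP; rewrite -[RHS](subnn (\sum_(a : 'I_n) a * cnt rho a)%N).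
  by congr (_ - _)%N; apply: eq_bigr => a _; rewrite sq.
rewrite sum_nat_eq0 => /forallP H; apply/ffunP => t; apply: ord_inj; apply/eqP.
by rewrite eqn_leq qr andbT -subn_eq0; exact: H.
Qed.

(* Words of the same content below rho are not coverable, hence relations. *)
Lemma relvec_below q f : samecnt q -> prec rho q rho -> inv (fun t => (rho t, q t)) f ->
  relvec rho (orbvec rho q f).
Proof.
elim/(@prec_ind _ _ rho): q f => q IH f sq pq jf; have zB := @zspanB (vec r 'I_n).
have nc : ~~ coverable rho q.
  by apply/negP => /coverable_samecnt/(_ sq) E; rewrite E in pq; exact: prec_irr pq.
have : leads rho (relvec rho (C := 'I_n)) q f.
  move: nc; rewrite negb_forall => /existsP[i]; rewrite negb_forall => /existsP[a].
  by rewrite -ltnNge => YZ; apply: (@leads_uncoverable n r rho q _ _ _ i a f) => //; exact: zspan0.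
move=> /(leads_project sq)[u [[Ru su] eu uq du]].
have jf' := inv_swap jf; rewrite -[orbvec rho q f](subrK u); apply: zspanD => //.
apply: (@span_orbvec n r rho _ (@zspan0 _ _) (@zspanB _ _) (fun q' => samecnt q' /\ prec rho q' q)) => [q' g [sq' pq'] jg||].
- by apply: IH => //; exact: prec_trans pq.
- by apply: eqvecB => //; exact: orbvec_eqvec.
move=> q' nz; case: (pselect (u q' = 0)) => [u0|u0].
  case: nz; rewrite vecB u0 subr0; apply/funext => o.
  case: (orbvec_supp rho q q' f o) => // -[w [rw q'E E]].
  rewrite E; move: u0; rewrite q'E => /(congr1 (fun g : lfun => g (oact w (oact w^-1%g o)))).
  by rewrite eu.2 // uq.
split; first exact: su.
case: (du q' u0) => // e; case: nz; have [w [rw ->]] : exists w, fixes rho w /\ q' = pact w q.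
  by apply: req_orbit => j a; rewrite e.
apply/funext => o; rewrite vecB -[o](oactKV w) lfunB eu.2 // (orbvec_eqvec jf').2 //.
by rewrite uq orbvec_lc // subrr.
Qed.

(** By [colconst_covrel] the scalar is the leading coefficient at [rho] of a relation. Words of
    other contents are projected away, and the lower terms of the same content are relations by
    [relvec_below]. *)
Theorem relvec_scalar c : inv rho c -> (forall x : point, injective x -> c (spread rho x) = 0) ->
  relvec rho (orbvec rho rho c).
Proof.
move=> jc vc; have Zc := colconst_covrel jc vc.
have leads_c : leads rho (relvec rho (C := 'I_n)) rho c.
  apply: (leads_zspan (@zspan0 _ _) (@zspanB _ _) _ Zc) => f [i [i' [ii' jf vf]]].
  rewrite -[f]mulr1; apply: (@leads_blocks n r rho rho _ _ _ i i') => //.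
  - by apply: inv_sub jf => w /fixesP fw; apply/fixesP => t; case: (fw t).
  - have inY s : rho s = i' -> s \in blockY rho rho i i'.
      by move=> rs; rewrite inE rs leqnn andbT ii'.
    move=> o [h [hI hP]]; apply: (vf o h) => [t t'|t ti'].
      by rewrite !inE => /eqP ti' /eqP ti''; apply: hI; exact: inY.
    by have [] := hP t (inY t ti'); rewrite inE => /andP[/eqP].
  exact: inv1.
have [u [[Ru su] eu uq du]] := leads_project (introT (samecntP rho) (fun=> erefl)) leads_c.
have jc' : inv (fun t => (rho t, rho t)) c.
  by apply: inv_sub jc => w /fixesP fw; apply/fixesP => t; case: (fw t).
rewrite -[orbvec rho rho c](subrK u); apply: zspanD => //.
apply: (@span_orbvec n r rho _ (@zspan0 _ _) (@zspanB _ _) (fun q' => samecnt q' /\ prec rho q' rho)) => [q' g [sq' pq'] jg||].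
- exact: relvec_below.
- by apply: eqvecB => //; exact: orbvec_eqvec.
move=> q' nz; have q'rho : q' <> rho.
  by move=> E; apply: nz; rewrite E vecB uq orbvec_lc // subrr.
case: (pselect (u q' = 0)) => [u0|u0].
  case: nz; rewrite vecB u0 subr0; apply/funext => o.
  case: (orbvec_supp rho rho q' c o) => // -[w [rw q'E _]].
  by case: q'rho; rewrite q'E; apply/eqP; rewrite -fixes_pact.
split; first exact: su.
case: (du q' u0) => // e; have [w [rw q'E]] : exists w, fixes rho w /\ q' = pact w rho.
  by apply: req_orbit => j a; rewrite e.
by case: q'rho; rewrite q'E; apply/eqP; rewrite -fixes_pact.
Qed.

End Faithful.

(** * Noetherian modules *)

Section Noetherian.
Variable M : zmodType.
Implicit Types (ts : seq (M -> M)) (X Y : seq M) (S N : M -> Prop).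

Definition subg S := S 0 /\ forall x y, S x -> S y -> S (x - y).

Fixpoint allops (P : (M -> M) -> Prop) ts : Prop :=
  if ts is t :: ts' then P t /\ allops P ts' else True.

Fixpoint commops ts : Prop := if ts is t :: ts' then
  allops (fun t' => forall x, t (t' x) = t' (t x)) ts' /\ commops ts' else True.

Definition stable ts S := allops (fun t => forall x, S x -> S (t x)) ts.

(** The submodule generated by [X] over the polynomial ring whose variables act as the operators in
    [ts]. *)
Definition gen ts X x := forall S, subg S -> stable ts S -> (forall x, x \in X -> S x) -> S x.

Lemma subgN S x : subg S -> S x -> S (- x).
Proof. by move=> [S0 SB] Sx; rewrite -sub0r; exact: SB. Qed.

Lemma subgD S x y : subg S -> S x -> S y -> S (x + y).
Proof. by move=> sS Sx Sy; rewrite -[y]opprK; apply: sS.2 => //; exact: subgN. Qed.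

Lemma subgMz S x (c : int) : subg S -> S x -> S (x *~ c).
Proof.
move=> sS Sx; have nat k : S (x *+ k).
  by elim: k => [|k IH]; [exact: sS.1|rewrite mulrS; exact: subgD].
by case: c => k; rewrite ?NegzE ?mulrNz -pmulrn; [|apply: subgN => //].
Qed.

Lemma morphB0 (t : M -> M) : {morph t : x y / x - y} -> t 0 = 0.
Proof. by move=> tB; have := tB 0 0; rewrite !subrr. Qed.

Lemma morphBD (t : M -> M) : {morph t : x y / x - y} -> {morph t : x y / x + y}.
Proof.
move=> tB x y; rewrite -{1}[y]opprK tB; congr (_ + _).
by rewrite -[- y]sub0r tB morphB0 // sub0r opprK.
Qed.

Lemma allops_impl (P Q : (M -> M) -> Prop) ts :
  (forall t, P t -> Q t) -> allops P ts -> allops Q ts.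
Proof. by move=> PQ; elim: ts => //= t ts IH [/PQ Pt /IH]. Qed.

Lemma allops_and (P Q : (M -> M) -> Prop) ts :
  allops P ts -> allops Q ts -> allops (fun t => P t /\ Q t) ts.
Proof. by elim: ts => //= t ts IH [Pt Pts] [Qt Qts]; split; [|exact: IH]. Qed.

Lemma gen_subg ts X : subg (gen ts X).
Proof.
split=> [S sS _ _|x y gx gy S sS tS XS]; first exact: sS.1.
by apply: sS.2; [exact: gx|exact: gy].
Qed.

Lemma gen_mem ts X x : x \in X -> gen ts X x.
Proof. by move=> xX S _ _; exact. Qed.

Lemma gen_stable ts X : stable ts (gen ts X).
Proof.
suff H ts0 : (forall S, stable ts S -> stable ts0 S) -> stable ts0 (gen ts X) by exact: H.
elim: ts0 => //= t ts0 IH sub; split.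
  by move=> x gx S sS tS XS; case: (sub S tS) => tt _; apply: tt; exact: gx.
by apply: IH => S /sub[].
Qed.

Lemma int_ideal (I : int -> Prop) : I 0 -> (forall x y, I x -> I y -> I (x - y)) ->
  exists2 g, I g & forall c, I c -> exists q, c = q * g.
Proof.
move=> I0 IB; have IN x : I x -> I (- x) by rewrite -[- x]sub0r; exact: IB.
have ID x y : I x -> I y -> I (x + y) by rewrite -[y in x + y]opprK => ? ?; apply: IB => //; exact: IN.
have IM x q : I x -> I (q * x).
  move=> Ix; have nat k : I (k%:Z * x).
    by elim: k => [|k IH]; rewrite ?mul0r // -addn1 PoszD mulrDl mul1r; exact: ID.
  by case: q => k; rewrite ?NegzE ?mulNr; [|apply: IN].
case: (pselect (exists c, I c /\ c != 0)) => [[c [Ic c0]]|no]; last first.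
  exists 0 => // c Ic; exists 0; rewrite mul0r; apply/eqP/negPn/negP => c0.
  by apply: no; exists c.
have ex : exists k, `[< I k.+1%:Z >].
  exists `|c|.-1%N; apply/asboolP; rewrite prednK ?absz_gt0 // abszE.
  by case: (ger0P c) => // _; exact: IN.
have [k /asboolP Ik kmin] := ex_minnP ex.
exists k.+1%:Z => // d Id; exists (d %/ k.+1)%Z.
have Im : I (d %% k.+1)%Z by rewrite /modz; apply: IB => //; exact: IM.
rewrite {1}(divz_eq d k.+1) -[RHS]addr0; congr (_ + _); apply: contrapT => m0.
have : (0 <= (d %% k.+1)%Z) by rewrite modz_ge0.
have : (d %% k.+1)%Z < k.+1%:Z by rewrite ltz_pmod.
case: (d %% k.+1)%Z Im m0 => // -[//|j] Ij _ jk _.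
have := kmin j (introT (asboolP _) Ij); rewrite leqNgt => /negP; apply.
by move: jk; rewrite ltz_nat ltnS.
Qed.

(** The coefficients of [x0] in elements of [N] form an ideal of Z, so one element of [N] reduces
    all others to combinations of the remaining generators. *)
Lemma hilbert_basis_nil X N : subg N -> (forall x, N x -> gen [::] X x) ->
  exists Y, (forall y, y \in Y -> N y) /\ forall x, N x -> gen [::] Y x.
Proof.
elim: X N => [|x0 X IH] N sN NX.
  exists [::]; split=> // x /NX gx; apply: gx => //; exact: gen_subg.
have split_x x : gen [::] (x0 :: X) x -> exists c m, gen [::] X m /\ x = x0 *~ c + m.
  move=> gx; apply: (gx (fun x => exists c m, gen [::] X m /\ x = x0 *~ c + m)) => //.
    split; first by exists 0, 0; rewrite addr0 mulr0z; split=> //; exact: (gen_subg _ _).1.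
    move=> _ _ [c [m [gm ->]]] [d [k [gk ->]]]; exists (c - d), (m - k); split.
      exact: (gen_subg _ _).2.
    by rewrite mulrzBr opprD addrACA.
  move=> y; rewrite inE => /orP[/eqP->|yX].
    by exists 1, 0; rewrite addr0 mulr1z; split=> //; exact: (gen_subg _ _).1.
  by exists 0, y; rewrite mulr0z add0r; split=> //; exact: gen_mem.
have gX := gen_subg [::] X.
have [||g [m0 [gm0 Nm0]] gP] := @int_ideal (fun c => exists m, gen [::] X m /\ N (x0 *~ c + m)).
- by exists 0; rewrite mulr0z addr0; split; [exact: gX.1|exact: sN.1].
- move=> c d [m [gm Nm]] [k [gk Nk]]; exists (m - k); split; first exact: gX.2.
  by rewrite mulrzBr addrACA -opprD; exact: sN.2.
have [|x [_ gx]//|Y [YN NY]] := IH (fun x => N x /\ gen [::] X x).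
  split=> [|x y [Nx gx] [Ny gy]]; first by split; [exact: sN.1|exact: gX.1].
  by split; [exact: sN.2|exact: gX.2].
exists (x0 *~ g + m0 :: Y); split=> [y|x Nx].
  by rewrite inE => /orP[/eqP->//|/YN[]].
have [c [m [gm xE]]] := split_x x (NX x Nx).
have [|q cE] := gP c; first by exists m; rewrite -xE.
have gY := gen_subg [::] (x0 *~ g + m0 :: Y).
have xE' : x - (x0 *~ g + m0) *~ q = m - m0 *~ q.
  by rewrite xE cE mulrzDl -mulrzA [g * q]mulrC opprD addrACA subrr add0r.
rewrite -[x](subrK ((x0 *~ g + m0) *~ q)); apply: (subgD gY); last first.
  by apply: (subgMz _ gY); apply: gen_mem; rewrite inE eqxx.
have : gen [::] Y (x - (x0 *~ g + m0) *~ q).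
  apply: NY; split; first by apply: sN.2 => //; exact: subgMz.
  by rewrite xE'; apply: gX.2 => //; exact: (subgMz _ gX).
by apply=> // y yY; apply: gen_mem; rewrite inE yY orbT.
Qed.

Section Step.
Variables (t : M -> M) (ts : seq (M -> M)) (X : seq M).
Hypotheses (tB : {morph t : x y / x - y}) (tsB : allops (fun t => {morph t : x y / x - y}) ts).
Hypothesis tC : allops (fun t' => forall x, t (t' x) = t' (t x)) ts.

Let iterB d : {morph iter d t : x y / x - y}.
Proof. by elim: d => [|d IHd] x y //=; rewrite IHd tB. Qed.

Let iter0 d : iter d t 0 = 0.
Proof. exact: morphB0 (iterB d). Qed.

Fixpoint deg_lt d x : Prop := if d is d'.+1 then
  exists a b, [/\ gen ts X a, deg_lt d' b & x = iter d' t a + b] else x = 0.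

Let deg_lt_subg d : subg (deg_lt d).
Proof.
have gX := gen_subg ts X; elim: d => [|d IH]; first by split=> // x y -> ->; rewrite subr0.
split=> [|_ _ [a [b [ga lb ->]]] [a' [b' [ga' lb' ->]]]].
  by exists 0, 0; split; [exact: gX.1|exact: IH.1|rewrite iter0 addr0].
exists (a - a'), (b - b'); split; [exact: gX.2|exact: IH.2|].
by rewrite iterB opprD addrACA.
Qed.

Let deg_ltS d x : deg_lt d x -> deg_lt d.+1 x.
Proof.
move=> lx; exists 0, x; split=> //; last by rewrite iter0 add0r.
exact: (gen_subg ts X).1.
Qed.

Let deg_lt_t d x : deg_lt d x -> deg_lt d.+1 (t x).
Proof.
elim: d x => [|d IH] x; first by move=> ->; rewrite -[t 0]/(iter 1 t 0) iter0; exact: (deg_lt_subg 1).1.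
move=> [a [b [ga lb ->]]]; exists a, (t b); split=> //; first exact: IH.
by rewrite (morphBD tB).
Qed.

Let deg_lt_iter e d x : deg_lt d x -> deg_lt (e + d) (iter e t x).
Proof. by move=> lx; elim: e => //= e IH; exact: deg_lt_t. Qed.

Let deg_lt_le d e x : (d <= e)%N -> deg_lt d x -> deg_lt e x.
Proof. by move=> /subnK <- lx; elim: (e - d)%N => //= k; exact: deg_ltS. Qed.

Let deg_lt_stable d : stable ts (deg_lt d).
Proof.
have := allops_and (allops_and tsB tC) (gen_stable ts X).
apply: allops_impl => t' [[t'B t'C] gt'].
have t'0 := morphB0 t'B.
have t'D := morphBD t'B.
elim: d => [|d IH] x; first by move=> ->.
move=> [a [b [ga lb ->]]]; exists (t' a), (t' b); split; [exact: gt'|exact: IH|].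
by rewrite t'D; congr (_ + _); elim: (d) => //= k <-; rewrite t'C.
Qed.

Let gen_deg_lt x : gen (t :: ts) X x -> exists d, deg_lt d x.
Proof.
move=> gx; apply: (gx (fun x => exists d, deg_lt d x)).
- split; first by exists 0%N.
  move=> y z [d ly] [e lz]; exists (maxn d e).
  by apply: (deg_lt_subg _).2; [apply: deg_lt_le ly|apply: deg_lt_le lz]; rewrite ?leq_maxl ?leq_maxr.
- split; first by move=> y [d ly]; exists d.+1; exact: deg_lt_t.
  have H : allops (fun t' => forall d, forall x, deg_lt d x -> deg_lt d (t' x)) ts.
    elim: (ts) deg_lt_stable => //= t' ts' IH H; split=> [d|]; first by case: (H d).
    by apply: IH => d; case: (H d).
  by apply: allops_impl H => t' H y [d ly]; exists d; exact: H.
move=> y yX; exists 1%N, y, 0; split=> //; last by rewrite addr0.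
exact: gen_mem.
Qed.

Variable N : M -> Prop.
Hypotheses (sN : subg N) (tN : stable (t :: ts) N).
Hypothesis NX : forall x, N x -> gen (t :: ts) X x.
Hypothesis IH : forall N' : M -> Prop, subg N' -> stable ts N' -> (forall x, N' x -> gen ts X x) ->
  exists Y, (forall y, y \in Y -> N' y) /\ forall x, N' x -> gen ts Y x.

(** A possible coefficient of degree [d] of an element of [N]; the same element may have several. *)
Definition leading d a := gen ts X a /\ exists b, deg_lt d b /\ N (iter d t a + b).

Let leading_subg d : subg (leading d).
Proof.
have gX := gen_subg ts X; split=> [|x y [gx [b [lb Nb]]] [gy [c [lc Nc]]]].
  split; first exact: gX.1.
  by exists 0; rewrite iter0 addr0; split; [exact: (deg_lt_subg d).1|exact: sN.1].
split; first exact: gX.2.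
exists (b - c); split; first exact: (deg_lt_subg d).2.
by rewrite iterB addrACA -opprD; exact: sN.2.
Qed.

Let leading_stable d : stable ts (leading d).
Proof.
have := allops_and (allops_and tsB tC) (allops_and (allops_and (gen_stable ts X) (deg_lt_stable d)) tN.2).
apply: allops_impl => t' [[t'B t'C] [[gt' lt'] Nt']] x [gx [b [lb Nb]]].
split; first exact: gt'.
exists (t' b); split; first exact: lt'.
have -> : iter d t (t' x) + t' b = t' (iter d t x + b); last exact: Nt'.
have -> : iter d t (t' x) = t' (iter d t x) by elim: (d) => //= k ->; rewrite t'C.
by rewrite (morphBD t'B).
Qed.

Let leadingS d a : leading d a -> leading d.+1 a.
Proof.
move=> [ga [b [lb Nb]]]; split=> //; exists (t b); split; first exact: deg_lt_t.
by rewrite /= -(morphBD tB); exact: tN.1.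
Qed.

Let leading_le d e a : (d <= e)%N -> leading d a -> leading e a.
Proof. by move=> /subnK <- la; elim: (e - d)%N => //= k; exact: leadingS. Qed.

Let layer d : exists Y, (forall y, y \in Y -> N y) /\ forall a, leading d a ->
  exists z, [/\ gen (t :: ts) Y z & deg_lt d (iter d t a - z)].
Proof.
have [A [AL LA]] := IH (leading_subg d) (leading_stable d) (fun x => @proj1 _ _).
have H a : exists y, a \in A -> N y /\ deg_lt d (iter d t a - y).
  have [/AL[ga [b [lb Nb]]]|_] := boolP (a \in A); last by exists 0.
  exists (iter d t a + b) => _; split=> //; rewrite opprD addrA subrr.
  by apply: (deg_lt_subg d).2 => //; exact: (deg_lt_subg d).1.
have [y yP] := choice H; exists [seq y a | a <- A]; split=> [_ /mapP[a aA ->]|a /LA ga].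
  by case: (yP a aA).
have gY := gen_subg (t :: ts) [seq y a | a <- A].
apply: (ga (fun a => exists z, gen (t :: ts) [seq y a | a <- A] z /\ deg_lt d (iter d t a - z))).
- split; first by exists 0; rewrite iter0 subr0; split; [exact: gY.1|exact: (deg_lt_subg d).1].
  move=> a1 a2 [z1 [g1 l1]] [z2 [g2 l2]]; exists (z1 - z2); split; first exact: gY.2.
  by rewrite iterB opprD addrACA -opprD; exact: (deg_lt_subg d).2.
- have := allops_and (allops_and tsB tC) (allops_and (deg_lt_stable d) (gen_stable (t :: ts) [seq y a | a <- A]).2).
  apply: allops_impl => t' [[t'B t'C] [lt' gt']] a1 [z [gz lz]]; exists (t' z); split; first exact: gt'.
  have -> : iter d t (t' a1) = t' (iter d t a1) by elim: (d) => //= k ->; rewrite t'C.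
  by rewrite -t'B; exact: lt'.
move=> a1 a1A; have [Ny ly] := yP a1 a1A; exists (y a1); split=> //.
by apply: gen_mem; exact: map_f.
Qed.

(** The modules [leading d] increase with [d] and their union is finitely generated, so they are
    constant from some [D] on; above [D] the layer [D] is shifted by powers of [t]. *)
Lemma hilbert_basis_step : exists Y, (forall y, y \in Y -> N y) /\ forall x, N x -> gen (t :: ts) Y x.
Proof.
have [Yf YP] := choice layer.
have [||a [d la]|A [AL LA]] := IH (N' := fun a => exists d, leading d a).
- split; first by exists 0%N; exact: (leading_subg _).1.
  move=> x y [d lx] [e ly]; exists (maxn d e); apply: (leading_subg _).2.
    by apply: leading_le lx; exact: leq_maxl.
  by apply: leading_le ly; exact: leq_maxr.
- have H : allops (fun t' => forall d, forall x, leading d x -> leading d (t' x)) ts.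
    elim: (ts) leading_stable => //= t' ts' IH' H; split=> [d|]; first by case: (H d).
    by apply: IH' => d; case: (H d).
  by apply: allops_impl H => t' H y [d ly]; exists d; exact: H.
- by case: la.
have [D DP] : exists D, forall a, (exists d, leading d a) -> leading D a.
  have [D DA] : exists D, forall a, a \in A -> leading D a.
    elim: (A) AL => [|a A' IHA] AL'; first by exists 0%N.
    have [|D DA] := IHA; first by move=> x xA; apply: AL'; rewrite inE xA orbT.
    have [e le] := AL' a (mem_head _ _); exists (maxn D e) => x; rewrite inE => /orP[/eqP->|/DA].
      by apply: leading_le le; exact: leq_maxr.
    by apply: leading_le; exact: leq_maxl.
  by exists D => a /LA ga; apply: ga DA; [exact: leading_subg|exact: leading_stable].
pose Y := flatten [seq Yf d | d <- iota 0 D.+1].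
have YfY d : (d <= D)%N -> forall z, gen (t :: ts) (Yf d) z -> gen (t :: ts) Y z.
  move=> dD z gz; apply: gz; [exact: gen_subg|exact: gen_stable|] => y yY; apply: gen_mem.
  by apply/flattenP; exists (Yf d) => //; apply: map_f; rewrite mem_iota.
have YN y : y \in Y -> N y.
  by move=> /flattenP[_ /mapP[d _ ->]]; exact: (YP d).1.
have gN z : gen (t :: ts) Y z -> N z by move=> gz; exact: gz.
exists Y; split=> // x Nx; have [d lx] := gen_deg_lt (NX Nx).
elim: d x Nx lx => [|d IHd] x Nx; first by move=> ->; exact: (gen_subg _ _).1.
move=> [a [b [ga lb xE]]].
have la : leading d a by split=> //; exists b; rewrite -xE.
have [z [gz lz]] : exists z, gen (t :: ts) Y z /\ deg_lt d (iter d t a - z).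
  have [dD|Dd] := leqP d D.
    by have [z [gz lz]] := (YP d).2 a la; exists z; split=> //; exact: YfY gz.
  have [z [gz lz]] := (YP D).2 a (DP a (ex_intro _ d la)).
  exists (iter (d - D) t z); split.
    by elim: (d - D)%N => [|k gk] /=; [exact: YfY gz|exact: (gen_stable (t :: ts) Y).1].
  by rewrite -{1 2}(subnK (ltnW Dd)) iterD -iterB; exact: deg_lt_iter.
rewrite -[x](subrK z); apply: (subgD (gen_subg _ _)) => //.
apply: IHd; first by apply: sN.2 => //; exact: gN.
by rewrite xE addrAC; exact: (subgD (deg_lt_subg d)).
Qed.

End Step.

(* The leading coefficients need not be well defined, so no polynomials are
   introduced. *)
Theorem hilbert_basis ts X N : allops (fun t => {morph t : x y / x - y}) ts -> commops ts ->
  subg N -> stable ts N -> (forall x, N x -> gen ts X x) ->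
  exists Y, (forall y, y \in Y -> N y) /\ forall x, N x -> gen ts Y x.
Proof.
elim: ts N => [|t ts IH] N; first by move=> _ _ sN _; exact: hilbert_basis_nil.
move=> [tB tsB] [tC cts] sN tN NX; apply: (hilbert_basis_step tB tsB tC sN tN NX) => N' sN' tN' NX'.
exact: IH.
Qed.

End Noetherian.

Lemma allops_mapP (M : zmodType) (I : eqType) (g : I -> M -> M) (s : seq I) P :
  (forall c, c \in s -> P (g c)) <-> allops P [seq g c | c <- s].
Proof.
elim: s => //= c s IH; split=> [H|[gc gs] c'].
  by split; [apply: H; exact: mem_head|apply/IH => c' c's; apply: H; rewrite inE c's orbT].
by rewrite inE => /orP[/eqP->//|]; move/IH: gs; exact.
Qed.

Lemma commops_map (M : zmodType) (I : eqType) (g : I -> M -> M) (s : seq I) :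
  (forall c c' x, g c (g c' x) = g c' (g c x)) -> commops [seq g c | c <- s].
Proof. by move=> gC; elim: s => //= c s IH; split=> //; apply/allops_mapP. Qed.

(** * Finite generation over the symmetric Laurent polynomials *)

Section FiniteGeneration.
Variable r : nat.
Local Notation lfun := (lfun r).
Local Notation point := (point r).
Let T : {set 'I_r} := [set t | true].

(** Up to sign, the elementary symmetric functions of all the variables and the inverse of their
    product. *)
Definition symgens : seq lfun := ch0V T :: [seq ch T l | l <- iota 0 #|T|.+1].

Lemma symgens_inv c : c \in symgens -> inv (fun=> tt) c.
Proof.
have H f : inv (fun t => t \in T) f -> inv (fun _ : 'I_r => tt) f.
  by apply: inv_sub => w _; apply/fixesP => t; rewrite !inE.
rewrite inE => /orP[/eqP->|/mapP[l _ ->]]; apply: H; [exact: inv_ch0V|exact: inv_ch].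
Qed.

Definition symops : seq (lfun -> lfun) := [seq (fun f => c * f) | c <- symgens].

Lemma symops_noeth X N : subg N -> stable symops N -> (forall x, N x -> gen symops X x) ->
  exists Y, (forall y, y \in Y -> N y) /\ forall x, N x -> gen symops Y x.
Proof.
apply: hilbert_basis; first by apply/allops_mapP => c _ x y; exact: mulrBr.
by apply: commops_map => c c' x; exact: mulrCA.
Qed.

(** Variables and their inverses are integral over the symmetric functions, so the monomials with
    all exponents between 0 and [r - 1] generate. *)
Lemma Laur_gen : exists X : seq lfun, (forall x, x \in X -> Laur x) /\
  forall f, Laur f -> gen symops X f.
Proof.
(* The multipliers that preserve every generated submodule. They have the closure properties that
   [reduces_xpow] asks for, without a description of the ring generated by [symgens]. *)
pose K (f : lfun) := forall X v, gen symops X v -> gen symops X (f * v).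
have K1 : K 1 by move=> X v; rewrite mul1r.
have KB f g : K f -> K g -> K (f - g).
  by move=> Kf Kg X v gv; rewrite mulrBl; apply: (gen_subg _ _).2; [exact: Kf|exact: Kg].
have KM f g : K f -> K g -> K (f * g).
  by move=> Kf Kg X v gv; rewrite -mulrA; apply: Kf; exact: Kg.
have Ksym c : c \in symgens -> K c.
  by move=> cs X v; have /allops_mapP/(_ c cs) := gen_stable symops X; apply.
have Kch0V : K (ch0V T) by apply: Ksym; exact: mem_head.
have Kch l : K (ch T l).
  have [lm|ml] := leqP l #|T|.
    by apply: Ksym; rewrite inE; apply/orP; right; apply: map_f; rewrite mem_iota.
  have -> : ch T l = 0; last by move=> X v _; rewrite mul0r; exact: (gen_subg _ _).1.
  apply/funext => o; rewrite /ch nth_default // /charp -big_enum size_prod_XsubC -cardE.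
  exact: ml.
have [R RP] := choice (reduces_xpow K1 KB KM Kch Kch0V).
pose mon (J : {ffun 'I_r -> 'I_#|T|}) : lfun := \prod_u xpow u (J u : nat).
have Lmon J : Laur (mon J) by apply: Laur_prod => u _; exact: Laur_xpow.
exists [seq mon J | J <- enum {ffun 'I_r -> 'I_#|T|}]; split=> [_ /mapP[J _ ->]//|f Lf].
apply: (Lf (gen symops [seq mon J | J <- enum {ffun 'I_r -> 'I_#|T|}])).
- exact: (gen_subg _ _).1.
- by move=> x y; exact: (gen_subg _ _).2.
move=> _ [a ->].
have -> : mono a = \sum_(J : {ffun 'I_r -> 'I_#|T|}) (\prod_u R (a u) (J u)) * mon J.
  apply/funext => o; rewrite lfun_sum /mono.
  transitivity (\prod_u \sum_(l < #|T|) (xpow u (l : nat) * R (a u) l) o).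
    apply: eq_bigr => u _; rewrite -/(xpow u (a u) o) (RP (a u)).2 ?inE //.
  rewrite bigA_distr_bigA; apply: eq_bigr => J _.
  by rewrite [RHS]lfunM /mon !lfun_prod [RHS]mulrC -big_split.
apply: big_ind => [|x y gx gy|J _]; first exact: (gen_subg _ _).1.
  exact: subgD (gen_subg _ _) gx gy.
have KR : K (\prod_u R (a u) (J u)) by apply: big_ind => // u _; case: (RP (a u)).
by apply: KR; apply: gen_mem; apply: map_f; rewrite mem_enum.
Qed.

(* Artin-Tate: the invariants are a finite module over the symmetric functions. *)
Lemma inv_gen (K : eqType) (k : 'I_r -> K) : exists Y : seq lfun,
  (forall y, y \in Y -> inv k y) /\ forall f, inv k f -> gen symops Y f.
Proof.
have [X [LX XL]] := Laur_gen; apply: (@symops_noeth X).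
- by split; [exact: inv0|move=> x y; exact: invB].
- apply/allops_mapP => c /symgens_inv ic x; apply: invM.
  by apply: inv_sub ic => w _; apply/fixesP.
by move=> f [Lf _]; exact: XL.
Qed.

Section Matrices.
Variable n : nat.
Local Notation W := (word r 'I_n).
Local Notation mat := (mat r 'I_n 'I_n).

Definition zmat : zmodType := (W -> W -> lfun : zmodType).

Definition matops : seq (zmat -> zmat) := [seq (fun M p q => c * M p q) : zmat -> zmat | c <- symgens].

(** The matrices of Laurent polynomials form a finite module, generated by matrices with a single
    nonzero entry. *)
Lemma mat_noeth (N : zmat -> Prop) : subg N ->
  (forall c M, inv (fun=> tt) c -> N M -> N (fun p q => c * M p q)) ->
  (forall M p q, N M -> Laur (M p q)) ->
  exists Y, (forall y, y \in Y -> N y) /\ forall x, N x -> gen matops Y x.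
Proof.
move=> sN sc LN; have [X [LX XL]] := Laur_gen.
pose dl (p q : W) (f : lfun) : zmat := fun p' q' => if (p', q') == (p, q) then f else 0.
pose Z := [seq dl pq.1 pq.2 f | pq <- enum {: W * W}, f <- X].
apply: (@hilbert_basis zmat matops Z).
- by apply/allops_mapP => c _ x y; apply/funext => p; apply/funext => q; exact: mulrBr.
- by apply: commops_map => c c' x; apply/funext => p; apply/funext => q; exact: mulrCA.
- exact: sN.
- by apply/allops_mapP => c /symgens_inv ic M; exact: sc.
move=> M NM; have gZ := gen_subg matops Z.
have dlZ p q f : Laur f -> gen matops Z (dl p q f).
  move=> /XL gf; apply: (gf (fun f => gen matops Z (dl p q f))).
  - split; first by rewrite (_ : dl p q 0 = 0); [exact: gZ.1|
      apply/funext => p'; apply/funext => q'; rewrite /dl; case: ifP].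
    move=> x y gx gy; rewrite (_ : dl p q (x - y) = dl p q x - dl p q y); first exact: gZ.2.
    apply/funext => p'; apply/funext => q'.
    rewrite -[RHS]/(dl p q x p' q' - dl p q y p' q') /dl.
    by case: ifP; rewrite ?subrr.
  - apply/allops_mapP => c cs x gx.
    have /allops_mapP/(_ c cs (dl p q x) gx) := gen_stable matops Z.
    rewrite (_ : (fun p' q' => _) = dl p q (c * x)) //.
    by apply/funext => p'; apply/funext => q'; rewrite /dl; case: ifP; rewrite ?mulr0.
  move=> x xX; apply: gen_mem; apply/allpairsP; exists ((p, q), x); split=> //.
  by rewrite mem_enum.
have -> : M = \sum_(pq : W * W) dl pq.1 pq.2 (M pq.1 pq.2).
  apply/funext => p; apply/funext => q; apply/esym.
  transitivity (\sum_(pq : W * W) dl pq.1 pq.2 (M pq.1 pq.2) p q).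
    by elim/big_rec2: _ => // pq x y _ <-.
  rewrite (bigD1 (p, q)) //= big1 ?addr0 /dl ?eqxx // => -[p' q'] pq.
  by rewrite eq_sym (negPf pq).
by apply: big_ind => [|x y gx gy|pq _]; [exact: gZ.1|exact: subgD gZ gx gy|apply: dlZ; exact: LN].
Qed.

End Matrices.
End FiniteGeneration.

(** * Heredity ideals from bases *)

(** Coordinates map the tensor product with [M] to [M^m]. This map is injective: the uniqueness in
    the universal property shows that it has a left inverse. In coordinates the induced map is [f]
    applied componentwise. *)
Lemma free_flat (B : pzRingType) (V : lmodType B^c) m (Y : 'I_m -> V) (coef : V -> 'I_m -> B^c) :
  (forall v, v = \sum_i coef v i *: Y i) ->
  (forall c c' : 'I_m -> B^c, \sum_i c i *: Y i = \sum_i c' i *: Y i -> c =1 c') ->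
  (forall b b' : B, b * b' = b' * b) -> flat V.
Proof.
move=> VY Yfree BC M N f fI VM VN tM tN [bM uM] [bN uN] h hE.
have coefE c : coef (\sum_i c i *: Y i) =1 c by apply: Yfree; rewrite -VY.
have coefD v v' i : coef (v + v') i = coef v i + coef v' i.
  rewrite -(coefE (fun i => coef v i + coef v' i)); congr coef.
  by rewrite {1}(VY v) {1}(VY v') -big_split; apply: eq_bigr => j _; rewrite scalerDl.
have coefZ (b : B^c) v i : coef (b *: v) i = b * coef v i.
  rewrite -(coefE (fun i => b * coef v i)); congr coef.
  by rewrite {1}(VY v) scaler_sumr; apply: eq_bigr => j _; rewrite scalerA.
have bal (L : lmodType B) : balanced (fun v (l : L) => [ffun i => (coef v i : B) *: l]).
  split=> [v v' l|v l l'|b v l]; apply/ffunP => i; rewrite !ffunE.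
  - by rewrite coefD scalerDl.
  - by rewrite scalerDr.
  by rewrite coefZ scalerA.
have [aM [aME aMu]] := uM _ _ (bal M).
have [aN [aNE aNu]] := uN _ _ (bal N).
have aMI z : aM z = 0 -> z = 0.
  move=> az; pose g (x : {ffun 'I_m -> M}) : VM := \sum_i tM (Y i) (x i).
  have tM0 v : tM v 0 = 0.
    by case: bM => _ tD _; apply: (@addrI _ (tM v 0)); rewrite -tD !addr0.
  have gB : zmod_morphism (g \o aM).
    move=> x y; rewrite /g /= raddfB -sumrB; apply: eq_bigr => i _.
    case: bM => _ tD _; rewrite !ffunE; apply: (@addIr _ (tM (Y i) (aM y i))).
    by rewrite -tD !subrK.
  pose gh : {additive VM -> VM} := HB.pack (g \o aM) (GRing.isZmodMorphism.Build _ _ _ gB).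
  have [idh [idE idu]] := uM VM tM bM.
  have gid : gh =1 idh.
    apply: idu => v l; rewrite /gh /= /g aME.
    case: bM => tD _ tb; rewrite [v in RHS]VY.
    have tS (s : seq 'I_m) (F : 'I_m -> V) : tM (\sum_(i <- s) F i) l = \sum_(i <- s) tM (F i) l.
      elim: s => [|i s IH]; last by rewrite !big_cons tD IH.
      by rewrite !big_nil; apply: (@addrI _ (tM 0 l)); rewrite -tD !addr0.
    by rewrite tS; apply: eq_bigr => i _; rewrite ffunE -tb.
  have idid : (idfun : {additive VM -> VM}) =1 idh by apply: idu.
  have -> : z = idh z by exact: (idid z).
  rewrite -gid /gh /= az /g big1 // => i _.
  by rewrite ffunE tM0.
have comm z i : aN (h z) i = f (aM z i).
  pose F (x : {ffun 'I_m -> M}) : {ffun 'I_m -> N} := [ffun i => f (x i)].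
  have FB : zmod_morphism (F \o aM).
    by move=> x y; apply/ffunP => j; rewrite !ffunE raddfB !ffunE linearB.
  pose Fh : {additive VM -> {ffun 'I_m -> N}} := HB.pack (F \o aM) (GRing.isZmodMorphism.Build _ _ _ FB).
  have balf : balanced (fun v (l : M) => [ffun i => (coef v i : B) *: f l]).
    have [h1 h2 h3] := bal N; split=> [v v' l|v l l'|b v l].
    - exact: h1.
    - by rewrite linearD; exact: h2.
    by rewrite h3 linearZ.
  have [c [cE cu]] := uM _ _ balf.
  have e1 : Fh =1 c.
    by apply: cu => v l; apply/ffunP => j; rewrite /Fh /= /F ffunE aME !ffunE linearZ.
  have e2 : (aN \o h : {additive VM -> {ffun 'I_m -> N}}) =1 c.
    by apply: cu => v l /=; rewrite hE aNE.
  by rewrite -[aN (h z)]/((aN \o h) z) e2 -e1 /Fh /= /F ffunE.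
suff hI z : h z = 0 -> z = 0.
  by move=> x y /eqP; rewrite -subr_eq0 -raddfB => /eqP/hI/eqP; rewrite subr_eq0 => /eqP.
move=> hz; apply: aMI; apply/ffunP => i; rewrite ffunE; apply: fI.
by rewrite -comm hz raddf0 ffunE linear0.
Qed.

(** * The left ideal of an idempotent and its endomorphisms *)

Section IdempotentModule.
Variables (R : pzRingType) (ei : Defs.idempotent R).
Local Notation e := (idem_val ei).

(** The left ideal [R e], described as the fixed points of right multiplication by [e]. *)
Definition idem_pred : {pred R^o} := fun x : R => x * e == x.

Record idem_module : Type := IdemModule { idem_module_val : R^o; _ : idem_module_val \in idem_pred }.

HB.instance Definition _ := [isSub for idem_module_val].
HB.instance Definition _ := [Choice of idem_module by <:].

Lemma idem_submod_closed : submod_closed idem_pred.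
Proof.
split=> [|a x y /eqP xe /eqP ye]; first by apply/eqP; rewrite mul0r.
by apply/eqP; rewrite mulrDl -[in RHS]xe -[in RHS]ye -mulrA.
Qed.

HB.instance Definition _ := GRing.isSubmodClosed.Build R R^o idem_pred idem_submod_closed.
HB.instance Definition _ := [SubChoice_isSubLmodule of idem_module by <:].

Lemma idem_moduleP (p : idem_module) : (val p : R) * e = val p.
Proof. by case: p => x /= /eqP. Qed.

Lemma idem_genP : (e : R^o) \in idem_pred.
Proof. by apply/eqP; exact: idem_mulK. Qed.

Definition idem_gen : idem_module := IdemModule idem_genP.

Lemma idem_moduleE (p : idem_module) : p = (val p : R) *: idem_gen.
Proof. by apply: val_inj; rewrite /= -[RHS]/((val p : R) * e) idem_moduleP. Qed.

Lemma projective_idem : projective idem_module.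
Proof.
move=> M N g f gs; have [y gy] := gs (f idem_gen).
pose h (p : idem_module) : M := (val p : R) *: y.
have hl : linear h.
  by move=> a p q; rewrite /h linearP /= scalerDl scalerA.
pose hh : {linear idem_module -> M} := HB.pack h (GRing.isLinear.Build _ _ _ _ h hl).
exists hh => p; rewrite /hh /= /h linearZ gy -linearZ /=.
by rewrite -idem_moduleE.
Qed.

Lemma idem_rmulP (x : R) (p : idem_module) : ((val p : R) * (e * x * e) : R^o) \in idem_pred.
Proof. by apply/eqP; rewrite -!mulrA idem_mulK. Qed.

Definition idem_rmul_fun (x : R) (p : idem_module) : idem_module := IdemModule (idem_rmulP x p).

Lemma idem_rmul_linear x : linear (idem_rmul_fun x).
Proof. by move=> a p q; apply: val_inj; rewrite [RHS]linearP /= mulrDl; congr (_ + _); exact: (esym (mulrA _ _ _)). Qed.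

HB.instance Definition _ x := GRing.isLinear.Build R idem_module idem_module _ _ (idem_rmul_linear x).

(** Together with [idem_endo] it identifies the endomorphism ring of [R e] with [e R e]. The order
    of factors is preserved because endomorphisms act on the right. *)
Definition idem_rmul (x : R) : endo idem_module := idem_rmul_fun x.

Definition idem_endo (f : endo idem_module) : R := val (endo_fun f idem_gen).

Lemma idem_endoP f : e * idem_endo f * e = idem_endo f.
Proof.
rewrite /idem_endo -mulrA idem_moduleP.
have eg : (e : R) *: idem_gen = idem_gen by apply: val_inj; exact: (idem_mulK ei).
by rewrite -{2}eg linearZ.
Qed.

Lemma idem_endoK f : idem_rmul (idem_endo f) = f.
Proof.
apply: endoP => p; apply: val_inj; rewrite /= idem_endoP.
by rewrite [in RHS](idem_moduleE p) linearZ.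
Qed.

Lemma idem_rmulK x : e * x * e = x -> idem_endo (idem_rmul x) = x.
Proof. by move=> ex; rewrite /idem_endo /= !mulrA idem_mulK. Qed.

Lemma idem_endoM f g : idem_endo (f * g) = idem_endo f * idem_endo g.
Proof.
rewrite /idem_endo -[endo_fun (f * g) _]/(endo_fun g (endo_fun f idem_gen)).
by rewrite {1}(idem_moduleE (endo_fun f idem_gen)) linearZ.
Qed.

End IdempotentModule.

(* A e is free over e A e with basis Y, and Y' spans e A. *)
Theorem affine_heredity_of_basis (k : idomainType) (A : algebra k) (ei : Defs.idempotent A)
    (J : {pred A}) m (Y Y' : 'I_m -> A) (e := idem_val ei) :
  is_AeA e J ->
  (forall i, Y i * e = Y i) -> (forall i, e * Y' i = Y' i) ->
  (forall x : A, x * e = x -> exists c : 'I_m -> A,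
     (forall i, e * c i * e = c i) /\ x = \sum_i Y i * c i) ->
  (forall x : A, e * x = x -> exists c : 'I_m -> A,
     (forall i, e * c i * e = c i) /\ x = \sum_i c i * Y' i) ->
  (forall c : 'I_m -> 'I_m -> A, (forall i j, e * c i j * e = c i j) ->
     \sum_i \sum_j Y i * c i j * Y' j = 0 -> forall i j, c i j = 0) ->
  (forall x y : A, e * x * e = x -> e * y * e = y -> x * y = y * x) ->
  (exists l (g : 'I_l -> A), (forall i, e * g i * e = g i) /\
     forall S : A -> Prop, S e -> (forall x y, S x -> S y -> S (x - y)) ->
       (forall x y, e * x * e = x -> e * y * e = y -> S x -> S y -> S (x * y)) ->
       (forall i, S (g i)) -> forall x, e * x * e = x -> S x) ->
  affine_heredity_ideal J.
Proof.
move=> JE Ye Y'e B1 B1' B2 BC [l [g [ge gen]]].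
have ee : e * e = e by exact: idem_mulK.
split; first by exists e; split=> //; apply/JE; exists [:: (1, 1)]; rewrite big_seq1 mul1r mulr1.
pose P : lmodType A := idem_module ei; exists P.
have Pe (p : P) : (val p : A) * e = val p by exact: idem_moduleP.
have YP i : (Y i : A^o) \in idem_pred ei by apply/eqP; exact: Ye.
pose YI i : P := IdemModule (YP i).
(* Expanding each [x j] in the [Y i] shows that the copies of [P] inside [J] form a direct sum. *)
have indep (x : 'I_m -> P) : \sum_j (val (x j) : A) * Y' j = 0 -> forall j, x j = 0.
  move=> x0 j; have [c cP] := choice (fun j => B1 (val (x j)) (Pe (x j))).
  have c0 i j' : c j' i = 0.
    apply: (B2 (fun i j => c j i)) => [i' j0|]; first by case: (cP j0).
    rewrite -[RHS]x0 exchange_big; apply: eq_bigr => j0 _ /=.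
    by rewrite [in RHS](cP j0).2 mulr_suml.
  apply: val_inj; rewrite /= (cP j).2 big1 // => i _.
  by rewrite c0 mulr0.
split.
- pose F (x : {ffun 'I_m -> P}) : A^o := \sum_j (val (x j) : A) * Y' j.
  have Fl : linear F.
    move=> a x y; rewrite /F scaler_sumr -big_split; apply: eq_bigr => j _ /=.
    rewrite !ffunE [val _]linearP mulrDl; congr (_ + _); exact: (esym (mulrA _ _ _)).
  pose Fh : {linear {ffun 'I_m -> P} -> A^o} := HB.pack F (GRing.isLinear.Build _ _ _ _ F Fl).
  exists m, Fh; split=> [x y xy|x].
    apply/ffunP => j; apply/eqP; rewrite -subr_eq0; apply/eqP.
    have := indep (x - y); rewrite -[X in X = 0 -> _]/(Fh (x - y)) linearB xy subrr.
    by move=> /(_ erefl j); rewrite !ffunE.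
  rewrite JE; split=> [[s ->]|[p <-]].
    elim: s => [|[a b] s [p pE]]; first by exists 0; rewrite big_nil linear0.
    have [|c [ce bE]] := B1' (e * b); first by rewrite mulrA ee.
    have qP j : (a * c j : A^o) \in idem_pred ei.
      by apply/eqP; rewrite -[in RHS]ce -mulrA -[in LHS]ce -!mulrA ee !mulrA.
    exists ([ffun j => IdemModule (qP j)] + p); rewrite big_cons linearD pE /=; congr (_ + _).
    rewrite /Fh /= /F -mulrA bE mulr_sumr; apply: eq_bigr => j _.
    by rewrite ffunE mulrA.
  exists [seq (val (p j) : A, Y' j) | j <- index_enum 'I_m].
  by rewrite big_map; apply: eq_bigr => j _ /=; rewrite Pe.
- exact: projective_idem.
- have comm (x y : endo P) : x * y = y * x.
    rewrite -[LHS]idem_endoK -[RHS]idem_endoK !idem_endoM BC //; exact: idem_endoP.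
  split=> //; exists l, (fun i => idem_rmul ei (g i)) => S [S1 SB SM] _ Sg x.
  rewrite -[x]idem_endoK.
  have rB a b : idem_rmul ei (a - b) = idem_rmul ei a - idem_rmul ei b.
    apply: endoP => p; apply: val_inj.
    rewrite -[endo_fun (_ - _) p]/(idem_rmul_fun a p - idem_rmul_fun b p) linearB /=.
    by rewrite mulrBr mulrBl mulrBr.
  apply: (gen (fun a => idem_rmul ei a \in S)) => //; last exact: idem_endoP.
  - suff -> : idem_rmul ei e = 1 by [].
    by apply: endoP => p; apply: val_inj; rewrite /= !ee Pe.
  - by move=> a b Sa Sb; rewrite rB; exact: SB.
  move=> a b ea eb Sa Sb; suff -> : idem_rmul ei (a * b) = idem_rmul ei a * idem_rmul ei b by exact: SM.
  apply: (can_inj (@idem_endoK _ ei)); rewrite idem_endoM !idem_rmulK //.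
  by rewrite -ea -eb !mulrA ee -!mulrA ee.
- exists m, YI => v; have [c [ce vE]] := B1 (val (v : P)) (Pe v).
  exists (fun i => idem_rmul ei (c i) : (endo P)^c); apply: val_inj.
  rewrite linear_sum /= [LHS]vE; apply: eq_bigr => i _.
  by rewrite /= ce.
pose V := right_endo_module P.
have [cf cfP] := choice (fun v : V => B1 (val (v : P)) (Pe v)).
apply: (@free_flat (endo P) V m YI (fun v i => idem_rmul ei (cf v i))).
- move=> v; apply: val_inj; rewrite linear_sum /= [LHS](cfP v).2; apply: eq_bigr => i _.
  by rewrite /= (cfP v).1.
- move=> c c' /(congr1 val); rewrite !linear_sum /= => H i.
  have cE (d : (endo P)^c) j : val (d *: (YI j : V) : P) = Y j * idem_endo d.
    by rewrite -[d in LHS](@idem_endoK _ ei) /= idem_endoP.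
  pose d j := idem_endo (c j : endo P) - idem_endo (c' j : endo P).
  have dE j : e * d j * e = d j by rewrite mulrBr mulrBl !idem_endoP.
  have Yd : \sum_j Y j * d j = 0.
    under eq_bigr do rewrite mulrBr -!cE.
    by rewrite sumrB; apply/eqP; rewrite subr_eq0; apply/eqP.
  have d0 : d i = 0.
    (* Placing the coefficients in the single column [i] turns a relation among the [Y j] into one
       to which [B2] applies. *)
    have := B2 (fun j j' => if j' == i then d j else 0).
    move=> /(_ _ _ i i); rewrite eqxx; apply.
      by move=> j j'; case: ifP => _ //; rewrite mulr0 mul0r.
    rewrite exchange_big (bigD1 i) //= [X in _ + X]big1 ?addr0 => [|j /negPf ji].
      transitivity ((\sum_j Y j * d j) * Y' i); last by rewrite Yd mul0r.
      by rewrite mulr_suml; apply: eq_bigr => j _; rewrite eqxx.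
    by apply: big1 => j' _; rewrite ji mulr0 mul0r.
  rewrite -[LHS](@idem_endoK _ ei) -[RHS](@idem_endoK _ ei); congr (idem_rmul _ _).
  by apply/eqP; rewrite -subr_eq0; apply/eqP.
by move=> b b'; rewrite -[LHS]idem_endoK -[RHS]idem_endoK !idem_endoM BC //; exact: idem_endoP.
Qed.

(** * The heredity chain of the ring of equivariant matrices *)

Section Lex.
Variables n r : nat.
Local Notation W := (word r 'I_n).
Implicit Types s p q : W.

Lemma lexgtP s p : reflect (exists2 j : 'I_n, forall i : 'I_n, (i < j)%N -> cnt s i = cnt p i & (cnt p j < cnt s j)%N)
  (lexgt s p).
Proof.
apply: (iffP existsP) => [[j /andP[/forallP H lt]]|[j H lt]]; exists j => //.
  by move=> i ij; have := H i; rewrite ij /= => /eqP.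
by rewrite lt andbT; apply/forallP => i; apply/implyP => /H->.
Qed.

Lemma lexgt_irr s : lexgt s s = false.
Proof. by apply/lexgtP => -[j _]; rewrite ltnn. Qed.

Lemma lexgt_trans p s q : lexgt s p -> lexgt p q -> lexgt s q.
Proof.
move=> /lexgtP[j H lt] /lexgtP[j' H' lt']; apply/lexgtP.
case: (ltngtP j j') => jj.
- by exists j => [i ij|]; [rewrite H // H' // (ltn_trans ij)|rewrite -(H' j)].
- by exists j' => [i ij|]; [rewrite H ?H' // (ltn_trans ij)|rewrite (H j')].
have jE : j = j' by exact: val_inj.
exists j => [i ij|]; first by rewrite H // H' // -jE.
by apply: ltn_trans lt; rewrite jE.
Qed.

Lemma lexgt_total s p : ~~ lexgt s p -> ~~ lexgt p s -> samecnt s p.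
Proof.
move=> sp ps; apply/samecntP.
suff H m : forall a : 'I_n, (a < m)%N -> cnt p a = cnt s a by move=> a; exact: (H a.+1).
elim: m => // m IH a; rewrite ltnS leq_eqVlt => /orP[/eqP am|]; last exact: IH.
have IH' (i : 'I_n) : (i < a)%N -> cnt p i = cnt s i by rewrite am; exact: IH.
case: (ltngtP (cnt p a) (cnt s a)) => // lt.
- by case/lexgtP: sp; exists a => // i /IH'->.
- by case/lexgtP: ps; exists a.
Qed.

Lemma samecnt_lexgt s p q : samecnt s p -> lexgt s q = lexgt p q.
Proof.
by move=> /samecntP sp; apply: eq_existsb => j; rewrite sp; congr (_ && _); apply: eq_forallb => i; rewrite sp.
Qed.

(** Turns the order of contents into a numerical level that can index the chain; the levels that
    occur need not be consecutive. *)
Definition lexrank s : nat := #|[pred s' | lexgt s s']|.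

Lemma lexrank_lt s p : (lexrank s < lexrank p)%N = lexgt p s.
Proof.
have up s' p' : lexgt p' s' -> (lexrank s' < lexrank p')%N.
  move=> ps; apply: proper_card; apply/fintype.properP; split; first by apply/fintype.subsetP => q; exact: lexgt_trans.
  by exists s'; rewrite !inE // lexgt_irr.
apply/idP/idP => [lt|]; last exact: up.
apply: contraLR lt => ps; rewrite -leqNgt; have [/up/ltnW//|sp] := boolP (lexgt s p).
have E := lexgt_total sp ps; apply: subset_leq_card; apply/fintype.subsetP => q.
by rewrite !inE (samecnt_lexgt _ E).
Qed.

Lemma lexrank_le s p : (lexrank s <= lexrank p)%N = lexgt p s || samecnt s p.
Proof.
rewrite leqNgt lexrank_lt; apply/idP/orP => [sp|[ps|E]].
- by have [ps|ps] := boolP (lexgt p s); [left|right; exact: lexgt_total].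
- by apply/negP => sp; have := lexgt_trans ps sp; rewrite lexgt_irr.
by rewrite (samecnt_lexgt _ E) lexgt_irr.
Qed.

End Lex.

(** Generated by the idempotent 0, with an empty basis. It serves at levels without words and for
    contents that are not partitions. *)
Lemma heredity_zero (k : idomainType) (B : algebra k) (J : {pred B}) :
  (forall x, x \in J <-> x = 0) -> affine_heredity_ideal J.
Proof.
move=> J0; pose ei : Defs.idempotent B := Idempotent (mulr0 (0 : B)).
have z0 (x : B) : x * 0 = x -> x = 0 by rewrite mulr0.
apply: (@affine_heredity_of_basis _ B ei J 0 (fun=> 0) (fun=> 0)) => /=.
- move=> x; rewrite J0; split=> [->|[s ->]]; first by exists [::]; rewrite big_nil.
  by rewrite big1 // => i _; rewrite mulr0 mul0r.
- by case.
- by case.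
- by move=> x /z0->; exists (fun=> 0); split=> [[]//|]; rewrite big_ord0.
- by move=> x; rewrite mul0r => <-; exists (fun=> 0); split=> [[]//|]; rewrite big_ord0.
- by move=> c _ _ [].
- by move=> x y; rewrite !mulr0 => <- <-.
exists 0%N, (fun=> 0); split=> [[]//|S S0 _ _ _ x].
by rewrite mulr0 => <-.
Qed.

Lemma int_left_noetherian : left_noetherian int.
Proof.
move=> I [I0 IM]; have [||g Ig gP] := @int_ideal (fun x => x \in I); first exact: I0.
  by move=> x y Ix Iy; have := IM (-1) y x Iy Ix; rewrite mulN1r addrC.
exists 1%N, (fun=> g); split=> // x /gP[q ->].
by exists (fun=> q); rewrite big_ord1.
Qed.

(** * Ideals and layers of the ring of equivariant matrices *)

Section MatrixRing.
Variables n r : nat.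
Local Notation W := (word r 'I_n).
Local Notation lfun := (lfun r).
Local Notation point := (point r).
Local Notation mat := (mat r 'I_n 'I_n).
Variables (A : pzRingType) (mu : A -> mat).
Hypotheses (muI : injective mu) (mu_eqmat : forall x, eqmat (mu x)).
Hypothesis mu_onto : forall M, eqmat M -> exists x, mu x = M.
Hypothesis muB : forall x y p q, mu (x - y) p q = mu x p q - mu y p q.
Hypothesis muM : forall x y, mu (x * y) = mulm (mu x) (mu y).
Implicit Types (x y : A) (T : pred W) (w : 'S_r) (o : point).

Lemma mu0 p q : mu 0 p q = 0.
Proof. by rewrite -(subrr 0) muB subrr. Qed.

Lemma muD x y p q : mu (x + y) p q = mu x p q + mu y p q.
Proof. by rewrite -[y in LHS]opprK muB -[- y]sub0r muB mu0 sub0r opprK. Qed.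

Lemma mu_sum I (s : seq I) (P : pred I) (F : I -> A) p q :
  mu (\sum_(i <- s | P i) F i) p q = \sum_(i <- s | P i) mu (F i) p q.
Proof. by elim/big_rec2: _ => [|i y x _ <-]; rewrite ?mu0 ?muD. Qed.

Lemma mu_ext x y : (forall p q, mu x p q = mu y p q) -> x = y.
Proof. by move=> E; apply: muI; apply/funext => p; apply/funext => q. Qed.

Let mat_preimage M : exists x, eqmat M -> mu x = M.
Proof.
by have [/mu_onto[x <-]|no] := pselect (eqmat M); [exists x|exists 0 => /no].
Qed.

Definition of_mat (M : mat) : A := projT1 (cid (mat_preimage M)).

Lemma of_matK M : eqmat M -> mu (of_mat M) = M.
Proof. exact: (projT2 (cid (mat_preimage M))). Qed.

(** The anti-involution that carries results on [A e] over to [e A]. *)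
Definition transp (x : A) : A := of_mat (fun p q => mu x q p).

Lemma transpE x p q : mu (transp x) p q = mu x q p.
Proof.
rewrite /transp of_matK //; split=> [p' q'|w p' q' o]; first exact: (mu_eqmat x).1.
exact: (mu_eqmat x).2.
Qed.

Lemma transpK : involutive transp.
Proof. by move=> x; apply: mu_ext => p q; rewrite !transpE. Qed.

Lemma transpB x y : transp (x - y) = transp x - transp y.
Proof. by apply: mu_ext => p q; rewrite muB !transpE muB. Qed.

Lemma transpM x y : transp (x * y) = transp y * transp x.
Proof.
apply: mu_ext => p q; rewrite transpE !muM /mulm; apply: eq_bigr => s _.
by rewrite !transpE mulrC.
Qed.

(** A two-sided ideal although only left factors [a] occur: right multiplication of [b] keeps its
    rows outside [T] zero. *)
Definition generates T x := zspan (fun y => exists a b, y = a * b /\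
  forall p q, ~~ T p -> mu b p q = 0) x.

Section Ideal.
Variable T : pred W.

Definition ideal_pred : {pred A} := fun x => `[< generates T x >].

Lemma ideal_predP x : reflect (generates T x) (x \in ideal_pred).
Proof. exact: asboolP. Qed.

Lemma ideal_zmod_closed : zmod_closed ideal_pred.
Proof.
split=> [|x y /ideal_predP gx /ideal_predP gy]; apply/ideal_predP; first exact: zspan0.
exact: zspanB.
Qed.

Lemma ideal_mull a : {in ideal_pred, forall x, a * x \in ideal_pred}.
Proof.
move=> x /ideal_predP gx; apply/ideal_predP.
apply: (zspan_map (h := fun x => a * x) _ _ gx) => [|y z|_ [b [c [-> c0]]]].
- exact: mulr0.
- exact: mulrBr.
by apply: zspan_gen; exists (a * b), c; rewrite mulrA.
Qed.

Lemma ideal_mulr a : {in ideal_pred, forall x, x * a \in ideal_pred}.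
Proof.
move=> x /ideal_predP gx; apply/ideal_predP.
apply: (zspan_map (h := fun x => x * a) _ _ gx) => [|y z|_ [b [c [-> c0]]]].
- exact: mul0r.
- exact: mulrBl.
apply: zspan_gen; exists b, (c * a); split=> [|p q Tp]; first by rewrite mulrA.
by rewrite muM /mulm big1 // => s _; rewrite c0 // mul0r.
Qed.

HB.instance Definition _ := GRing.isZmodClosed.Build A ideal_pred ideal_zmod_closed.
HB.instance Definition _ := isTwoSided.Build A ideal_pred ideal_mull ideal_mulr.

End Ideal.

Lemma mul_in_ideal T x y : (forall p q, ~~ T p -> mu y p q = 0) -> x * y \in ideal_pred T.
Proof. by move=> y0; apply/ideal_predP; apply: zspan_gen; exists x, y. Qed.

Definition stableW T := forall w p, T (pact w p) = T p.

Definition diagmat T : mat := fun p q => if (p == q) && T p then 1 else 0.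

Lemma eqmat_diag T : stableW T -> eqmat (diagmat T).
Proof.
move=> sT; split=> [p q|w p q o]; rewrite /diagmat; first by case: ifP => _; [exact: Laur1|exact: Laur0].
by rewrite sT (inj_eq (can_inj (@pactK r 'I_n w))); case: ifP.
Qed.

Definition diag T : A := of_mat (diagmat T).

Lemma mu_diagl T x p q : stableW T -> mu (diag T * x) p q = if T p then mu x p q else 0.
Proof.
move=> sT; rewrite muM /mulm of_matK; last exact: eqmat_diag.
rewrite (bigD1 p) //= big1 ?addr0 => [|s /negPf sp]; last by rewrite /diagmat eq_sym sp mul0r.
by rewrite /diagmat eqxx /=; case: ifP; rewrite ?mul1r ?mul0r.
Qed.

Lemma mu_diagr T x p q : stableW T -> mu (x * diag T) p q = if T q then mu x p q else 0.
Proof.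
move=> sT; rewrite muM /mulm of_matK; last exact: eqmat_diag.
rewrite (bigD1 q) //= big1 ?addr0 => [|s /negPf sp]; last by rewrite /diagmat sp mulr0.
by rewrite /diagmat eqxx /=; case: ifP; rewrite ?mulr1 ?mulr0.
Qed.

Lemma diag_idem T : stableW T -> diag T * diag T = diag T.
Proof.
move=> sT; apply: mu_ext => p q; rewrite mu_diagl // of_matK; last exact: eqmat_diag.
by rewrite /diagmat; case: (T p); rewrite ?andbF.
Qed.

Lemma diag_in T T' : stableW T -> (forall p, T p -> T' p) -> diag T \in ideal_pred T'.
Proof.
move=> sT TT'; rewrite -[diag T]mul1r; apply: mul_in_ideal => p q Tp.
rewrite of_matK; last exact: eqmat_diag.
rewrite /diagmat; case: ifP => // /andP[_ /TT'].
by rewrite (negPf Tp).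
Qed.

Lemma transp_in T x : stableW T -> x \in ideal_pred T -> transp x \in ideal_pred T.
Proof.
move=> sT /ideal_predP gx; apply/ideal_predP.
apply: (zspan_map (h := transp) _ _ gx); first by have := transpB 0 0; rewrite !subrr.
  exact: transpB.
move=> _ [a [b [-> b0]]]; apply/ideal_predP; rewrite transpM.
have -> : transp b = transp b * diag T.
  by apply: mu_ext => p q; rewrite mu_diagr // !transpE; case: ifP => // /negbT/b0->.
by rewrite -mulrA; apply: mul_in_ideal => p q Tp; rewrite mu_diagl // (negPf Tp).
Qed.

Section Layer.
Variable rho : W.
Definition higher : pred W := fun p => lexgt p rho.
Definition same_content : pred W := samecnt rho.

Lemma stable_higher : stableW higher.
Proof.
move=> w p; apply: eq_existsb => j; rewrite cnt_pact; congr (_ && _).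
by apply: eq_forallb => i; rewrite cnt_pact.
Qed.

Lemma stable_same_content : stableW same_content.
Proof. by move=> w p; exact: samecnt_act. Qed.

Local Notation e := (diag same_content).

Lemma samecnt_orbit q : samecnt rho q -> exists w, q = pact w rho.
Proof.
move=> /samecntP sq; have [|w wP] := @perm_of_counts r _ q rho; first by move=> a; exact: sq.
by exists w; apply/ffunP => t; rewrite ffunE.
Qed.

(** Extends a column at [rho] by equivariance to all words in the orbit of [rho], and by 0
    elsewhere. This identifies [A e] with the equivariant vectors. *)
Definition extmat (u : vec r 'I_n) : mat := fun p q o =>
  if [pick w : 'S_r | pact w rho == q] is Some w then u (pact w^-1%g p) (oact w^-1%g o) else 0.

Lemma extmatE u w p o : eqvec rho u -> extmat u p (pact w rho) o = u (pact w^-1%g p) (oact w^-1%g o).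
Proof.
move=> eu; rewrite /extmat; case: pickP => [w' /eqP ww'|/(_ w)]; last by rewrite eqxx.
have fw : fixes rho (w^-1 * w')%g by rewrite fixes_pact -pactM ww' pactK.
rewrite -(eu.2 _ fw (pact w'^-1%g p)) pactM oactM.
by rewrite -mulgA mulgV mulg1.
Qed.

Lemma extmat0 u p q : ~~ samecnt rho q -> extmat u p q = 0.
Proof.
move=> sq; apply/funext => o; rewrite /extmat; case: pickP => // w /eqP E.
by move: sq; rewrite -E samecnt_act /samecnt; move/forallP; case=> a.
Qed.

Lemma extmat_rho u p : eqvec rho u -> extmat u p rho = u p.
Proof.
by move=> eu; apply/funext => o; rewrite -{1}(pact1 rho) extmatE // invg1 pact1 oact1.
Qed.

Lemma eqmat_ext u : eqvec rho u -> eqmat (extmat u).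
Proof.
move=> eu; split=> [p q|w p q o].
  have [/samecnt_orbit[w ->]|sq] := boolP (samecnt rho q); last by rewrite extmat0 //; exact: Laur0.
  have -> : extmat u p (pact w rho) = fun o => u (pact w^-1%g p) (oact w^-1%g o).
    by apply/funext => o; exact: extmatE.
  by apply: Laur_act; exact: eu.1.
have [/samecnt_orbit[w' ->]|sq] := boolP (samecnt rho q); last first.
  by rewrite !extmat0 // samecnt_act.
by rewrite pactM !extmatE // invMg -pactM pactK -oactM oactK.
Qed.

Definition ext u : A := of_mat (extmat u).

Lemma mu_ext_rho u p : eqvec rho u -> mu (ext u) p rho = u p.
Proof. by move=> eu; rewrite of_matK ?extmat_rho //; exact: eqmat_ext. Qed.

Lemma ext_e u : eqvec rho u -> ext u * e = ext u.
Proof.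
move=> eu; apply: mu_ext => p q; rewrite mu_diagr; last exact: stable_same_content.
rewrite of_matK; last exact: eqmat_ext.
by rewrite /same_content; case: ifP => // /negbT sq; rewrite extmat0.
Qed.

Definition rho_col x : vec r 'I_n := fun p => mu x p rho.

Lemma rho_col_eqvec x : eqvec rho (rho_col x).
Proof. exact: eqvec_col. Qed.

Lemma rho_col_ext x : x * e = x -> x = ext (rho_col x).
Proof.
move=> xe; apply: mu_ext => p q; rewrite of_matK; last exact/eqmat_ext/rho_col_eqvec.
have [/samecnt_orbit[w ->]|sq] := boolP (samecnt rho q); last first.
  by rewrite extmat0 // -xe mu_diagr ?/same_content ?(negPf sq) //; exact: stable_same_content.
apply/funext => o; rewrite extmatE; last exact: rho_col_eqvec.
by rewrite /rho_col -{1}(pactKV w p) -{1}(oactKV w o) (mu_eqmat x).2.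
Qed.

Lemma rho_col_inj x y : x * e = x -> y * e = y -> rho_col x = rho_col y -> x = y.
Proof. by move=> xe ye E; rewrite [LHS](rho_col_ext xe) E -(rho_col_ext ye). Qed.

Lemma rho_colM x y : rho_col (x * y) = mulv (mu x) (rho_col y).
Proof. by apply/funext => p; rewrite /rho_col muM. Qed.

Lemma relvec_rho_col x : x \in ideal_pred higher -> relvec rho (rho_col x).
Proof.
move=> /ideal_predP gx; apply: (zspan_map (h := rho_col) _ _ gx).
- by apply/funext => p; exact: mu0.
- by move=> y z; apply/funext => p; exact: muB.
move=> _ [a [b [-> b0]]]; apply: zspan_gen; exists (mu a), (rho_col b); split=> //.
- exact: rho_col_eqvec.
- by move=> s sT; rewrite /rho_col b0.
exact: rho_colM.
Qed.

Lemma rho_col_in x : x * e = x -> relvec rho (rho_col x) -> x \in ideal_pred higher.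
Proof.
move=> xe Rc; rewrite (rho_col_ext xe).
suff [] : eqvec rho (rho_col x) /\ ext (rho_col x) \in ideal_pred higher by [].
have extB u v : eqvec rho u -> eqvec rho v -> ext (u - v) = ext u - ext v.
  move=> eu ev; have euv := eqvecB eu ev; apply: rho_col_inj; rewrite ?mulrBl ?ext_e //.
  by apply/funext => p; rewrite /rho_col muB !mu_ext_rho.
have ext0 : ext 0 = 0 by rewrite -(subrr 0) extB ?subrr //; exact: eqvec0.
apply: (Rc (fun u => eqvec rho u /\ ext u \in ideal_pred higher)).
- by split; [exact: eqvec0|rewrite ext0 rpred0].
- by move=> u v [eu Iu] [ev Iv]; split; [exact: eqvecB|rewrite extB // rpredB].
move=> _ [M [v [eM ev v0 ->]]]; have eMv := eqvec_mul eM ev; split=> //.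
have -> : ext (mulv M v) = of_mat M * ext v.
  apply: rho_col_inj; rewrite -?mulrA ?ext_e //; apply/funext => p.
  by rewrite rho_colM /rho_col mu_ext_rho // of_matK // /mulv; apply: eq_bigr => s _; rewrite mu_ext_rho.
apply: mul_in_ideal => p q Tp; rewrite of_matK; last exact: eqmat_ext.
have [/samecnt_orbit[w ->]|sq] := boolP (samecnt rho q); last by rewrite extmat0.
by apply/funext => o; rewrite extmatE // v0 // -/(higher _) stable_higher.
Qed.

(** Right multiplication by it multiplies the column at [rho] by [g], see [rho_col_mul_scalar_elt].
    By [scalar_mod] these elements represent all of [e A e] modulo the higher ideal, which makes the
    layer commutative. *)
Definition scalar_elt (g : lfun) : A := ext (orbvec rho rho g).

Let inv2 g : inv rho g -> inv (fun t => (rho t, rho t)) g.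
Proof. by apply: inv_sub => w /fixesP fw; apply/fixesP => t; case: (fw t). Qed.

Lemma orbvec_eq g : inv rho g -> eqvec rho (orbvec rho rho g).
Proof. by move=> /inv2; exact: orbvec_eqvec. Qed.

Lemma orbvec_rho g p : inv rho g -> orbvec rho rho g p = if p == rho then g else 0.
Proof.
move=> /inv2 jg; case: eqP => [->|pr]; first exact: orbvec_lc.
apply/funext => o; case: (orbvec_supp rho rho p g o) => // -[w [rw pE _]].
by case: pr; rewrite pE; apply/eqP; rewrite -fixes_pact.
Qed.

Lemma rho_col_scalar_elt g p : inv rho g -> rho_col (scalar_elt g) p = if p == rho then g else 0.
Proof. by move=> jg; rewrite /rho_col mu_ext_rho ?orbvec_rho //; exact: orbvec_eq. Qed.

Lemma scalar_elt_e g : inv rho g -> scalar_elt g * e = scalar_elt g.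
Proof. by move=> jg; apply: ext_e; exact: orbvec_eq. Qed.

Lemma rho_col_mul_scalar_elt x g p : inv rho g -> rho_col (x * scalar_elt g) p = rho_col x p * g.
Proof.
move=> jg; rewrite rho_colM /mulv (bigD1 rho) //= big1 ?addr0 => [|s /negPf sr].
  by rewrite rho_col_scalar_elt // eqxx.
by rewrite rho_col_scalar_elt // sr mulr0.
Qed.

Lemma e_scalar_elt g : inv rho g -> e * scalar_elt g = scalar_elt g.
Proof.
move=> jg; apply: rho_col_inj; rewrite -?mulrA ?scalar_elt_e //; apply/funext => p.
rewrite /rho_col mu_diagl; last exact: stable_same_content.
rewrite -/(rho_col (scalar_elt g) p) rho_col_scalar_elt //; case: eqP => [->|_]; last by case: ifP.
by rewrite /same_content (introT (samecntP rho rho)).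
Qed.

Lemma scalar_eltB f g : inv rho f -> inv rho g -> scalar_elt (f - g) = scalar_elt f - scalar_elt g.
Proof.
move=> jf jg; have jfg := invB jf jg; apply: rho_col_inj; rewrite ?mulrBl ?scalar_elt_e //.
apply/funext => p; rewrite [in RHS]/rho_col muB -!/(rho_col _ p) !rho_col_scalar_elt //.
by case: ifP; rewrite ?subrr.
Qed.

Lemma scalar_elt0 : scalar_elt 0 = 0.
Proof. by rewrite -(subrr 0) scalar_eltB ?subrr //; exact: inv0. Qed.

Lemma scalar_eltD f g : inv rho f -> inv rho g -> scalar_elt (f + g) = scalar_elt f + scalar_elt g.
Proof.
move=> jf jg; have jn : inv rho (0 - g) by apply: invB => //; exact: inv0.
rewrite -[X in f + X]opprK -[- g]sub0r scalar_eltB // scalar_eltB //; last exact: inv0.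
by rewrite scalar_elt0 sub0r opprK.
Qed.

Lemma scalar_eltM f g : inv rho f -> inv rho g -> scalar_elt (f * g) = scalar_elt f * scalar_elt g.
Proof.
move=> jf jg; have jfg := invM jf jg; apply: rho_col_inj; rewrite -?mulrA ?scalar_elt_e //.
apply/funext => p; rewrite rho_col_mul_scalar_elt // !rho_col_scalar_elt //.
by case: ifP; rewrite ?mul0r.
Qed.

Lemma scalar_elt1 : scalar_elt 1 = e.
Proof.
apply: rho_col_inj; rewrite ?scalar_elt_e ?diag_idem //; try exact: inv1; try exact: stable_same_content.
apply/funext => p; rewrite rho_col_scalar_elt; last exact: inv1.
rewrite /rho_col of_matK; last exact/eqmat_diag/stable_same_content.
rewrite /diagmat; case: eqP => //= ->.
by rewrite /same_content (introT (samecntP rho rho)).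
Qed.

Local Notation I0 := (ideal_pred higher : ideal A).
Local Notation pi := (quot_pi I0).
Local Notation bv p := (ext (basisvec rho p)).

Section PartitionLayer.
Hypothesis part : partition_word rho.

(** Only the words with the content of [rho] matter, and among them only [rho] itself is coverable;
    at the others every coefficient leads a relation. *)
Lemma scalar_mod x : e * x * e = x -> exists g, inv rho g /\ x - scalar_elt g \in ideal_pred higher.
Proof.
move=> exe; have xe : x * e = x by rewrite -exe -mulrA diag_idem //; exact: stable_same_content.
have ex : e * x = x by rewrite -exe !mulrA diag_idem //; exact: stable_same_content.
pose S u := exists g, inv rho g /\ relvec rho (project rho u - orbvec rho rho g).
have projB (u v : vec r 'I_n) : project rho (u - v) = project rho u - project rho v.
  apply/funext => p; rewrite vecB /project vecB.
  by case: ifP; rewrite ?subrr.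
have orbB f g : inv rho f -> inv rho g -> orbvec rho rho (f - g) = orbvec rho rho f - orbvec rho rho g.
  move=> jf jg; apply/funext => p; rewrite vecB !orbvec_rho //; last exact: invB.
  by case: ifP; rewrite ?subrr.
have orb0 : orbvec rho rho 0 = 0.
  by apply/funext => p; rewrite orbvec_rho ?if_same //; exact: inv0.
have Srel u : relvec rho (project rho u) -> S u.
  by move=> Ru; exists 0; rewrite orb0 subr0; split=> //; exact: inv0.
have [g [jg Rg]] : S (rho_col x).
  apply: leads_all (rho_col_eqvec x).
  - apply: Srel; rewrite (_ : project rho 0 = 0); first exact: zspan0.
    by apply/funext => p; rewrite /project; case: ifP.
  - move=> u v [f [jf Rf]] [g [jg Rg]]; exists (f - g); split; first exact: invB.
    by rewrite projB orbB // opprD addrACA -opprD; exact: zspanB.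
  move=> q f jf; have [sq|sq] := boolP (samecnt rho q).
    have [cq|ncq] := boolP (coverable rho q); last first.
      move: ncq; rewrite negb_forall => /existsP[i]; rewrite negb_forall => /existsP[a].
      rewrite -ltnNge => YZ; have [||u [Ru eu uq du]] := @leads_uncoverable n r rho q (relvec rho (C := 'I_n)) _ _ i a f YZ jf.
      - exact: zspan0.
      - by [].
      by exists u; split=> //; apply: Srel; exact: relvec_project.
    have qr := coverable_samecnt cq sq; rewrite qr in jf *.
    have jf' : inv rho f by apply: inv_sub jf => w /fixesP fw; apply/fixesP => t; rewrite fw.
    exists (orbvec rho rho f); split.
    - exists f; split=> //; rewrite (_ : project rho _ = orbvec rho rho f) ?subrr; first exact: zspan0.
      apply/funext => p; rewrite /project orbvec_rho //; case: ifP => // sp.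
      by case: eqP => // pr; move: sp; rewrite pr (introT (samecntP rho rho)).
    - exact: orbvec_eq.
    - by rewrite orbvec_rho // eqxx.
    by move=> q'; rewrite orbvec_rho //; case: eqP => [-> _|//]; left.
  exists (orbvec rho q f); split.
  - apply: Srel; rewrite (_ : project rho _ = 0); first exact: zspan0.
    apply/funext => p; rewrite /project; case: ifP => // sp; apply/funext => o.
    case: (orbvec_supp rho q p f o) => // -[w [_ pE _]].
    by rewrite pE samecnt_act (negPf sq) in sp.
  - by apply: orbvec_eqvec; exact: inv_swap.
  - by rewrite orbvec_lc //; exact: inv_swap.
  move=> q' nz; left; apply: contrapT => nr; apply: nz; apply/funext => o.
  case: (orbvec_supp rho q q' f o) => // -[w [rw q'E _]].
  by case: nr => i a; rewrite q'E rcnt_act.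
exists g; split=> //; apply: rho_col_in; first by rewrite mulrBl xe scalar_elt_e.
suff -> : rho_col (x - scalar_elt g) = project rho (rho_col x) - orbvec rho rho g by [].
apply/funext => p; rewrite vecB /rho_col muB -!/(rho_col _ p) rho_col_scalar_elt // orbvec_rho //; congr (_ - _).
rewrite /project /rho_col -{1}ex mu_diagl; last exact: stable_same_content.
by [].
Qed.

Lemma spanning_mod x : x * e = x -> exists c : W -> lfun, (forall p, inv rho (c p)) /\
  x - \sum_(p | colstrict rho p) ext (basisvec rho p) * scalar_elt (c p) \in ideal_pred higher.
Proof.
move=> xe; have [c [jc Rc]] := spanning part (rho_col_eqvec x); exists c; split=> //.
apply: rho_col_in.
  rewrite mulrBl xe mulr_suml; congr (_ - _); apply: eq_bigr => p _.
  by rewrite -mulrA scalar_elt_e.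
suff -> : rho_col (x - \sum_(p | colstrict rho p) ext (basisvec rho p) * scalar_elt (c p)) =
  rho_col x - (fun q => \sum_(p | colstrict rho p) basisvec rho p q * c p) by [].
apply/funext => q; rewrite vecB /rho_col muB mu_sum; congr (_ - _).
apply: eq_bigr => p _; rewrite -/(rho_col _ q) rho_col_mul_scalar_elt // /rho_col mu_ext_rho //.
exact: basisvec_eqvec.
Qed.

Lemma scalar_elt_in g : inv rho g -> (forall x : point, injective x -> g (spread rho x) = 0) ->
  scalar_elt g \in ideal_pred higher.
Proof.
move=> jg vg; apply: rho_col_in; first exact: scalar_elt_e.
suff -> : rho_col (scalar_elt g) = orbvec rho rho g by exact: relvec_scalar.
by apply/funext => p; rewrite rho_col_scalar_elt // orbvec_rho.
Qed.

(** Antisymmetrize the column at [rho] and evaluate at the word [rho]. The scalar contributes [b o],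
    since only the identity preserves rows and columns; in the product, the sum over column
    permutations can be shifted onto [u]. *)
Lemma pairing (u v : vec r 'I_n) o b : eqvec rho u -> eqvec rho v -> inv rho b -> colconst rho o ->
  transp (ext u) * ext v - scalar_elt b \in ideal_pred higher ->
  b o = \sum_p antisym rho o u p * v p o.
Proof.
move=> eu ev jb co /relvec_rho_col R0.
have := antisym_relvec part rho co R0.
have -> : rho_col (transp (ext u) * ext v - scalar_elt b) = rho_col (transp (ext u) * ext v) - rho_col (scalar_elt b).
  by apply/funext => p; exact: muB.
rewrite antisymB => /eqP; rewrite subr_eq0 => /eqP E.
have <- : antisym rho o (rho_col (scalar_elt b)) rho = b o.
  rewrite /antisym (bigD1 1%g) /=; last exact: fixes1.
  rewrite pact1 odd_perm1 expr0 mul1r rho_col_scalar_elt // eqxx big1 ?addr0 // => w /andP[/fixesP cw w1].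
  rewrite rho_col_scalar_elt //; case: eqP => [/eqP|]; last by rewrite mulr0.
  rewrite -fixes_pact => /fixesP rw; case/eqP: w1; apply/permP => t.
  by rewrite perm1; apply: (@col_inj _ _ rho).
rewrite -E rho_colM /antisym.
transitivity (\sum_(w : 'S_r | colperm rho w) (-1) ^+ w * \sum_p u (pact w^-1%g p) o * v p o).
  apply: eq_bigr => w cw; congr (_ * _); rewrite mulvE; apply: eq_bigr => p _.
  rewrite transpE of_matK; last exact: eqmat_ext.
  rewrite extmatE // (colconst_act co) //; last exact: fixesV.
  by rewrite /rho_col mu_ext_rho.
under eq_bigr do rewrite mulr_sumr.
rewrite exchange_big; apply: eq_bigr => p _ /=; rewrite mulr_suml.
rewrite (reindex_inj invg_inj) /=; apply: eq_big => [w|w cw].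
  by apply/idP/idP => /fixesV; rewrite ?invgK.
by rewrite odd_permV invgK mulrA.
Qed.

Lemma pi_eq x y : x - y \in ideal_pred higher -> pi x = pi y.
Proof. by move=> xy; apply/quot_piE. Qed.

Lemma pi_eq0 x : pi x = 0 -> x \in ideal_pred higher.
Proof. by rewrite -(rmorph0 pi) => /quot_piE; rewrite subr0. Qed.

Lemma transp_e : transp e = e.
Proof.
apply: mu_ext => p q; rewrite transpE !of_matK; try exact/eqmat_diag/stable_same_content.
by rewrite /diagmat eq_sym; case: eqP => // ->.
Qed.

Lemma e_transp x : x * e = x -> e * transp x = transp x.
Proof. by move=> xe; rewrite -{1}transp_e -transpM xe. Qed.

Lemma bv_e p : bv p * e = bv p.
Proof. by apply: ext_e; exact: basisvec_eqvec. Qed.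

(* Multiplying by the dual vector of a word q turns the factors transp (bv q)
   into scalars, whose values are known by [pairing]. *)
Lemma basis_indep_mod (d : W -> W -> A) : (forall p q, e * d p q * e = d p q) ->
  \sum_(p | colstrict rho p) \sum_(q | colstrict rho q) bv p * d p q * transp (bv q)
    \in ideal_pred higher ->
  forall p q, colstrict rho p -> colstrict rho q -> d p q \in ideal_pred higher.
Proof.
move=> de Z0 p0 q0 cp0 cq0.
have [g gP] := choice (fun pq : W * W => scalar_mod (de pq.1 pq.2)).
suff g0 (x : point) : injective x -> g (p0, q0) (spread rho x) = 0.
  have [jg dg_] := gP (p0, q0); rewrite -[d p0 q0](subrK (scalar_elt (g (p0, q0)))).
  by apply: rpredD => //; apply: scalar_elt_in.
move=> xI; apply: (antisym_basis_inj part (v := fun q => g (p0, q) (spread rho x)) xI) => // q1 cq1.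
pose v := orbvec rho q1 (separator rho x q1).
have ev : eqvec rho v by apply: orbvec_eqvec; exact: inv_separator.
have H q : exists b, inv rho b /\ transp (bv q) * ext v - scalar_elt b \in ideal_pred higher.
  by apply: scalar_mod; rewrite -!mulrA ext_e // mulrA e_transp // bv_e.
have [b bP] := choice H.
have bE q : b q (spread rho x) = antisym rho (spread rho x) (basisvec rho q) q1 *
    separator rho x q1 (spread rho x).
  rewrite (pairing _ ev (bP q).1 (@colconst_spread _ _ rho x) (bP q).2); last exact: basisvec_eqvec.
  rewrite (bigD1 q1) //= big1 ?addr0 => [|p /negPf pq].
    by rewrite /v orbvec_separator eqxx.
  by rewrite /v orbvec_separator pq mulr0.
pose c p : lfun := \sum_(q | colstrict rho q) g (p, q) * b q.
have jc p : inv rho (c p).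
  by apply: inv_sum => q _; apply: invM; [case: (gP (p, q))|case: (bP q)].
have scalar_elt_sum (s : seq W) (F : W -> lfun) : (forall q, inv rho (F q)) ->
    scalar_elt (\sum_(q <- s | colstrict rho q) F q) = \sum_(q <- s | colstrict rho q) scalar_elt (F q).
  move=> jF; elim: s => [|q s IH].
    by rewrite !big_nil scalar_elt0.
  rewrite !big_cons; case: ifP => // _; rewrite -IH scalar_eltD //; exact: inv_sum.
have Zc : \sum_(p | colstrict rho p) bv p * scalar_elt (c p) \in ideal_pred higher.
  apply: pi_eq0; rewrite rmorph_sum /=.
  have := ideal_mulr (ext v) Z0; rewrite -[X in X -> _]/(is_true (_ \in ideal_pred higher)) => Zv.
  rewrite -[RHS](_ : pi ((\sum_(p | colstrict rho p) \sum_(q | colstrict rho q)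
      bv p * d p q * transp (bv q)) * ext v) = 0); last first.
    by rewrite -(rmorph0 pi); apply: pi_eq; rewrite subr0.
  rewrite rmorphM rmorph_sum mulr_suml; apply: eq_bigr => p _ /=.
  rewrite rmorphM /c scalar_elt_sum; last by move=> q; apply: invM; [case: (gP (p, q))|case: (bP q)].
  rewrite !rmorph_sum mulr_suml mulr_sumr; apply: eq_bigr => q _ /=.
  rewrite scalar_eltM; [|by case: (gP (p, q))|by case: (bP q)].
  apply: (etrans (y := pi (bv p * (scalar_elt (g (p, q)) * scalar_elt (b q))))); first exact/esym/quot_piM.
  apply: (etrans (y := pi (bv p * d p q * transp (bv q) * ext v))); last exact: quot_piM.
  apply: pi_eq; have := ideal_mull (bv p) (ideal_mulr (scalar_elt (b q)) (gP (p, q)).2).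
  have := ideal_mull (bv p * d p q) (bP q).2 => /= I1 I2; rewrite -rpredN.
  suff -> : - (bv p * (scalar_elt (g (p, q)) * scalar_elt (b q)) - bv p * d p q * transp (bv q) * ext v) =
      bv p * ((d p q - scalar_elt (g (p, q))) * scalar_elt (b q)) + bv p * d p q * (transp (bv q) * ext v - scalar_elt (b q)).
    by apply: rpredD.
  by rewrite mulrBl !mulrBr !mulrA opprB [RHS]addrC addrA subrK.
have Rc : relvec rho (fun q => \sum_(p | colstrict rho p) basisvec rho p q * c p).
  suff <- : rho_col (\sum_(p | colstrict rho p) bv p * scalar_elt (c p)) =
      fun q => \sum_(p | colstrict rho p) basisvec rho p q * c p by exact: relvec_rho_col.
  apply/funext => q; rewrite /rho_col mu_sum; apply: eq_bigr => p _.
  by rewrite -/(rho_col _ q) rho_col_mul_scalar_elt // /rho_col mu_ext_rho //; exact: basisvec_eqvec.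
have := basisvec_indep part Rc xI cp0; rewrite /c lfun_sum => E.
have s0 := @separator_neq0 _ _ rho x xI q1; apply: (mulIf s0); rewrite mul0r -[RHS]E mulr_suml.
by apply: eq_bigr => q _; rewrite lfunM bE; ring.
Qed.

Definition layer_algebra := quot_algebra (k := int) (A := int_algebra A) I0.

Lemma pi_surj (X : layer_algebra) : exists x, X = pi x.
Proof. exact: quot_piP. Qed.

Lemma pi_idem : pi e * pi e = pi e.
Proof. by rewrite -rmorphM diag_idem //; exact: stable_same_content. Qed.

Lemma piM3 x y z : (pi x : layer_algebra) * pi y * pi z = pi (x * y * z).
Proof. by rewrite !quot_piM. Qed.

Lemma pi_corner (X : layer_algebra) : pi e * X * pi e = X -> exists2 x, e * x * e = x & X = pi x.
Proof.
have [x ->] := pi_surj X => E; exists (e * x * e).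
  by rewrite -!mulrA (diag_idem stable_same_content) !mulrA (diag_idem stable_same_content).
by rewrite -[LHS]E; exact: piM3.
Qed.

Lemma layer_heredity (J : {pred layer_algebra}) : is_AeA (pi e) J ->
  affine_heredity_ideal (A := layer_algebra) J.
Proof.
move=> JE; pose ei : Defs.idempotent layer_algebra := Idempotent pi_idem.
pose D := [pred p | colstrict rho p]; pose cst := @enum_val _ D.
have cstP k : colstrict rho (cst k) by exact: (enum_valP k).
have reindex (V : zmodType) (F : W -> V) : \sum_(p | colstrict rho p) F p = \sum_(k < #|D|) F (cst k).
  exact: (big_enum_val (A := D)).
have corner_scalar_elt g : inv rho g -> e * scalar_elt g * e = scalar_elt g by move=> jg; rewrite e_scalar_elt ?scalar_elt_e.
have B1 x : x * e = x -> exists c : W -> lfun, (forall p, inv rho (c p)) /\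
    pi x = \sum_(k < #|D|) pi (bv (cst k)) * pi (scalar_elt (c (cst k))).
  move=> /spanning_mod[c [jc Rc]]; exists c; split=> //.
  rewrite (pi_eq Rc) rmorph_sum /= reindex; apply: eq_bigr => k _.
  by rewrite rmorphM.
apply: (@affine_heredity_of_basis _ layer_algebra ei J #|D| (fun k => pi (bv (cst k)))
  (fun k => pi (transp (bv (cst k))))) => //=.
- by move=> k; rewrite -rmorphM bv_e.
- by move=> k; rewrite -rmorphM e_transp // bv_e.
- move=> X Xe; have [x xE] := pi_surj X.
  have [|c [jc cE]] := B1 (x * e); first by rewrite -mulrA (diag_idem stable_same_content).
  exists (fun k => pi (scalar_elt (c (cst k)))); split=> [k|]; first by rewrite [LHS]piM3 corner_scalar_elt.
  by rewrite -[LHS]Xe xE -rmorphM.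
- move=> X eX; have [x xE] := pi_surj X.
  (* Spanning of [e A] is the transpose of spanning of [A e]. *)
  have [|c [jc Rc]] := @spanning_mod (transp (e * x)).
    by rewrite -{2}transp_e -transpM mulrA (diag_idem stable_same_content).
  exists (fun k => pi (transp (scalar_elt (c (cst k))))); split=> [k|].
    by rewrite [LHS]piM3 -{1 2}transp_e -!transpM mulrA corner_scalar_elt.
  have := transp_in stable_higher Rc; rewrite transpB transpK => /pi_eq Rc'.
  rewrite -[LHS]eX xE; apply: (etrans (y := pi (e * x))); first exact/esym/quot_piM.
  rewrite [LHS]Rc'.
  have transp_sum (s : seq W) (F : W -> A) : transp (\sum_(p <- s | colstrict rho p) F p) =
      \sum_(p <- s | colstrict rho p) transp (F p).
    by apply: mu_ext => p q; rewrite transpE !mu_sum; apply: eq_bigr => s' _; rewrite transpE.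
  rewrite transp_sum rmorph_sum /= reindex; apply: eq_bigr => k _.
  by rewrite transpM rmorphM.
- move=> c cE c0 i0 j0.
  have H (ij : 'I_#|D| * 'I_#|D|) : exists x, e * x * e = x /\ c ij.1 ij.2 = pi x.
    by have [x ex cx] := pi_corner (cE ij.1 ij.2); exists x.
  have [d dP] := choice H.
  (* The coefficients, extended by 0 from the column strict fillings to all words. *)
  pose dd p q := if (p \in D) =P true is ReflectT pD then
    if (q \in D) =P true is ReflectT qD then d (enum_rank_in pD p, enum_rank_in qD q) else 0 else 0.
  have ddE i j : dd (cst i) (cst j) = d (i, j).
    rewrite /dd; case: eqP => [pD|]; last by rewrite enum_valP.
    case: eqP => [qD|]; last by rewrite enum_valP.
    by rewrite !enum_valK_in.
  rewrite (dP (i0, j0)).2 -ddE -(rmorph0 pi); apply: pi_eq; rewrite subr0.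
  apply: basis_indep_mod => // [p q|].
    rewrite /dd; case: eqP => [pD|]; last by rewrite mulr0 mul0r.
    case: eqP => [qD|]; last by rewrite mulr0 mul0r.
    by rewrite (dP _).1.
  apply: pi_eq0; rewrite rmorph_sum /= reindex -[RHS]c0; apply: eq_bigr => i _.
  rewrite rmorph_sum /= reindex; apply: eq_bigr => j _.
  by rewrite !rmorphM ddE (dP (i, j)).2.
- move=> X Y /pi_corner[x ex ->] /pi_corner[y ey ->].
  have [f [jf xf]] := scalar_mod ex; have [g [jg yg]] := scalar_mod ey.
  by rewrite (pi_eq xf) (pi_eq yg) -!rmorphM -!scalar_eltM // mulrC.
(* Module generators of the invariants over the symmetric functions, together with [symgens],
   generate the invariants as a ring. *)
have [Y [YI YG]] := inv_gen rho.
pose G := Y ++ symgens r; pose gn i := nth 0 G i.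
have jG f : f \in G -> inv rho f.
  rewrite mem_cat => /orP[/YI//|/symgens_inv]; apply: inv_sub => w _.
  exact/fixesP.
exists (size G), (fun i => pi (scalar_elt (gn i))); split=> [i|S Se SB SM Sg X].
  by rewrite [LHS]piM3 corner_scalar_elt //; apply: jG; rewrite mem_nth.
move=> /pi_corner[x ex ->]; have [f [jf xf]] := scalar_mod ex; rewrite (pi_eq xf).
have SG f' : f' \in G -> S (pi (scalar_elt f')).
  move=> fG; rewrite -(nth_index 0 fG).
  have fi : (index f' G < size G)%N by rewrite index_mem.
  exact: (Sg (Ordinal fi)).
suff [] : inv rho f /\ S (pi (scalar_elt f)) by [].
apply: (YG f jf (fun f => inv rho f /\ S (pi (scalar_elt f)))).
- split; first split; first exact: inv0.
    by rewrite -(subrr 1) scalar_eltB ?rmorphB /=; [apply: SB; rewrite scalar_elt1; exact: Se|exact: inv1|exact: inv1].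
  by move=> a b [ja Sa] [jb Sb]; split; [exact: invB|rewrite scalar_eltB // rmorphB; exact: SB].
- apply/allops_mapP => c cs g [jg Sg'].
  have cG : c \in G by rewrite mem_cat cs orbT.
  have jc := jG c cG; split; first exact: invM.
  rewrite scalar_eltM // rmorphM; apply: SM => //; last exact: SG.
    by rewrite [LHS]piM3 corner_scalar_elt.
  by rewrite [LHS]piM3 corner_scalar_elt.
move=> y yY; have yG : y \in G by rewrite mem_cat yY.
by split; [exact: jG|exact: SG].
Qed.

End PartitionLayer.

(** If the rows of [b] lie in [T1], then [b] and [e * b] differ only in rows of higher content. *)
Lemma layer_AeA T1 : (forall p, T1 p = higher p || samecnt rho p) ->
  is_AeA (A := layer_algebra) (pi e) (@quot_image A I0 (ideal_pred T1)).
Proof.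
move=> T1E X; split=> [/asboolP[a /ideal_predP ga ->]|[s ->]].
  apply: (ga (fun a => exists s : seq (layer_algebra * layer_algebra), pi a = \sum_(ab <- s) ab.1 * pi e * ab.2)).
  - by exists [::]; rewrite big_nil rmorph0.
  - move=> x y [s sE] [t tE]; exists (s ++ [seq (- ab.1, ab.2) | ab <- t]).
    rewrite quot_piB big_cat big_map sE tE -sumrN; congr (_ + _).
    by apply: eq_bigr => ab _; rewrite !mulNr.
  move=> _ [x [y [-> y0]]]; exists [:: (pi x : layer_algebra, pi y : layer_algebra)].
  rewrite big_seq1 [RHS]piM3; apply: pi_eq; rewrite -mulrA -mulrBr; apply: mul_in_ideal => p q Tp.
  rewrite muB mu_diagl; last exact: stable_same_content.
  rewrite /same_content; case: ifP => sp; rewrite ?subrr // y0 ?subr0 //.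
  by rewrite T1E negb_or Tp sp.
elim: s => [|[X1 X2] s IH].
  by rewrite big_nil; apply/asboolP; exists 0; rewrite ?rpred0 // rmorph0.
rewrite big_cons; have /asboolP[a Ia ->] := IH.
have [x ->] := pi_surj X1; have [y ->] := pi_surj X2.
apply/asboolP; exists (x * e * y + a).
  apply: rpredD => //; apply: ideal_mulr; apply: ideal_mull; apply: diag_in; first exact: stable_same_content.
  by move=> p sp; rewrite T1E; apply/orP; right.
by rewrite [RHS]quot_piD; congr (_ + _); exact: piM3.
Qed.

Lemma layer_step T1 : (forall p, T1 p = higher p || samecnt rho p) ->
  affine_heredity_ideal (A := layer_algebra) (@quot_image A I0 (ideal_pred T1)).
Proof.
move=> T1E; have AeA := layer_AeA T1E.
have [part|npart] := pselect (partition_word rho); first exact: layer_heredity.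
have [i [i' [ii' lt]]] : exists i i' : 'I_n, i' = i.+1 :> nat /\ (cnt rho i < cnt rho i')%N.
  apply: contrapT => no; apply: npart => i i' ii'; rewrite leqNgt; apply/negP => lt.
  by apply: no; exists i, i'.
have e0 : pi e = 0.
  rewrite -(rmorph0 pi); apply: pi_eq; rewrite subr0; apply: rho_col_in; first exact/diag_idem/stable_same_content.
  by apply: (nonpartition_relvec ii' lt); exact: rho_col_eqvec.
apply: heredity_zero => X; split=> [/AeA[s ->]|->].
  by apply: big1 => ab _; rewrite e0 mulr0 mul0r.
by apply/AeA; exists [::]; rewrite big_nil.
Qed.

End Layer.

Let scalar_mat (c : lfun) : mat := fun p q => if p == q then c else 0.

Let eqmat_scalar_mat c : inv (fun=> tt) c -> eqmat (scalar_mat c).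
Proof.
move=> jc; split=> [p q|w p q o]; rewrite /scalar_mat.
  by case: ifP => _; [exact: jc.1|exact: Laur0].
rewrite (inj_eq (can_inj (@pactK r 'I_n w))); case: ifP => // _.
by apply: jc.2; apply/fixesP.
Qed.

(** A left ideal is in particular a module over the symmetric functions, which act as scalar
    matrices. *)
Lemma matrix_ring_noetherian : left_noetherian A.
Proof.
move=> I [I0 IM].
have muS0 c x p q : inv (fun=> tt) c -> mu (of_mat (scalar_mat c) * x) p q = c * mu x p q.
  move=> jc; rewrite muM of_matK; last exact: eqmat_scalar_mat.
  rewrite /mulm (bigD1 p) //= big1 ?addr0 => [|s /negPf sp]; last by rewrite /scalar_mat eq_sym sp mul0r.
  by rewrite /scalar_mat eqxx.
have [|c M jc [x [Ix ->]]|M p q [x [_ ->]]|Y [YI YG]] :=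
    @mat_noeth r n (fun M => exists x, x \in I /\ M = mu x).
- split; first by exists 0; split=> //; apply/funext => p; apply/funext => q; rewrite mu0.
  move=> _ _ [x [Ix ->]] [y [Iy ->]]; exists (x - y); split.
    by have := IM (-1) y x Iy Ix; rewrite mulN1r addrC.
  by apply/funext => p; apply/funext => q; rewrite muB.
- exists (of_mat (scalar_mat c) * x); split; first by have := IM (of_mat (scalar_mat c)) x 0 Ix I0; rewrite addr0.
  by apply/funext => p; apply/funext => q; rewrite muS0.
- exact: (mu_eqmat x).1.
have H (i : 'I_(size Y)) : exists x, x \in I /\ nth 0 Y i = mu x by apply: YI; rewrite mem_nth.
have [g gP] := choice H; exists (size Y), g; split=> [i|x Ix]; first by case: (gP i).
suff [c cE] : exists c : 'I_(size Y) -> A, mu x = mu (\sum_i c i * g i) by exists c; exact: muI.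
apply: (YG (mu x) _ (fun M => exists c : 'I_(size Y) -> A, M = mu (\sum_i c i * g i))); first by exists x.
- split.
    exists (fun=> 0); rewrite big1 => [|i _]; last exact: mul0r.
    by apply/funext => p; apply/funext => q; rewrite mu0.
  move=> _ _ [c ->] [d ->]; exists (fun i => c i - d i).
  apply/funext => p; apply/funext => q; rewrite -[LHS]muB -sumrB.
  by congr (mu _ p q); apply: eq_bigr => i _; rewrite mulrBl.
- apply/allops_mapP => c /symgens_inv jc _ [d ->]; exists (fun i => of_mat (scalar_mat c) * d i).
  apply/funext => p; apply/funext => q; rewrite -muS0 // mulr_sumr.
  by congr (mu _ p q); apply: eq_bigr => i _; rewrite mulrA.
move=> y yY; have yi : (index y Y < size Y)%N by rewrite index_mem.
exists (fun i => if i == Ordinal yi then 1 else 0).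
rewrite (bigD1 (Ordinal yi)) //= eqxx mul1r big1 ?addr0 => [|i /negPf->]; last by rewrite mul0r.
by rewrite -(gP (Ordinal yi)).2 /= nth_index.
Qed.

Theorem matrix_ring_aqh : affine_quasi_hereditary (int_algebra A).
Proof.
split; [exact: int_left_noetherian|exact: matrix_ring_noetherian|].
(* Ranks are at most the number of words, hence below [K]: no word qualifies at level 0, and all
   words do at level [K]. *)
pose K := #|{: W}|.+1; pose T i : pred W := fun p => (K <= lexrank p + i)%N.
exists K, (fun i => ideal_pred (T i) : ideal A); split=> [x|x|i iK].
- apply/idP/eqP => [/ideal_predP gx|->]; last exact: rpred0.
  apply: (gx (fun x => x = 0)) => // [x1 y ->->|_ [a [b [-> b0]]]]; first exact: subrr.
  rewrite (_ : b = 0) ?mulr0 //; apply: mu_ext => p q; rewrite mu0 b0 //.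
  by rewrite /T addn0 -ltnNge ltnS max_card.
- rewrite -[x]mulr1; apply: mul_in_ideal => p q.
  by rewrite /T leq_addl.
split.
  move=> x /ideal_predP gx; apply/ideal_predP => S S0 SB Sg; apply: gx => // _ [a [b [-> b0]]].
  apply: Sg; exists a, b; split=> // p q Tp; apply: b0; apply: contra Tp; rewrite /T addnS.
  exact: leqW.
have [[rho rE]|no] := pselect (exists rho : W, K = (lexrank rho + i).+1).
  have TE : T i = higher rho.
    by apply/funext => p; rewrite /T rE ltn_add2r lexrank_lt.
  have T1E p : T i.+1 p = higher rho p || samecnt rho p.
    by rewrite /T rE addnS ltnS leq_add2r lexrank_le.
  by move: T1E; move: (T i.+1) => T1 T1E; rewrite TE; exact: layer_step.
(* No content has this rank, so the chain repeats its ideal. *)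
have -> : T i.+1 = T i.
  apply/funext => p; rewrite /T addnS leq_eqVlt; case: eqP => //= E.
  by case: no; exists p.
apply: heredity_zero => X; split=> [/asboolP[a Ia ->]|->].
  by rewrite -(rmorph0 (quot_pi (ideal_pred (T i) : ideal A))); apply/quot_piE; rewrite subr0.
by apply/asboolP; exists 0; rewrite ?rpred0 ?rmorph0.
Qed.

End MatrixRing.

(** * Affine Schur algebras as rings of equivariant matrices *)

Section FinitelySupported.
Variable r : nat.
Local Notation expo := (expo r).
Local Notation lfun := (lfun r).
Implicit Types (a b : expo) (c : expo -> int) (A : seq expo).

Definition fsupp c := exists A, forall a, a \notin A -> c a = 0.

Let supp_ex c : exists A, fsupp c -> uniq A /\ forall a, a \notin A -> c a = 0.
Proof.
have [[A cA]|no] := pselect (fsupp c); last by exists [::] => /no.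
by exists (undup A) => _; split=> [|a]; rewrite ?undup_uniq // mem_undup; exact: cA.
Qed.

(* [lpoly c] is 0 when the support of c is infinite. *)
Definition lpoly c : lfun := \sum_(a <- projT1 (cid (supp_ex c))) mono a *~ c a.

Lemma lpolyE c A : uniq A -> (forall a, a \notin A -> c a = 0) ->
  lpoly c = \sum_(a <- A) mono a *~ c a.
Proof.
move=> uA cA; rewrite /lpoly; case: cid => B /= H; have [|uB cB] := H; first by exists A.
have uAB : uniq (undup (A ++ B)) by exact: undup_uniq.
rewrite (big_ext_seq uB uAB) => [|a aB|a /cB->]; last 2 first.
- by rewrite mem_undup mem_cat aB orbT.
- exact: mulr0z.
rewrite [RHS](big_ext_seq uA uAB) // => [a aA|a /cA->]; last exact: mulr0z.
by rewrite mem_undup mem_cat aA.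
Qed.

Lemma fsupp_common (I : finType) (c : I -> expo -> int) : (forall i, fsupp (c i)) ->
  exists2 A, uniq A & forall i a, a \notin A -> c i a = 0.
Proof.
move=> /choice[A cA]; exists (undup (flatten [seq A i | i <- enum I])); first exact: undup_uniq.
move=> i a; rewrite mem_undup => aA; apply: cA; apply: contra aA => aA.
by apply/flattenP; exists (A i) => //; apply: map_f; rewrite mem_enum.
Qed.

Lemma lpolyB c c' : fsupp c -> fsupp c' -> lpoly (fun a => c a - c' a) = lpoly c - lpoly c'.
Proof.
move=> fc fc'; have [|A uA cA] := @fsupp_common bool (fun b : bool => if b then c else c'); first by case.
have ccA a : a \notin A -> c a - c' a = 0 by move=> aA; rewrite (cA true) // (cA false) // subrr.
rewrite (lpolyE uA ccA) (lpolyE uA (cA true)) (lpolyE uA (cA false)).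
by rewrite -sumrB; apply: eq_bigr => a _; rewrite mulrzBr.
Qed.

Lemma lpoly0 : lpoly (fun=> 0) = 0.
Proof. by rewrite (@lpolyE _ [::]) ?big_nil. Qed.

Lemma lpoly_inj c c' : fsupp c -> fsupp c' -> lpoly c = lpoly c' -> c =1 c'.
Proof.
move=> fc fc' E a; apply/eqP; rewrite -subr_eq0; apply/eqP.
have [|A uA cA] := @fsupp_common bool (fun b : bool => if b then c else c'); first by case.
have [aA|aA] := boolP (a \in A); last by rewrite (cA true) // (cA false) // subrr.
apply/eqP; rewrite -(intr_eq0 rat); apply/eqP.
apply: (@mono_indep _ A (fun a => (c a - c' a)%:~R)) => // o _.
have -> : \sum_(a <- A) (c a - c' a)%:~R * mono a o = lpoly (fun a => c a - c' a) o; last first.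
  by rewrite lpolyB // E subrr.
rewrite (lpolyE uA) => [|b bA]; last by rewrite (cA true) // (cA false) // subrr.
by rewrite lfun_sum; apply: eq_bigr => b _; rewrite lfunMz mulrzl.
Qed.

Lemma lpoly_Laur c : Laur (lpoly c).
Proof. by apply: Laur_sum => a _; apply: zspanMz; exact: Laur_mono. Qed.

Lemma Laur_lpoly (f : lfun) : Laur f -> exists2 c, fsupp c & f = lpoly c.
Proof.
move=> /LaurST/LaurS_rep[A [c [uA cA _ fE]]]; exists c; first by exists A.
apply/funext => o; rewrite fE (lpolyE uA cA) lfun_sum; apply: eq_bigr => a _.
by rewrite lfunMz mulrzl.
Qed.

Lemma lpoly_shift c d : fsupp c -> lpoly (fun a => c (a - d)) = mono d * lpoly c.
Proof.
case=> A' cA'; have uA := undup_uniq A'; set A := undup A' in uA.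
have cA a : a \notin A -> c a = 0 by rewrite mem_undup; exact: cA'.
rewrite (lpolyE uA cA) (@lpolyE _ [seq a + d | a <- A]).
- by rewrite big_map mulr_sumr; apply: eq_bigr => a _; rewrite addrK monoD mulrC mulrzAr.
- by rewrite map_inj_uniq //; exact: addIr.
by move=> a aA; apply: cA; apply: contra aA => aA; apply/mapP; exists (a - d); rewrite ?subrK.
Qed.

Lemma lpoly_sum (I : finType) (A : seq expo) (F : I -> expo -> expo -> int) : uniq A ->
  (forall i a, fsupp (F i a)) ->
  lpoly (fun b => \sum_i \sum_(a <- A) F i a b) = \sum_i \sum_(a <- A) lpoly (F i a).
Proof.
move=> uA fF.
have [|B uB FB] := @fsupp_common (I * seq_sub A)%type (fun ia => F ia.1 (val ia.2)); first by case.
have FB' i a b : a \in A -> b \notin B -> F i a b = 0.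
  by move=> aA; exact: (FB (i, SeqSub aA)).
rewrite (lpolyE uB) => [|b bB]; last first.
  by apply: big1 => i _; rewrite big1_seq // => a /andP[_ aA]; exact: FB'.
under eq_bigr do rewrite -mulrzl rmorph_sum mulr_suml.
rewrite exchange_big; apply: eq_bigr => i _ /=.
under eq_bigr do rewrite rmorph_sum mulr_suml.
rewrite exchange_big; apply: eq_big_seq => a aA /=.
rewrite (lpolyE uB) => [|b]; last exact: FB'.
by apply: eq_bigr => b _; rewrite mulrzl.
Qed.

Lemma lpolyMz (z : int) c : fsupp c -> lpoly (fun a => z * c a) = lpoly c *~ z.
Proof.
case=> A' cA'; have uA := undup_uniq A'; set A := undup A' in uA.
have cA a : a \notin A -> c a = 0 by rewrite mem_undup; exact: cA'.
rewrite !(lpolyE uA) // => [|a /cA->]; last exact: mulr0.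
by rewrite -mulrzr mulr_suml; apply: eq_bigr => a _; rewrite mulrzr -mulrzA mulrC.
Qed.

Lemma lpoly_delta : lpoly (fun a => (a == 0)%:R) = 1.
Proof.
rewrite (@lpolyE _ [:: 0]) // => [|a]; last by rewrite inE => /negPf->.
by rewrite big_seq1 eqxx mono0.
Qed.

Lemma lpoly_act (w : 'S_r) c o : fsupp c ->
  lpoly (fun a => c (actE w a)) (oact w o) = lpoly c o.
Proof.
case=> A' cA'; have uA := undup_uniq A'; set A := undup A' in uA.
have cA a : a \notin A -> c a = 0 by rewrite mem_undup; exact: cA'.
rewrite (lpolyE uA cA) (@lpolyE _ [seq actE w^-1%g a | a <- A]).
- rewrite big_map !lfun_sum; apply: eq_bigr => a _; rewrite !lfunMz.
  by rewrite /oact mono_act actEM mulVg actE1.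
- by rewrite map_inj_uniq //; exact: can_inj (actEK _).
move=> a aA; apply: cA; apply: contra aA => aA; apply/mapP; exists (actE w a) => //.
by rewrite actEK.
Qed.

End FinitelySupported.

(** * Matrices of an affine Schur algebra or of its corner *)

Section SchurMatrices.
Variables n N r : nat.
Hypothesis nN : (n <= N)%N.
Local Notation S := (affine_schur N.+1 r).
Local Notation W := (word r 'I_n.+1).
Local Notation lfun := (lfun r).
Local Notation expo := (expo r).
Local Notation mat := (mat r 'I_n.+1 'I_n.+1).
Local Notation act := (@affine_act N.+1 r).
Implicit Types (p q s : W) (a b : expo) (w : 'S_r).

Definition base_index p : multiindex r := [ffun t => (p t : nat).+1%:Z].
Definition lift_word p a : multiindex r := [ffun t => (p t : nat).+1%:Z + N.+1%:Z * a t].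

Lemma lift_word0 p : lift_word p 0 = base_index p.
Proof. by apply/ffunP => t; rewrite !ffunE mulr0 addr0. Qed.

Lemma act_lift w (e : expo) p a :
  act w e (lift_word p a) = lift_word (pact w p) [ffun t => a (w t) + e t].
Proof. by apply/ffunP => t; rewrite !ffunE mulrDr addrA. Qed.

(** The letters lie between 1 and [n + 1 <= N + 1], so they are distinct modulo [N + 1]. *)
Lemma lift_word_inj p q a b : lift_word p a = lift_word q b -> p = q /\ a = b.
Proof.
move=> E; have H t : (p t : nat) = q t /\ a t = b t.
  move/ffunP/(_ t): E; rewrite !ffunE; have := ltn_ord (p t); have := ltn_ord (q t).
  move: (p t : nat) (q t : nat) (a t) (b t) nN => x y u v; rewrite !ltnS => lN yn xn E.
  have [uv|[uv|uv]] : u = v \/ (1 <= u - v) \/ (u - v <= -1) by lia.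
  - by split=> //; rewrite uv in E; lia.
  - by nia.
  - by nia.
by split; apply/ffunP => t; [apply: val_inj|]; case: (H t).
Qed.

(** The multiindices with entries congruent to 1, ..., n + 1 modulo [N + 1]; they support the
    kernels of the corner. *)
Definition corner_index (i : multiindex r) : bool := `[< exists p a, i = lift_word p a >].

Lemma corner_index_act w e i : corner_index (act w e i) = corner_index i.
Proof.
have up w' e' j : corner_index j -> corner_index (act w' e' j).
  by move=> /asboolP[p [a ->]]; apply/asboolP; rewrite act_lift; do 2!eexists.
apply/idP/idP; last exact: up.
by move=> /(up w^-1%g [ffun t => - e (w^-1%g t)]); rewrite act_inv.
Qed.

Lemma kernel_act w e x i j : kernel (x : S) (act w e i) (act w e j) = kernel x i j.
Proof. by rewrite /kernel orb_act. Qed.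

Definition coef (x : S) p q a : int := kernel x (base_index p) (lift_word q a).

Lemma coef_lift x p q a b : kernel x (lift_word p a) (lift_word q b) = coef x p q (b - a).
Proof.
rewrite /coef -[RHS](kernel_act 1 a) -lift_word0 !act_lift; congr (kernel x (lift_word _ _) (lift_word _ _)).
- by apply/ffunP => t; rewrite ffunE perm1.
- by apply/ffunP => t; rewrite !ffunE add0r.
- by rewrite pact1.
- by apply/ffunP => t; rewrite !ffunE perm1 subrK.
Qed.

Lemma coef_fsupp x p q : fsupp (coef x p q).
Proof.
have [T xT] := coversP x (base_index p).
exists [seq ([ffun t => ((i t - (q t : nat).+1%:Z) %/ N.+1%:Z)%Z] : expo) | i : multiindex r <- T] => a.
apply: contraNeq => /xT aT; apply/mapP; exists (lift_word q a) => //.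
by apply/ffunP => t; rewrite !ffunE addrC addKr mulKz.
Qed.

Lemma coef_act x w p q a : coef x (pact w p) (pact w q) a = coef x p q (actE w a).
Proof.
rewrite /coef -[RHS](kernel_act w 0) -!lift_word0 !act_lift.
congr (kernel x (lift_word _ _) (lift_word _ _)); apply/ffunP => t; rewrite !ffunE ?addr0 //.
by rewrite permK.
Qed.

(* For A = affine_schur n.+1 r (with n = N, iota the identity) and for the
   corner e S e (with iota the inclusion) at once. *)
Variables (A : pzRingType) (iota : A -> S).
Hypothesis iotaI : injective iota.
Hypothesis iotaB : {morph iota : x y / x - y}.
Hypothesis iotaM : {morph iota : x y / x * y}.
Hypothesis iota1 : forall i j, kernel (iota 1) i j = ((i == j) && corner_index i)%:R.
Hypothesis iota_good : forall x i j, kernel (iota x) i j != 0 -> corner_index i && corner_index j.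
Hypothesis iota_onto : forall y : S, (forall i j, kernel y i j != 0 -> corner_index i && corner_index j) ->
  exists x, iota x = y.

(* Every pair of multiindices is equivalent to one whose first member is a word;
   the translation of the second becomes the exponent of a monomial. *)
Definition schur_mat (x : A) : mat := fun p q => lpoly (coef (iota x) p q).

Lemma schur_mat_inj : injective schur_mat.
Proof.
move=> x y E; apply: iotaI; apply: kernelP => i j.
have coefE p q : coef (iota x) p q =1 coef (iota y) p q.
  by apply: lpoly_inj; [exact: coef_fsupp|exact: coef_fsupp|exact: (congr1 (fun M : mat => M p q) E)].
have [/andP[/asboolP[p [a ->]] /asboolP[q [b ->]]]|bad] := boolP (corner_index i && corner_index j).
  by rewrite !coef_lift coefE.
have bad0 z : kernel (iota z) i j = 0 by apply/eqP; apply: contraNT bad => /iota_good.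
by rewrite !bad0.
Qed.

Lemma schur_mat_eq x : eqmat (schur_mat x).
Proof.
split=> [p q|w p q o]; first exact: lpoly_Laur.
rewrite /schur_mat -(lpoly_act w o (coef_fsupp (iota x) p q)); congr (lpoly _ _).
by apply/funext => a; exact: coef_act.
Qed.

Lemma kernelN (x : S) i j : kernel (- x) i j = - kernel x i j.
Proof. exact: mcoeffN. Qed.

Lemma schur_matB x y p q : schur_mat (x - y) p q = schur_mat x p q - schur_mat y p q.
Proof.
rewrite /schur_mat -lpolyB; try exact: coef_fsupp.
by congr lpoly; apply/funext => a; rewrite /coef iotaB kernelD kernelN.
Qed.

Lemma schur_mat1 p q : schur_mat 1 p q = if p == q then 1 else 0.
Proof.
have cE a : coef (iota 1) p q a = ((p == q) && (a == 0))%:R.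
  rewrite /coef iota1 -lift_word0; have -> : corner_index (lift_word p 0) by apply/asboolP; exists p, 0.
  rewrite andbT; congr (nat_of_bool _)%:R; apply/eqP/andP => [/lift_word_inj[-> <-]//|[/eqP-> /eqP->]//].
rewrite /schur_mat (funext cE); case: (p == q); first exact: lpoly_delta.
exact: lpoly0.
Qed.

(** Only lifted words contribute to the convolution over multiindices, so it becomes a sum over
    words and exponents: matrix product and product of Laurent polynomials at once. *)
Lemma coefM x y p q b L : uniq L -> (forall s a, a \notin L -> coef (iota x) p s a = 0) ->
  coef (iota (x * y)) p q b = \sum_s \sum_(a <- L) coef (iota x) p s a * coef (iota y) s q (b - a).
Proof.
move=> uL xL; rewrite /coef iotaM -[iota x * iota y]/(schur_mul (iota x) (iota y)).
have [T xT] := coversP (iota x) (base_index p); rewrite (kernelM _ _ xT).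
pose Q := [seq lift_word s a | s <- enum W, a <- L].
have uQ : uniq Q.
  apply: allpairs_uniq; rewrite ?enum_uniq // => -[s a] [s' a'] _ _ /=.
  by move=> /lift_word_inj[-> ->].
pose F i := kernel (iota x) (base_index p) i * kernel (iota y) i (lift_word q b).
have uTQ : uniq (undup (T ++ Q)) by exact: undup_uniq.
rewrite [LHS](big_ext_seq (F := F) (fset_uniq T) uTQ) => [|i iT|i iT]; last 2 first.
- by rewrite mem_undup mem_cat iT.
- by rewrite /F; have /eqP->  : kernel (iota x) (base_index p) i == 0; [apply: contraNT iT => /xT|rewrite mul0r].
rewrite -(big_ext_seq (F := F) uQ uTQ) => [|i iQ|i iQ]; last 2 first.
- by rewrite mem_undup mem_cat iQ orbT.
- rewrite /F; have /eqP-> : kernel (iota x) (base_index p) i == 0; last exact: mul0r.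
  apply: contraNT iQ => nz; have /andP[_ /asboolP[s [a iE]]] := iota_good nz.
  rewrite iE; apply/allpairsP; exists (s, a); split=> //; first by rewrite mem_enum.
  by apply: contraNT nz => /xL E; rewrite iE -[kernel _ _ _]/(coef (iota x) p s a) E.
rewrite big_allpairs_dep big_enum; apply: eq_bigr => s _; apply: eq_bigr => a _.
by rewrite /F coef_lift.
Qed.

Lemma schur_matM x y : schur_mat (x * y) = mulm (schur_mat x) (schur_mat y).
Proof.
apply/funext => p; apply/funext => q.
have [L uL xL] := fsupp_common (fun s => coef_fsupp (iota x) p s).
rewrite /schur_mat (funext (fun b => coefM y q b uL xL)) lpoly_sum => [|//|s a]; last first.
  have [B yB] := coef_fsupp (iota y) s q; exists [seq b + a | b <- B] => b bB.
  by rewrite yB ?mulr0 //; apply: contra bB => bB; apply/mapP; exists (b - a); rewrite ?subrK.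
apply: eq_bigr => s _; rewrite (lpolyE uL (xL s)) mulr_suml; apply: eq_bigr => a _.
rewrite (@lpolyMz _ _ (fun b => coef (iota y) s q (b - a))).
  by rewrite lpoly_shift ?mulrzAl //; exact: coef_fsupp.
have [B yB] := coef_fsupp (iota y) s q; exists [seq b + a | b <- B] => b bB.
by rewrite yB //; apply: contra bB => bB; apply/mapP; exists (b - a); rewrite ?subrK.
Qed.

Lemma schur_mat_onto M : eqmat M -> exists x, schur_mat x = M.
Proof.
move=> [LM eM]; have H (pq : W * W) : exists c, fsupp c /\ M pq.1 pq.2 = lpoly c.
  by have [c fc ME] := Laur_lpoly (LM pq.1 pq.2); exists c.
have [c cP] := choice H.
have c_act w p q a : c (pact w p, pact w q) a = c (p, q) (actE w a).
  have [fc ME] := cP (p, q); have [fc' ME'] := cP (pact w p, pact w q).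
  have fa : fsupp (fun a => c (p, q) (actE w a)).
    have [B cB] := fc; exists [seq actE w^-1%g b | b <- B] => b bB; apply: cB.
    by apply: contra bB => bB; apply/mapP; exists (actE w b); rewrite ?actEK.
  move: a; apply: (lpoly_inj fc' fa); rewrite -ME' /=; apply/funext => o.
  by rewrite -[o](oactKV w) eM /= lpoly_act // -ME.
pose orbc p q a : pair_orbit N.+1 r := orb (base_index p) (lift_word q a).
have orbcP p q a p' q' a' : orbc p q a = orbc p' q' a' -> c (p, q) a = c (p', q') a'.
  move=> /orbE[w [e]]; rewrite -!lift_word0 !act_lift => -[/lift_word_inj[p'E e0] /lift_word_inj[q'E a'E]].
  rewrite p'E q'E c_act; congr (c _ _); apply/ffunP => t; rewrite a'E !ffunE permKV.
  by move/ffunP/(_ (w^-1%g t)): e0; rewrite !ffunE add0r => <-; rewrite addr0.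
(* The coefficient prescribed on each orbit, well defined by [orbcP]; orbits that do not come from
   words get 0. *)
pose f (O : pair_orbit N.+1 r) : int :=
  if pselect (exists pqa : W * W * expo, O = orbc pqa.1.1 pqa.1.2 pqa.2) is left h then
    c (projT1 (cid h)).1 (projT1 (cid h)).2 else 0.
have fE p q a : f (orbc p q a) = c (p, q) a.
  rewrite /f; case: pselect => [h|[]]; last by exists (p, q, a).
  by case: (cid h) => -[[p' q'] a'] /= /orbcP.
have fN O : f O != 0 -> exists p q a, O = orbc p q a.
  rewrite /f; case: pselect => [[[[p q] a] OE]|]; last by rewrite eqxx.
  by exists p, q, a.
have [B uB cB] := fsupp_common (fun pq => (cP pq).1).
pose x0 : S := \sum_(O \in [set: pair_orbit N.+1 r]) << f O *g O >>.
have kE i j : kernel x0 i j = f (orb i j).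
  rewrite /kernel mcoeff_fsum ?in_setT //.
  pose Q := [seq orbc pq.1 pq.2 a | pq <- enum {: W * W}, a <- B].
  apply: (@sub_finite_set _ _ [set` Q]); last exact: finite_seq.
  move=> O [_ /eqP fO]; have [p [q [a OE]]] := fN O fO; rewrite /= OE.
  apply/allpairsP; exists ((p, q), a); split=> //=; first by rewrite mem_enum.
  by apply: contraNT fO => aB; rewrite OE fE cB.
have [|x xE] := @iota_onto x0.
  move=> i j; rewrite kE => /fN[p [q [a /esym/orbE[w [e [-> ->]]]]]].
  by rewrite !corner_index_act; apply/andP; split; apply/asboolP; [exists p, 0; rewrite lift_word0|exists q, a].
exists x; apply/funext => p; apply/funext => q; rewrite (cP (p, q)).2 /schur_mat; congr lpoly.
by apply/funext => a; rewrite /coef xE kE -fE.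
Qed.

Lemma schur_aqh : affine_quasi_hereditary (int_algebra A).
Proof.
apply: (@matrix_ring_aqh n.+1 r A schur_mat).
- exact: schur_mat_inj.
- exact: schur_mat_eq.
- exact: schur_mat_onto.
- exact: schur_matB.
exact: schur_matM.
Qed.

End SchurMatrices.

(** Both rings are identified with the full ring of equivariant matrices over the same words. *)
Lemma matrix_ring_iso (n r : nat) (A A' : pzRingType) (mu : A -> mat r 'I_n 'I_n) (mu' : A' -> mat r 'I_n 'I_n) :
  injective mu -> injective mu' ->
  (forall x, eqmat (mu x)) -> (forall y, eqmat (mu' y)) ->
  (forall M, eqmat M -> exists x, mu x = M) -> (forall M, eqmat M -> exists y, mu' y = M) ->
  (forall x y p q, mu (x - y) p q = mu x p q - mu y p q) ->
  (forall x y p q, mu' (x - y) p q = mu' x p q - mu' y p q) ->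
  (forall x y, mu (x * y) = mulm (mu x) (mu y)) -> (forall x y, mu' (x * y) = mulm (mu' x) (mu' y)) ->
  (forall p q, mu 1 p q = if p == q then 1 else 0) ->
  (forall p q, mu' 1 p q = if p == q then 1 else 0) ->
  exists f : {rmorphism A -> A'}, bijective f.
Proof.
move=> muI muI' muE muE' mu_onto muS' muB muB' muM muM' mu1 mu1'.
have [f fE] := choice (fun x => muS' _ (muE x)); have [g gE] := choice (fun y => mu_onto _ (muE' y)).
have ext (x y : A') : (forall p q, mu' x p q = mu' y p q) -> x = y.
  by move=> E; apply: muI'; apply/funext => p; apply/funext => q.
have fB : {morph f : x y / x - y} by move=> x y; apply: ext => p q; rewrite muB' !fE muB.
have fM : {morph f : x y / x * y} by move=> x y; apply: muI'; rewrite muM' !fE muM.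
have f1 : f 1 = 1 by apply: ext => p q; rewrite mu1' fE mu1.
pose F : {rmorphism A -> A'} := HB.pack f (GRing.isZmodMorphism.Build A A' f fB)
  (GRing.isMonoidMorphism.Build A A' f (conj f1 fM)).
exists F; exists g => [x|y]; first by apply: muI; rewrite gE fE.
by apply: muI'; rewrite /= fE gE.
Qed.

(** Division with remainder, shifted by 1 because the letters start at 1. *)
Lemma all_good n r i : corner_index n n (i : multiindex r).
Proof.
apply/asboolP; exists [ffun t => inord `|((i t - 1) %% n.+1)%Z|%N], [ffun t => ((i t - 1) %/ n.+1)%Z].
apply/ffunP => t; rewrite !ffunE inordK; last first.
  by rewrite -ltz_nat gez0_abs ?modz_ge0 ?ltz_pmod.
have := divz_eq (i t - 1) n.+1; have := @modz_ge0 (i t - 1) n.+1 isT.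
set u := (_ %/ _)%Z; set v := (_ %% _)%Z => v0 E.
by rewrite intS gez0_abs // mulrC -addrA [v + _]addrC -E addrC subrK.
Qed.

(** * The corner as the kernels supported on words and their translates *)

Section Corner.
Variables n N r : nat.
Hypothesis nN : (n <= N)%N.
Local Notation S := (affine_schur N.+1 r).
Local Notation corner_index := (corner_index n N).
Local Notation C := (corner (schur_idempotent n N r)).

Lemma pad_bound (l : {ffun 'I_n.+1 -> nat}) x :
  x \in weight_word (pad N.+1 l) -> (0 < x <= n.+1)%N.
Proof.
case: x => [|x] xw; first by have := weight_word_bound xw.
move: xw; rewrite -has_pred1 has_count count_weight_word.
case: insubP => [u _ uE|//]; rewrite ffunE; case: insubP => [v vn vE _|//].
by rewrite -uE /= ltnS -ltnS.
Qed.

Lemma pad_Lambda (l : {ffun 'I_n.+1 -> nat}) : @Lambda n.+1 r l -> @Lambda N.+1 r (pad N.+1 l).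
Proof.
rewrite /Lambda /= => <-.
pose F (i : nat) := if insub i is Some u then l u else 0%N.
transitivity (\sum_(t < n.+1) F t)%N; last by apply: eq_bigr => t _; rewrite /F valK.
rewrite (big_ord_widen N.+1 F) // [LHS](bigID (fun t : 'I_N.+1 => (t < n.+1)%N)) /=.
rewrite [X in (_ + X)%N]big1 ?addn0 => [|t tn]; last by rewrite ffunE insubF // (negPf tn).
by apply: eq_bigr => t _; rewrite ffunE.
Qed.

(** Sorting: the word under [i] and the weight word of its content have the same multiplicities,
    hence differ by a permutation. *)
Lemma good_weight (i : multiindex r) : corner_index i -> exists2 l, @Lambda_sub n N r l &
  orb i i = orb (weight_index r l) (weight_index r l) :> pair_orbit N.+1 r.
Proof.
move=> /asboolP[p [a iE]]; pose l : {ffun 'I_n.+1 -> nat} := [ffun t => cnt p t].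
have Ll : @Lambda n.+1 r l.
  rewrite /Lambda /=; under eq_bigr do rewrite ffunE.
  rewrite exchange_big /= -[RHS]card_ord -sum1_card; apply: eq_bigr => t _.
  by rewrite (bigD1 (p t)) //= eqxx big1 ?addn0 // => u /negPf; rewrite eq_sym => ->.
have Lp := pad_Lambda Ll; exists (pad N.+1 l); first by split=> //; exists l.
pose ww (t : 'I_r) := nth 0%N (weight_word (pad N.+1 l)) t.
have [w wP] : exists w : 'S_r, forall t, ww t = (p (w t)).+1.
  apply: (@perm_of_counts r _ ww (fun t => (p t).+1)) => x.
  have -> : (\sum_t (ww t == x) = count_mem x (weight_word (pad N.+1 l)))%N.
    rewrite -sum1_count (big_nth 0%N) (size_weight_word Lp) big_mkord.
    by rewrite [RHS]big_mkcond; apply: eq_bigr => t _ /=; case: eqP.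
  case: x => [|x].
    rewrite big1 //; apply/count_memPn; apply/negP => /weight_word_bound.
    by rewrite ltnn.
  rewrite count_weight_word; case: insubP => [u uN uE|xN].
    rewrite ffunE; case: insubP => [v vn vE|un].
      rewrite ffunE; apply: eq_bigr => t _; congr nat_of_bool.
      by rewrite eqSS -uE -[val u]vE (inj_eq val_inj).
    rewrite big1 // => t _; rewrite eqSS -uE; case: eqP => // pt.
    by rewrite /= -pt ltn_ord in un.
  rewrite big1 // => t _; rewrite eqSS; case: eqP => // pt.
  by case/negP: xN; rewrite -pt (leq_trans (ltn_ord _)).
apply/esym/orbE; exists w^-1%g, a.
suff -> : i = affine_act N.+1 w^-1%g a (weight_index r (pad N.+1 l)) by [].
rewrite iE; apply/ffunP => t; rewrite !ffunE -/(ww (w^-1%g t)) wP.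
by rewrite permKV.
Qed.

Lemma weight_good l (i : multiindex r) : @Lambda_sub n N r l ->
  orb i i = orb (weight_index r l) (weight_index r l) :> pair_orbit N.+1 r -> corner_index i.
Proof.
move=> [Ll [m _ lE]] /esym/orbE[w [e [-> _]]]; rewrite corner_index_act; apply/asboolP.
exists [ffun t : 'I_r => inord (nth 0%N (weight_word l) t).-1], 0.
apply/ffunP => t; rewrite !ffunE mulr0 addr0 -lE.
have /pad_bound : nth 0%N (weight_word (pad N.+1 m)) t \in weight_word (pad N.+1 m).
  by rewrite mem_nth // lE (size_weight_word Ll).
by case: (nth _ _ _) => [//|x] /= xn; rewrite inordK.
Qed.

Lemma kernel_corner i j : kernel (corner_elt n N r) i j = ((i == j) && corner_index i)%:R.
Proof.
pose h (l : {ffun 'I_N.+1 -> nat}) : pair_orbit N.+1 r :=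
  orb (weight_index r l) (weight_index r l).
have fL : finite_set (@Lambda_sub n N r) by apply: finite_setIl; exact: finite_Lambda.
have -> : corner_elt n N r = \sum_(c \in image (@Lambda_sub n N r) h) basis c.
  rewrite fsbig_image // => l m /set_mem[Ll _] /set_mem[Lm _].
  exact: weight_orb_inj.
rewrite kernel_fsum; last exact: finite_image.
congr (nat_of_bool _)%:R; apply/idP/andP => [/set_mem[l Ll /esym E]|[/eqP<- /good_weight[l Ll E]]].
  by have E' := orb_diag E; rewrite -E' eqxx in E *; split=> //; exact: weight_good Ll E.
by apply/mem_set; exists l.
Qed.

Local Notation e := (corner_elt n N r).

Lemma kernel_cornerl (x : S) i j : kernel (e * x) i j = if corner_index i then kernel x i j else 0.
Proof.
rewrite -[e * x]/(schur_mul e x) (@kernelM _ _ _ _ _ _ [fset i]%fset).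
  by rewrite big_seq_fset1 kernel_corner eqxx; case: (corner_index i); rewrite ?mul1r ?mul0r.
by move=> s; rewrite kernel_corner inE (eq_sym s i); case: (i == s).
Qed.

Lemma kernel_cornerr (x : S) i j : kernel (x * e) i j = if corner_index j then kernel x i j else 0.
Proof.
have [T xT] := coversP x i.
rewrite -[x * e]/(schur_mul x e) (@kernelM _ _ _ _ _ _ (j |` T)%fset); last first.
  by apply: coversW xT; exact: fsubsetU1.
rewrite (big_fsetD1 j) ?fset1U1 //= kernel_corner eqxx big1_seq ?addr0 => [|s].
  by case: (corner_index j); rewrite ?mulr1 ?mulr0.
by move=> /andP[_]; rewrite in_fsetD1 kernel_corner => /andP[/negPf-> _]; rewrite mulr0.
Qed.

Lemma corner_good (x : C) i j : kernel (val x) i j != 0 -> corner_index i && corner_index j.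
Proof.
have /cornerP[a ->] : val x \in corner_pred (schur_idempotent n N r) by case: x.
by rewrite kernel_cornerr kernel_cornerl; case: (corner_index i); case: (corner_index j); rewrite ?eqxx.
Qed.

Lemma corner_onto (y : S) : (forall i j, kernel y i j != 0 -> corner_index i && corner_index j) ->
  exists x : C, val x = y.
Proof.
move=> yg; have yE : y = e * y * e.
  apply: kernelP => i j; rewrite kernel_cornerr kernel_cornerl.
  by have [->|/yg/andP[-> ->]//] := eqVneq (kernel y i j) 0; rewrite !if_same.
have yP : y \in corner_pred (schur_idempotent n N r) by apply/cornerP; exists y.
by exists (Corner yP).
Qed.

End Corner.

Theorem theorem6p4 (n r N : nat) (le_nr : (n.+1 <= r)%N) (lt_rN : (r < N.+1)%N) :
  [/\ affine_quasi_hereditary (int_algebra (corner (schur_idempotent n N r))),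
      exists f : {rmorphism affine_schur n.+1 r ->
                            corner (schur_idempotent n N r)}, bijective f
    & affine_quasi_hereditary (int_algebra (affine_schur n.+1 r))].
Proof.
have nN : (n <= N)%N by rewrite -ltnS (leq_trans le_nr) // ltnW.
have vI : injective (val : corner (schur_idempotent n N r) -> affine_schur N.+1 r) by exact: val_inj.
have vB : {morph (val : corner (schur_idempotent n N r) -> affine_schur N.+1 r) : x y / x - y} by [].
have vM : {morph (val : corner (schur_idempotent n N r) -> affine_schur N.+1 r) : x y / x * y} by [].
have v1 i j := kernel_corner nN i j : kernel (val (1 : corner (schur_idempotent n N r))) i j = _.
have vG := @corner_good n N r nN; have vO := @corner_onto n N r nN.
have idB : {morph (id : affine_schur n.+1 r -> affine_schur n.+1 r) : x y / x - y} by [].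
have idM : {morph (id : affine_schur n.+1 r -> affine_schur n.+1 r) : x y / x * y} by [].
have id1 i j : kernel (1 : affine_schur n.+1 r) i j = ((i == j) && corner_index n n i)%:R.
  by rewrite all_good andbT; exact: kernel1.
have idG (x : affine_schur n.+1 r) i j : kernel x i j != 0 -> corner_index n n i && corner_index n n j by rewrite !all_good.
have idO (y : affine_schur n.+1 r) : (forall i j, kernel y i j != 0 -> corner_index n n i && corner_index n n j) ->
  exists x, id x = y by exists y.
split.
- exact: (schur_aqh nN vI vB vM vG vO).
- have H := @matrix_ring_iso n.+1 r (affine_schur n.+1 r) (corner (schur_idempotent n N r))
    (@schur_mat n n r (affine_schur n.+1 r) id) (@schur_mat n N r (corner (schur_idempotent n N r)) val).
  apply: H.
  + exact: (schur_mat_inj (@inj_id _) idG).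
  + exact: (schur_mat_inj vI vG).
  + exact: schur_mat_eq.
  + exact: schur_mat_eq.
  + exact: (schur_mat_onto _ idO).
  + exact: (schur_mat_onto nN vO).
  + exact: (schur_matB idB).
  + exact: (schur_matB vB).
  + exact: (schur_matM _ idM idG).
  + exact: (schur_matM nN vM vG).
  + exact: (schur_mat1 _ id1).
  + exact: (schur_mat1 nN v1).
exact: (schur_aqh (leqnn n) (@inj_id _) idB idM idG idO).
Qed.
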